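(* Let $\alpha\in(0,1)$. Assume $T(\mathbb F_n,\mathbb G_r)=Q(\mathbb F_n,\mathbb G_r)$ for $\min N$ sufficiently large. Suppose $T$ and $Q$ are uniformly Hadamard differentiable in $(F,G)$ with Hadamard derivatives $\mathrm dT(F,G)$ and $\mathrm dQ(F,G)$, respectively. (In this case $J=(F,G)$; let $U$ be the corresponding limit process defined in the context.) If the distribution function of $\sup_{z\in\overline{\mathbb R}^u}|U(z)|$ is strictly increasing on the non-negative half-line, then $\lim_{\min N\to\infty}P(\mathrm{KS}_N\ge c_{N;1-\alpha})=\alpha$. If the distribution function of $\int U^2(z)\,T(F,G)(\mathrm dz)$ is strictly increasing on the non-negative half-line, then $\lim_{\min N\to\infty}P(\mathrm{CvM}_N\ge d_{N;1-\alpha})=\alpha$.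
   Context: Conventions: $\overline{\mathbb R}^l=[-\infty,\infty]^l$ with its compact product topology; $\le$ and $\min$ on $\overline{\mathbb R}^l$ are componentwise; $\mathrm I(\cdot)$ is the indicator. $\mathcal D(\overline{\mathbb R}^l)$ is the set of all distribution functions defined on $\overline{\mathbb R}^l$; $\ell^\infty(S)$ is the space of bounded real functions on $S$ with the supremum norm; $\int h(x)K(\mathrm dx)$ is integration with respect to the probability measure with distribution function $K$. Setting: $m,s,u\in\mathbb N$. $X_1,X_2,\dots$ are independent $\mathbb R^m$-valued random vectors with distribution functions $F_i$, $V_1,V_2,\dots$ are independent $\mathbb R^s$-valued random vectors with distribution functions $G_i$ (neither sequence need be identically distributed), and the two sequences are independent of each other. $F\in\mathcal D(\overline{\mathbb R}^m)$, $G\in\mathcal D(\overline{\mathbb R}^s)$ are uniformly continuous with $F_i\to F$ and $G_i\to G$ uniformly. $N=\{n,r\}$ denotes the sample sizes; limits as $\min N\to\infty$ are taken along sample sizes with $n/r\to\eta\in(0,\infty)$. Real weights satisfy $\alpha_{i,n}\ge0$, $\sum_{i=1}^n\alpha_{i,n}=1$, $\sqrt n\max_i\alpha_{i,n}\to0$, $n\sum_{i=1}^n\alpha_{i,n}^2\to\kappa\in[1,\infty)$, and $\beta_{i,r}\ge0$, $\sum_{i=1}^r\beta_{i,r}=1$, $\sqrt r\max_i\beta_{i,r}\to0$, $r\sum_{i=1}^r\beta_{i,r}^2\to\tau\in[1,\infty)$. Put $\mathbb F_n=\sum_{i=1}^n\alpha_{i,n}F_i$, $\mathbb G_r=\sum_{i=1}^r\beta_{i,r}G_i$,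 $\hat{\mathbb F}_n(x)=\sum_{i=1}^n\alpha_{i,n}\mathrm I(X_i\le x)$, $\hat{\mathbb G}_r(v)=\sum_{i=1}^r\beta_{i,r}\mathrm I(V_i\le v)$. Functionals: $T,Q:\mathcal D(\overline{\mathbb R}^m)\times\mathcal D(\overline{\mathbb R}^s)\to\mathcal D(\overline{\mathbb R}^u)$ and $j:\mathcal D(\overline{\mathbb R}^m)\times\mathcal D(\overline{\mathbb R}^s)\to\mathcal D(\overline{\mathbb R}^m)\times\mathcal D(\overline{\mathbb R}^s)$ are continuous for the supremum metrics, $T\circ j=Q\circ j$, and $j(K)=K$ whenever $T(K)=Q(K)$. Put $\hat{\mathbb J}_N=j(\hat{\mathbb F}_n,\hat{\mathbb G}_r)=(\hat{\mathbb J}_{N,m},\hat{\mathbb J}_{N,s})$ and $J=j(F,G)=(J_m,J_s)$. It is assumed that $T(\hat{\mathbb F}_n,\hat{\mathbb G}_r)$, $Q(\hat{\mathbb F}_n,\hat{\mathbb G}_r)$, $T(\hat{\mathbb J}_N)$ are step functions with countably many vertices (to guarantee measurability). Statistics: $U_N(z)=\sqrt[4]{nr}\,\big(T(\hat{\mathbb F}_n,\hat{\mathbb G}_r)(z)-Q(\hat{\mathbb F}_n,\hat{\mathbb G}_r)(z)\big)$, $\mathrm{KS}_N=\sup_{z\in\overline{\mathbb R}^u}|U_N(z)|$, $\mathrm{CvM}_N=\int U_N^2(z)\,T(\hat{\mathbb J}_N)(\mathrm dz)$. Critical values: for $H=(H_m,H_s)\in\mathcal D(\overline{\mathbb R}^m)\times\mathcal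 D(\overline{\mathbb R}^s)$ let $c_N(H)$ (resp. $d_N(H)$) be the $(1-\alpha)$-quantile of the distribution that $\mathrm{KS}_N$ (resp. $\mathrm{CvM}_N$) has when $X_1,\dots,X_n$ are i.i.d. with distribution function $H_m$ and, independently, $V_1,\dots,V_r$ are i.i.d. with distribution function $H_s$. Then $c_{N;1-\alpha}=c_N(\hat{\mathbb J}_N)$, $d_{N;1-\alpha}=d_N(\hat{\mathbb J}_N)$. Uniform Hadamard differentiability of $T$ in $K\in\mathcal D(\overline{\mathbb R}^m)\times\mathcal D(\overline{\mathbb R}^s)$: there is a continuous linear map $\mathrm dT(K):\ell^\infty(\overline{\mathbb R}^m)\times\ell^\infty(\overline{\mathbb R}^s)\to\ell^\infty(\overline{\mathbb R}^u)$ (the Hadamard derivative) such that $t_n^{-1}(T(K_n+t_nL_n)-T(K_n))\to\mathrm dT(K)(L)$ uniformly on $\overline{\mathbb R}^u$ for all $K_n\in\mathcal D(\overline{\mathbb R}^m)\times\mathcal D(\overline{\mathbb R}^s)$ with $K_n\to K$ uniformly, all $L_n,L\in\ell^\infty(\overline{\mathbb R}^m)\times\ell^\infty(\overline{\mathbb R}^s)$ with $L_n\to L$ uniformly, and all $t_n\in(0,\infty)$ with $t_n\to0$, such that $K_n+t_nL_n\in\mathcal D(\overline{\mathbb R}^m)\times\mathcal D(\overline{\mathbb R}^s)$ for all $n$. Limit process: on $\overline{\mathbb R}^l$ let $\rho(x,y)=\int|\mathrm I(w\le x)-\mathrm I(w\le y)|\,\Phi_l(\mathrm dw)$, $\Phi_l$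 the distribution function of the $l$-dimensional standard normal distribution. $M_m$ and $M_s$ are independent centered Gaussian processes on $\overline{\mathbb R}^m$ and $\overline{\mathbb R}^s$ with a.s. uniformly $\rho$-continuous sample paths and covariance functions $\kappa\eta\big(J_m(\min(x,y))-J_m(x)J_m(y)\big)$ and $\tau\eta\big(J_s(\min(v,w))-J_s(v)J_s(w)\big)$ respectively; $M=(M_m,M_s)$ and $U(z)=\mathrm dT(J)(M)(z)-\mathrm dQ(J)(M)(z)$, $z\in\overline{\mathbb R}^u$. *)

(* Defs.v *)
From HB Require Import structures.
From mathcomp Require Import all_boot all_order all_algebra finmap.
From mathcomp Require Import all_classical all_reals all_analysis.
From mathcomp Require Import measurable_realfun.

Set Implicit Arguments.
Unset Strict Implicit.
Unset Printing Implicit Defensive.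

Import Order.TTheory GRing.Theory Num.Theory.
Import numFieldNormedType.Exports.

Local Open Scope classical_set_scope.
Local Open Scope ring_scope.

(* The measurable structure of a tuple type is the product sigma-algebra; on
   [l.-tuple (\bar R)] this is the Borel sigma-algebra. *)
Notation xvec R l := (l.-tuple (\bar R)) (only parsing).

Section extended_vectors.
Context {R : realType} {l : nat}.

Definition lev (x y : xvec R l) : bool :=
  [forall k, (tnth x k <= tnth y k)%E].

Definition minv (x y : xvec R l) : xvec R l :=
  [tuple Order.min (tnth x k) (tnth y k) | k < l].

Definition xvec_of (x : l.-tuple R) : xvec R l := map_tuple EFin x.

Definition is_df_of (mu : probability (xvec R l) R) (K : xvec R l -> R) :=
  forall x, mu [set w | lev w x] = (K x)%:E.

(* Row vectors carry the product uniformity, which tuples lack. *)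
Definition unif_cont_xvec (K : xvec R l -> R) :=
  unif_continuous (fun x : 'rV[\bar R]_l => K [tuple x ord0 k | k < l]).

(* Distribution function of a discrete law carried by the vertices [v k] with
   masses [p k]; vanishing masses allow for finitely many vertices. *)
Definition is_step (K : xvec R l -> R) :=
  exists (v : nat -> xvec R l) (p : nat -> R), (forall k, 0 <= p k) /\
    forall z, (K z)%:E = (\sum_(k <oo) (p k * (lev (v k) z)%:R)%:E)%E.

(* The probability measure whose distribution function is [K]; it is unique,
   and the default value is irrelevant when [K] is a distribution function. *)
Definition df_prob (K : xvec R l -> R) : probability (xvec R l) R :=
  if pselect (exists mu, is_df_of mu K) is left h then sval (cid h)
  else \d_([tuple 0%E | k < l]).

End extended_vectors.

(* Membership in [distfuns R l] is the existence of a probability measure, so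
   that mass at infinity is allowed. *)
Definition distfuns (R : realType) (l : nat) : set (xvec R l -> R) :=
  [set K | exists mu, is_df_of mu K].
Arguments distfuns : clear implicits.

Definition linf (R : realType) (l : nat) : set (xvec R l -> R) :=
  [set f | bounded_fun f].
Arguments linf : clear implicits.

Section probability_notions.
Context {R : realType}.

(* The events formed from the test statistics need not be measurable, and [mu]
   is unspecified outside the sigma-algebra; [outer mu] is [mu] on it. *)
Definition outer d (T : measurableType d) (mu : {measure set T -> \bar R}) :
  set T -> \bar R := mu_ext mu.

Definition sigma_of {d d'} {W : measurableType d} {T : measurableType d'}
    {I : Type} (X : I -> W -> T) : set (set W) :=
  <<s \bigcup_i preimage_set_system setT (X i) measurable >>.

Definition indep_seq {d d'} {W : measurableType d} {T : measurableType d'}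
    (P : probability W R) (X : nat -> W -> T) :=
  forall (J : {fset nat}) (A : nat -> set T), (forall i, measurable (A i)) ->
    P (\bigcap_(i in [set` J]) (X i @^-1` A i)) =
    (\prod_(i <- J) P (X i @^-1` A i))%E.

Definition indep_families {d d1 d2} {W : measurableType d}
    {T1 : measurableType d1} {T2 : measurableType d2} {I1 I2 : Type}
    (P : probability W R) (X : I1 -> W -> T1) (Y : I2 -> W -> T2) :=
  forall A B, sigma_of X A -> sigma_of Y B -> (P (A `&` B) = P A * P B)%E.

Definition rv_df {d} {W : measurableType d} {l} (P : probability W R)
    (X : W -> l.-tuple R) : xvec R l -> R :=
  fun x => fine (P [set w | lev (xvec_of (X w)) x]).

Section iid_law.
Context {d} {T : measurableType d} (mu : probability T R).

Definition cons_pair n (x : T * n.-tuple T) : n.+1.-tuple T :=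
  [tuple of x.1 :: x.2].

Lemma measurable_cons_pair n : measurable_fun setT (@cons_pair n).
Proof. exact: measurable_cons. Qed.

HB.instance Definition _ n :=
  isMeasurableFun.Build _ _ _ _ (@cons_pair n) (@measurable_cons_pair n).

Fixpoint iid_law n : probability (n.-tuple T) R :=
  match n with
  | 0 => \d_([tuple])
  | n'.+1 => distribution (mu \x iid_law n')%E (@cons_pair n')
  end.

End iid_law.

Definition quantile {d} {T : measurableType d} (p : R)
    (mu : {measure set T -> \bar R}) (S : T -> R) : R :=
  inf [set t | (p%:E <= outer mu [set y | (S y <= t)%R])%E].

(* [normal_prob] is not the point mass when the standard deviation is 0. *)
Definition normal_law (a s : R) (A : set R) : \bar R :=
  if s == 0 then \d_a A else normal_prob a s A.

(* Multivariate normality of the finite-dimensional laws, possibly degenerate. *)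
Definition gaussian_process {d} {W : measurableType d} {I : Type}
    (P : probability W R) (M : I -> {RV P >-> R}) :=
  forall n (t : 'I_n -> I) (c : 'I_n -> R), exists a s : R, forall A,
    measurable A ->
    P ((fun w => \sum_(i < n) c i * M (t i) w) @^-1` A) = normal_law a s A.

(* [iid_law (normal_prob 0 1) l] is the standard normal law on R^l. *)
Definition rho {l} (x y : xvec R l) : R :=
  \int[iid_law (normal_prob 0 1) l]_(w in setT)
    `|(lev (xvec_of w) x)%:R - (lev (xvec_of w) y)%:R|.

Definition unif_rho_cont {l} (f : xvec R l -> R) :=
  forall e : R, 0 < e -> exists2 de : R, 0 < de &
    forall x y, rho x y < de -> `|f x - f y| < e.

Definition limit_process {d} {W : measurableType d} {l}
    (P : probability W R) (M : xvec R l -> {RV P >-> R})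
    (c : R) (K : xvec R l -> R) :=
  [/\ gaussian_process M,
      forall x, ('E_P[M x] = 0)%E,
      forall x y, covariance P (M x) (M y) =
                  (c * (K (minv x y) - K x * K y))%:E
    & {ae P, forall w, unif_rho_cont (fun x => M x w)}].

End probability_notions.

Section functionals.
Context {R : realType} {m s u : nat}.

Notation fpair := ((xvec R m -> R) * (xvec R s -> R))%type.

Notation ufun l := {uniform xvec R l -> R}.

(* Continuity on [A] for the supremum metrics. *)
Definition sup_continuous (A : set (ufun m * ufun s))
    (T : ufun m * ufun s -> ufun u) :=
  {within A, continuous T}.

Definition sup_continuous2 (A : set (ufun m * ufun s))
    (j : ufun m * ufun s -> ufun m * ufun s) :=
  {within A, continuous j}.

Definition pair_unif_cvg (K_ : nat -> fpair) (K : fpair) :=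
  {uniform, (fun n => (K_ n).1) @ \oo --> K.1} /\
  {uniform, (fun n => (K_ n).2) @ \oo --> K.2}.

(* Only the values of [dT] on bounded functions matter. *)
Definition cont_linear (dT : fpair -> xvec R u -> R) :=
  [/\ set_fun (linf R m `*` linf R s) (linf R u) dT,
      forall (a : R) (L L' : fpair), (linf R m `*` linf R s) L ->
        (linf R m `*` linf R s) L' -> dT (a *: L + L') = a *: dT L + dT L'
    & sup_continuous (linf R m `*` linf R s) dT].

Definition unif_hadamard (T : fpair -> xvec R u -> R) (K : fpair)
    (dT : fpair -> xvec R u -> R) :=
  cont_linear dT /\
  forall (K_ L_ : nat -> fpair) (L : fpair) (t : nat -> R),
    (forall n, (distfuns R m `*` distfuns R s) (K_ n)) -> pair_unif_cvg K_ K ->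
    (forall n, (linf R m `*` linf R s) (L_ n)) ->
    (linf R m `*` linf R s) L -> pair_unif_cvg L_ L ->
    (forall n, 0 < t n) -> t @ \oo --> 0 ->
    (forall n, (distfuns R m `*` distfuns R s) (K_ n + t n *: L_ n)) ->
    {uniform, (fun n => (t n)^-1 *: (T (K_ n + t n *: L_ n) - T (K_ n))) @ \oo
                --> dT L}.

End functionals.

Section statistics.
Context {R : realType}.

(* Indices start at 0: the weights of a sample of size [n] are
   [a n 0, ..., a n n.-1]. *)
Definition weights (a : nat -> nat -> R) (kappa : R) :=
  [/\ forall n i, (i < n)%N -> 0 <= a n i,
      forall n, (0 < n)%N -> \sum_(i < n) a n i = 1,
      (fun n => Num.sqrt n%:R * \big[Order.max/0]_(i < n) a n i) @ \oo --> (0 : R),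
      (fun n => n%:R * \sum_(i < n) a n i ^+ 2) @ \oo --> kappa
    & 1 <= kappa].

Definition wmean {l} (a : nat -> nat -> R) (F_ : nat -> xvec R l -> R) n :
    xvec R l -> R :=
  fun x => \sum_(i < n) a n i * F_ i x.

(* The sample may take values in [-oo, +oo]^l, as it does when drawn from an
   arbitrary distribution function on that space. *)
Definition wedf {l} (a : nat -> nat -> R) n (y : n.-tuple (xvec R l)) :
    xvec R l -> R :=
  fun x => \sum_(i < n) a n i * (lev (tnth y i) x)%:R.

Definition wedf_rv {W : Type} {l} (a : nat -> nat -> R) n
    (X : nat -> W -> l.-tuple R) (w : W) : xvec R l -> R :=
  wedf a [tuple xvec_of (X i w) | i < n].

Definition supnorm {l} (f : xvec R l -> R) : R := sup (range (fun z => `|f z|)).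

Definition sqint {l} (K f : xvec R l -> R) : R :=
  \int[df_prob K]_(z in setT) (f z ^+ 2).

Section test.
Context {m s u : nat}.
Notation fpair := ((xvec R m -> R) * (xvec R s -> R))%type.
Variables (T Q : fpair -> xvec R u -> R) (j : fpair -> fpair).
Variables (al be : nat -> nat -> R).

(* The statistics are functions of the pair [K] of empirical distribution
   functions and of the sample sizes. *)
Definition UN (n r : nat) (K : fpair) : xvec R u -> R :=
  fun z => (n%:R * r%:R) `^ (4%:R)^-1 * (T K z - Q K z).

Definition KS (n r : nat) (K : fpair) : R := supnorm (UN n r K).

Definition CvM (n r : nat) (K : fpair) : R := sqint (T (j K)) (UN n r K).

(* [p]-quantile of the law of [S] applied to the empirical distribution
   functions of independent i.i.d. samples from [H.1] and [H.2]. *)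
Definition crit (S : nat -> nat -> fpair -> R) (p : R) (n r : nat) (H : fpair) :
    R :=
  quantile p (iid_law (df_prob H.1) n \x iid_law (df_prob H.2) r)%E
    (fun y => S n r (wedf al y.1, wedf be y.2)).

End test.
End statistics.

(* Main.v *)
(* Put L_N = (nr)^(1/4) (K^ - K), the weighted two-sample empirical process.
   Symmetrization and Levy's inequality, applied slab by slab along finite grids,
   make L_N equicontinuous in probability, and a Lindeberg argument gives its
   finite-dimensional limits. With Hadamard differentiability along the arrays,
   KS_N and the square root of CvM_N converge in law to q(N), where q is a seminorm
   and N a Gaussian process; this holds for all triangular arrays whose distribution
   functions tend to (F, G) and which satisfy the null hypothesis.

   The law of q(N) has no atom at c > 0: rotating two independent copies of N yields
   infinitely many disjoint events of the same probability. Likewise q(N) = 0 has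
   probability 0 or 1, and strict monotonicity of the limit distribution function
   excludes 1. Here the variances of N are kappa / sqrt eta and tau * sqrt eta, while
   M has kappa * eta and tau * eta; only the nondegeneracy of q(M) is used, and it
   does not depend on such factors.

   Samples drawn from J^ -> (F, G) form such arrays, because T (j K) = Q (j K). Hence
   the critical values lie between levels t1 and t2 of q(N) at 1 - alpha -+ e, and the
   probability of rejection is alpha up to multiples of e. *)
Require Import Defs.
From HB Require Import structures.
From mathcomp Require Import all_boot all_order all_algebra finmap.
From mathcomp Require Import all_classical all_reals all_analysis.
From mathcomp Require Import measurable_realfun.
From mathcomp Require Import ring lra zify.

Set Implicit Arguments.
Unset Strict Implicit.
Unset Printing Implicit Defensive.

Import Order.TTheory GRing.Theory Num.Theory.
Import numFieldNormedType.Exports.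

Local Open Scope classical_set_scope.
Local Open Scope ring_scope.

(** * Expectations of bounded functions *)

Section bounded_measurable.
Context {R : realType} {d} {T : measurableType d}.
Implicit Types f g : T -> R.

(** The events formed with the statistics are estimated without deciding their measurability:
    probability bounds are stated through [small], a measurable cover, and distributional limits are
    tested on expectations of bounded measurable functions. Laws are handled by real cosine
    transforms with a free phase; Bernstein polynomials in sines lead from these to Lipschitz
    functions of finitely many coordinates, and grid projections of finite range lead from there to
    functionals of whole paths. The Hadamard condition speaks of sequences only, whereas bounds in
    probability are needed; compactness of the set of typical paths turns the sequential statement
    into a uniform one. The square root of CvM_N is used because its limit is a seminorm, so that
    one argument covers both statistics. The same arrays have to describe the data and the bootstrap
    samples, which forces non-identical laws and probability spaces that vary with the index. *)

Definition bmeas f := measurable_fun setT f /\ exists B, forall x, `|f x| <= B.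

Lemma bmeas_cst c : bmeas (fun=> c).
Proof. by split; [exact: measurable_cst|exists `|c|]. Qed.

Lemma bmeasD f g : bmeas f -> bmeas g -> bmeas (fun x => f x + g x).
Proof.
move=> [mf [B hB]] [mg [C hC]]; split; first exact: measurable_funD.
by exists (B + C) => x; rewrite (le_trans (ler_normD _ _))// lerD.
Qed.

Lemma bmeasM f g : bmeas f -> bmeas g -> bmeas (fun x => f x * g x).
Proof.
move=> [mf [B hB]] [mg [C hC]]; split; first exact: measurable_funM.
by exists (B * C) => x; rewrite normrM ler_pM.
Qed.

Lemma bmeasZ c f : bmeas f -> bmeas (fun x => c * f x).
Proof. by move=> mf; apply: bmeasM => //; exact: bmeas_cst. Qed.

Lemma bmeasN f : bmeas f -> bmeas (fun x => - f x).
Proof.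
move=> mf; rewrite (_ : (fun _ => _) = fun x => -1 * f x).
  exact: bmeasZ.
by apply/funext => x; rewrite mulN1r.
Qed.

Lemma bmeasB f g : bmeas f -> bmeas g -> bmeas (fun x => f x - g x).
Proof. by move=> mf mg; apply: bmeasD => //; exact: bmeasN. Qed.

Lemma bmeasX f n : bmeas f -> bmeas (fun x => f x ^+ n).
Proof.
move=> mf; elim: n => [|n IH]; first exact: bmeas_cst.
by under eq_fun do rewrite exprS; exact: bmeasM.
Qed.

Lemma bmeas_norm f : bmeas f -> bmeas (fun x => `|f x|).
Proof.
move=> [mf [B hB]]; split; first exact: measurableT_comp.
by exists B => x; rewrite normr_id.
Qed.

Lemma bmeas_max f g : bmeas f -> bmeas g -> bmeas (fun x => Num.max (f x) (g x)).
Proof.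
move=> [mf [B hB]] [mg [C hC]]; split; first exact: measurable_maxr.
exists (B + C) => x; have := hB x; have := hC x.
rewrite maxEle; have := normr_ge0 (f x); have := normr_ge0 (g x).
by case: ifP; lra.
Qed.

Lemma bmeas_comp_cont (h : R -> R) f : continuous h -> (exists B, forall x, `|h x| <= B) ->
  measurable_fun setT f -> bmeas (fun x => h (f x)).
Proof.
move=> ch [B hB] mf; split; last by exists B.
by apply: measurableT_comp => //; exact: continuous_measurable_fun.
Qed.

Lemma bmeas_ind (A : T -> bool) : measurable [set x | A x] -> bmeas (fun x => (A x)%:R).
Proof.
move=> mA; rewrite (_ : (fun _ => _) = \1_[set x | A x]).
  split; first exact: measurable_indic.
  by exists 1 => x; rewrite indicE; case: (_ \in _); rewrite ?normr1 ?normr0.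
apply/funext => x; rewrite indicE.
by case: (boolP (A x)) => Ax; [rewrite mem_set|rewrite memNset//=; exact/negP].
Qed.

Lemma bmeas_sum I (r : seq I) (p : pred I) (F : I -> T -> R) :
  (forall i, bmeas (F i)) -> bmeas (fun x => \sum_(i <- r | p i) F i x).
Proof.
move=> mF; elim: r => [|i r IH].
  by under eq_fun do rewrite big_nil; exact: bmeas_cst.
under eq_fun do rewrite big_cons; case: (p i) => //.
exact: bmeasD.
Qed.

Lemma bmeas_bigmax I (r : seq I) (F : I -> T -> R) :
  (forall i, bmeas (F i)) -> bmeas (fun x => \big[Num.max/0]_(i <- r) F i x).
Proof.
move=> mF; elim: r => [|i r IH].
  by under eq_fun do rewrite big_nil; exact: bmeas_cst.
by under eq_fun do rewrite big_cons; exact: bmeas_max.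
Qed.

End bounded_measurable.

Lemma bmeas_comp {R : realType} {d d'} {T : measurableType d} {T' : measurableType d'}
  (f : T -> R) (h : T' -> T) : bmeas f -> measurable_fun setT h -> bmeas (f \o h).
Proof.
by move=> [mf [B hB]] mh; split; [exact: measurableT_comp|exists B => x /=].
Qed.

Section expectation.
Context {R : realType} {d} {T : measurableType d} (P : probability T R).
Implicit Types f g : T -> R.

Definition Ex f : R := \int[P]_x f x.

Lemma bmeas_int f : bmeas f -> P.-integrable setT (EFin \o f).
Proof.
move=> [mf [B hB]]; apply: measurable_bounded_integrable => //.
  by rewrite -ge0_fin_numE// fin_num_measure.
exists B; split; first exact: num_real.
by move=> y By x _ /=; rewrite (le_trans (hB x))// ltW.
Qed.

Lemma eq_Ex f g : f =1 g -> Ex f = Ex g.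
Proof. by move=> /funext ->. Qed.

Lemma Ex_cst c : Ex (fun=> c) = c.
Proof. by rewrite /Ex Rintegral_cst// [X in fine X]probability_setT/= mulr1. Qed.

Lemma ExD f g : bmeas f -> bmeas g -> Ex (fun x => f x + g x) = Ex f + Ex g.
Proof. by move=> /bmeas_int mf /bmeas_int mg; exact: RintegralD. Qed.

Lemma ExB f g : bmeas f -> bmeas g -> Ex (fun x => f x - g x) = Ex f - Ex g.
Proof. by move=> /bmeas_int mf /bmeas_int mg; exact: RintegralB. Qed.

Lemma ExZ c f : bmeas f -> Ex (fun x => c * f x) = c * Ex f.
Proof. by move=> /bmeas_int mf; exact: RintegralZl. Qed.

Lemma ExZr c f : bmeas f -> Ex (fun x => f x * c) = Ex f * c.
Proof. by move=> /bmeas_int mf; exact: RintegralZr. Qed.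

Lemma Ex_sum I (r : seq I) (p : pred I) (F : I -> T -> R) : (forall i, bmeas (F i)) ->
  Ex (fun x => \sum_(i <- r | p i) F i x) = \sum_(i <- r | p i) Ex (F i).
Proof.
move=> mF; elim: r => [|i r IH].
  by rewrite big_nil; under eq_Ex do rewrite big_nil; exact: Ex_cst.
rewrite big_cons -IH; under eq_Ex do rewrite big_cons; case: (p i) => //.
by rewrite ExD//; exact: bmeas_sum.
Qed.

Lemma le_Ex f g : bmeas f -> bmeas g -> (forall x, f x <= g x) -> Ex f <= Ex g.
Proof. by move=> /bmeas_int mf /bmeas_int mg fg; exact: le_Rintegral. Qed.

Lemma Ex_ge0 f : (forall x, 0 <= f x) -> 0 <= Ex f.
Proof. by move=> f0; exact: Rintegral_ge0. Qed.

Lemma Ex_norm_le f : bmeas f -> `|Ex f| <= Ex (fun x => `|f x|).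
Proof. by move=> /bmeas_int mf; exact: le_normr_Rintegral. Qed.

Lemma Ex_le_bound f c : bmeas f -> (forall x, `|f x| <= c) -> `|Ex f| <= c.
Proof.
move=> mf hf; rewrite (le_trans (Ex_norm_le mf))// -[leRHS]Ex_cst.
by apply: le_Ex => //; [exact: bmeas_norm|exact: bmeas_cst].
Qed.

Lemma Ex_EFin f : bmeas f -> (Ex f)%:E = (\int[P]_x (f x)%:E)%E.
Proof.
by move=> /bmeas_int mf; rewrite /Ex/Rintegral fineK//; exact: integrable_fin_num.
Qed.

Lemma Ex_ind (A : T -> bool) : measurable [set x | A x] ->
  (Ex (fun x => (A x)%:R))%:E = P [set x | A x].
Proof.
move=> mA; rewrite Ex_EFin; last exact: bmeas_ind.
rewrite -[in RHS](setIT [set x | A x]) -integral_indic//.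
apply: eq_integral => x _; rewrite indicE; congr (_ %:E).
by case: (boolP (A x)) => Ax; [rewrite mem_set|rewrite memNset//=; exact/negP].
Qed.

Lemma Ex_sub_norm f g c : bmeas f -> bmeas g -> (forall x, `|f x - g x| <= c) ->
  `|Ex f - Ex g| <= c.
Proof. by move=> mf mg h; rewrite -ExB//; apply: Ex_le_bound => //; exact: bmeasB. Qed.

Lemma Ex_markov f (c : R) : bmeas f -> (forall x, 0 <= f x) -> 0 < c ->
  (P [set x | (c <= f x)%R] <= (Ex f / c)%:E)%E.
Proof.
move=> bf f0 c0.
have mA : measurable [set x | c <= f x].
  rewrite -[X in measurable X]setTI; case: bf => mf _.
  have := mf measurableT `[c, +oo[%classic (measurable_itv _).
  by congr (measurable (_ `&` _)); apply/seteqP; split => x /=; rewrite in_itv/= andbT.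
rewrite -Ex_ind// lee_fin ler_pdivlMr// -ExZr//; last exact: bmeas_ind.
apply: le_Ex => //.
  by apply: bmeasM; [exact: bmeas_ind|exact: bmeas_cst].
move=> x; case: (boolP (c <= f x)) => h; first by rewrite mul1r.
by rewrite mul0r.
Qed.

(** Dominated convergence with a constant majorant. Measurability of the limit is part of the
    conclusion because several functions below are known only as pointwise limits of measurable
    approximations. *)
Lemma Ex_bounded_cvg (f : nat -> T -> R) g (B : R) :
  (forall n, measurable_fun setT (f n)) -> (forall n x, `|f n x| <= B) ->
  (forall x, f ^~ x @ \oo --> g x) ->
  bmeas g /\ (fun n => Ex (f n)) @ \oo --> Ex g.
Proof.
move=> mf fB fg.
have mg : measurable_fun setT g.
  by apply: (measurable_fun_cvg mf) => x _; exact: fg.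
have gB x : `|g x| <= B.
  have h : (fun n => `|f n x|) @ \oo --> `|g x| by apply: cvg_norm; exact: fg.
  rewrite -(cvg_lim _ h)//; apply: limr_le; first by apply/cvg_ex; exists `|g x|.
  by apply: nearW => n.
have bg : bmeas g by split => //; exists B.
split => //.
have intB : P.-integrable setT (EFin \o (fun=> B)).
  by apply: bmeas_int; exact: bmeas_cst.
have := @dominated_cvg _ _ _ P setT measurableT (fun n => EFin \o f n) (EFin \o g) (EFin \o (fun=> B)).
move=> H.
apply: fine_cvg; rewrite -/(Ex g).
have -> : (fine (\int[P]_x (g x)%:E))%:E = (\int[P]_x (EFin \o g) x)%E.
  by rewrite -Ex_EFin.
apply: H => //.
- by move=> n; exact/measurable_EFinP.
- by move=> x _; apply: cvg_EFin; [exact: nearW|exact: fg].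
- by move=> n x _ /=; rewrite lee_fin.
Qed.

Lemma Ex_ae f g (N : set T) : measurable N -> P N = 0%E -> bmeas f -> bmeas g ->
  (forall x, ~ N x -> f x = g x) -> Ex f = Ex g.
Proof.
move=> mN PN bf bg fg; rewrite /Ex /Rintegral; congr fine.
apply: ae_eq_integral => //.
- by case: bf => mf _; exact/measurable_EFinP.
- by case: bg => mf _; exact/measurable_EFinP.
exists N; split => // x /= h; apply: contrapT => /fg e; apply: h => _ /=.
by rewrite e.
Qed.

End expectation.

Lemma Ex_distribution {R : realType} {d d'} {T : measurableType d}
    {T' : measurableType d'} (P : probability T R) (X : {mfun T >-> T'}) (f : T' -> R) :
  bmeas f -> Ex (distribution P X) f = Ex P (f \o X).
Proof.
move=> bf; rewrite /Ex /Rintegral; congr fine.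
rewrite integral_pushforward//=.
  by case: bf => mf _; exact/measurable_EFinP.
exact: (bmeas_int P (bmeas_comp bf (measurable_funPT X))).
Qed.

Section fubini.
Context {R : realType} {d1 d2} {T1 : measurableType d1} {T2 : measurableType d2}.
Implicit Type f : T1 * T2 -> R.

Lemma bmeas_pair1 f x : bmeas f -> bmeas (fun y => f (x, y)).
Proof. by move=> bf; apply: (bmeas_comp bf); exact: measurable_pair1. Qed.

Lemma bmeas_pair2 f y : bmeas f -> bmeas (fun x => f (x, y)).
Proof. by move=> bf; apply: (bmeas_comp bf); exact: measurable_pair2. Qed.

(** Adding the bound [B] makes the integrand nonnegative, so that Tonelli's theorem applies and no
    integrability on the product has to be checked. The Fubini statements below use the same
    shift. *)
Lemma bmeas_Ex2 (P2 : probability T2 R) f : bmeas f -> bmeas (fun x => Ex P2 (fun y => f (x, y))).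
Proof.
move=> bf; have [_ [B hB]] := bf; split; last first.
  exists B => x; apply: Ex_le_bound; first exact: bmeas_pair1.
  by move=> y; exact: hB.
have bg : bmeas (fun z => f z + B).
  by apply: bmeasD => //; exact: bmeas_cst.
have g0 z : 0 <= f z + B by have := hB z; rewrite ler_norml => /andP[]; lra.
have -> : (fun x => Ex P2 (fun y => f (x, y))) =
   (fun x => fine (\int[P2]_y ((f (x, y) + B)%:E))%E - B).
  apply/funext => x; rewrite -Ex_EFin/=; last exact: (bmeas_pair1 x bg).
  rewrite ExD; [|exact: bmeas_pair1|exact: bmeas_cst].
  by rewrite Ex_cst addrK.
apply: measurable_funB => //; apply: measurableT_comp => //.
apply: (@measurable_fun_fubini_tonelli_F _ _ _ _ R P2 (fun z => (f z + B)%:E)).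
- by case: bg => mg _; exact/measurable_EFinP.
- by move=> z; rewrite lee_fin.
Qed.

Lemma bmeas_Ex1 (P1 : probability T1 R) f : bmeas f -> bmeas (fun y => Ex P1 (fun x => f (x, y))).
Proof.
move=> bf; have [_ [B hB]] := bf; split; last first.
  exists B => y; apply: Ex_le_bound; first exact: bmeas_pair2.
  by move=> x; exact: hB.
have bg : bmeas (fun z => f z + B).
  by apply: bmeasD => //; exact: bmeas_cst.
have g0 z : 0 <= f z + B by have := hB z; rewrite ler_norml => /andP[]; lra.
have -> : (fun y => Ex P1 (fun x => f (x, y))) =
   (fun y => fine (\int[P1]_x ((f (x, y) + B)%:E))%E - B).
  apply/funext => y; rewrite -Ex_EFin/=; last exact: (bmeas_pair2 y bg).
  rewrite ExD; [|exact: bmeas_pair2|exact: bmeas_cst].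
  by rewrite Ex_cst addrK.
apply: measurable_funB => //; apply: measurableT_comp => //.
apply: (@measurable_fun_fubini_tonelli_G _ _ _ _ R P1 (fun z => (f z + B)%:E)).
- by case: bg => mg _; exact/measurable_EFinP.
- by move=> z; rewrite lee_fin.
Qed.

Lemma Ex_fubini1 (P1 : probability T1 R) (P2 : probability T2 R) f : bmeas f ->
  Ex (P1 \x P2)%E f = Ex P1 (fun x => Ex P2 (fun y => f (x, y))).
Proof.
move=> bf; have [_ [B hB]] := bf.
have bg : bmeas (fun z => f z + B).
  by apply: bmeasD => //; exact: bmeas_cst.
have g0 z : 0 <= f z + B by have := hB z; rewrite ler_norml => /andP[]; lra.
suff : Ex (P1 \x P2)%E (fun z => f z + B) = Ex P1 (fun x => Ex P2 (fun y => f (x, y) + B)).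
  rewrite ExD//; last exact: bmeas_cst.
  rewrite Ex_cst.
  under [in X in _ = X -> _]eq_Ex do
    (rewrite ExD; [|exact: bmeas_pair1|exact: bmeas_cst]; rewrite Ex_cst).
  rewrite ExD; [|exact: bmeas_Ex2|exact: bmeas_cst].
  by rewrite Ex_cst => /addIr.
apply: EFin_inj; rewrite Ex_EFin//.
rewrite Ex_EFin; last exact: (bmeas_Ex2 P2 bg).
rewrite (@fubini_tonelli1 _ _ _ _ R P1 P2 (fun z => (f z + B)%:E)); last 2 first.
- by case: bg => mg _; exact/measurable_EFinP.
- by move=> z; rewrite lee_fin.
apply: eq_integral => x _; rewrite Ex_EFin//.
exact: (bmeas_pair1 x bg).
Qed.

Lemma Ex_swap (P1 : probability T1 R) (P2 : probability T2 R) f : bmeas f ->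
  Ex P1 (fun x => Ex P2 (fun y => f (x, y))) = Ex P2 (fun y => Ex P1 (fun x => f (x, y))).
Proof.
move=> bf; have [_ [B hB]] := bf.
have bg : bmeas (fun z => f z + B).
  by apply: bmeasD => //; exact: bmeas_cst.
have g0 z : 0 <= f z + B by have := hB z; rewrite ler_norml => /andP[]; lra.
suff : Ex P1 (fun x => Ex P2 (fun y => f (x, y) + B)) = Ex P2 (fun y => Ex P1 (fun x => f (x, y) + B)).
  under [in X in X = _ -> _]eq_Ex do
    (rewrite ExD; [|exact: bmeas_pair1|exact: bmeas_cst]; rewrite Ex_cst).
  under [in X in _ = X -> _]eq_Ex do
    (rewrite ExD; [|exact: bmeas_pair2|exact: bmeas_cst]; rewrite Ex_cst).
  rewrite ExD; [|exact: bmeas_Ex2|exact: bmeas_cst].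
  rewrite ExD; [|exact: bmeas_Ex1|exact: bmeas_cst].
  by rewrite !Ex_cst => /addIr.
apply: EFin_inj; rewrite !Ex_EFin; last 2 first.
  exact: (bmeas_Ex1 P1 bg).
  exact: (bmeas_Ex2 P2 bg).
under eq_integral do (rewrite Ex_EFin; last exact: (bmeas_pair1 _ bg)).
under [in RHS]eq_integral do (rewrite Ex_EFin; last exact: (bmeas_pair2 _ bg)).
apply: (@fubini_tonelli _ _ _ _ R P1 P2 (fun z => (f z + B)%:E)).
- by case: bg => mg _; exact/measurable_EFinP.
- by move=> z; rewrite lee_fin.
Qed.

End fubini.

(** [A] may fail to be measurable, hence the measurable cover [B]. Smallness is monotone and
    subadditive; it bounds the outer measure of [A] from above and that of its complement from
    below. *)
Definition small {R : realType} {d} {T : measurableType d} (P : {measure set T -> \bar R})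
  (A : set T) (e : R) := exists B, [/\ measurable B, A `<=` B & (P B <= e%:E)%E].

Section small.
Context {R : realType} {d} {T : measurableType d} (P : probability T R).

Lemma small_sub (A B : set T) e e' : A `<=` B -> e <= e' -> small P B e -> small P A e'.
Proof.
move=> AB ee [C [mC BC PC]]; exists C; split => //; first exact: subset_trans AB BC.
by rewrite (le_trans PC)// lee_fin.
Qed.

Lemma smallU (A B : set T) e e' : small P A e -> small P B e' -> small P (A `|` B) (e + e').
Proof.
move=> [C [mC AC PC]] [D [mD BD PD]]; exists (C `|` D); split.
- exact: measurableU.
- exact: setUSS.
- by rewrite (le_trans (measureU2 _ mC mD))// EFinD leeD.
Qed.

Lemma small_big I (r : seq I) (A : I -> set T) (e : I -> R) :
  (forall i, small P (A i) (e i)) ->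
  small P (\big[setU/set0]_(i <- r) A i) (\sum_(i <- r) e i).
Proof.
move=> h; elim: r => [|i r IH].
  by rewrite !big_nil; exists set0; split => //; rewrite measure0.
by rewrite !big_cons; exact: smallU.
Qed.

Lemma small_outer A e : small P A e -> (outer P A <= e%:E)%E.
Proof.
move=> [B [mB AB PB]]; rewrite (le_trans _ PB)//.
by rewrite -(measurable_mu_extE P mB); exact: le_mu_ext.
Qed.

(** The complement of a measurable cover of the complement of [A] is a measurable subset of [A]. *)
Lemma outer_setC_ge A e : small P (~` A) e -> ((1 - e)%:E <= outer P A)%E.
Proof.
move=> [B [mB AB PB]].
have h : (P (~` B) <= outer P A)%E.
  rewrite -(measurable_mu_extE P (measurableC mB)); apply: le_mu_ext.
  by move=> x /= nB; apply: contrapT => /AB.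
rewrite (le_trans _ h)// probability_setC// EFinB.
by rewrite leeB.
Qed.

End small.

Lemma small_preimage {R : realType} {d d'} {T : measurableType d}
    {T' : measurableType d'} (P : probability T R) (Q : probability T' R) (X : T -> T') A e :
  measurable_fun setT X ->
  (forall B, measurable B -> P (X @^-1` B) = Q B) ->
  small Q A e -> small P (X @^-1` A) e.
Proof.
move=> mX h [B [mB AB PB]]; exists (X @^-1` B); split.
- by rewrite -[X in measurable X]setTI; exact: mX.
- exact: preimage_subset.
- by rewrite [leLHS]h.
Qed.

(** * Uniform convergence *)

Section sup_metric.
Context {R : realType}.

Definition sup_close {I : Type} (f g : I -> R) (e : R) := forall x, `|f x - g x| <= e.

Lemma entourage_R (E : set (R * R)) : entourage E -> exists2 e : R, 0 < e &
  forall a b, `|a - b| < e -> E (a, b).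
Proof.
rewrite -entourage_from_ballE => -[e e0 eE].
by exists e => // a b ab; apply: eE.
Qed.

Lemma entourage_lt (e : R) : 0 < e -> entourage [set ab : R * R | `|ab.1 - ab.2| < e].
Proof. by move=> e0; rewrite -entourage_from_ballE; exists e. Qed.

Lemma uniform_near {l} (f : xvec R l -> R) (P : set (xvec R l -> R)) :
  nbhs (f : {uniform xvec R l -> R}) P <->
  exists2 e : R, 0 < e & forall h, (forall x, `|f x - h x| < e) -> P h.
Proof.
rewrite uniform_nbhs; split.
  move=> [E [/entourage_R[e e0 eE] EP]]; exists e => // h fh.
  by apply: EP => x _ /=; exact: eE.
move=> [e e0 eP]; exists [set ab : R * R | `|ab.1 - ab.2| < e]; split; first exact: entourage_lt.
by move=> h fh; apply: eP => x; exact: fh.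
Qed.

Lemma unif_cvgP {l} (f : nat -> xvec R l -> R) g : {uniform, f @ \oo --> g} <->
  forall e : R, 0 < e -> \forall n \near \oo, sup_close (f n) g e.
Proof.
split.
  move=> fg e e0.
  have : nbhs (g : {uniform xvec R l -> R}) [set h | forall x, `|g x - h x| < e].
    by apply/uniform_near; exists e.
  move=> /fg h; apply: (filterS _ (h : \forall n \near \oo, [set h | forall x, `|g x - h x| < e] (f n))).
  by move=> n hn x; rewrite distrC; apply: ltW; exact: hn.
move=> H P /uniform_near[e e0 eP].
have e20 : 0 < e / 2 by rewrite divr_gt0.
have := H _ e20; apply: filterS => n h; apply: eP => x.
by rewrite distrC (le_lt_trans (h x))// ltr_pdivrMr// ltr_pMr// ltr1n.
Qed.

Lemma prod_uniform_near {m s} (K : {uniform xvec R m -> R} * {uniform xvec R s -> R})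
    (P : set ({uniform xvec R m -> R} * {uniform xvec R s -> R})) :
  nbhs K P -> exists2 e : R, 0 < e & forall K' : _ * _,
    sup_close K.1 K'.1 e -> sup_close K.2 K'.2 e -> P K'.
Proof.
move=> [[P1 P2] /= [/uniform_near[e1 e10 h1] /uniform_near[e2 e20 h2]] sub].
have e0 : 0 < Num.min e1 e2 / 2 by rewrite divr_gt0// lt_min e10.
have le1 : Num.min e1 e2 / 2 < e1.
  by rewrite ltr_pdivrMr// (@le_lt_trans _ _ e1) ?ge_min ?lexx// ltr_pMr// ltr1n.
have le2 : Num.min e1 e2 / 2 < e2.
  by rewrite ltr_pdivrMr// (@le_lt_trans _ _ e2) ?ge_min ?lexx ?orbT// ltr_pMr// ltr1n.
exists (Num.min e1 e2 / 2) => // K' c1 c2; apply: sub; split => /=.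
- by apply: h1 => x; rewrite (le_lt_trans (c1 x)).
- by apply: h2 => x; rewrite (le_lt_trans (c2 x)).
Qed.

Lemma sup_continuousE {m s u} (A : set (_ * _)) (T : (xvec R m -> R) * (xvec R s -> R) -> xvec R u -> R) :
  sup_continuous A T -> forall K, A K -> forall e, 0 < e -> exists2 de : R, 0 < de &
    forall K', A K' -> sup_close K.1 K'.1 de -> sup_close K.2 K'.2 de ->
    sup_close (T K) (T K') e.
Proof.
move=> /subspace_continuousP H K AK e e0.
have : nbhs (T K : {uniform xvec R u -> R}) [set h | forall x, `|T K x - h x| < e].
  by apply/uniform_near; exists e.
move=> /(H K AK) /prod_uniform_near[de de0 hde].
by exists de => // K' AK' c1 c2 x; apply: ltW; exact: (hde _ c1 c2 AK').
Qed.

Lemma sup_continuous2E {m s} (A : set (_ * _))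
    (j : (xvec R m -> R) * (xvec R s -> R) -> (xvec R m -> R) * (xvec R s -> R)) :
  sup_continuous2 A j -> forall K, A K -> forall e, 0 < e -> exists2 de : R, 0 < de &
    forall K', A K' -> sup_close K.1 K'.1 de -> sup_close K.2 K'.2 de ->
    sup_close (j K).1 (j K').1 e /\ sup_close (j K).2 (j K').2 e.
Proof.
move=> /subspace_continuousP H K AK e e0.
have : nbhs ((j K) : {uniform xvec R m -> R} * {uniform xvec R s -> R})
  [set h | (forall x, `|(j K).1 x - h.1 x| < e) /\ (forall x, `|(j K).2 x - h.2 x| < e)].
  exists ([set h | forall x, `|(j K).1 x - h x| < e],
          [set h | forall x, `|(j K).2 x - h x| < e]); last by move=> h [].
  by split; apply/uniform_near; exists e.
move=> /(H K AK) /prod_uniform_near[de de0 hde].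
exists de => // K' AK' c1 c2.
have [h1 h2] := hde _ c1 c2 AK'.
by split=> x; apply: ltW.
Qed.

Lemma linfP {l} (f : xvec R l -> R) : linf R l f <-> exists B : R, forall x, `|f x| <= B.
Proof.
split.
  move=> [M [_ hM]]; exists (M + 1) => x; apply: (hM (M + 1)) => //.
  by rewrite ltrDl.
move=> [B hB]; exists B; split; first exact: num_real.
by move=> y By x _ /=; rewrite (le_trans (hB x))// ltW.
Qed.

(** Continuity at the origin with tolerance 1 holds within a radius [de]; homogeneity turns this
    into a bound with constant [de^-1]. *)
Lemma cont_linear_bound {m s u} (dT : (xvec R m -> R) * (xvec R s -> R) -> xvec R u -> R) :
  cont_linear dT -> exists2 C : R, 0 < C & forall L (B : R),
    (forall x, `|L.1 x| <= B) -> (forall x, `|L.2 x| <= B) -> forall z, `|dT L z| <= C * B.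
Proof.
move=> [_ lin cont].
have l0 : (linf R m `*` linf R s) (0, 0) by split; apply/linfP; exists 0 => x; rewrite normr0.
have dT0 : dT (0, 0) = 0.
  have := lin 1 (0, 0) (0, 0) l0 l0.
  rewrite !scale1r addr0 => h; have := congr1 (fun f => f - dT (0, 0)) h.
  by rewrite addrK subrr.
have [de de0 h] := sup_continuousE cont l0 ltr01.
exists de^-1; first by rewrite invr_gt0.
move=> L B L1 L2 z.
(* The bound [B] may be zero, so the rescaling by [de / c] is done with a positive [c >= B], and [c]
   is sent to [B] at the end. *)
have key c : 0 < c -> B <= c -> `|dT L z| <= de^-1 * c.
  move=> c0 Bc.
  have lL : (linf R m `*` linf R s) L by split; apply/linfP; exists B.
  pose a := de / c.
  have a0 : 0 < a by rewrite divr_gt0.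
  have aB b : `|b| <= B -> `|0 - a * b| <= de.
    move=> hb; rewrite sub0r normrN normrM gtr0_norm// /a mulrAC.
    by rewrite ler_pdivrMr// ler_pM2l// (le_trans hb).
  have lL' : (linf R m `*` linf R s) (a *: L).
    by split; apply/linfP; exists de => x; [have := aB _ (L1 x)|have := aB _ (L2 x)];
      rewrite sub0r normrN.
  have := h (a *: L) lL' (fun x => aB _ (L1 x)) (fun x => aB _ (L2 x)) z.
  have -> : dT (a *: L) = a *: dT L.
    by have := lin a L (0, 0) lL l0; rewrite dT0 !addr0.
  rewrite dT0 sub0r normrN normrM gtr0_norm// /a.
  by rewrite -ler_pdivlMl ?divr_gt0// mulr1 invf_div mulrC.
have B0 : 0 <= B by rewrite (le_trans _ (L1 [tuple 0%E | k < m])).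
apply/ler_addgt0Pr => e e0.
have := key (B + de * e); rewrite mulrDr mulrA mulVf ?gt_eqF// mul1r; apply.
- by rewrite ltr_wpDl// mulr_gt0.
- by rewrite lerDl mulr_ge0// ltW.
Qed.

Lemma cont_linear0 {m s u} (dT : (xvec R m -> R) * (xvec R s -> R) -> xvec R u -> R) :
  cont_linear dT -> forall a L L', (linf R m `*` linf R s) L -> (linf R m `*` linf R s) L' ->
  forall z, dT (a *: L + L') z = a * dT L z + dT L' z.
Proof. by move=> [_ lin _] a L L' hL hL' z; rewrite lin. Qed.

(** The metric of the extended reals is the one pulled back by [contract], and row vectors carry its
    maximum over the coordinates. *)
Lemma unif_cont_contract {l} (K : xvec R l -> R) : unif_cont_xvec K ->
  forall e, 0 < e -> exists2 de : R, 0 < de & forall x y : xvec R l,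
    (forall k, `|contract (tnth x k) - contract (tnth y k)| < de) -> `|K x - K y| < e.
Proof.
move=> /unif_continuousP H e e0; have [de de0 h] := H e e0.
exists de => // x y xy.
have /(_ _) := h (\row_k tnth x k, \row_k tnth y k) => /=.
have -> : [tuple (\row_k0 tnth x k0) ord0 k | k < l] = x.
  by apply: eq_from_tnth => k; rewrite tnth_mktuple mxE.
have -> : [tuple (\row_k0 tnth y k0) ord0 k | k < l] = y.
  by apply: eq_from_tnth => k; rewrite tnth_mktuple mxE.
apply; split => // i k; rewrite !mxE; exact: xy.
Qed.

End sup_metric.

(** * The normal law *)

Section normal_moments.
Context {R : realType}.
Notation leb := (@lebesgue_measure R).

(** The fundamental theorem of calculus on [[-(n + 1), n + 1]] and dominated convergence. The
    integrations by parts against the normal density below are instances: the integral of a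
    derivative whose primitive vanishes at both ends. *)
Lemma integral_derivative0 (H h : R -> R) :
  (forall x : R, is_derive x 1 H (h x)) -> continuous h ->
  leb.-integrable setT (EFin \o h) ->
  (fun n => H n.+1%:R) @ \oo --> 0 -> (fun n => H (- n.+1%:R)) @ \oo --> 0 ->
  \int[leb]_x h x = 0.
Proof.
move=> dH ch ih Hp Hm.
pose A n : set R := `[- n.+1%:R, n.+1%:R]%classic.
have mh : measurable_fun setT h by case/integrableP : ih => /measurable_EFinP.
have lim1 : (fun n => \int[leb]_x (h x * \1_(A n) x)) @ \oo --> \int[leb]_x h x.
  apply: fine_cvg.
  have -> : (fine (\int[leb]_x (h x)%:E))%:E = (\int[leb]_x (EFin \o h) x)%E.
    by rewrite fineK//; exact: (integrable_fin_num measurableT ih).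
  apply: (@dominated_cvg _ _ _ leb setT measurableT (fun n x => (h x * \1_(A n) x)%:E) (EFin \o h)
    (fun x => `|(h x)%:E|%E)) => //.
  - move=> n; apply/measurable_EFinP; apply: measurable_funM => //.
    by apply: measurable_indic; exact: measurable_itv.
  - move=> x _; apply: cvg_EFin; first exact: nearW.
    have [N hN] : exists N : nat, `|x| <= N%:R.
      by exists (Num.bound `|x : R|); rewrite ltW// archi_boundP.
    apply: cvg_near_cst; exists N => // n /= Nn.
    rewrite indicE mem_set ?mulr1// /A /= in_itv/= -ler_norml (le_trans hN)// ler_nat.
    exact: (leq_trans Nn).
  - exact: integrable_abse.
  - move=> n x _; rewrite /= lee_fin normrM indicE.
    by case: (_ \in _); rewrite ?normr1 ?normr0 ?mulr1 ?mulr0.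
have eqn n : \int[leb]_x (h x * \1_(A n) x) = H n.+1%:R - H (- n.+1%:R).
  have -> : \int[leb]_x (h x * \1_(A n) x) = \int[leb]_(x in A n) h x.
    rewrite [RHS]Rintegral_mkcond; apply: eq_Rintegral => x _.
    by rewrite patchE indicE; case: ifPn => xA; rewrite ?mulr1 ?mulr0.
  rewrite /Rintegral (@continuous_FTC2 _ _ H)//.
  - by rewrite gtrN.
  - exact: continuous_subspaceT.
  - have cH x : H @ x --> H x.
      by apply/differentiable_continuous/derivable1_diffP; have := dH x; case.
    split.
    + by move=> x _; have := dH x; case.
    + exact/cvg_at_right_filter/cH.
    + exact/cvg_at_left_filter/cH.
  - by move=> x _; rewrite derive1E derive_val.
have lim2 : (fun n => \int[leb]_x (h x * \1_(A n) x)) @ \oo --> 0 - 0.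
  by under eq_fun do rewrite eqn; exact: cvgB.
by have := cvg_unique _ lim1 lim2; rewrite subr0; apply.
Qed.

Variables (a s : R).
Hypothesis s0 : s != 0.
Notation g := (normal_fun a s).
Notation pdf := (normal_pdf a s).

Lemma pdfE x : pdf x = normal_peak s * g x.
Proof. by rewrite normal_pdfE. Qed.

Let ss : s ^+ 2 != 0. Proof. by rewrite sqrf_eq0. Qed.

Lemma is_derive_pdf (x : R) : is_derive x 1 pdf (- (x - a) / s ^+ 2 * pdf x).
Proof.
have d1 : is_derive x 1 (fun x : R => - (x - a) ^+ 2 / (s ^+ 2 *+ 2)) (- (x - a) / s ^+ 2).
  have -> : (fun x : R => - (x - a) ^+ 2 / (s ^+ 2 *+ 2)) =
     (fun x : R => - (s ^+ 2 *+ 2)^-1 *: (x - a) ^+ 2).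
    by apply/funext => y; rewrite /= /GRing.scale/= mulrC mulrN mulNr.
  apply: is_derive_eq; rewrite /GRing.scale/= -mulr_natr; field.
  exact: s0.
have d2 : is_derive x 1 g (- (x - a) / s ^+ 2 * g x).
  have := @is_derive1_comp R expR (fun x : R => - (x - a) ^+ 2 / (s ^+ 2 *+ 2)) x _ _ (is_derive_expR _) d1.
  by rewrite mulrC.
have -> : pdf = (fun x => normal_peak s *: g x) by apply/funext => y; rewrite pdfE.
have := is_deriveZ (normal_peak s) d2 => d3.
by apply: is_derive_eq; rewrite /GRing.scale/= mulrCA.
Qed.

(** With [y = (x - a)^2 / (4 s^2)] the density is a multiple of [expR (- y) * expR (- y)]. One
    factor absorbs the polynomial through [1 + y <= expR y]; the other one is, up to its constant,
    the normal density with variance [2 s^2]. *)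
Lemma pdf_dom : exists2 K : R, 0 <= K & forall x,
  [/\ pdf x <= K * normal_pdf a (s * Num.sqrt 2) x,
   `|x - a| * pdf x <= K * normal_pdf a (s * Num.sqrt 2) x &
   (x - a) ^+ 2 * pdf x <= K * normal_pdf a (s * Num.sqrt 2) x].
Proof.
pose s' := s * Num.sqrt 2.
have s'0 : s' != 0 by rewrite mulf_neq0// sqrtr_eq0 -ltNge.
have s'2 : s' ^+ 2 = s ^+ 2 *+ 2 by rewrite exprMn sqr_sqrtr// mulr_natr.
exists (normal_peak s * (normal_peak s')^-1 * (1 + 4 * s ^+ 2)).
  rewrite !mulr_ge0 ?normal_peak_ge0 ?invr_ge0 ?normal_peak_ge0//.
  by rewrite addr_ge0// mulr_ge0// sqr_ge0.
move=> x.
rewrite !pdfE normal_pdfE// -/s'.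
set K := 1 + _; set p := normal_peak s; set p' := normal_peak s'.
have p0 : 0 <= p by exact: normal_peak_ge0.
have p'0 : 0 < p' by exact: normal_peak_gt0.
have -> : p * p'^-1 * K * (p' * normal_fun a s' x) = p * (K * normal_fun a s' x).
  by field; rewrite gt_eqF.
set y := (x - a) ^+ 2 / (4 * s ^+ 2).
have s20 : 0 < s ^+ 2 by rewrite exprn_even_gt0.
have y0 : 0 <= y by rewrite divr_ge0 ?sqr_ge0// mulr_ge0// ltW.
have g1 : g x = expR (- y) * expR (- y).
  rewrite -expRD; congr expR; rewrite /y -mulr_natr; field.
  exact: s0.
have g2 : normal_fun a s' x = expR (- y).
  rewrite /normal_fun s'2; congr expR; rewrite /y.
  have -> : s ^+ 2 *+ 2 *+ 2 = 4 * s ^+ 2 by rewrite -mulrnA -[LHS]mulr_natl.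
  by rewrite mulNr.
rewrite g1 g2.
have e1 : 1 + y <= expR y by exact: expR_ge1Dx.
have e2 : expR y * expR (- y) = 1 by rewrite -expRD subrr expR0.
have e3 : 0 < expR (- y) by exact: expR_gt0.
have xa : (x - a) ^+ 2 = 4 * s ^+ 2 * y by rewrite /y; field; rewrite s0.
have h1 : (1 + y) * expR (- y) <= 1 by rewrite -[leRHS]e2 ler_pM2r.
have k1 : expR (- y) <= 1 by rewrite -expR0 ler_expR; lra.
have main q : 0 <= q -> q <= K * (1 + y) -> q * (p * (expR (- y) * expR (- y))) <= p * (K * expR (- y)).
  move=> q0 qK.
  rewrite mulrCA ler_wpM2l// mulrA ler_pM2r//.
  apply: (@le_trans _ _ (K * (1 + y) * expR (- y))); first by rewrite ler_pM2r.
  rewrite -mulrA ler_piMr// /K addr_ge0// mulr_ge0// ltW//.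
split.
- rewrite -[leLHS]mul1r; apply: main => //.
  rewrite /K; nra.
- apply: main => //.
  have : `|x - a| ^+ 2 = 4 * s ^+ 2 * y by rewrite real_normK ?num_real.
  have := normr_ge0 (x - a); rewrite /K; nra.
- by apply: main; [exact: sqr_ge0|rewrite xa /K; nra].
Qed.

Lemma pdf_integrable (f : R -> R) : measurable_fun setT f ->
  (exists C, forall x, `|f x| <= C * (1 + `|x - a| + (x - a) ^+ 2)) ->
  leb.-integrable setT (EFin \o (fun x => f x * pdf x)).
Proof.
move=> mf [C hC]; have [K K0 hK] := pdf_dom.
have C0 : 0 <= C by have := hC a; rewrite subrr normr0 expr0n/= !addr0 mulr1; exact: le_trans.
apply: (@le_integrable _ _ _ leb setT measurableT _ (EFin \o (fun x => (C * (K + K + K)) * normal_pdf a (s * Num.sqrt 2) x))).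
- apply/measurable_EFinP; apply: measurable_funM => //; exact: measurable_normal_pdf.
- move=> x _; rewrite /= lee_fin normrM.
  rewrite (ger0_norm (normal_pdf_ge0 _ _ _)) [leRHS]ger0_norm; last first.
    by rewrite !mulr_ge0 ?normal_pdf_ge0// !addr_ge0.
  have [h1 h2 h3] := hK x.
  have h0 : `|f x| * pdf x <= C * (1 + `|x - a| + (x - a) ^+ 2) * pdf x.
    by rewrite ler_wpM2r ?normal_pdf_ge0.
  apply: (le_trans h0); rewrite -!mulrA ler_wpM2l//; lra.
- have -> : EFin \o (fun x => (C * (K + K + K)) * normal_pdf a (s * Num.sqrt 2) x) =
    (fun x => (C * (K + K + K))%:E * (normal_pdf a (s * Num.sqrt 2) x)%:E)%E.
    by apply/funext => x; rewrite -EFinM.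
  by apply: integrableZl => //; exact: integrable_normal_pdf.
Qed.

(** The condition [e ^+ 2 = 1] makes [e] a sign, so that both tails are treated at once. *)
Lemma pdf_cvg0 (f : R -> R) : (exists C, forall x, `|f x| <= C * (1 + `|x - a|)) ->
  forall e : R, e ^+ 2 = 1 -> (fun n => f (e * n.+1%:R) * pdf (e * n.+1%:R)) @ \oo --> 0.
Proof.
move=> [C hC] e e2.
have s20 : 0 < s ^+ 2 by rewrite exprn_even_gt0.
have C0 : 0 <= C by have := hC a; rewrite subrr normr0 !addr0 mulr1; exact: le_trans.
pose c := normal_peak s.
have c0 : 0 <= c by exact: normal_peak_ge0.
(* [exp (- z^2 / 2 s^2) <= 2 s^2 / z^2], and [1 + |z| <= 2 z^2] for [|z| >= 1] *)
have bnd x : 1 <= `|x - a| -> `|f x * pdf x| <= C * c * (8 * (s ^+ 2) * (1 + s ^+ 2)) / `|x - a|.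
  move=> z1; set z := `|x - a| in z1 *.
  have z0 : 0 < z by exact: lt_le_trans z1.
  rewrite normrM (ger0_norm (normal_pdf_ge0 _ _ _)).
  rewrite ler_pdivlMr// pdfE -/c.
  set w := z ^+ 2 / (s ^+ 2 * 4).
  have zw : z ^+ 2 = s ^+ 2 * 4 * w by rewrite /w; field; rewrite s0.
  have w0 : 0 <= w by rewrite divr_ge0 ?sqr_ge0// mulr_ge0// ltW.
  have gw : g x = expR (- w) * expR (- w).
    have z2 : z ^+ 2 = (x - a) ^+ 2 by rewrite /z real_normK// num_real.
    rewrite -expRD; congr expR; rewrite /w z2 -mulr_natr; field.
    exact: s0.
  have e1 : 1 + w <= expR w by exact: expR_ge1Dx.
  have ee : expR w * expR (- w) = 1 by rewrite -expRD subrr expR0.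
  have e3 : 0 < expR (- w) by exact: expR_gt0.
  have h1 : w * expR (- w) <= 1 by rewrite -[leRHS]ee ler_pM2r//; lra.
  have h2 : expR (- w) <= 1 by rewrite -expR0 ler_expR; lra.
  have hf := hC x; rewrite -/z in hf.
  have hf2 : `|f x| * z <= C * (2 * z ^+ 2).
    apply: (@le_trans _ _ (C * (1 + z) * z)); first by rewrite ler_pM2r.
    rewrite -mulrA ler_wpM2l//; nra.
  rewrite gw.
  have -> : `|f x| * (c * (expR (- w) * expR (- w))) * z = c * (`|f x| * z * (expR (- w) * expR (- w))) by ring.
  have -> : C * c * (8 * s ^+ 2 * (1 + s ^+ 2)) = c * (C * (8 * s ^+ 2 * (1 + s ^+ 2))) by ring.
  rewrite ler_wpM2l//.
  apply: (@le_trans _ _ (C * (2 * z ^+ 2) * (expR (- w) * expR (- w)))).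
    by rewrite ler_wpM2r// mulr_ge0// ltW.
  rewrite -mulrA ler_wpM2l// zw.
  have -> : 2 * (s ^+ 2 * 4 * w) * (expR (- w) * expR (- w)) = 8 * s ^+ 2 * ((w * expR (- w)) * expR (- w)) by ring.
  rewrite -mulrA -[leRHS]mulrA ler_wpM2l// ler_wpM2l ?(ltW s20)//.
  apply: (@le_trans _ _ 1); last by rewrite lerDl ltW.
  by apply: mulr_ile1 => //; apply: mulr_ge0 => //; exact: ltW.
pose D := C * c * (8 * (s ^+ 2) * (1 + s ^+ 2)).
have D0 : 0 <= D by rewrite /D; apply: mulr_ge0; [exact: mulr_ge0|apply: mulr_ge0; [apply: mulr_ge0 => //; exact: ltW|apply: addr_ge0 => //; exact: ltW]].
apply/cvgrPdist_le => /= eps eps0.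
have e1 : `|e| = 1.
  have : `|e| ^+ 2 = 1 by rewrite real_normK// num_real.
  have := normr_ge0 e; nra.
near=> n.
rewrite sub0r normrN.
have nb : `|a| + 1 + D / eps <= `|e * n.+1%:R - a|.
  have : `|e * n.+1%:R| <= `|e * n.+1%:R - a| + `|a|.
    by rewrite -[X in `|X| <= _](subrK a) ler_normD.
  rewrite normrM e1 mul1r normr_nat.
  have : `|a| + `|a| + 1 + D / eps <= n%:R by near: n; exact: nbhs_infty_ger.
  have : (n%:R : R) <= n.+1%:R by rewrite ler_nat.
  by lra.
have De : 0 <= D / eps by rewrite divr_ge0// ltW.
have a0 := normr_ge0 a.
have z1 : 1 <= `|e * n.+1%:R - a| by lra.
apply: (le_trans (bnd _ z1)); rewrite -/D ler_pdivrMr; last exact: lt_le_trans z1.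
rewrite -ler_pdivrMl// mulrC; lra.
Unshelve. all: by end_near. Qed.

Lemma pdf_cvg0p (f : R -> R) : (exists C, forall x, `|f x| <= C * (1 + `|x - a|)) ->
  (fun n => f n.+1%:R * pdf n.+1%:R) @ \oo --> 0.
Proof.
move=> hf; have := pdf_cvg0 hf (expr1n _ _ : 1 ^+ 2 = 1).
by rewrite (_ : (fun n => _) = (fun n => f n.+1%:R * pdf n.+1%:R))//; apply/funext => n; rewrite mul1r.
Qed.

Lemma pdf_cvg0m (f : R -> R) : (exists C, forall x, `|f x| <= C * (1 + `|x - a|)) ->
  (fun n => f (- n.+1%:R) * pdf (- n.+1%:R)) @ \oo --> 0.
Proof.
move=> hf; have e : (- 1 : R) ^+ 2 = 1 by rewrite sqrrN expr1n.
have := pdf_cvg0 hf e.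
by rewrite (_ : (fun n => _) = (fun n => f (- n.+1%:R) * pdf (- n.+1%:R)))//; apply/funext => n; rewrite mulN1r.
Qed.

Lemma is_derive_affine (p q x : R) : is_derive x 1 (fun x : R => p + q * x) q.
Proof.
have -> : (fun x : R => p + q * x) = cst p + q \*: id by apply/funext.
have := is_deriveD (is_derive_cst p x 1) (is_deriveZ q (is_derive_id x 1)) => d.
by apply: is_derive_eq; rewrite add0r /GRing.scale/= mulr1.
Qed.

Lemma integral_pdf1 : \int[leb]_x pdf x = 1.
Proof. by rewrite /Rintegral integral_normal_pdf. Qed.

Let cpdf : continuous pdf. Proof. exact: continuous_normal_pdf. Qed.

Lemma integral_pdf_mean : \int[leb]_x ((x - a) * pdf x) = 0.
Proof.
have mX : measurable_fun setT (fun x : R => x - a) by exact: measurable_funB.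
have bX : exists C, forall x : R, `|x - a| <= C * (1 + `|x - a| + (x - a) ^+ 2).
  by exists 1 => x; have := sqr_ge0 (x - a); lra.
have iX := pdf_integrable mX bX.
have := @integral_derivative0 (fun x => - s ^+ 2 * pdf x) (fun x => (x - a) * pdf x).
apply.
- move=> x; have := is_deriveZ (- s ^+ 2) (is_derive_pdf x) => d.
  by apply: is_derive_eq; rewrite /GRing.scale/=; field.
- by move=> x; apply: cvgM; [apply: cvgB => //; exact: cvg_cst|exact: cpdf].
- exact: iX.
- apply: (@pdf_cvg0p (fun=> - s ^+ 2)).
  by exists (s ^+ 2) => x; rewrite normrN ger0_norm ?sqr_ge0// ler_peMr ?sqr_ge0// lerDl.
- apply: (@pdf_cvg0m (fun=> - s ^+ 2)).
  by exists (s ^+ 2) => x; rewrite normrN ger0_norm ?sqr_ge0// ler_peMr ?sqr_ge0// lerDl.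
Qed.

Lemma integral_pdf_var : \int[leb]_x ((x - a) ^+ 2 * pdf x) = s ^+ 2.
Proof.
have i2 : leb.-integrable setT (EFin \o (fun x => (x - a) ^+ 2 * pdf x)).
  apply: pdf_integrable; first by apply: measurable_funX; exact: measurable_funB.
  by exists 1 => x; rewrite ger0_norm ?sqr_ge0//; have := normr_ge0 (x - a); lra.
have i0 : leb.-integrable setT (EFin \o (fun x => s ^+ 2 * pdf x)).
  apply: pdf_integrable; first exact: measurable_cst.
  exists (s ^+ 2) => x; rewrite ger0_norm ?sqr_ge0// ler_peMr ?sqr_ge0//.
  by rewrite -addrA lerDl addr_ge0// sqr_ge0.
have : \int[leb]_x ((s ^+ 2 - (x - a) ^+ 2) * pdf x) = 0.
  apply: (@integral_derivative0 (fun x => s ^+ 2 * (x - a) * pdf x) (fun x => (s ^+ 2 - (x - a) ^+ 2) * pdf x)).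
  - move=> x; have d := is_derive_pdf x.
    have d1 : is_derive x 1 (fun x : R => s ^+ 2 *: (x - a)) (s ^+ 2).
      by apply: is_derive_eq; rewrite subr0 /GRing.scale/= mulr1.
    have := is_deriveM d1 d => d2.
    by apply: is_derive_eq; rewrite /GRing.scale/=; field.
  - move=> x; apply: cvgM; last exact: cpdf.
    apply: cvgB; first exact: cvg_cst.
    apply: (@continuous_comp _ _ _ (fun x : R => x - a) (fun y => y ^+ 2)).
      by apply: continuousB => //; exact: cst_continuous.
    exact: exprn_continuous.
  - have -> : EFin \o (fun x => (s ^+ 2 - (x - a) ^+ 2) * pdf x) =
      (fun x => (s ^+ 2 * pdf x)%:E - ((x - a) ^+ 2 * pdf x)%:E)%E.
      by apply/funext => x /=; rewrite -EFinB mulrBl.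
    exact: integrableB.
  - apply: (@pdf_cvg0p (fun x => s ^+ 2 * (x - a))).
    by exists (s ^+ 2) => x; rewrite normrM ger0_norm ?sqr_ge0// ler_wpM2l ?sqr_ge0// lerDr.
  - apply: (@pdf_cvg0m (fun x => s ^+ 2 * (x - a))).
    by exists (s ^+ 2) => x; rewrite normrM ger0_norm ?sqr_ge0// ler_wpM2l ?sqr_ge0// lerDr.
under eq_Rintegral do rewrite mulrBl.
rewrite RintegralB// => /eqP; rewrite subr_eq0 => /eqP <-.
rewrite RintegralZl//; last exact: integrable_normal_pdf.
by rewrite integral_pdf1 mulr1.
Qed.

(** Real form of the characteristic function: the phase [th] makes the cosine stand for the sine as
    well. *)
Definition pdf_cos (th t : R) := \int[leb]_x (cos (th + t * (x - a)) * pdf x).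

Let mcos (th t : R) : measurable_fun setT (fun x : R => cos (th + t * (x - a))).
Proof.
apply: measurableT_comp; first by apply: continuous_measurable_fun; exact: continuous_cos.
by apply: measurable_funD => //; apply: measurable_funM => //; exact: measurable_funB.
Qed.

Let msin (th t : R) : measurable_fun setT (fun x : R => sin (th + t * (x - a))).
Proof.
apply: measurableT_comp; first by apply: continuous_measurable_fun; exact: continuous_sin.
by apply: measurable_funD => //; apply: measurable_funM => //; exact: measurable_funB.
Qed.

Let icos (th t : R) : leb.-integrable setT (EFin \o (fun x => cos (th + t * (x - a)) * pdf x)).
Proof.
apply: pdf_integrable => //; exists 1 => x; rewrite mul1r.
rewrite (le_trans (_ : _ <= 1)) ?ler_norml ?cos_geN1 ?cos_le1//.
by rewrite -addrA lerDl addr_ge0// sqr_ge0.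
Qed.

Let lin_deriv (th t x : R) : is_derive t 1 (fun t : R => th + t * (x - a)) (x - a).
Proof.
have -> : (fun t : R => th + t * (x - a)) = (fun t : R => th + (x - a) * t).
  by apply/funext => y; rewrite mulrC.
exact: is_derive_affine.
Qed.

Let cos_deriv (th t x : R) : is_derive t 1 (fun t : R => cos (th + t * (x - a)) * pdf x)
  (- (x - a) * sin (th + t * (x - a)) * pdf x).
Proof.
have d1 := @is_derive1_comp R cos _ t _ _ (is_derive_cos _) (lin_deriv th t x).
have -> : (fun t : R => cos (th + t * (x - a)) * pdf x) = (fun t : R => pdf x *: (cos \o (fun t => th + t * (x - a))) t).
  by apply/funext => y; rewrite /GRing.scale/= mulrC.
have := is_deriveZ (pdf x) d1 => d2.
by apply: is_derive_eq; rewrite /GRing.scale/=; ring.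
Qed.

(** Stein's identity for [sin (th + t * (x - a))]. The left side is the derivative of [pdf_cos th]
    in [t], so this is a linear differential equation for that function. *)
Lemma integral_pdf_sin (th t : R) :
  \int[leb]_x (- (x - a) * sin (th + t * (x - a)) * pdf x) = - s ^+ 2 * t * pdf_cos th t.
Proof.
have i1 : leb.-integrable setT (EFin \o (fun x => - (x - a) * sin (th + t * (x - a)) * pdf x)).
  apply: pdf_integrable.
    apply: measurable_funM => //; apply: measurable_funN => //; exact: measurable_funB.
  exists 1 => x; rewrite mul1r normrM normrN.
  have : `|sin (th + t * (x - a))| <= 1 by rewrite ler_norml sin_geN1 sin_le1.
  have := normr_ge0 (sin (th + t * (x - a))); have := normr_ge0 (x - a).
  by have := sqr_ge0 (x - a); nra.
have i0 : leb.-integrable setT (EFin \o (fun x => s ^+ 2 * t * (cos (th + t * (x - a)) * pdf x))).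
  have -> : EFin \o (fun x => s ^+ 2 * t * (cos (th + t * (x - a)) * pdf x)) =
    (fun x => (s ^+ 2 * t)%:E * (cos (th + t * (x - a)) * pdf x)%:E)%E.
    by apply/funext => x; rewrite -EFinM.
  by apply: integrableZl => //; exact: icos.
have := @integral_derivative0 (fun x => s ^+ 2 * sin (th + t * (x - a)) * pdf x)
  (fun x => s ^+ 2 * t * (cos (th + t * (x - a)) * pdf x) + - (x - a) * sin (th + t * (x - a)) * pdf x).
rewrite RintegralD// RintegralZl; [|by []|exact: icos].
move=> H; suff : s ^+ 2 * t * pdf_cos th t +
  \int[leb]_x (- (x - a) * sin (th + t * (x - a)) * pdf x) = 0 by lra.
apply: H.
- move=> x; have d := is_derive_pdf x.
  have l1 : is_derive x 1 (fun x : R => th + t * (x - a)) t.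
    have -> : (fun x : R => th + t * (x - a)) = (fun x : R => (th - t * a) + t * x).
      by apply/funext => y; ring.
    exact: is_derive_affine.
  have d1 := @is_derive1_comp R sin _ x _ _ (is_derive_sin _) l1.
  have d2 : is_derive x 1 (fun x : R => s ^+ 2 * sin (th + t * (x - a)))
    (s ^+ 2 * (cos (th + t * (x - a)) * t)) by exact: (is_deriveZ (s ^+ 2) d1).
  have := is_deriveM d2 d => d3.
  by apply: is_derive_eq; rewrite /GRing.scale/=; field.
- have cl : continuous (fun x : R => th + t * (x - a)).
    move=> x; apply: cvgD; first exact: cvg_cst.
    apply: cvgM; first exact: cvg_cst.
    by apply: cvgB => //; exact: cvg_cst.
  move=> x; apply: cvgD.
    apply: cvgM; first exact: cvg_cst.
    apply: cvgM; last exact: cpdf.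
    apply: (@continuous_comp _ _ _ (fun x => th + t * (x - a)) cos); first exact: cl.
    exact: continuous_cos.
  apply: cvgM; last exact: cpdf.
  apply: cvgM.
    by apply: cvgN; apply: cvgB => //; exact: cvg_cst.
  apply: (@continuous_comp _ _ _ (fun x => th + t * (x - a)) sin); first exact: cl.
  exact: continuous_sin.
- have -> : EFin \o (fun x => s ^+ 2 * t * (cos (th + t * (x - a)) * pdf x) + - (x - a) * sin (th + t * (x - a)) * pdf x)
   = (fun x => (s ^+ 2 * t * (cos (th + t * (x - a)) * pdf x))%:E + (- (x - a) * sin (th + t * (x - a)) * pdf x)%:E)%E.
    by apply/funext => x /=; rewrite -EFinD.
  exact: integrableD.
- apply: (@pdf_cvg0p (fun x => s ^+ 2 * sin (th + t * (x - a)))).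
  exists (s ^+ 2) => x; rewrite normrM ger0_norm ?sqr_ge0// ler_wpM2l ?sqr_ge0//.
  by rewrite (le_trans (_ : _ <= 1)) ?ler_norml ?sin_geN1 ?sin_le1// lerDl.
- apply: (@pdf_cvg0m (fun x => s ^+ 2 * sin (th + t * (x - a)))).
  exists (s ^+ 2) => x; rewrite normrM ger0_norm ?sqr_ge0// ler_wpM2l ?sqr_ge0//.
  by rewrite (le_trans (_ : _ <= 1)) ?ler_norml ?sin_geN1 ?sin_le1// lerDl.
Qed.

(** Differentiation under the integral sign gives [y' = - s^2 t y] for [pdf_cos th]. After
    multiplication by the integrating factor the function is constant, with value [cos th] at
    [t = 0]. *)
Lemma pdf_cosE (th t : R) : pdf_cos th t = cos th * expR (- (s ^+ 2 * t ^+ 2 / 2)).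
Proof.
have d (u : R) : is_derive u 1 (pdf_cos th) (- s ^+ 2 * u * pdf_cos th u).
  have iG : leb.-integrable setT (EFin \o (fun x => `|x - a| * pdf x)).
    apply: pdf_integrable; first by apply: measurableT_comp => //; exact: measurable_funB.
    by exists 1 => x; rewrite mul1r normr_id; have := sqr_ge0 (x - a); lra.
  have uI : `]u - 1, u + 1[%classic u by rewrite /= in_itv/=; apply/andP; split; lra.
  have GE x y : partial1of2 (fun t x => cos (th + t * (x - a)) * pdf x) x y =
     - (y - a) * sin (th + x * (y - a)) * pdf y.
    by rewrite partial1of2E; have := cos_deriv th x y => h; rewrite derive_val.
  have dd x y : derivable ((fun t x => cos (th + t * (x - a)) * pdf x) ^~ y) x 1.
    by have := cos_deriv th x y; case.
  have ub x y : `|partial1of2 (fun t x => cos (th + t * (x - a)) * pdf x) x y| <= `|y - a| * pdf y.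
    rewrite GE normrM (ger0_norm (normal_pdf_ge0 _ _ _)) ler_wpM2r ?normal_pdf_ge0//.
    by rewrite normrM normrN ler_piMr// ler_norml sin_geN1 sin_le1.
  have C := @cvg_differentiation_under_integral R _ _ leb (fun t x => cos (th + t * (x - a)) * pdf x)
    setT measurableT u (u - 1) (u + 1) uI (fun x _ => icos th x) (fun x y _ _ => dd x y)
    (fun x => `|x - a| * pdf x) (fun y => mulr_ge0 (normr_ge0 _) (normal_pdf_ge0 _ _ _)) iG (fun x y _ _ => ub x y).
  have E : \int[leb]_y partial1of2 (fun t x => cos (th + t * (x - a)) * pdf x) u y = - s ^+ 2 * u * pdf_cos th u.
    by rewrite -integral_pdf_sin; apply: eq_Rintegral => x _; rewrite GE.
  rewrite E in C.
  have C' : h^-1 *: ((pdf_cos th \o shift u) (h *: (1:R)) - pdf_cos th u) @[h --> 0^'] --> - s ^+ 2 * u * pdf_cos th u.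
    move: C; apply: cvg_trans; apply: near_eq_cvg; near=> h.
    by rewrite /= /GRing.scale/= mulr1.
  by apply: DeriveDef; [apply/cvg_ex; eexists; exact: C'|exact: cvg_lim].
pose H u := pdf_cos th u * expR (s ^+ 2 / 2 * u ^+ 2).
have dH (u : R) : is_derive u 1 H 0.
  have d1 : is_derive u 1 (fun u : R => s ^+ 2 / 2 *: u ^+ 2) (s ^+ 2 * u).
    by apply: is_derive_eq; rewrite /GRing.scale/=; field.
  have d2 := @is_derive1_comp R expR _ u _ _ (is_derive_expR _) d1.
  have := is_deriveM (d u) d2 => d3.
  by apply: is_derive_eq; rewrite /GRing.scale/=; ring.
have Hc : H t = H 0 by apply: is_derive_0_is_cst.
have H0 : H 0 = cos th.
  rewrite /H expr0n/= mulr0 expR0 mulr1 /pdf_cos.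
  under eq_Rintegral do rewrite mul0r addr0.
  by rewrite RintegralZl ?integral_pdf1 ?mulr1//; exact: integrable_normal_pdf.
have e : expR (s ^+ 2 / 2 * t ^+ 2) * expR (- (s ^+ 2 * t ^+ 2 / 2)) = 1.
  rewrite -expRD (_ : s ^+ 2 / 2 * t ^+ 2 - s ^+ 2 * t ^+ 2 / 2 = 0) ?expR0//; by field.
by rewrite -H0 -Hc /H -[RHS]mulrA e mulr1.
Unshelve. all: by end_near. Qed.

End normal_moments.

Section normal_law.
Context {R : realType}.
Notation leb := (@lebesgue_measure R).

Import HBNNSimple.

(** On sets the law is the integral of the density by definition; simple functions and monotone
    convergence carry the formula to nonnegative functions. *)
Lemma integral_normal_prob (a s : R) (f : _ -> \bar R) :
  measurable_fun setT f -> (forall x, 0 <= f x)%E ->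
  (\int[normal_prob a s]_x f x = \int[leb]_x (f x * (normal_pdf a s x)%:E))%E.
Proof.
move=> mf f0.
have mpdf : measurable_fun setT (EFin \o normal_pdf a s).
  by apply/measurable_EFinP; exact: measurable_normal_pdf.
have p0 x : (0 <= (normal_pdf a s x)%:E)%E by rewrite lee_fin normal_pdf_ge0.
pose f_ := nnsfun_approx measurableT mf.
have lhs : (\int[normal_prob a s]_x f x =
   lim (\int[normal_prob a s]_x (f_ n x)%:E @[n --> \oo]))%E.
  rewrite -monotone_convergence//=.
  - apply: eq_integral => x _; apply/esym/cvg_lim => //=.
    exact: cvg_nnsfun_approx.
  - by move=> n; apply/measurable_EFinP; first [exact: measurable_funPT|exact: measurable_funP|exact: measurable_funTS].
  - by move=> n x _; rewrite lee_fin.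
  - by move=> x _ m n mn; rewrite lee_fin; exact/lefP/nd_nnsfun_approx.
rewrite lhs.
have rhs : (\int[leb]_x (f x * (normal_pdf a s x)%:E) =
   lim (\int[leb]_x ((f_ n x)%:E * (normal_pdf a s x)%:E) @[n --> \oo]))%E.
  rewrite -monotone_convergence//=.
  - apply: eq_integral => x _; apply/esym/cvg_lim => //=.
    by apply: cvgeZr => //; exact: cvg_nnsfun_approx.
  - move=> n; apply: emeasurable_funM => //.
    apply/measurable_EFinP; first [exact: measurable_funPT|exact: measurable_funP|exact: measurable_funTS].
  - by move=> n x _; rewrite mule_ge0// lee_fin.
  - by move=> x _ m n mn; rewrite lee_pmul// ?lee_fin//; exact/lefP/nd_nnsfun_approx.
rewrite rhs; apply: congr_lim; apply/funext => n.
under eq_integral do rewrite fimfunE -fsumEFin//.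
under [RHS]eq_integral.
  move=> x _; rewrite fimfunE -fsumEFin// ge0_mule_fsuml; last first.
    by move=> r; rewrite EFinM nnfun_muleindic_ge0.
  over.
rewrite ge0_integral_fsum//; last 2 first.
- by move=> r; apply/measurable_EFinP; apply: measurable_funM => //; apply: measurable_indic; rewrite -[X in measurable X]setTI; exact: measurable_funP.
- by move=> r x _; rewrite EFinM nnfun_muleindic_ge0.
rewrite ge0_integral_fsum//; last 2 first.
- move=> r; apply: emeasurable_funM => //.
  apply/measurable_EFinP; apply: measurable_funM => //; apply: measurable_indic; rewrite -[X in measurable X]setTI; exact: measurable_funP.
- by move=> r x _; rewrite mule_ge0// EFinM nnfun_muleindic_ge0.
apply: eq_fsbigr => r _.
set A := f_ n @^-1` [set r].
have mA : measurable A by rewrite /A -[X in measurable X]setTI; exact: measurable_funP.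
have [r0|r0] := ltP r 0.
  have A0 : A = set0.
    by apply/seteqP; split => x //= xr; move: r0; rewrite -xr ltNge; case/negP.
  rewrite !integral0_eq// => x _; rewrite A0 indic0 mulr0 ?mul0e//.
under eq_integral do rewrite EFinM.
under [RHS]eq_integral do rewrite EFinM -muleA.
rewrite !ge0_integralZl_EFin//; last 3 first.
- by move=> x _; rewrite mule_ge0// lee_fin.
- by apply: emeasurable_funM => //; exact/measurable_EFinP/measurable_indic.
- exact/measurable_EFinP/measurable_indic.
congr (_ * _)%E; rewrite integral_indic// setIT.
transitivity (\int[leb]_(x in A) (normal_pdf a s x)%:E)%E => //.
rewrite [LHS]integral_mkcond.
apply: eq_integral => x _; rewrite patchE indicE.
by case: ifPn => _; rewrite ?mul1e ?mul0e.
Qed.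

(** The center [b] is arbitrary: comparing two values of it later determines the mean and the
    variance of a normal variable. *)
Lemma normal_prob_sqr (a s b : R) : s != 0 ->
  (\int[normal_prob a s]_x ((x - b) ^+ 2)%:E = (s ^+ 2 + (a - b) ^+ 2)%:E)%E.
Proof.
move=> s0; rewrite integral_normal_prob; last 2 first.
- apply/measurable_EFinP; apply: measurable_funX; exact: measurable_funB.
- by move=> x; rewrite lee_fin sqr_ge0.
have mB (c : R) : measurable_fun setT (fun x : R => x - c) by exact: measurable_funB.
have i2 : leb.-integrable setT (EFin \o (fun x => (x - a) ^+ 2 * normal_pdf a s x)).
  apply: pdf_integrable => //; first by apply: measurable_funX.
  by exists 1 => x; rewrite ger0_norm ?sqr_ge0//; have := normr_ge0 (x - a); lra.
have i1 : leb.-integrable setT (EFin \o (fun x => (2 * (a - b)) * ((x - a) * normal_pdf a s x))).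
  under eq_fun do rewrite mulrA.
  apply: pdf_integrable => //; first exact: measurable_funM.
  exists `|2 * (a - b)| => x; rewrite normrM ler_wpM2l//.
  by have := sqr_ge0 (x - a); lra.
have i0 : leb.-integrable setT (EFin \o (fun x => (a - b) ^+ 2 * normal_pdf a s x)).
  apply: pdf_integrable => //.
  exists ((a - b) ^+ 2) => x; rewrite ger0_norm ?sqr_ge0// ler_peMr ?sqr_ge0//.
  by rewrite -addrA lerDl addr_ge0// sqr_ge0.
have i10 : leb.-integrable setT (EFin \o (fun x => (2 * (a - b)) * ((x - a) * normal_pdf a s x) + (a - b) ^+ 2 * normal_pdf a s x)).
  have -> : EFin \o (fun x => (2 * (a - b)) * ((x - a) * normal_pdf a s x) + (a - b) ^+ 2 * normal_pdf a s x) =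
    (fun x => ((2 * (a - b)) * ((x - a) * normal_pdf a s x))%:E + ((a - b) ^+ 2 * normal_pdf a s x)%:E)%E.
    by apply/funext => x /=; rewrite EFinD.
  exact: integrableD.
have E : (fun x : R => ((x - b) ^+ 2)%:E * (normal_pdf a s x)%:E)%E = EFin \o (fun x =>
  (x - a) ^+ 2 * normal_pdf a s x + ((2 * (a - b)) * ((x - a) * normal_pdf a s x) + (a - b) ^+ 2 * normal_pdf a s x)).
  by apply/funext => x /=; rewrite -EFinM; congr EFin; ring.
have iE : leb.-integrable setT (fun x : R => ((x - b) ^+ 2)%:E * (normal_pdf a s x)%:E)%E.
  rewrite E (_ : EFin \o _ = (fun x => ((x - a) ^+ 2 * normal_pdf a s x)%:E +
    ((2 * (a - b)) * ((x - a) * normal_pdf a s x) + (a - b) ^+ 2 * normal_pdf a s x)%:E)%E).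
    exact: integrableD.
  by apply/funext => x /=; rewrite EFinD.
rewrite -[LHS]fineK; last exact: integrable_fin_num.
congr EFin; rewrite E -/(Rintegral _ _ _) RintegralD// RintegralD//.
rewrite RintegralZl//; last first.
  apply: pdf_integrable => //; exists 1 => x; have := sqr_ge0 (x - a); lra.
rewrite RintegralZl//; last exact: integrable_normal_pdf.
by rewrite integral_pdf_mean// integral_pdf1 integral_pdf_var//; ring.
Qed.

Lemma normal_prob_cos (a s th t : R) : s != 0 ->
  Ex (normal_prob a s) (fun x => cos (th + t * x)) =
  cos (th + t * a) * expR (- (s ^+ 2 * t ^+ 2 / 2)).
Proof.
move=> s0; rewrite -(pdf_cosE a s0).
have mc : measurable_fun setT (fun x : R => cos (th + t * x)).
  apply: measurableT_comp; first by apply: continuous_measurable_fun; exact: continuous_cos.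
  by apply: measurable_funD => //; apply: measurable_funM.
have bc : bmeas (fun x : R => cos (th + t * x)).
  by split => //; exists 1 => x; rewrite ler_norml cos_geN1 cos_le1.
have bc1 : bmeas (fun x : R => cos (th + t * x) + 1) by apply: bmeasD => //; exact: bmeas_cst.
have ip := @integrable_normal_pdf R a s.
have ic : leb.-integrable setT (EFin \o (fun x => cos (th + t * x) * normal_pdf a s x)).
  apply: pdf_integrable => //; exists 1 => x.
  rewrite mul1r (le_trans (_ : _ <= 1)) ?ler_norml ?cos_geN1 ?cos_le1//.
  by rewrite -addrA lerDl addr_ge0// sqr_ge0.
(* Adding 1 makes the integrand nonnegative, as [integral_normal_prob] requires. *)
have H : Ex (normal_prob a s) (fun x => cos (th + t * x) + 1) =
   \int[leb]_x (cos (th + t * x) * normal_pdf a s x + normal_pdf a s x).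
  rewrite /Ex/Rintegral; congr fine; rewrite integral_normal_prob.
  - by apply: eq_integral => x _; rewrite -EFinM mulrDl mul1r.
  - by case: bc1 => m1 _; exact/measurable_EFinP.
  - by move=> x; rewrite lee_fin; have := cos_geN1 (th + t * x); lra.
rewrite ExD// in H; last exact: bmeas_cst.
rewrite Ex_cst RintegralD// integral_pdf1 in H.
have -> : pdf_cos a s (th + t * a) t = \int[leb]_x (cos (th + t * x) * normal_pdf a s x).
  by apply: eq_Rintegral => x _; congr (cos _ * _); ring.
exact: (addIr _ H).
Qed.

End normal_law.

(** * Products of laws *)

Section mfun_pack.
Context {d d'} {T : measurableType d} {T' : measurableType d'}.
Definition mfun_of (f : T -> T') (mf : measurable_fun setT f) : {mfun T >-> T'} :=
  HB.pack f (isMeasurableFun.Build _ _ _ _ f mf).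
End mfun_pack.

Section prod_law.
Context {R : realType} {d} {T : measurableType d}.

(** Law of independent coordinates with individual laws [mu i]. The recursion is that of [iid_law],
    which is the constant case, so that data and bootstrap samples fall under the same
    statements. *)
Fixpoint prod_law (mu : nat -> probability T R) n : probability (n.-tuple T) R :=
  match n with
  | 0 => \d_([tuple])
  | n'.+1 => distribution (mu 0%N \x prod_law (fun i => mu i.+1) n')%E (@cons_pair d T n')
  end.

Lemma iid_lawE (mu : probability T R) n : iid_law mu n = prod_law (fun=> mu) n.
Proof. by elim: n => //= n ->. Qed.

Lemma tnth_cons0 n (x : T) (y : n.-tuple T) : tnth (cons_pair (x, y)) ord0 = x.
Proof. by []. Qed.

Lemma tnth_consS n (x : T) (y : n.-tuple T) i : tnth (cons_pair (x, y)) (lift ord0 i) = tnth y i.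
Proof. exact: tnthS. Qed.

Lemma Ex_prod_law0 (mu : nat -> probability T R) (f : 0.-tuple T -> R) :
  Ex (prod_law mu 0) f = f [tuple].
Proof.
have -> : f = fun=> f [tuple] by apply/funext => y; rewrite (tuple0 y).
exact: Ex_cst.
Qed.

Lemma Ex_prod_lawS (mu : nat -> probability T R) n (f : n.+1.-tuple T -> R) : bmeas f ->
  Ex (prod_law mu n.+1) f =
  Ex (mu 0%N) (fun x => Ex (prod_law (fun i => mu i.+1) n) (fun y => f (cons_pair (x, y)))).
Proof.
move=> bf; rewrite /= Ex_distribution// Ex_fubini1//.
by apply: (bmeas_comp bf); exact: measurable_cons_pair.
Qed.

Lemma bmeas_cons n (f : n.+1.-tuple T -> R) : bmeas f -> bmeas (fun z : T * n.-tuple T => f (cons_pair z)).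
Proof. by move=> bf; apply: (bmeas_comp bf); exact: measurable_cons_pair. Qed.

Lemma bmeas_tnth n (f : T -> R) (i : 'I_n) : bmeas f -> bmeas (fun y : n.-tuple T => f (tnth y i)).
Proof. by move=> bf; apply: (bmeas_comp bf); exact: measurable_tnth. Qed.

Lemma prod_law_rect (mu : nat -> probability T R) n (A : nat -> set T) :
  (forall i, measurable (A i)) ->
  prod_law mu n [set y | forall i : 'I_n, A i (tnth y i)] = (\prod_(i < n) mu i (A i))%E.
Proof.
elim: n mu A => [|n IH] mu A mA.
  rewrite big_ord0 (_ : [set _ | _] = setT) ?probability_setT//.
  by apply/seteqP; split => // y _ [].
rewrite big_ord_recl -(IH (fun i => mu i.+1) (fun i => A i.+1))// -product_measure1E//; last first.
  rewrite (_ : [set y | _] = \big[setI/setT]_(i < n) ((@tnth n T ^~ i) @^-1` A i.+1)).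
    apply: bigsetI_measurable => i _; rewrite -[X in measurable X]setTI.
    exact: measurable_tnth.
  rewrite -bigcap_seq; apply/seteqP; split => y /= h i; last exact: (h i (mem_index_enum _)).
  by move=> _; exact: h.
rewrite /=; congr (product_measure1 _ _ _).
apply/seteqP; split => -[x y] /=.
  by move=> h; split; [exact: (h ord0)|move=> i; rewrite -(tnth_consS x); exact: (h (lift ord0 i))].
move=> [hx hy] i; case: (unliftP ord0 i) => [k|] ->; last by rewrite tnth_cons0.
by rewrite tnth_consS; exact: hy.
Qed.

End prod_law.

Section independence.
Context {R : realType} {d} {W : measurableType d} (P : probability W R).

(** Rectangles are stable under intersection and generate the product sigma-algebra, so a law is
    determined by its values on them. *)
Lemma prod_law_unique {d'} {T : measurableType d'} (mu : nat -> probability T R) n (Y : {mfun W >-> n.-tuple T}) :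
  (forall A : nat -> set T, (forall i, measurable (A i)) ->
    P [set w | forall i : 'I_n, A i (tnth (Y w) i)] = (\prod_(i < n) mu i (A i))%E) ->
  forall B, measurable B -> P (Y @^-1` B) = prod_law mu n B.
Proof.
move=> H B mB.
pose G : set (set (n.-tuple T)) := [set C | exists A : nat -> set T, (forall i, measurable (A i)) /\
   C = [set y | forall i : 'I_n, A i (tnth y i)]].
have mG C : G C -> measurable C.
  move=> [A [mA ->]].
  rewrite (_ : [set y | _] = \big[setI/setT]_(i < n) ((@tnth n T ^~ i) @^-1` A i)).
    apply: bigsetI_measurable => i _; rewrite -[X in measurable X]setTI.
    exact: measurable_tnth.
  rewrite -bigcap_seq; apply/seteqP; split => y /= h i; last exact: (h i (mem_index_enum _)).
  by move=> _; exact: h.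
have := @measure_unique _ R _ G (fun=> setT) _ _ _ _ (distribution P Y) (prod_law mu n).
apply => //.
- apply/seteqP; split; last first.
    by apply: smallest_sub => //; exact: sigma_algebra_measurable.
  apply: smallest_sub; first exact: smallest_sigma_algebra.
  rewrite -bigcup_seq; apply: bigcup_sub => i _ C [D mD <-].
  (* A condition on the single coordinate [i] is the rectangle whose other sides are the whole
     space. *)
  apply: sub_sigma_algebra; exists (fun j => if j == i :> nat then D else setT); split.
    by move=> j; case: ifP.
  apply/seteqP; split => y /=.
    move=> [_ Dy] j; case: ifPn => // /eqP ji.
    by rewrite (_ : j = i)//; exact: val_inj.
  by move=> h; split => //; have := h i; rewrite eqxx.
- move=> C D [A [mA ->]] [A' [mA' ->]]; exists (fun i => A i `&` A' i); split.
    by move=> i; exact: measurableI.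
  apply/seteqP; split => y /=; first by move=> [h h'] i; split.
  by move=> h; split => i; case: (h i).
- by move=> i; exists (fun=> setT); split => //; apply/seteqP; split.
- by rewrite bigcup_const//; exists 0%N.
- by move=> C [A [mA ->]]; rewrite [RHS]prod_law_rect// -H.
- by move=> k; rewrite [ltLHS]probability_setT ltry.
Qed.

Lemma pair_law_unique {d1 d2} {T1 : measurableType d1} {T2 : measurableType d2}
  (Q1 : probability T1 R) (Q2 : probability T2 R) (Y : {mfun W >-> (T1 * T2)%type}) :
  (forall A B, measurable A -> measurable B -> P (Y @^-1` (A `*` B)) = (Q1 A * Q2 B)%E) ->
  forall B, measurable B -> P (Y @^-1` B) = (Q1 \x Q2)%E B.
Proof.
move=> H B mB.
by have := @product_measure_unique _ _ _ _ R Q1 Q2 (distribution P Y) H B mB.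
Qed.

End independence.

(** * Random signs and maximal inequalities *)

Section signs.
Context {R : realType} {I : Type}.
Notation vec := (I -> R).
Implicit Types (g h : vec -> R) (v y : vec) (s : seq vec).

(* [rad g v s] is the expectation of [g (v + \sum_i e_i s_i)], [e_i] random signs. *)
Fixpoint rad g v s : R :=
  match s with
  | [::] => g v
  | y :: s' => (rad g (v + y) s' + rad g (v - y) s') / 2
  end.

(* [pm g s v a] is the expectation of the maximum of [a] and of the values of [g]
   at the partial sums. *)
Fixpoint pm g s v (a : R) : R :=
  match s with
  | [::] => Num.max a (g v)
  | y :: s' => (pm g s' (v + y) (Num.max a (g v)) + pm g s' (v - y) (Num.max a (g v))) / 2
  end.

Lemma le_rad g h v s : (forall u, g u <= h u) -> rad g v s <= rad h v s.
Proof.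
move=> gh; elim: s v => [|y s IH] v //=.
by rewrite ler_pM2r ?invr_gt0// lerD.
Qed.

Lemma rad_cst (c : R) v s : rad (fun=> c) v s = c.
Proof. by elim: s v => [|y s IH] v //=; rewrite !IH; field. Qed.

Lemma radD g h v s : rad (fun u => g u + h u) v s = rad g v s + rad h v s.
Proof. by elim: s v => [|y s IH] v //=; rewrite !IH; field. Qed.

Lemma radB g h v s : rad (fun u => g u - h u) v s = rad g v s - rad h v s.
Proof. by elim: s v => [|y s IH] v //=; rewrite !IH; field. Qed.

Lemma rad_reflect g c v s : rad (fun u => g (c - u)) v s = rad g (c - v) s.
Proof.
elim: s v => [|y s IH] v //=; rewrite !IH addrC.
by rewrite !opprD !opprK !addrA.
Qed.

(** Levy's inequality in integrated form. When a partial sum [v] raises the running maximum from [a]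
    to [g v], reflecting the remaining signs sends the final sum [u] to [v + v - u]. Quasi-convexity
    makes one of the two have [g] at least [g v], and both have the same law; so twice the mean of
    the gain [k] pays for the increase [g v - a]. *)
Lemma levy_rad g s v a : (forall u y, g u <= Num.max (g (u + y)) (g (u - y))) ->
  pm g s v a <= a + 2 * rad (fun u => Num.max 0 (g u - a)) v s.
Proof.
move=> qg; elim: s v a => [|y s IH] v a.
  by rewrite /= /Num.max; do 2 case: ifP; lra.
set a' := Num.max a (g v).
have le1 : pm g (y :: s) v a <= a' + 2 * rad (fun u => Num.max 0 (g u - a')) v (y :: s).
  have := IH (v + y) a'; have := IH (v - y) a'.
  by rewrite /= -/a'; lra.
apply: (le_trans le1).
have [gva|gva] := lerP (g v) a.
  by rewrite /a' (max_idPl gva).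
have -> : a' = g v by rewrite /a'; apply/max_idPr/ltW.
pose k u := Num.max 0 (g u - a) - Num.max 0 (g u - g v).
have kk u : g v - a <= k u + k (v + v - u).
  have := qg v (u - v); rewrite /k addrC subrK opprB addrA.
  move: (g u) (g (v + v - u)) => b c.
  rewrite /Num.max; do 5 (case: ifP); lra.
have : g v - a <= 2 * rad k v (y :: s).
  rewrite -[leLHS](rad_cst _ v (y :: s)); apply: (le_trans (le_rad _ _ kk)).
  by rewrite radD rad_reflect addrK; lra.
by rewrite /k radB; lra.
Qed.

(** Fourth powers, because second moments would not suffice later: over the slabs of a grid the
    probabilities add up to 1, whereas the sum of their squares vanishes with the mesh. *)
Definition gmax (A : seq I) v : R := \big[Num.max/0]_(x <- A) (v x) ^+ 4.

Lemma gmax_ge0 A v : 0 <= gmax A v.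
Proof.
rewrite /gmax; elim: A => [|x A IH]; first by rewrite big_nil.
by rewrite big_cons le_max IH orbT.
Qed.

Lemma gmax_le A v c : 0 <= c -> (forall x, List.In x A -> (v x) ^+ 4 <= c) -> gmax A v <= c.
Proof.
move=> c0; rewrite /gmax; elim: A => [|x A IH] h; first by rewrite big_nil.
by rewrite big_cons ge_max h/=; [apply: IH => z zA; apply: h; right|left].
Qed.

Lemma le_gmax A v x : List.In x A -> (v x) ^+ 4 <= gmax A v.
Proof.
rewrite /gmax; elim: A => // z A IH [->|xA]; rewrite big_cons le_max ?lexx//.
by rewrite IH ?orbT.
Qed.

Lemma gmax_quasiconvex A v y : gmax A v <= Num.max (gmax A (v + y)) (gmax A (v - y)).
Proof.
apply: gmax_le; first by rewrite le_max gmax_ge0.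
move=> x xA; have := le_gmax (v + y) xA; have := le_gmax (v - y) xA.
rewrite !fctE => h1 h2.
have : v x ^+ 4 <= (v x + y x) ^+ 4 \/ v x ^+ 4 <= (v x - y x) ^+ 4.
  have : `|v x| <= `|v x + y x| \/ `|v x| <= `|v x - y x|.
    have [h|h] := lerP 0 (v x * y x); [left|right];
    rewrite -ler_sqr ?nnegrE// !real_normK ?num_real//; have := sqr_ge0 (y x); nra.
  have e4 (b : R) : b ^+ 4 = `|b| ^+ 4 by rewrite -normrX ger0_norm// exprn_even_ge0.
  rewrite (e4 (v x)) (e4 (v x + y x)) (e4 (v x - y x)) => -[h|h]; [left|right];
    by rewrite lerXn2r ?nnegrE.
by rewrite le_max => -[h|h]; apply/orP; [left|right]; apply: (le_trans h).
Qed.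

Lemma rad_cat_cons (T : Type) (Y : T -> vec) g v (t : T) (s1 s2 : seq T) :
  rad g v (map Y (s1 ++ t :: s2)) = rad g v (map Y (t :: s1 ++ s2)).
Proof.
elim: s1 v => [|t' s1 IH] v //; rewrite cat_cons/= !IH/=.
by rewrite !(addrAC v (Y t')) !(addrAC v (- Y t')); field.
Qed.

Lemma rad_perm (T : eqType) (Y : T -> vec) g v (s1 s2 : seq T) : perm_eq s1 s2 ->
  rad g v (map Y s1) = rad g v (map Y s2).
Proof.
elim: s1 s2 v => [|t s1 IH] s2 v; first by rewrite perm_sym => /perm_nilP ->.
move=> p; have ts2 : t \in s2 by rewrite -(perm_mem p) mem_head.
case/splitPr: ts2 p => a b p; rewrite rad_cat_cons.
have {}p : perm_eq s1 (a ++ b).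
  by rewrite -(perm_cons t) (perm_trans p)// -cat1s perm_catCA.
by rewrite /= !(IH _ _ p).
Qed.

(** After sorting by [th], the terms that count at [x] form an initial segment, so the full sum of
    the truncated vectors at [x] is a partial sum of the untruncated ones. The last hypothesis is
    the invariant of the induction: at [x] either the two sums still agree, or the truncated one is
    frozen at a value already recorded in [a]. *)
Lemma rad_le_pm (T : eqType) (Y Y' : T -> vec) (th : T -> \bar R) (c : I -> \bar R) (A : seq I)
  (s : seq T) u v a :
  (forall t x, Y t x = if (th t <= c x)%E then Y' t x else 0) ->
  sorted (fun t t' => (th t <= th t')%E) s ->
  (forall x, List.In x A -> u x = v x \/
    (u x ^+ 4 <= a /\ forall t, t \in s -> ~~ (th t <= c x)%E)) ->
  rad (gmax A) u (map Y s) <= pm (gmax A) (map Y' s) v a.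
Proof.
move=> YE; elim: s u v a => [|t s IH] u v a srt H /=.
  apply: gmax_le; first by rewrite le_max gmax_ge0 orbT.
  move=> x xA; case: (H x xA) => [->|[h _]].
    by rewrite le_max le_gmax ?orbT.
  by rewrite le_max h.
have tr : transitive (fun t t' : T => (th t <= th t')%E) by move=> a1 a2 a3; exact: le_trans.
have srt' : sorted (fun t t' : T => (th t <= th t')%E) s by exact: path_sorted srt.
have alls : forall t', t' \in s -> (th t <= th t')%E.
  by apply/allP; exact: order_path_min srt.
rewrite ler_pM2r ?invr_gt0//; apply: lerD; apply: IH => // x xA; rewrite !fctE YE.
- case: (H x xA) => [uv|[h cl]].
    case: ifPn => tc; first by left; rewrite uv.
    right; split; first by rewrite addr0 uv le_max le_gmax ?orbT.
    by move=> t' t's; apply: contra tc => /(le_trans (alls _ t's)).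
  rewrite (negbTE (cl t (mem_head _ _))); right; split; first by rewrite addr0 le_max h.
  by move=> t' t's; apply: cl; rewrite inE t's orbT.
- case: (H x xA) => [uv|[h cl]].
    case: ifPn => tc; first by left; rewrite uv.
    right; split; first by rewrite subr0 uv le_max le_gmax ?orbT.
    by move=> t' t's; apply: contra tc => /(le_trans (alls _ t's)).
  rewrite (negbTE (cl t (mem_head _ _))); right; split; first by rewrite subr0 le_max h.
  by move=> t' t's; apply: cl; rewrite inE t's orbT.
Qed.

(** Khintchine's inequality of order four. The starting value [b] is carried along for the
    induction, in which the odd terms of the two signs cancel. *)
Lemma rad_gmax_const (T : Type) (A : seq I) (c : T -> R) (b : R) (s : seq T) :
  rad (gmax A) (fun=> b) (map (fun t => fun=> c t) s) <=
  b ^+ 4 + 6 * b ^+ 2 * (\sum_(t <- s) c t ^+ 2) + 3 * (\sum_(t <- s) c t ^+ 2) ^+ 2.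
Proof.
elim: s b => [|t s IH] b.
  rewrite big_nil /= mulr0 expr0n/= mulr0 !addr0.
  by apply: gmax_le => //; exact: exprn_even_ge0.
rewrite big_cons /=.
have := IH (b + c t); have := IH (b - c t).
rewrite -[(fun=> b) + (fun=> c t)]/(fun=> b + c t) -[(fun=> b) - (fun=> c t)]/(fun=> b - c t).
set S := \sum_(_ <- s) _.
set r1 := rad _ _ _; set r2 := rad _ _ _.
move=> h1 h2.
have : r2 + r1 <= 2 * (b ^+ 4 + 6 * b ^+ 2 * (c t ^+ 2 + S) + 3 * (c t ^+ 2 + S) ^+ 2).
  apply: (le_trans (lerD h2 h1)).
  rewrite -subr_ge0 (_ : _ - _ = 4 * (c t ^+ 2) ^+ 2); last by ring.
  by rewrite mulr_ge0// sqr_ge0.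
by rewrite ler_pdivrMr// mulrC.
Qed.

End signs.

Section orthant_signs.
Context {R : realType} {m : nat}.
Notation X := (xvec R m).

(** Only the coordinates from [j] on are compared: [j = 0] gives [lev] and [j = m] no condition, so
    that the coordinates can be removed one at a time. *)
Definition levj (j : nat) (w x : X) : bool :=
  [forall k : 'I_m, (j <= k)%N ==> (tnth w k <= tnth x k)%E].

Lemma levj0 w x : levj 0 w x = lev w x.
Proof. by apply/eq_forallb => k; rewrite leq0n. Qed.

Lemma levjm w x : levj m w x.
Proof. by apply/forallP => k; rewrite leqNgt ltn_ord. Qed.

Lemma levjS (j : 'I_m) w x : levj j w x = (tnth w j <= tnth x j)%E && levj j.+1 w x.
Proof.
apply/forallP/andP.
  move=> h; split; first by have := h j; rewrite leqnn.
  by apply/forallP => k; apply/implyP => jk; have := h k; rewrite (ltnW jk).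
move=> [h1 /forallP h2] k; apply/implyP; rewrite leq_eqVlt => /predU1P[jk|jk].
  by rewrite (_ : k = j)//; exact: val_inj.
by have := h2 k; rewrite jk.
Qed.

Definition ovec j (p : R * X) : X -> R := fun x => p.1 * (levj j p.2 x)%:R.

(** Sorting by coordinate [j] turns the condition on it into the choice of an initial segment, and
    Levy's inequality at level 0 removes it at the price of a factor 2. *)
Lemma rad_coord (j : 'I_m) (A : seq X) (s : seq (R * X)) :
  rad (gmax A) 0 (map (ovec j) s) <= 2 * rad (gmax A) 0 (map (ovec j.+1) s).
Proof.
pose le := fun t t' : R * X => (tnth t.2 j <= tnth t'.2 j)%E.
have tot : total le by move=> t t'; exact: le_total.
have ps : perm_eq s (sort le s) by rewrite perm_sym perm_sort.
rewrite !(rad_perm _ _ _ ps).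
apply: (@le_trans _ _ (pm (gmax A) (map (ovec j.+1) (sort le s)) 0 0)).
  apply: (@rad_le_pm _ _ _ _ _ (fun t : R * X => tnth t.2 j) (fun x => tnth x j)).
  - by move=> t x; rewrite /ovec levjS; case: ifP => _ //=; rewrite mulr0.
  - exact: sort_sorted.
  - by move=> x _; left.
apply: (le_trans (levy_rad _ _ _ (gmax_quasiconvex A))).
rewrite add0r ler_pM2l//; apply: le_rad => u.
by rewrite subr0 ge_max gmax_ge0 lexx.
Qed.

(** After [m] removals the vectors no longer depend on the point, the maximum over [A] becomes
    trivial and Khintchine's inequality applies: hence [2 ^+ m] and 3. The bound does not involve
    the size of [A]. *)
Lemma rad_orthant (A : seq X) (s : seq (R * X)) :
  rad (gmax A) 0 (map (fun p => fun x => p.1 * (lev p.2 x)%:R) s) <=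
  2 ^+ m * (3 * (\sum_(p <- s) p.1 ^+ 2) ^+ 2).
Proof.
have H k : (k <= m)%N -> rad (gmax A) 0 (map (ovec 0) s) <= 2 ^+ k * rad (gmax A) 0 (map (ovec k) s).
  elim: k => [|k IH] km; first by rewrite expr0 mul1r.
  apply: (le_trans (IH (ltnW km))); rewrite exprSr -mulrA ler_pM2l ?exprn_gt0//.
  exact: (rad_coord (Ordinal km)).
have -> : (fun p : R * X => fun x => p.1 * (lev p.2 x)%:R) = ovec 0.
  by apply/funext => p; apply/funext => x; rewrite /ovec levj0.
apply: (le_trans (H _ (leqnn m))); rewrite ler_pM2l ?exprn_gt0//.
have -> : ovec m = (fun p => fun=> p.1).
  by apply/funext => p; apply/funext => x; rewrite /ovec levjm mulr1.
have := @rad_gmax_const R X _ A (fun p : R * X => p.1) 0 s.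
by rewrite !expr0n/= mulr0 mul0r !add0r.
Qed.

End orthant_signs.

Section symmetrization.
Context {R : realType} {d} {T : measurableType d} {I : Type}.
Notation vec := (I -> R).

(** Indexed map over a sample, taken as a list because [rad] recurses on lists. *)
Fixpoint vl (T' : Type) (f : nat -> T -> T') (l : seq T) : seq T' :=
  match l with
  | [::] => [::]
  | t :: l' => f 0%N t :: vl (fun i => f i.+1) l'
  end.

Lemma map_vl (T1 T2 : Type) (h : T1 -> T2) (f : nat -> T -> T1) l :
  map h (vl f l) = vl (fun i t => h (f i t)) l.
Proof. by elim: l f => [|t l IH] f //=; rewrite IH. Qed.

Lemma bmeas_gmax {d'} {O : measurableType d'} (A : seq I) (v : O -> vec) :
  (forall x, bmeas (fun w => v w x)) -> bmeas (fun w => gmax A (v w)).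
Proof. by move=> mv; apply: bmeas_bigmax => x; exact: bmeasX. Qed.

Lemma bmeas_rad {d'} {O : measurableType d'} (A : seq I) n (f : nat -> T -> vec)
  (v : O -> vec) (Y : O -> n.-tuple T) :
  (forall i x, bmeas (fun t => f i t x)) -> (forall x, bmeas (fun w => v w x)) ->
  measurable_fun setT Y ->
  bmeas (fun w => rad (gmax A) (v w) (vl f (Y w))).
Proof.
elim: n f v Y => [|n IH] f v Y mf mv mY.
  under eq_fun do rewrite (tuple0 (Y _)) /=.
  exact: bmeas_gmax.
pose h w := tnth (Y w) ord0.
pose Y' w : n.-tuple T := [tuple of behead (Y w)].
have YE w : val (Y w) = h w :: val (Y' w).
  by rewrite /h /Y' [in LHS](tuple_eta (Y w)).
have mh : measurable_fun setT h.
  exact: (measurableT_comp (measurable_tnth ord0) mY).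
have mY' : measurable_fun setT Y'.
  exact: (measurableT_comp (@measurable_behead _ _ n) mY).
under eq_fun do rewrite [val (Y _)]YE /=.
apply: bmeasM; last exact: bmeas_cst.
apply: bmeasD; [apply: (IH (fun i => f i.+1) (fun w => v w + f 0%N (h w)) Y') => // x|
  apply: (IH (fun i => f i.+1) (fun w => v w - f 0%N (h w)) Y') => // x].
- by apply: bmeasD => //; exact: (bmeas_comp (mf 0%N x) mh).
- by apply: bmeasB => //; exact: (bmeas_comp (mf 0%N x) mh).
Qed.

(** Jensen's inequality, from the tangent to the fourth power at [s]. *)
Lemma Ex_pow4 (P : probability T R) (f : T -> R) a : bmeas f ->
  (a - Ex P f) ^+ 4 <= Ex P (fun t => (a - f t) ^+ 4).
Proof.
move=> bf; set s := a - Ex P f.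
have ba : bmeas (fun t => a - f t) by apply: bmeasB => //; exact: bmeas_cst.
have Es : Ex P (fun t => a - f t) = s.
  by rewrite ExB//; [rewrite Ex_cst|exact: bmeas_cst].
have : Ex P (fun t => s ^+ 4 - 4 * s ^+ 3 * s + 4 * s ^+ 3 * (a - f t)) <= Ex P (fun t => (a - f t) ^+ 4).
  apply: le_Ex; [|exact: bmeasX|].
    by apply: bmeasD; [exact: bmeas_cst|exact: bmeasZ].
  move=> t; set z := a - f t; rewrite -subr_ge0.
  have -> : z ^+ 4 - (s ^+ 4 - 4 * s ^+ 3 * s + 4 * s ^+ 3 * z) = (z - s) ^+ 2 * ((z + s) ^+ 2 + 2 * s ^+ 2) by ring.
  by rewrite mulr_ge0 ?sqr_ge0// addr_ge0 ?sqr_ge0// mulr_ge0// sqr_ge0.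
rewrite ExD; [|exact: bmeas_cst|exact: bmeasZ].
by rewrite Ex_cst ExZ// Es subrK.
Qed.

(** Jensen's inequality replaces the mean by an independent copy [t'], and [V + f t - f t'] is the
    midpoint of [V + 2 f t] and [V - 2 f t']. Convexity then separates the two copies, which
    explains the factor 2 and why no copy is left in the conclusion. *)
Lemma symm_step (P : probability T R) (A : seq I) (f : T -> vec) (V : vec) :
  (forall x, bmeas (fun t => f t x)) ->
  Ex P (fun t => gmax A (fun x => V x + (f t x - Ex P (fun t' => f t' x)))) <=
  (Ex P (fun t => gmax A (V + (fun x => 2 * f t x))) +
   Ex P (fun t => gmax A (V - (fun x => 2 * f t x)))) / 2.
Proof.
move=> mf.
have bp : bmeas (fun t => gmax A (V + (fun x => 2 * f t x))).
  by apply: bmeas_gmax => x; apply: bmeasD; [exact: bmeas_cst|exact: bmeasZ].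
have bm : bmeas (fun t => gmax A (V - (fun x => 2 * f t x))).
  by apply: bmeas_gmax => x; apply: bmeasB; [exact: bmeas_cst|exact: bmeasZ].
set Em := Ex P (fun t => gmax A (V - _)).
have Em0 : 0 <= Em by apply: Ex_ge0 => t; exact: gmax_ge0.
apply: (@le_trans _ _ (Ex P (fun t => (gmax A (V + (fun x => 2 * f t x)) + Em) / 2))); last first.
  rewrite ExZr; last by apply: bmeasD => //; exact: bmeas_cst.
  by rewrite ExD// ?Ex_cst//; exact: bmeas_cst.
apply: le_Ex.
- apply: bmeas_gmax => x; apply: bmeasD; first exact: bmeas_cst.
  by apply: bmeasB => //; exact: bmeas_cst.
- apply: bmeasM; last exact: bmeas_cst.
  by apply: bmeasD => //; exact: bmeas_cst.
move=> t; apply: gmax_le.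
  by rewrite divr_ge0// addr_ge0// gmax_ge0.
move=> x xA; rewrite addrA.
apply: (le_trans (Ex_pow4 P (V x + f t x) (mf x))).
apply: (@le_trans _ _ (Ex P (fun t' => (gmax A (V + (fun x => 2 * f t x)) + gmax A (V - (fun x => 2 * f t' x))) / 2))).
  apply: le_Ex.
  - by apply: bmeasX; apply: bmeasB => //; exact: bmeas_cst.
  - apply: bmeasM; last exact: bmeas_cst.
    by apply: bmeasD => //; exact: bmeas_cst.
  move=> t'.
  have h1 := le_gmax (V + (fun x => 2 * f t x)) xA.
  have h2 := le_gmax (V - (fun x => 2 * f t' x)) xA.
  rewrite !fctE in h1 h2.
  apply: (@le_trans _ _ (((V x + 2 * f t x) ^+ 4 + (V x - 2 * f t' x) ^+ 4) / 2)); last first.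
    by rewrite ler_pM2r ?invr_gt0// lerD.
  set p := V x + 2 * f t x; set q := V x - 2 * f t' x.
  have -> : V x + f t x - f t' x = (p + q) / 2 by rewrite /p /q; field.
  rewrite -subr_ge0.
  have -> : (p ^+ 4 + q ^+ 4) / 2 - ((p + q) / 2) ^+ 4 =
    ((p - q) / 2) ^+ 2 * (6 * ((p + q) / 2) ^+ 2 + ((p - q) / 2) ^+ 2) by field.
  by rewrite mulr_ge0 ?sqr_ge0// addr_ge0 ?sqr_ge0// mulr_ge0// sqr_ge0.
rewrite ExZr; last by apply: bmeasD => //; exact: bmeas_cst.
by rewrite ExD// ?Ex_cst//; exact: bmeas_cst.
Qed.

(** The first centered summand is exchanged for a random sign by [symm_step], with the other
    summands frozen; Fubini then lets the induction hypothesis act at the shifted starting points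
    [v + 2 f 0 t] and [v - 2 f 0 t]. *)
Lemma symmetrization (A : seq I) n (mu : nat -> probability T R) (f : nat -> T -> vec) (v : vec) :
  (forall i x, bmeas (fun t => f i t x)) ->
  Ex (prod_law mu n) (fun y => gmax A (fun x => v x +
     \sum_(i < n) (f i (tnth y i) x - Ex (mu i) (fun t => f i t x)))) <=
  Ex (prod_law mu n) (fun y => rad (gmax A) v (vl (fun i t x => 2 * f i t x) y)).
Proof.
elim: n mu f v => [|n IH] mu f v mf.
  rewrite !Ex_prod_law0/=; rewrite (_ : (fun _ => _) = v)//.
  by apply/funext => x; rewrite big_ord0 addr0.
have bsum k (mu' : nat -> probability T R) (f' : nat -> T -> vec) (mf' : forall i x, bmeas (fun t => f' i t x)) x :
    bmeas (fun y : k.-tuple T => \sum_(i < k) (f' i (tnth y i) x - Ex (mu' i) (fun t => f' i t x))).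
  apply: bmeas_sum => i; apply: bmeasB; last exact: bmeas_cst.
  exact: (bmeas_tnth _ (mf' i x)).
have bL : bmeas (fun y : n.+1.-tuple T => gmax A (fun x => v x +
     \sum_(i < n.+1) (f i (tnth y i) x - Ex (mu i) (fun t => f i t x)))).
  by apply: bmeas_gmax => x; apply: bmeasD; [exact: bmeas_cst|exact: bsum].
have bR (u : vec) : bmeas (fun y : n.+1.-tuple T => rad (gmax A) u (vl (fun i t x => 2 * f i t x) y)).
  apply: bmeas_rad => // [i x|x]; [exact: bmeasZ|exact: bmeas_cst].
rewrite !Ex_prod_lawS//.
set mu' := fun i => mu i.+1; set f' := fun i => f i.+1.
have mf' i x : bmeas (fun t => f' i t x) by exact: mf.
pose S (y : n.-tuple T) x := \sum_(i < n) (f' i (tnth y i) x - Ex (mu' i) (fun t => f' i t x)).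
have bS x : bmeas (fun y => S y x) by exact: bsum.
rewrite (@Ex_swap _ _ _ _ _ _ _ (fun z => gmax A (fun x => v x +
     \sum_(i < n.+1) (f i (tnth (cons_pair z) i) x - Ex (mu i) (fun t => f i t x))))); last exact: (bmeas_cons bL).
have b2 (e : R) : bmeas (fun z : T * n.-tuple T => gmax A (v + (fun x => S z.2 x) + (fun x => e * f 0%N z.1 x))).
  apply: bmeas_gmax => x; apply: bmeasD.
    apply: bmeasD; first exact: bmeas_cst.
    exact: (bmeas_comp (bS x) measurable_snd).
  apply: bmeasZ; exact: (bmeas_comp (mf 0%N x) measurable_fst).
have b2m (e : R) : bmeas (fun z : T * n.-tuple T => gmax A (v + (fun x => S z.2 x) - (fun x => e * f 0%N z.1 x))).
  apply: bmeas_gmax => x; apply: bmeasB.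
    apply: bmeasD; first exact: bmeas_cst.
    exact: (bmeas_comp (bS x) measurable_snd).
  apply: bmeasZ; exact: (bmeas_comp (mf 0%N x) measurable_fst).
have le1 : Ex (prod_law mu' n) (fun y => Ex (mu 0%N) (fun t => gmax A (fun x => v x +
     \sum_(i < n.+1) (f i (tnth (cons_pair (t, y)) i) x - Ex (mu i) (fun t => f i t x))))) <=
   Ex (prod_law mu' n) (fun y => (Ex (mu 0%N) (fun t => gmax A (v + S y + (fun x => 2 * f 0%N t x))) +
     Ex (mu 0%N) (fun t => gmax A (v + S y - (fun x => 2 * f 0%N t x)))) / 2).
  apply: le_Ex.
  - exact: (bmeas_Ex1 _ (bmeas_cons bL)).
  - apply: bmeasM; last exact: bmeas_cst.
    apply: bmeasD; [exact: (bmeas_Ex1 _ (b2 2))|exact: (bmeas_Ex1 _ (b2m 2))].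
  move=> y; apply: le_trans (symm_step (mu 0%N) A (v + S y) (mf 0%N)).
  rewrite le_eqVlt; apply/orP; left; apply/eqP; apply: eq_Ex => t.
  congr (gmax A _); apply/funext => x; rewrite big_ord_recl tnth_cons0 !fctE.
  rewrite -[RHS]addrA [X in _ = _ + X]addrC; congr (_ + (_ + _)).
  by apply: eq_bigr => i _; rewrite tnth_consS lift0.
apply: (le_trans le1).
have swp (e : R) (hb : bmeas (fun z : T * n.-tuple T => gmax A (v + (fun x => S z.2 x) + (fun x => e * f 0%N z.1 x)))) :
  Ex (prod_law mu' n) (fun y => Ex (mu 0%N) (fun t => gmax A (v + S y + (fun x => e * f 0%N t x)))) <=
  Ex (mu 0%N) (fun t => Ex (prod_law mu' n) (fun y => rad (gmax A) (v + (fun x => e * f 0%N t x)) (vl (fun i t x => 2 * f' i t x) y))).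
  rewrite -(Ex_swap (mu 0%N) (prod_law mu' n) hb).
  apply: le_Ex.
  - exact: (bmeas_Ex2 _ hb).
  - apply: (@bmeas_Ex2 _ _ _ _ _ _ (fun z : T * n.-tuple T => rad (gmax A) (v + (fun x => e * f 0%N z.1 x)) (vl (fun i t x => 2 * f' i t x) z.2))).
    apply: bmeas_rad => // [i x|x]; first exact: bmeasZ.
    apply: bmeasD; first exact: bmeas_cst.
    apply: bmeasZ; exact: (bmeas_comp (mf 0%N x) measurable_fst).
  move=> t /=; apply: le_trans (IH mu' f' _ mf').
  rewrite le_eqVlt; apply/orP; left; apply/eqP; apply: eq_Ex => y.
  by congr (gmax A _); apply/funext => x; rewrite !fctE addrAC.
have E1 (e : R) : bmeas (fun y => Ex (mu 0%N) (fun t => gmax A (v + S y + (fun x => e * f 0%N t x)))).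
  exact: (bmeas_Ex1 _ (b2 e)).
have NE (t : T) u : u - (fun x => 2 * f 0%N t x) = u + (fun x => -2 * f 0%N t x).
  by apply/funext => x; rewrite !fctE mulNr.
under eq_Ex do under [X in _ + X]eq_Ex do rewrite NE.
rewrite ExZr; last exact: bmeasD.
rewrite ExD//.
apply: (@le_trans _ _ ((Ex (mu 0%N) (fun t => Ex (prod_law mu' n) (fun y => rad (gmax A) (v + (fun x => 2 * f 0%N t x)) (vl (fun i t x => 2 * f' i t x) y)))
 + Ex (mu 0%N) (fun t => Ex (prod_law mu' n) (fun y => rad (gmax A) (v + (fun x => -2 * f 0%N t x)) (vl (fun i t x => 2 * f' i t x) y)))) / 2)).
  by rewrite ler_pM2r ?invr_gt0// lerD// swp.
have br (e : R) : bmeas (fun z : T * n.-tuple T => rad (gmax A) (v + (fun x => e * f 0%N z.1 x)) (vl (fun i t x => 2 * f' i t x) z.2)).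
  apply: bmeas_rad => // [i x|x]; first exact: bmeasZ.
  apply: bmeasD; first exact: bmeas_cst.
  apply: bmeasZ; exact: (bmeas_comp (mf 0%N x) measurable_fst).
have br1 (e : R) t := bmeas_pair1 t (br e).
have br2 (e : R) := bmeas_Ex2 (prod_law mu' n) (br e).
rewrite -ExD; [|exact: (br2 2)|exact: (br2 (-2))].
rewrite -ExZr; last by apply: bmeasD; [exact: (br2 2)|exact: (br2 (-2))].
rewrite le_eqVlt; apply/orP; left; apply/eqP; apply: eq_Ex => t.
rewrite -ExD; [|exact: (br1 2)|exact: (br1 (-2))].
rewrite -ExZr; last by apply: bmeasD; [exact: (br1 2)|exact: (br1 (-2))].
by apply: eq_Ex => y /=; rewrite NE.
Qed.

End symmetrization.

Section sum_of_squares.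
Context {R : realType} {d} {T : measurableType d}.

(** Squared mean plus variance, each variance being bounded by a second moment; the offset [t] takes
    up the coordinates that have been split off. *)
Lemma Ex_sqr_sum n (mu : nat -> probability T R) (D : nat -> T -> R) (t : R) :
  (forall i, bmeas (D i)) ->
  Ex (prod_law mu n) (fun y => (t + \sum_(i < n) D i (tnth y i)) ^+ 2) <=
  (t + \sum_(i < n) Ex (mu i) (D i)) ^+ 2 + \sum_(i < n) Ex (mu i) (fun x => D i x ^+ 2).
Proof.
elim: n mu D t => [|n IH] mu D t mD.
  by rewrite Ex_prod_law0 !big_ord0 !addr0.
have bs (r : R) k (D' : nat -> T -> R) (mD' : forall i, bmeas (D' i)) : bmeas (fun y : k.-tuple T => (r + \sum_(i < k) D' i (tnth y i)) ^+ 2).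
  apply: bmeasX; apply: bmeasD; first exact: bmeas_cst.
  by apply: bmeas_sum => i; exact: bmeas_tnth.
rewrite Ex_prod_lawS//; last exact: bs.
rewrite !big_ord_recl.
set mu' := fun i => mu i.+1; set D' := fun i => D i.+1.
set S := \sum_(i < n) Ex (mu (lift ord0 i)) (D (lift ord0 i)).
set V := \sum_(i < n) Ex (mu (lift ord0 i)) (fun x => D (lift ord0 i) x ^+ 2).
apply: (@le_trans _ _ (Ex (mu 0%N) (fun x => ((t + S) ^+ 2 + V) + (2 * (t + S) * D 0%N x + D 0%N x ^+ 2)))).
  apply: le_Ex.
  - exact: (bmeas_Ex2 _ (bmeas_cons (bs t n.+1 D mD))).
  - apply: bmeasD; first exact: bmeas_cst.
    by apply: bmeasD; [exact: bmeasZ|exact: bmeasX].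
  move=> x; have := IH mu' D' (t + D 0%N x) (fun i => mD i.+1).
  have -> : \sum_(i < n) Ex (mu' i) (D' i) = S by apply: eq_bigr => i _; rewrite lift0.
  have -> : \sum_(i < n) Ex (mu' i) (fun x => D' i x ^+ 2) = V by apply: eq_bigr => i _; rewrite lift0.
  have -> : (t + D 0%N x + S) ^+ 2 + V = (t + S) ^+ 2 + V + (2 * (t + S) * D 0%N x + D 0%N x ^+ 2) by ring.
  apply: le_trans; rewrite le_eqVlt; apply/orP; left; apply/eqP; apply: eq_Ex => y.
  rewrite big_ord_recl tnth_cons0 addrA; congr ((_ + _) ^+ 2).
  by apply: eq_bigr => i _; rewrite tnth_consS lift0.
rewrite ExD; [|exact: bmeas_cst|by apply: bmeasD; [exact: bmeasZ|exact: bmeasX]].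
rewrite Ex_cst ExD; [|exact: bmeasZ|exact: bmeasX].
rewrite ExZ//.
set e := Ex _ (D _); set e2 := Ex _ (fun x => _).
rewrite -subr_ge0 (_ : _ - _ = e ^+ 2) ?sqr_ge0//; ring.
Qed.

End sum_of_squares.

Section orthant_moment.
Context {R : realType} {m : nat}.
Notation X := (xvec R m).

Lemma measurable_lev (x : X) : measurable [set w : X | lev w x].
Proof.
rewrite (_ : [set w : X | lev w x] = \big[setI/setT]_(k < m) ((@tnth m _ ^~ k) @^-1` [set e | (e <= tnth x k)%E])).
  apply: bigsetI_measurable => k _; rewrite -[X in measurable X]setTI.
  apply: measurable_tnth => //.
  by rewrite -set_itvNyc; exact: emeasurable_itv.
rewrite -bigcap_seq; apply/seteqP; split => w /=.
  by move=> /forallP h k _; exact: h.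
by move=> h; apply/forallP => k; exact: (h k (mem_index_enum _)).
Qed.

Lemma bmeas_lev (x : X) : bmeas (fun w : X => (lev w x)%:R : R).
Proof. by apply: bmeas_ind; exact: measurable_lev. Qed.

Lemma natr_and (a b : bool) : ((a && b)%:R : R) = a%:R * b%:R.
Proof. by case: a; case: b; rewrite ?mul1r ?mul0r. Qed.

(** With the sample fixed, [rad_orthant] integrates the signs; there remains the second moment of a
    sum of squares. The constant is [48 = 3 * 16], where 16 is the fourth power of the factor 2 of
    symmetrization. *)
Lemma orthant_moment (A : seq X) n (mu : nat -> probability X R) (c : nat -> R) (sl : X -> bool) :
  measurable [set w | sl w] ->
  Ex (prod_law mu n) (fun y => gmax A (fun x => \sum_(i < n)
    c i * ((sl (tnth y i) && lev (tnth y i) x)%:R - Ex (mu i) (fun w => (sl w && lev w x)%:R)))) <=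
  2 ^+ m * (48 * ((\sum_(i < n) c i ^+ 2 * Ex (mu i) (fun w => (sl w)%:R)) ^+ 2 +
     \sum_(i < n) c i ^+ 4 * Ex (mu i) (fun w => (sl w)%:R))).
Proof.
move=> msl.
have bsl : bmeas (fun w : X => (sl w)%:R : R) by exact: bmeas_ind.
have bf x : bmeas (fun w : X => (sl w && lev w x)%:R : R).
  by under eq_fun do rewrite natr_and; apply: bmeasM => //; exact: bmeas_lev.
pose f i w x := c i * (sl w && lev w x)%:R.
have mf i x : bmeas (fun w => f i w x) by apply: bmeasZ.
have := symmetrization A n mu (fun=> 0) mf.
have -> : Ex (prod_law mu n) (fun y => gmax A (fun x => 0 + \sum_(i < n) (f i (tnth y i) x - Ex (mu i) (fun t => f i t x))))
 = Ex (prod_law mu n) (fun y => gmax A (fun x => \sum_(i < n)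
    c i * ((sl (tnth y i) && lev (tnth y i) x)%:R - Ex (mu i) (fun w => (sl w && lev w x)%:R)))).
  apply: eq_Ex => y; congr (gmax A _); apply/funext => x; rewrite add0r.
  by apply: eq_bigr => i _; rewrite /f ExZ// mulrBr.
move=> /le_trans; apply.
pose D i (w : X) : R := 4 * c i ^+ 2 * (sl w)%:R.
have bD i : bmeas (D i) by exact: bmeasZ.
have sqb (b : bool) : (b%:R : R) ^+ 2 = b%:R by case: b; rewrite ?expr1n ?expr0n.
have bnd (y : n.-tuple X) : rad (gmax A) (fun=> 0) (vl (fun i t x => 2 * f i t x) y) <=
   2 ^+ m * (3 * (0 + \sum_(i < n) D i (tnth y i)) ^+ 2).
  pose g i (w : X) : R * X := (2 * c i * (sl w)%:R, w).
  have -> : vl (fun i t x => 2 * f i t x) y = map (fun p : R * X => fun x => p.1 * (lev p.2 x)%:R) (vl g y).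
    rewrite map_vl; congr vl; apply/funext => i; apply/funext => w; apply/funext => x.
    by rewrite /f /g /= natr_and !mulrA.
  apply: (le_trans (rad_orthant _ _)); rewrite add0r.
  suff -> : \sum_(p <- vl g y) p.1 ^+ 2 = \sum_(i < n) D i (tnth y i) by [].
  rewrite /g /D; elim: n c y {f mf g bD D} => [|k IH] c y.
    by rewrite (tuple0 y) big_nil big_ord0.
  rewrite (tuple_eta y) /= big_cons big_ord_recl /=.
  have := IH (fun i => c i.+1) [tuple of behead y] => /= ->.
  congr (_ + _); first by rewrite !exprMn sqb; congr (_ * _ * _); rewrite -natrX.
  by apply: eq_bigr => i _; rewrite tnthS.
apply: (@le_trans _ _ (Ex (prod_law mu n) (fun y => 2 ^+ m * (3 * (0 + \sum_(i < n) D i (tnth y i)) ^+ 2)))).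
  apply: le_Ex => //.
  - by apply: bmeas_rad => // [i x|x]; [exact: bmeasZ|exact: bmeas_cst].
  - do 2 apply: bmeasZ; apply: bmeasX; apply: bmeasD; first exact: bmeas_cst.
    by apply: bmeas_sum => i; exact: bmeas_tnth.
have bS : bmeas (fun y : n.-tuple X => (0 + \sum_(i < n) D i (tnth y i)) ^+ 2).
  apply: bmeasX; apply: bmeasD; first exact: bmeas_cst.
  by apply: bmeas_sum => i; exact: bmeas_tnth.
rewrite ExZ; last exact: bmeasZ.
rewrite ler_pM2l ?exprn_gt0// ExZ// -[48]/((3 * 16)%:R) natrM -mulrA ler_pM2l//.
apply: (le_trans (Ex_sqr_sum _ _ _ bD)); rewrite mulrDr lerD//.
  rewrite add0r le_eqVlt; apply/orP; left; apply/eqP.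
  have -> : \sum_(i < n) Ex (mu i) (D i) = 4 * (\sum_(i < n) c i ^+ 2 * Ex (mu i) (fun w => (sl w)%:R)).
    by rewrite mulr_sumr; apply: eq_bigr => i _; rewrite /D ExZ// mulrA.
  by rewrite exprMn -natrX.
rewrite mulr_sumr le_eqVlt; apply/orP; left; apply/eqP; apply: eq_bigr => i _.
under eq_Ex do rewrite /D exprMn sqb.
by rewrite ExZ// exprMn -exprM -natrX mulrA.
Qed.

End orthant_moment.

(** * Grids and equicontinuity *)

Section grid.
Context {R : realType}.

(** Index 0 stands for [-oo], the indices [1, ..., gN p - 1] for the points of mesh [1 / (p + 1)]
    from [-(p + 1)] to [p + 1], and all larger ones for [+oo]. *)
Definition gN (p : nat) : nat := (2 * (p.+1 * p.+1) + 2)%N.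

Definition gpt (p j : nat) : \bar R :=
  if j == 0%N then -oo%E else
  if (j < gN p)%N then (j.-1%:R / p.+1%:R - p.+1%:R)%:E else +oo%E.

Lemma gpt_homo p : {homo gpt p : i j / (i <= j)%N >-> (i <= j)%E}.
Proof.
move=> i j ij; rewrite /gpt; case: ifPn => [_|i0]; first exact: leNye.
have j0 : j != 0%N by rewrite -lt0n (leq_trans _ ij)// lt0n.
rewrite (negbTE j0); case: (ltnP j (gN p)) => jN; last exact: leey.
rewrite (leq_ltn_trans ij jN) lee_fin lerD2r ler_pM2r ?invr_gt0// ler_nat.
by rewrite -ltnS !prednK ?lt0n.
Qed.

Lemma contract_lip (a b : R) : a <= b -> contract b%:E - contract a%:E <= b - a.
Proof.
move=> ab; rewrite /contract.
have key (c : R) : 0 <= c -> c / (1 + c) = 1 - (1 + c)^-1 by move=> c0; field; rewrite gt_eqF//; lra.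
have [a0|a0] := lerP 0 a.
  have b0 : 0 <= b by exact: le_trans ab.
  rewrite !ger0_norm// -subr_ge0.
  have -> : b - a - (b / (1 + b) - a / (1 + a)) = (b - a) * (1 - ((1 + b)^-1 * (1 + a)^-1)).
    by field; rewrite !gt_eqF//; lra.
  rewrite mulr_ge0 ?subr_ge0// mulr_ile1// ?invr_ge0 ?invf_le1//; lra.
have na : a / (1 + `|a|) >= a.
  rewrite ltr0_norm// ler_pdivlMr; last by lra.
  nra.
have [b0|b0] := lerP 0 b.
  rewrite (ger0_norm b0); apply: lerB => //.
  by rewrite ler_pdivrMr; [nra|lra].
rewrite !ltr0_norm// -subr_ge0.
have -> : b - a - (b / (1 - b) - a / (1 - a)) = (b - a) * (1 - ((1 - b)^-1 * (1 - a)^-1)).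
  by field; rewrite !gt_eqF//; lra.
rewrite mulr_ge0 ?subr_ge0// mulr_ile1// ?invr_ge0 ?invf_le1//; lra.
Qed.

(** The two unbounded cells have length [1 / (p + 2)] in this metric, since [contract] maps [p + 1]
    to [(p + 1) / (p + 2)]. *)
Lemma contract_gpt p j : `|contract (gpt p j.+1) - contract (gpt p j)| <= p.+1%:R^-1.
Proof.
have p0 : 0 < p.+1%:R :> R by [].
rewrite ger0_norm ?subr_ge0 ?le_contract ?gpt_homo//.
rewrite /gpt /=; case: (ltnP j.+1 (gN p)) => jN.
  have [->|j0] := eqVneq j 0%N.
    rewrite mul0r sub0r /= normrN ger0_norm// opprK.
    have -> : - p.+1%:R / (1 + p.+1%:R) + 1 = (1 + p.+1%:R)^-1 :> R.
      by field; rewrite gt_eqF// addr_gt0.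
    by rewrite lef_pV2 ?posrE ?addr_gt0// lerDr.
  rewrite (ltnW jN); apply: (le_trans (contract_lip _)).
    by rewrite lerD2r ler_pM2r ?invr_gt0// ler_nat leq_pred.
  rewrite opprD opprK addrACA addNr addr0 -mulrBl.
  have -> : (j%:R : R) = j.-1.+1%:R by rewrite prednK// lt0n.
  by rewrite -natr1 addrAC subrr add0r mul1r.
case: eqP => [j0|/eqP j0]; first by move: jN; rewrite j0 /gN addn2.
case: ltnP => jN'; last by rewrite /= subrr invr_ge0.
have -> : j.-1 = (2 * (p.+1 * p.+1))%N.
  have jE : j.+1 = gN p by apply/eqP; rewrite eqn_leq jN' jN.
  by move: jE; rewrite /gN addn2 => -[->].
have -> : (2 * (p.+1 * p.+1))%:R / p.+1%:R - p.+1%:R = p.+1%:R :> R.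
  by rewrite !natrM; field; rewrite gt_eqF.
rewrite /= ger0_norm//.
have -> : 1 - p.+1%:R / (1 + p.+1%:R) = (1 + p.+1%:R)^-1 :> R.
  by field; rewrite gt_eqF// addr_gt0.
by rewrite lef_pV2 ?posrE ?addr_gt0// lerDr.
Qed.

Definition gidx (p : nat) (e : \bar R) : nat := \max_(j < (gN p).+1 | (gpt p j <= e)%E) j.

Lemma gidx_max p j e : (j <= gN p)%N -> (gpt p j <= e)%E -> (j <= gidx p e)%N.
Proof.
by move=> jN je; rewrite /gidx; apply: (@leq_bigmax_cond _ _ (fun j : 'I__ => nat_of_ord j) (Ordinal (jN : (j < (gN p).+1)%N))).
Qed.

Lemma gidx_le p e : (gidx p e <= gN p)%N.
Proof. by apply/bigmax_leqP => i _; rewrite -ltnS. Qed.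

Lemma gpt_gidx p e : (gpt p (gidx p e) <= e)%E.
Proof.
have h : (gpt p (@ord0 (gN p)) <= e)%E by rewrite /gpt eqxx leNye.
rewrite /gidx (bigop.bigmax_eq_arg ord0)//.
by case: arg_maxnP => //.
Qed.

Lemma gidx_lt p e : (e <= gpt p (gidx p e).+1)%E.
Proof.
have [jN|jN] := ltnP (gidx p e) (gN p).
  rewrite leNgt; apply/negP => /ltW h.
  by have := gidx_max jN h; rewrite ltnn.
have E : gidx p e = gN p by apply/eqP; rewrite eqn_leq gidx_le jN.
by rewrite E /gpt /= ltnNge leqnSn /= leey.
Qed.

(* The slabs are disjoint. *)
Lemma slab_sum p (e : \bar R) N :
  \sum_(j < N) ((gpt p j < e) && (e <= gpt p j.+1))%E%:R <= 1 :> R.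
Proof.
suff H : \sum_(j < N) ((gpt p j < e) && (e <= gpt p j.+1))%E%:R <= ((e <= gpt p N)%E%:R : R).
  by apply: (le_trans H); case: (_ <= _)%E.
elim: N => [|N IH]; first by rewrite big_ord0; case: (_ <= _)%E.
rewrite big_ord_recr /=; apply: (le_trans (lerD IH (lexx _))).
have [h|h] := leP e (gpt p N).
  by rewrite (le_trans h (gpt_homo p (leqnSn N))) /= addr0.
by rewrite /= add0r.
Qed.

End grid.

Section grid_vectors.
Context {R : realType} {m : nat}.
Notation X := (xvec R m).

Definition gind p := (m.-tuple 'I_(gN p).+1)%type.

Definition gid p (x : X) : gind p := [tuple inord (gidx p (tnth x k)) | k < m].
Definition gval p (t : gind p) : X := [tuple gpt p (tnth t k) | k < m].
Definition gpi p (x : X) : X := gval (gid p x).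

Lemma tnth_gpi p x k : tnth (gpi p x) k = gpt p (gidx p (tnth x k)).
Proof. by rewrite !tnth_mktuple inordK// ltnS gidx_le. Qed.

Definition topv : X := [tuple +oo%E | k < m].

Definition coordv (k : 'I_m) (e : \bar R) : X := [tuple if i == k then e else +oo%E | i < m].

Lemma lev_coordv w k e : lev w (coordv k e) = (tnth w k <= e)%E.
Proof.
apply/forallP/idP => [/(_ k)|h i]; first by rewrite tnth_mktuple eqxx.
by rewrite tnth_mktuple; case: eqP => [->//|_]; exact: leey.
Qed.

(** Interpolates between [x] and [gpi p x] one coordinate at a time. Since rounding goes downwards,
    the orthants shrink, and each step loses only points of one slab. *)
Definition mixv p (x : X) (k : nat) : X :=
  [tuple if (i < k)%N then tnth (gpi p x) i else tnth x i | i < m].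

Definition slab p (k : 'I_m) (j : nat) (w : X) : bool :=
  ((gpt p j < tnth w k) && (tnth w k <= gpt p j.+1))%E.

Lemma mixv0 p x : mixv p x 0 = x.
Proof. by apply: eq_from_tnth => i; rewrite tnth_mktuple. Qed.

Lemma mixvm p x : mixv p x m = gpi p x.
Proof. by apply: eq_from_tnth => i; rewrite tnth_mktuple ltn_ord. Qed.

Lemma lev_mixvS p x (k : 'I_m) w :
  (slab p k (gidx p (tnth x k)) w && lev w (mixv p x k))%:R =
  (lev w (mixv p x k))%:R - (lev w (mixv p x k.+1))%:R :> R.
Proof.
have lS : lev w (mixv p x k.+1) = lev w (mixv p x k) && (tnth w k <= tnth (gpi p x) k)%E.
  apply/forallP/andP.
    move=> h; split.
      apply/forallP => i; rewrite tnth_mktuple; have := h i; rewrite tnth_mktuple ltnS.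
      case: (ltngtP i k) => // ik; rewrite (_ : i = k); last exact: val_inj.
      by move=> /le_trans; apply; rewrite tnth_gpi gpt_gidx.
    by have := h k; rewrite tnth_mktuple ltnSn.
  move=> [/forallP h hk] i; rewrite tnth_mktuple ltnS.
  have := h i; rewrite tnth_mktuple; case: (ltngtP i k) => // ik _.
  by rewrite (_ : i = k)//; exact: val_inj.
rewrite lS; case: (boolP (lev w (mixv p x k))) => /= h; last by rewrite andbF subrr.
rewrite andbT tnth_gpi /slab.
have hk : (tnth w k <= gpt p (gidx p (tnth x k)).+1)%E.
  move/forallP : h => /(_ k); rewrite tnth_mktuple ltnn => /le_trans; apply.
  exact: gidx_lt.
rewrite hk andbT ltNge.
by case: (_ <= _)%E; rewrite /= ?subrr ?subr0.
Qed.

Lemma measurable_slab p k j : measurable [set w : X | slab p k j w].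
Proof.
have mc e : measurable [set w : X | (tnth w k <= e)%E].
  rewrite (_ : [set w | _] = [set w | lev w (coordv k e)]); first exact: measurable_lev.
  by apply/seteqP; split => w /=; rewrite lev_coordv.
rewrite (_ : [set w | _] = [set w : X | (tnth w k <= gpt p j.+1)%E] `\` [set w : X | (tnth w k <= gpt p j)%E]).
  exact: measurableD.
apply/seteqP; split => w /=; rewrite /slab.
  by move=> /andP[h1 h2]; split => //; apply/negP; rewrite -ltNge.
by move=> [h1 /negP]; rewrite -ltNge => h2; rewrite h1 h2.
Qed.

Lemma slabE p k j w : (slab p k j w)%:R =
  (lev w (coordv k (gpt p j.+1)))%:R - (lev w (coordv k (gpt p j)))%:R :> R.
Proof.
rewrite !lev_coordv /slab ltNge; have [h|h] := boolP (tnth w k <= gpt p j)%E.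
  by rewrite (le_trans h (gpt_homo p (leqnSn j))) /= subrr.
by rewrite /= subr0.
Qed.

(** When [K] is a distribution function, these differences are the slab probabilities, by
    [slabE]. *)
Lemma unif_cont_grid (K : X -> R) : unif_cont_xvec K -> forall e : R, 0 < e ->
  \forall p \near \oo, forall k j, `|K (coordv k (gpt p j.+1)) - K (coordv k (gpt p j))| <= e.
Proof.
move=> /unif_cont_contract H e e0; have [de de0 hde] := H e e0.
near=> p => k j; apply/ltW/hde => i.
have p1 : p.+1%:R^-1 < de by near: p; exact: near_infty_natSinv_lt (PosNum de0).
rewrite !tnth_mktuple; case: eqP => _; last by rewrite subrr normr0.
exact: le_lt_trans (contract_gpt p j) p1.
Unshelve. all: by end_near. Qed.

End grid_vectors.

(** * Reduction of suprema over all points to countable ones *)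

Section dense.
Context {R : realType}.

Definition dval (q : option rat) : \bar R := if q is Some q then (ratr q : R)%:E else +oo%E.

(** Approximation from the right by rationals or by [+oo]: for every fixed [w] the indicator of
    [w <= e] is eventually equal to its limit along the sequence. *)
Lemma dense_coord (e : \bar R) : exists u : nat -> option rat, forall w : \bar R,
  \forall n \near \oo, (w <= dval (u n))%E = (w <= e)%E.
Proof.
case: e => [r| |].
- have h n : exists q : rat, r < ratr q < r + n.+1%:R^-1.
    have : r < r + n.+1%:R^-1 by rewrite ltrDl invr_gt0.
    by move=> /rat_in_itvoo[q qr]; exists q; move: qr; rewrite in_itv.
  have [u hu] := choice h; exists (fun n => Some (u n)) => -[w| |]; last 2 first.
  + by near=> n.
  + by near=> n; rewrite !leNye.
  have [wr|rw] := leP w r.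
    near=> n; rewrite !lee_fin wr; have /andP[h1 _] := hu n.
    by rewrite (le_trans wr)// ltW.
  have wr0 : 0 < w - r by rewrite subr_gt0.
  near=> n; rewrite !lee_fin (leNgt w r) rw/=; apply/negbTE; rewrite -ltNge.
  have /andP[_ h2] := hu n; apply: (lt_trans h2).
  have : n.+1%:R^-1 < w - r by near: n; exact: near_infty_natSinv_lt (PosNum wr0).
  by rewrite ltrBrDl.
- by exists (fun=> None) => w; near=> n.
- exists (fun n => Some (- n%:R)) => -[w| |]; last 2 first.
  + by near=> n.
  + by near=> n; rewrite !leNye.
  near=> n; rewrite lee_fin leNgt [RHS]leNgt ltNyr/=; apply/negbTE; rewrite negbK.
  rewrite rmorphN/= ratr_nat ltrNl.
  near: n; exact: nbhs_infty_gtr.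
Unshelve. all: by end_near. Qed.

Definition dpt {m} (q : m.-tuple (option rat)) : xvec R m := map_tuple dval q.

Lemma dense_vec {m} (x : xvec R m) : exists u : nat -> m.-tuple (option rat), forall w,
  \forall n \near \oo, lev w (dpt (u n)) = lev w x.
Proof.
have [u hu] := choice (fun k => dense_coord (tnth x k)).
exists (fun n => [tuple u k n | k < m]) => w.
have : \forall n \near \oo, forall k : 'I_m, (tnth w k <= dval (u k n))%E = (tnth w k <= tnth x k)%E.
  by apply: filter_forall => k; exact: hu.
apply: filterS => n h; apply: eq_forallb => k.
by rewrite tnth_map tnth_mktuple h.
Qed.

Definition dseq m (N : nat) : seq (xvec R m) :=
  [seq dpt q | q <- pmap (choice.unpickle : nat -> option (m.-tuple (option rat))) (iota 0 N)].

Lemma dseq_in m (q : m.-tuple (option rat)) : exists N, List.In (dpt q) (dseq m N).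
Proof.
exists (choice.pickle q).+1; rewrite /dseq; apply: List.in_map.
have : q \in pmap (choice.unpickle : nat -> option (m.-tuple (option rat))) (iota 0 (choice.pickle q).+1).
  rewrite mem_pmap; apply/mapP; exists (choice.pickle q); last by rewrite choice.pickleK.
  by rewrite mem_iota leq0n add0n ltnSn.
elim: (pmap _ _) => //= a l IH; rewrite inE => /predU1P[->|/IH]; [by left|by right].
Qed.

Lemma dseq_sub m (N M : nat) x : (N <= M)%N -> List.In x (dseq m N) -> List.In x (dseq m M).
Proof.
move=> NM; rewrite /dseq -(subnKC NM) iotaD pmap_cat map_cat => h.
by apply: List.in_or_app; left.
Qed.

End dense.

Lemma cvg_sumR {R : realType} {I : Type} (r : seq I) (f : I -> nat -> R) (g : I -> R) :
  (forall i, f i @ \oo --> g i) -> (fun k => \sum_(i <- r) f i k) @ \oo --> \sum_(i <- r) g i.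
Proof.
move=> fg; elim: r => [|i r IH].
  by rewrite big_nil; under eq_fun do rewrite big_nil; exact: cvg_cst.
by rewrite big_cons; under eq_fun do rewrite big_cons; exact: cvgD.
Qed.

Section tightness.
Context {R : realType} {m : nat}.
Notation X := (xvec R m).
Variables (n : nat) (mu : nat -> probability X R) (c : nat -> R).

Definition edf (x : X) (i : nat) : R := Ex (mu i) (fun w => (lev w x)%:R).

Definition eproc (y : n.-tuple X) (x : X) : R :=
  \sum_(i < n) c i * ((lev (tnth y i) x)%:R - edf x i).

Definition slproc (sl : X -> bool) (y : n.-tuple X) (x : X) : R :=
  \sum_(i < n) c i * ((sl (tnth y i) && lev (tnth y i) x)%:R -
     Ex (mu i) (fun w => (sl w && lev w x)%:R)).

Lemma bmeas_sl (sl : X -> bool) x : measurable [set w | sl w] ->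
  bmeas (fun w : X => (sl w && lev w x)%:R : R).
Proof.
move=> msl; under eq_fun do rewrite natr_and.
by apply: bmeasM; [exact: bmeas_ind|exact: bmeas_lev].
Qed.

Lemma bmeas_slproc (sl : X -> bool) x : measurable [set w | sl w] -> bmeas (fun y => slproc sl y x).
Proof.
move=> msl; apply: bmeas_sum => i; apply: bmeasZ; apply: bmeasB; last exact: bmeas_cst.
by apply: (bmeas_tnth i (bmeas_sl x msl)).
Qed.

(** One sequence serves all samples [y]. It reduces the supremum over the uncountable index set to a
    countable one, for which measurability and continuity of the measure are available. *)
Lemma slproc_dense (sl : X -> bool) x : measurable [set w | sl w] -> exists u : nat -> m.-tuple (option rat),
  forall y, (fun k => slproc sl y (dpt (u k))) @ \oo --> slproc sl y x.
Proof.
move=> msl; have [u hu] := dense_vec x; exists u => y.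
have cvgb (w : X) : (fun k => (sl w && lev w (dpt (u k)))%:R : R) @ \oo --> ((sl w && lev w x)%:R : R).
  by apply: cvg_near_cst; have := hu w; apply: filterS => k ->.
apply: cvg_sumR => i; apply: cvgM; first exact: cvg_cst.
apply: cvgB; first exact: cvgb.
have [] := @Ex_bounded_cvg _ _ _ (mu i) (fun k w => (sl w && lev w (dpt (u k)))%:R)
  (fun w => (sl w && lev w x)%:R) 1.
- by move=> k; have [] := bmeas_sl (dpt (u k)) msl.
- by move=> k w; case: (_ && _); rewrite ?normr1 ?normr0.
- exact: cvgb.
by [].
Qed.

Definition slbound (sl : X -> bool) : R :=
  2 ^+ m * (48 * ((\sum_(i < n) c i ^+ 2 * Ex (mu i) (fun w => (sl w)%:R)) ^+ 2 +
     \sum_(i < n) c i ^+ 4 * Ex (mu i) (fun w => (sl w)%:R))).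

(** The moment bound holds for every finite set of points with the same constant; Markov's
    inequality for fourth powers and continuity from below carry it to the countable dense set,
    hence to all points. *)
Lemma small_slproc (sl : X -> bool) (e : R) : measurable [set w | sl w] -> 0 < e ->
  small (prod_law mu n) [set y | exists x, e < `|slproc sl y x|] (slbound sl / e ^+ 4).
Proof.
move=> msl e0.
pose G N (y : n.-tuple X) := gmax (dseq m N) (slproc sl y).
have bG N : bmeas (G N) by apply: bmeas_gmax => x; exact: bmeas_slproc.
pose B N := [set y | e ^+ 4 <= G N y].
have mB N : measurable (B N).
  have [mG _] := bG N; rewrite /B -[X in measurable X]setTI.
  have := mG measurableT `[e ^+ 4, +oo[%classic (measurable_itv _).
  by congr (measurable (_ `&` _)); apply/seteqP; split => y /=; rewrite in_itv/= andbT.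
have PB N : (prod_law mu n (B N) <= (slbound sl / e ^+ 4)%:E)%E.
  apply: (le_trans (Ex_markov (prod_law mu n) (bG N) (fun y => gmax_ge0 _ _) (exprn_gt0 4 e0))).
  rewrite lee_fin ler_pM2r ?invr_gt0 ?exprn_gt0//.
  exact: orthant_moment.
have ndB : nondecreasing_seq B.
  move=> N M NM; apply/subsetPset => y /= h; apply: (le_trans h).
  apply: gmax_le; first exact: gmax_ge0.
  by move=> x /(dseq_sub NM) xM; exact: le_gmax.
exists (\bigcup_N B N); split.
- exact: bigcupT_measurable.
- move=> y /= [x hx]; have [u hu] := slproc_dense x msl.
  have : \forall k \near \oo, e < `|slproc sl y (dpt (u k))|.
    by apply: (cvgr_gt _ (cvg_norm (hu y))).
  move=> /filter_ex[k hk]; have [N hN] := @dseq_in R m (u k).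
  exists N => //=; rewrite /B/= /G; apply: le_trans (le_gmax _ hN).
  rewrite -[leRHS]ger0_norm ?exprn_even_ge0// normrX lerXn2r ?nnegrE ?(ltW e0) ?(ltW hk)//.
- have := nondecreasing_cvg_mu mB (bigcupT_measurable _ mB) ndB (mu := prod_law mu n) => cvB.
  have L : (limn (prod_law mu n \o B) <= (slbound sl / e ^+ 4)%:E)%E.
    by apply: lime_le; [exact: cvgP cvB|exact: nearW].
  by move: L; rewrite (cvg_lim _ cvB).
Qed.

Lemma eproc_telescope p (y : n.-tuple X) x : eproc y x - eproc y (gpi p x) =
  \sum_(k < m) slproc (slab p k (gidx p (tnth x k))) y (mixv p x k).
Proof.
have H k (km : (k <= m)%N) : eproc y x - eproc y (mixv p x k) =
  \sum_(i < m | (i < k)%N) slproc (slab p i (gidx p (tnth x i))) y (mixv p x i).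
  elim: k km => [|k IH] km.
    by rewrite mixv0 subrr big_pred0.
  pose k' := Ordinal km.
  rewrite (bigD1 k') /= ?ltnSn//.
  rewrite (eq_bigl (fun i : 'I_m => (i < k)%N)); last first.
    move=> i; rewrite ltnS leq_eqVlt andb_orl; case: (ltngtP i k) => ik /=.
    - by apply/eqP => h; move: ik; rewrite h ltnn.
    - by [].
    - by rewrite orbF; apply/negbTE/negPn/eqP; exact: val_inj.
  rewrite -IH; last exact: ltnW.
  have -> : slproc (slab p k' (gidx p (tnth x k'))) y (mixv p x k') = eproc y (mixv p x k) - eproc y (mixv p x k.+1).
    rewrite /slproc /eproc -sumrB; apply: eq_bigr => i _.
    rewrite -mulrBr (lev_mixvS p x k'); congr (_ * _).
    under eq_Ex do rewrite (lev_mixvS p x k').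
    by rewrite ExB; [rewrite /edf; ring|exact: bmeas_lev|exact: bmeas_lev].
  by ring.
rewrite -(mixvm p x) H//; apply: eq_bigl => i; exact: ltn_ord.
Qed.

Variables (b : R) (e : nat -> R) (F : X -> R) (p : nat) (w eps : R).
Hypothesis c0 : forall i, (i < n)%N -> 0 <= c i <= b.
Hypothesis eF : forall i x, (i < n)%N -> `|edf x i - F x| <= e i.
Hypothesis wF : forall k j, `|F (coordv k (gpt p j.+1)) - F (coordv k (gpt p j))| <= w.
Hypothesis eps0 : 0 < eps.

Let V := \sum_(i < n) c i ^+ 2.
Let Ee := \sum_(i < n) c i ^+ 2 * e i.

(** In each direction the slab weights [q k j] add up to at most [V], and each is at most
    [2 Ee + w V]. The sum of their squares is thus at most [(2 Ee + w V) V], small for fine grids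
    whatever the number of slabs; this is where fourth moments pay off. The term [b ^+ 2] comes from
    [c i ^+ 4 <= b ^+ 2 * c i ^+ 2]. *)
Lemma small_eproc : small (prod_law mu n)
  [set y | exists x, eps < `|eproc y x - eproc y (gpi p x)|]
  (2 ^+ m * 48 * m%:R * ((2 * Ee + w * V) + b ^+ 2) * V / (eps / m.+1%:R) ^+ 4).
Proof.
(* There are [m] slabs to cross; [m.+1] avoids a division by zero. *)
have em0 : 0 < eps / m.+1%:R by rewrite divr_gt0.
pose A (k : 'I_m) := \big[setU/set0]_(j <- index_enum 'I_(gN p).+1)
  [set y | exists x, eps / m.+1%:R < `|slproc (slab p k j) y x|].
pose q (k : 'I_m) (j : nat) := \sum_(i < n) c i ^+ 2 * Ex (mu i) (fun w => (slab p k j w)%:R).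
have smallA k : small (prod_law mu n) (A k) (\sum_(j <- index_enum 'I_(gN p).+1) slbound (slab p k j) / (eps / m.+1%:R) ^+ 4).
  by apply: small_big => j; apply: small_slproc => //; exact: measurable_slab.
have := small_big (index_enum 'I_m) smallA; apply: small_sub.
  move=> y /= [x hx]; apply: contrapT => nA; move: hx; apply/negP; rewrite -leNgt eproc_telescope.
  have em : \sum_(k < m) eps / m.+1%:R <= eps.
    rewrite sumr_const card_ord -[leLHS]mulr_natr -mulrA ler_piMr ?(ltW eps0)// ler_pdivrMl// mulr1 ler_nat//.
  apply: le_trans em; apply: (le_trans (ler_norm_sum _ _ _)); apply: ler_sum => k _.
  rewrite leNgt; apply/negP => h; apply: nA.
  rewrite -bigcup_seq; exists k => /=; first exact: mem_index_enum.
  rewrite /A -bigcup_seq; exists (inord (gidx p (tnth x k))); first exact: mem_index_enum.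
  by exists (mixv p x k); rewrite inordK// ltnS gidx_le.
have P1 k j i : (i < n)%N -> Ex (mu i) (fun w => (slab p k j w)%:R) <= 2 * e i + w.
  move=> ni; under eq_Ex do rewrite slabE.
  rewrite ExB; [|exact: bmeas_lev|exact: bmeas_lev]; rewrite -!/(edf _ _).
  have := eF (coordv k (gpt p j.+1)) ni; have := eF (coordv k (gpt p j)) ni; have := wF k j.
  rewrite !ler_norml => /andP[? ?] /andP[? ?] /andP[? ?]; lra.
have P0 k j i : 0 <= Ex (mu i) (fun w => (slab p k j w)%:R) by apply: Ex_ge0 => z; case: slab.
have sumP k i N : \sum_(j < N) Ex (mu i) (fun w => (slab p k j w)%:R) <= 1.
  rewrite -Ex_sum; last by move=> j; apply: bmeas_ind; exact: measurable_slab.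
  rewrite -[leRHS](Ex_cst (mu i)); apply: le_Ex; last by move=> z; exact: slab_sum.
  - by apply: bmeas_sum => j; apply: bmeas_ind; exact: measurable_slab.
  - exact: bmeas_cst.
have q0 k j : 0 <= q k j by apply: sumr_ge0 => i _; rewrite mulr_ge0 ?sqr_ge0.
have qle k j : q k j <= 2 * Ee + w * V.
  rewrite /Ee /V !mulr_sumr -big_split/=; apply: ler_sum => i _.
  by rewrite mulrCA [w * _]mulrC -mulrDr ler_wpM2l ?sqr_ge0// P1.
have b0 : (0 < n)%N -> 0 <= b.
  by move=> n0; have /andP[h1 h2] := c0 n0; exact: le_trans h2.
have c4 k j : \sum_(i < n) c i ^+ 4 * Ex (mu i) (fun w => (slab p k j w)%:R) <= b ^+ 2 * q k j.
  rewrite /q mulr_sumr; apply: ler_sum => i _; have /andP[h1 h2] := c0 (ltn_ord i).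
  rewrite (_ : c i ^+ 4 = c i ^+ 2 * c i ^+ 2); last by ring.
  rewrite -mulrA ler_wpM2r ?mulr_ge0 ?sqr_ge0// lerXn2r ?nnegrE//; exact: le_trans h2.
have sumq k : \sum_(j < (gN p).+1) q k j <= V.
  rewrite /q exchange_big /=; apply: ler_sum => i _.
  by rewrite -mulr_sumr ler_piMr ?sqr_ge0//; exact: sumP.
have V0 : 0 <= V by apply: sumr_ge0 => i _; exact: sqr_ge0.
have bnd k j : slbound (slab p k j) <= 2 ^+ m * 48 * ((2 * Ee + w * V) + b ^+ 2) * q k j.
  rewrite /slbound -!mulrA ler_pM2l ?exprn_gt0// ler_pM2l// mulrDl lerD ?c4//.
  by rewrite expr2 -/(q k j) ler_wpM2r.
rewrite (eq_bigr (fun k : 'I_m => (\sum_(j < (gN p).+1) slbound (slab p k j)) / (eps / m.+1%:R) ^+ 4)); last first.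
  by move=> k _; rewrite mulr_suml.
rewrite -mulr_suml ler_pM2r ?invr_gt0 ?exprn_gt0//.
(* The sign of the bound is read off a slab, which exists only if [m > 0]; for [m = 0] the sums over
   the directions are empty. *)
have W0 : 0 <= 2 ^+ m * 48 * (2 * Ee + w * V + b ^+ 2) \/ (m = 0)%N.
  case: (posnP m) => [->|m0]; [by right|left].
  rewrite mulr_ge0// addr_ge0 ?sqr_ge0//.
  exact: le_trans (q0 (Ordinal m0) 0%N) (qle _ _).
apply: (@le_trans _ _ (\sum_(k < m) 2 ^+ m * 48 * (2 * Ee + w * V + b ^+ 2) * V)).
  apply: ler_sum => k _; case: W0 => [W0|m0]; last by have := ltn_ord k; rewrite {2}m0.
  apply: (@le_trans _ _ (\sum_(j < (gN p).+1) 2 ^+ m * 48 * (2 * Ee + w * V + b ^+ 2) * q k j)).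
    by apply: ler_sum => j _; exact: bnd.
  by rewrite -mulr_sumr ler_wpM2l.
rewrite sumr_const card_ord -[_ *+ m]mulr_natr le_eqVlt; apply/orP; left; apply/eqP; ring.
Qed.

End tightness.

(** * Central limit theorem *)

Section trig_inequalities.
Context {R : realType}.
Implicit Types z : R.

(** The four trigonometric bounds follow from one another by the mean value theorem, which gives the
    constant 1 rather than the Taylor coefficient. *)
Lemma sin_lip z : `|sin z| <= `|z|.
Proof.
have H (x : R) : 0 < x -> `|sin x| <= x.
  move=> x0; have [c _] := @MVT R sin cos 0 x x0 (fun y _ => is_derive_sin y)
    (continuous_subspaceT (@continuous_sin R)).
  rewrite sin0 !subr0 => ->; rewrite normrM (gtr0_norm x0) ler_piMl ?(ltW x0)//.
  by rewrite ler_norml cos_geN1 cos_le1.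
have [z0|z0|->] := ltgtP z 0; last by rewrite sin0.
- by rewrite -normrN -sinN (ltr0_norm z0) H// oppr_gt0.
- by rewrite (gtr0_norm z0) H.
Qed.

Lemma cos_sub1 z : `|cos z - 1| <= z ^+ 2.
Proof.
have H (x : R) : 0 < x -> `|cos x - 1| <= x ^+ 2.
  move=> x0; have [c] := @MVT R cos (fun y => - sin y) 0 x x0 (fun y _ => is_derive_cos y)
    (continuous_subspaceT (@continuous_cos R)).
  rewrite in_itv/= cos0 subr0 => /andP[c0 cx] ->.
  rewrite normrM (gtr0_norm x0) expr2 ler_wpM2r ?(ltW x0)// normrN.
  by apply: (le_trans (sin_lip c)); rewrite gtr0_norm// ltW.
have [z0|z0|->] := ltgtP z 0; last by rewrite cos0 subrr normr0 sqr_ge0.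
- by rewrite -cosN -sqrrN H// oppr_gt0.
- exact: H.
Qed.

Lemma sin_sub z : `|sin z - z| <= `|z| ^+ 3.
Proof.
have H (x : R) : 0 < x -> `|sin x - x| <= x ^+ 3.
  move=> x0.
  have d (y : R) : is_derive y 1 (fun y : R => sin y - y) (cos y - 1) by apply: is_derive_eq.
  have cd : continuous (fun y : R => sin y - y).
    by move=> y; apply: cvgB => //; exact: continuous_sin.
  have [c] := @MVT R _ _ 0 x x0 (fun y _ => d y) (continuous_subspaceT cd).
  rewrite in_itv/= sin0 !subr0 => /andP[c0 cx] ->.
  rewrite normrM (gtr0_norm x0) exprSr ler_wpM2r ?(ltW x0)//.
  apply: (le_trans (cos_sub1 c)); rewrite lerXn2r ?nnegrE// ?(ltW x0) ?(ltW c0) ?(ltW cx)//.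
have [z0|z0|->] := ltgtP z 0; last by rewrite sin0 subrr normr0 expr0n.
- by rewrite -normrN opprD -sinN (ltr0_norm z0) H// oppr_gt0.
- by rewrite (gtr0_norm z0) H.
Qed.

Lemma cos_sub2 z : `|cos z - 1 + z ^+ 2 / 2| <= z ^+ 4.
Proof.
have H (x : R) : 0 < x -> `|cos x - 1 + x ^+ 2 / 2| <= x ^+ 4.
  move=> x0.
  have d (y : R) : is_derive y 1 (fun y : R => cos y - 1 + 2^-1 *: y ^+ 2) (- sin y + y).
    by apply: is_derive_eq; rewrite /GRing.scale/=; field.
  have cd : continuous (fun y : R => cos y - 1 + 2^-1 *: y ^+ 2).
    by move=> y; apply: differentiable_continuous; apply/derivable1_diffP; have := d y; case.
  have [c] := @MVT R _ _ 0 x x0 (fun y _ => d y) (continuous_subspaceT cd).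
  rewrite in_itv/= cos0 expr0n/= scaler0 subrr addr0 !subr0 /GRing.scale/= => /andP[c0 cx].
  rewrite [2^-1 * _]mulrC => ->.
  rewrite normrM (gtr0_norm x0) exprSr ler_wpM2r ?(ltW x0)//.
  rewrite addrC -opprB normrN.
  apply: (le_trans (sin_sub c)); rewrite gtr0_norm// lerXn2r ?nnegrE// ltW//.
have [z0|z0|->] := ltgtP z 0; last by rewrite cos0 !expr0n/= mul0r subrr add0r normr0.
- rewrite -cosN -[z ^+ 2]sqrrN; have := H (- z); rewrite oppr_gt0 => /(_ z0) h.
  by apply: (le_trans h); rewrite (_ : (- z) ^+ 4 = z ^+ 4)//; ring.
- exact: H.
Qed.

Lemma exp_sub1 (s : R) : 0 <= s -> `|expR (- s) - 1 + s| <= s ^+ 2.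
Proof.
move=> s0; have h1 : 1 - s <= expR (- s) by exact: expR_ge1Dx.
have h2 : 1 + s <= expR s by exact: expR_ge1Dx.
have h3 : expR s * expR (- s) = 1 by rewrite -expRD subrr expR0.
have h4 : 0 < expR (- s) by exact: expR_gt0.
rewrite ger0_norm; nra.
Qed.

Lemma cos_bound z : `|cos z| <= 1.
Proof. by rewrite ler_norml cos_geN1 cos_le1. Qed.

Lemma sin_bound z : `|sin z| <= 1.
Proof. by rewrite ler_norml sin_geN1 sin_le1. Qed.

End trig_inequalities.

Section clt.
Context {R : realType} {d} {T : measurableType d}.

Lemma bmeas_cos {d'} {O : measurableType d'} (f : O -> R) : measurable_fun setT f -> bmeas (fun w => cos (f w)).
Proof.
move=> mf; apply: (bmeas_comp_cont _ _ mf); first exact: continuous_cos.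
by exists 1 => x; exact: cos_bound.
Qed.

Lemma bmeas_sin {d'} {O : measurableType d'} (f : O -> R) : measurable_fun setT f -> bmeas (fun w => sin (f w)).
Proof.
move=> mf; apply: (bmeas_comp_cont _ _ mf); first exact: continuous_sin.
by exists 1 => x; exact: sin_bound.
Qed.

(** With [v] the variance, the mean of [cos z] is close to [1 - v / 2], which is close to
    [expR (- (v / 2))], and the mean of [sin z] is close to that of [z], which is 0. Each of the
    three errors is at most [b * v]. *)
Lemma clt_step (P : probability T R) (z : T -> R) (th b : R) : 0 <= b -> b <= 1 ->
  bmeas z -> (forall x, `|z x| <= b) -> Ex P z = 0 ->
  `|Ex P (fun x => cos (th + z x)) - expR (- (Ex P (fun x => z x ^+ 2) / 2)) * cos th| <=
  3 * b * Ex P (fun x => z x ^+ 2).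
Proof.
move=> b0 b1 bz zb Ez; set v := Ex P (fun x => z x ^+ 2).
have bz2 : bmeas (fun x => z x ^+ 2) by exact: bmeasX.
have v0 : 0 <= v by apply: Ex_ge0 => x; exact: sqr_ge0.
have z2b x : z x ^+ 2 <= b ^+ 2 by rewrite -(real_normK (num_real (z x))) lerXn2r ?nnegrE.
have vb : v <= b ^+ 2.
  rewrite -[leRHS](Ex_cst P); apply: le_Ex => //; exact: bmeas_cst.
have bc : bmeas (fun x => cos (z x)) by case: bz => mz _; exact: bmeas_cos.
have bs : bmeas (fun x => sin (z x)) by case: bz => mz _; exact: bmeas_sin.
have Ecos : `|Ex P (fun x => cos (z x)) - (1 - v / 2)| <= b * v.
  have -> : 1 - v / 2 = Ex P (fun x => 1 - z x ^+ 2 / 2).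
    rewrite ExB; [|exact: bmeas_cst|by apply: bmeasM => //; exact: bmeas_cst].
    by rewrite Ex_cst ExZr.
  have bb : bmeas (fun x => 1 - z x ^+ 2 / 2).
    by apply: bmeasB; [exact: bmeas_cst|apply: bmeasM => //; exact: bmeas_cst].
  rewrite -ExB//; apply: (le_trans (Ex_norm_le P (bmeasB bc bb))).
  rewrite -ExZ//; apply: le_Ex; [exact/bmeas_norm/bmeasB|exact: bmeasZ|].
  move=> x; have h := cos_sub2 (z x).
  have -> : cos (z x) - (1 - z x ^+ 2 / 2) = cos (z x) - 1 + z x ^+ 2 / 2 by ring.
  apply: (le_trans h); rewrite (_ : z x ^+ 4 = z x ^+ 2 * z x ^+ 2); last by ring.
  rewrite ler_wpM2r ?sqr_ge0//; apply: (le_trans (z2b x)).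
  by rewrite expr2 ler_piMl.
have Esin : `|Ex P (fun x => sin (z x))| <= b * v.
  have -> : Ex P (fun x => sin (z x)) = Ex P (fun x => sin (z x) - z x) by rewrite ExB// Ez subr0.
  apply: (le_trans (Ex_norm_le P (bmeasB bs bz))).
  rewrite -ExZ//; apply: le_Ex; [exact/bmeas_norm/bmeasB|exact: bmeasZ|].
  move=> x; apply: (le_trans (sin_sub (z x))).
  rewrite exprS real_normK ?num_real// ler_wpM2r ?sqr_ge0//.
have Eexp : `|expR (- (v / 2)) - (1 - v / 2)| <= b * v.
  have v20 : 0 <= v / 2 by rewrite divr_ge0.
  rewrite opprB addrA -addrAC; apply: (le_trans (exp_sub1 v20)); nra.
have -> : Ex P (fun x => cos (th + z x)) =
  cos th * Ex P (fun x => cos (z x)) - sin th * Ex P (fun x => sin (z x)).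
  rewrite -!ExZ// -ExB; [|exact: bmeasZ|exact: bmeasZ].
  by apply: eq_Ex => x; rewrite cosD.
move: Ecos Esin Eexp.
set C := Ex P _; set S := Ex P _; set E := expR _ => Ecos Esin Eexp.
have -> : cos th * C - sin th * S - E * cos th =
  cos th * (C - (1 - v / 2)) - cos th * (E - (1 - v / 2)) - sin th * S by ring.
have n1 (a x : R) : `|a| <= 1 -> `|x| <= b * v -> `|a * x| <= b * v.
  by move=> a1 xv; rewrite normrM; apply: le_trans xv; rewrite ler_piMl.
apply: (le_trans (ler_normB _ _)); rewrite (_ : 3 * b * v = b * v + b * v + b * v); last by ring.
apply: lerD; last exact: n1 (sin_bound th) Esin.
apply: (le_trans (ler_normB _ _)); apply: lerD; exact: n1 (cos_bound th) _.
Qed.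

(** The phase lets the induction absorb one summand at a time. The errors just add up, because the
    factors [expR (- (S / 2))] of the remaining summands are at most 1. *)
Lemma clt_cos n (mu : nat -> probability T R) (z : nat -> T -> R) (th b : R) : 0 <= b -> b <= 1 ->
  (forall i, bmeas (z i)) -> (forall i x, (i < n)%N -> `|z i x| <= b) ->
  (forall i, Ex (mu i) (z i) = 0) ->
  `|Ex (prod_law mu n) (fun y => cos (th + \sum_(i < n) z i (tnth y i))) -
   expR (- ((\sum_(i < n) Ex (mu i) (fun x => z i x ^+ 2)) / 2)) * cos th| <=
  3 * b * \sum_(i < n) Ex (mu i) (fun x => z i x ^+ 2).
Proof.
move=> b0 b1; elim: n mu z th => [|n IH] mu z th mz zb Ez.
  by rewrite Ex_prod_law0 !big_ord0 addr0 mul0r oppr0 expR0 mul1r subrr normr0 mulr0.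
have bs k (z' : nat -> T -> R) (mz' : forall i, bmeas (z' i)) (c : R) : bmeas (fun y : k.-tuple T => cos (c + \sum_(i < k) z' i (tnth y i))).
  apply: bmeas_cos; apply: measurable_funD => //.
  have [] // : bmeas (fun y : k.-tuple T => \sum_(i < k) z' i (tnth y i)).
  by apply: bmeas_sum => i; exact: bmeas_tnth.
rewrite Ex_prod_lawS; last exact: bs.
rewrite big_ord_recl.
set mu' := fun i => mu i.+1; set z' := fun i => z i.+1.
set S := \sum_(i < n) _.
have SE : \sum_(i < n) Ex (mu' i) (fun x => z' i x ^+ 2) = S.
  by apply: eq_bigr => i _; rewrite lift0.
set v := Ex (mu ord0) _.
have S0 : 0 <= S by apply: sumr_ge0 => i _; apply: Ex_ge0 => x; exact: sqr_ge0.
have mz0 : measurable_fun setT (z 0%N) by case: (mz 0%N).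
have bmz0 : bmeas (fun x => cos (th + z 0%N x)) by apply: bmeas_cos; exact: measurable_funD.
have inner x : `|Ex (prod_law mu' n) (fun y => cos (th + \sum_(i < n.+1) z i (tnth (cons_pair (x, y)) i))) -
   expR (- (S / 2)) * cos (th + z 0%N x)| <= 3 * b * S.
  have := IH mu' z' (th + z 0%N x) (fun i => mz i.+1) (fun i x => zb i.+1 x) (fun i => Ez i.+1).
  rewrite SE; congr (`|_ - _| <= _); apply: eq_Ex => y; congr cos.
  rewrite big_ord_recl tnth_cons0 addrA; congr (_ + _).
  by apply: eq_bigr => i _; rewrite tnth_consS lift0.
have bmi := bmeas_Ex2 (prod_law mu' n) (bmeas_cons (bs n.+1 z mz th)).
have bm2 : bmeas (fun x => expR (- (S / 2)) * cos (th + z 0%N x)) by exact: bmeasZ.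
have h1 := Ex_sub_norm (mu 0%N) bmi bm2 inner.
rewrite ExZ// in h1.
have h2 := clt_step th b0 b1 (mz 0%N) (fun x => zb 0%N x (ltn0Sn n)) (Ez 0%N).
have vE : Ex (mu 0%N) (fun x => z 0%N x ^+ 2) = v by [].
rewrite vE in h2.
have eS : 0 <= expR (- (S / 2)) <= 1.
  by rewrite expR_ge0 -expR0 ler_expR oppr_le0 divr_ge0.
have h3 : `|expR (- (S / 2)) * Ex (mu 0%N) (fun x => cos (th + z 0%N x)) -
   expR (- (S / 2)) * (expR (- (v / 2)) * cos th)| <= 3 * b * v.
  rewrite -mulrBr normrM ger0_norm ?expR_ge0//; apply: le_trans h2.
  by rewrite ler_piMl//; case/andP: eS.
have -> : expR (- ((v + S) / 2)) * cos th = expR (- (S / 2)) * (expR (- (v / 2)) * cos th).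
  by rewrite mulrA -expRD; congr (expR _ * _); field.
rewrite mulrDr [leRHS]addrC; apply: le_trans (lerD h1 h3).
by rewrite -[X in `|X| <= _](subrKA (expR (- (S / 2)) * Ex (mu 0%N) (fun x => cos (th + z 0%N x)))) ler_normD.
Qed.

End clt.

(** * Convergence of characteristic functions *)

Section trig_polynomials.
Context {R : realType} {J : finType}.
Implicit Types (f t : (J -> R) -> R) (v : J -> R).

Definition lin (c v : J -> R) : R := \sum_j c j * v j.

(* Triples [(a, c, th)] encode the terms [a * cos (th + c . v)]. *)
Definition tsum (s : seq (R * (J -> R) * R)) v : R := \sum_(x <- s) x.1.1 * cos (x.2 + lin x.1.2 v).

Definition istrig t := exists s, t =1 tsum s.

Lemma linD c c' v : lin (fun j => c j + c' j) v = lin c v + lin c' v.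
Proof. by rewrite /lin -big_split; apply: eq_bigr => j _; rewrite mulrDl. Qed.

Lemma linB c c' v : lin (fun j => c j - c' j) v = lin c v - lin c' v.
Proof. by rewrite /lin -sumrB; apply: eq_bigr => j _; rewrite mulrBl. Qed.

Lemma istrig_cst a : istrig (fun=> a).
Proof.
exists [:: (a, fun=> 0, 0)] => v; rewrite /tsum big_cons big_nil addr0 /= /lin.
by rewrite big1 ?addr0 ?cos0 ?mulr1// => j _; rewrite mul0r.
Qed.

Lemma istrigD t t' : istrig t -> istrig t' -> istrig (fun v => t v + t' v).
Proof. by move=> [s hs] [s' hs']; exists (s ++ s') => v; rewrite /tsum big_cat hs hs'. Qed.

Lemma istrigM t t' : istrig t -> istrig t' -> istrig (fun v => t v * t' v).
Proof.
move=> [s hs] [s' hs'].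
exists (flatten [seq flatten [seq [:: (x.1.1 * y.1.1 / 2, fun j => x.1.2 j + y.1.2 j, x.2 + y.2);
     (x.1.1 * y.1.1 / 2, fun j => x.1.2 j - y.1.2 j, x.2 - y.2)] | y <- s'] | x <- s]) => v.
rewrite hs hs' /tsum big_flatten big_map big_distrl/=; apply: eq_bigr => x _.
rewrite big_flatten big_map big_distrr/=; apply: eq_bigr => y _.
rewrite !big_cons big_nil addr0 /= linD linB.
rewrite (_ : x.2 + y.2 + (lin x.1.2 v + lin y.1.2 v) = (x.2 + lin x.1.2 v) + (y.2 + lin y.1.2 v)); last by ring.
rewrite (_ : x.2 - y.2 + (lin x.1.2 v - lin y.1.2 v) = (x.2 + lin x.1.2 v) - (y.2 + lin y.1.2 v)); last by ring.
move: (x.2 + lin x.1.2 v) (y.2 + lin y.1.2 v) => A B.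
by rewrite (cosB A B) (cosD A B); field.
Qed.

Lemma istrig_sin (w : R) (i : J) : istrig (fun v => sin (w * v i)).
Proof.
exists [:: (1, fun j => if j == i then w else 0, - (pi / 2))] => v.
rewrite /tsum big_cons big_nil addr0 /= mul1r /lin (bigD1 i)//= eqxx big1 ?addr0.
  by rewrite addrC cosB cos_pihalf mulr0 add0r sin_pihalf mulr1.
by move=> j /negbTE ->; rewrite mul0r.
Qed.

End trig_polynomials.

Section bernstein.
Context {R : realType}.

(* Expectation of [g] at a binomial variable with parameters [n] and [x]. *)
Fixpoint bern (n : nat) (g : nat -> R) (x : R) : R :=
  match n with
  | 0 => g 0%N
  | n'.+1 => (1 - x) * bern n' g x + x * bern n' (fun k => g k.+1) x
  end.

Lemma le_bern n g h x : 0 <= x <= 1 -> (forall k, g k <= h k) -> bern n g x <= bern n h x.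
Proof.
move=> /andP[x0 x1]; elim: n g h => [|n IH] g h gh //=.
by rewrite lerD// ler_wpM2l ?subr_ge0// IH.
Qed.

Lemma bernB n g h x : bern n (fun k => g k - h k) x = bern n g x - bern n h x.
Proof. by elim: n g h => [|n IH] g h //=; rewrite !IH; ring. Qed.

Lemma bernDcst n g (a b : R) x : bern n (fun k => a + b * g k) x = a + b * bern n g x.
Proof. by elim: n g => [|n IH] g //=; rewrite !IH; ring. Qed.

Lemma bern_cst n (a : R) x : bern n (fun=> a) x = a.
Proof. by elim: n => [|n IH] //=; rewrite !IH; ring. Qed.

Lemma bern_abs n g h x : 0 <= x <= 1 -> (forall k, `|g k| <= h k) -> `|bern n g x| <= bern n h x.
Proof.
move=> x01 gh; rewrite ler_norml; apply/andP; split.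
  rewrite -mulN1r -[leLHS]add0r -bernDcst; apply: le_bern => // k.
  by rewrite add0r mulN1r; have := gh k; rewrite ler_norml => /andP[].
by apply: le_bern => // k; have := gh k; rewrite ler_norml => /andP[].
Qed.

Lemma bern_var n (a : R) x :
  bern n (fun k => (k%:R + a) ^+ 2) x = (n%:R * x + a) ^+ 2 + n%:R * (x * (1 - x)).
Proof.
elim: n a => [|n IH] a /=; first by rewrite mul0r !add0r mul0r addr0.
rewrite IH; have -> : (fun k : nat => (k.+1%:R + a) ^+ 2) = (fun k => (k%:R + (1 + a)) ^+ 2).
  by apply/funext => k; rewrite -natr1 addrA.
by rewrite IH -natr1; ring.
Qed.

(** Bernstein's argument with [z <= de + z^2 / de] in place of a distinction of cases; the mean of
    [z^2] is the binomial variance divided by the square of the number of trials. *)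
Lemma bern_approx (h : R -> R) (K de : R) n x : 0 <= x <= 1 -> 0 < de -> 0 <= K ->
  (forall a b, `|h a - h b| <= K * `|a - b|) ->
  `|h x - bern n.+1 (fun k => h (k%:R / n.+1%:R)) x| <= K * (de + (n.+1%:R * de)^-1).
Proof.
move=> x01 de0 K0 hK; set N := n.+1.
have N0 : 0 < N%:R :> R by [].
have pt k : `|h x - h (k%:R / N%:R)| <= K * de + K / (de * N%:R ^+ 2) * (k%:R + - (N%:R * x)) ^+ 2.
  apply: (le_trans (hK _ _)); rewrite -mulrA -mulrDr ler_wpM2l//.
  have -> : x - k%:R / N%:R = - ((k%:R + - (N%:R * x)) / N%:R) by field; rewrite gt_eqF.
  rewrite normrN.
  have -> : (de * N%:R ^+ 2)^-1 * (k%:R - N%:R * x) ^+ 2 = ((k%:R - N%:R * x) / N%:R) ^+ 2 / de.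
    by field; rewrite !gt_eqF.
  set y := (_ / _); rewrite -(real_normK (num_real y)); have := normr_ge0 y.
  move: (`|y|) => z z0.
  rewrite -subr_ge0 (_ : _ - _ = ((z - de / 2) ^+ 2 + 3 / 4 * de ^+ 2) / de); last by field; rewrite gt_eqF.
  by rewrite divr_ge0 ?(ltW de0)// addr_ge0 ?sqr_ge0// mulr_ge0 ?sqr_ge0// divr_ge0.
have bd : bern N (fun k => (k%:R + - (N%:R * x)) ^+ 2) x = N%:R * (x * (1 - x)).
  by rewrite bern_var subrr expr0n add0r.
have x2 : x * (1 - x) <= 1 by case/andP: x01 => a b; nra.
have bnd : K * de + K / (de * N%:R ^+ 2) * (N%:R * (x * (1 - x))) <= K * (de + (N%:R * de)^-1).
  rewrite [leRHS]mulrDr lerD2l.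
  have -> : K / (de * N%:R ^+ 2) * (N%:R * (x * (1 - x))) = K * (N%:R * de)^-1 * (x * (1 - x)).
    by field; rewrite !gt_eqF.
  by rewrite ler_piMr// mulr_ge0// invr_ge0 mulr_ge0// ltW.
have -> : h x - bern N (fun k => h (k%:R / N%:R)) x = bern N (fun k => h x - h (k%:R / N%:R)) x.
  by rewrite bernB bern_cst.
by apply: (le_trans (bern_abs N x01 pt)); rewrite bernDcst bd.
Qed.

End bernstein.

Section trig_approximation.
Context {R : realType} {J : finType}.
Implicit Types (f t : (J -> R) -> R) (v : J -> R).

Definition lip f (K : R) := forall v v', `|f v - f v'| <= K * \sum_j `|v j - v' j|.

Lemma istrig_bern n (t : nat -> (J -> R) -> R) (x : (J -> R) -> R) :
  (forall k, istrig (t k)) -> istrig x -> istrig (fun v => bern n (fun k => t k v) (x v)).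
Proof.
move=> ht hx; elim: n t ht => [|n IH] t ht; first exact: ht.
apply: istrigD; apply: istrigM => //; last by apply: (IH (fun k => t k.+1)).
- apply: istrigD; first exact: istrig_cst.
  rewrite (_ : (fun v => - x v) = fun v => -1 * x v); last by apply/funext => v; rewrite mulN1r.
  by apply: istrigM => //; exact: istrig_cst.
- exact: (IH t).
Qed.

(** Bounded substitute for the identity that is a trigonometric polynomial and tends to the identity
    as [w] tends to 0. *)
Definition sinw (w x : R) := sin (w * x) / w.

(* Coordinates in [s] are replaced by [sin (w v_j) / w], a variable with values
   in [-1/w, 1/w] to which Bernstein's operator applies; the others are frozen. *)
Definition partw (w : R) (s : seq J) (g v : J -> R) : J -> R :=
  fun j => if j \in s then sinw w (v j) else g j.

(** Induction on the coordinates. Bernstein's operator in [x v = (1 + sin (w v_i)) / 2], which lies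
    in [[0, 1]], reduces the coordinate [i] to finitely many frozen values, and trigonometric
    polynomials are closed under the products that occur. *)
Lemma trig_approx_seq f (K w e : R) s g : uniq s -> lip f K -> 0 <= K -> 0 < w -> 0 < e ->
  exists2 t, istrig t & forall v, `|f (partw w s g v) - t v| <= e.
Proof.
move=> us fK K0 w0; elim: s us e g => [|i s IH] us e g e0.
  exists (fun=> f g); first exact: istrig_cst.
  by move=> v; rewrite /partw (_ : (fun _ => _) = g) ?subrr ?normr0 ?ltW//; apply/funext.
move: us => /= /andP[ins us].
have e20 : 0 < e / 2 by rewrite divr_gt0.
pose K2 := K * (2 / w).
have K20 : 0 <= K2 by rewrite mulr_ge0// divr_ge0// ltW.
(* With [n] such that [(n.+1 de)^-1 <= de], the error of Bernstein's operator is at most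
   [2 K2 de <= e / 2]. *)
pose de := e / (4 * (K2 + 1)).
have de0 : 0 < de by rewrite divr_gt0// mulr_gt0// ltr_wpDl.
pose n := Num.bound (de ^- 2).
have nde : (n.+1%:R * de)^-1 <= de.
  have nde0 : 0 < n.+1%:R * de by rewrite mulr_gt0.
  have ide0 : 0 < de^-1 by rewrite invr_gt0.
  rewrite -[leRHS]invrK lef_pV2 ?posrE//.
  rewrite -ler_pdivrMr// -invfM -expr2 ltW//.
  have : de ^- 2 < n%:R by apply: archi_boundP; rewrite invr_ge0 sqr_ge0.
  by move=> /lt_trans; apply; rewrite ltr_nat.
(* Inverse of the affine map that sends the value of [sinw] at coordinate [i] to [x v]. *)
pose val (x : R) := (2 * x - 1) / w.
pose gk (x : R) := fun j => if j == i then val x else g j.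
have [t ht] := choice (fun k : nat =>
  let: ex_intro2 t h1 h2 := IH us (e / 2) (gk (k%:R / n.+1%:R)) e20 in
  ex_intro (fun t => istrig t /\ forall v, `|f (partw w s (gk (k%:R / n.+1%:R)) v) - t v| <= e / 2) t (conj h1 h2)).
pose x v := (1 + sin (w * v i)) / 2.
have x01 v : 0 <= x v <= 1.
  rewrite /x; have := sin_geN1 (w * v i); have := sin_le1 (w * v i); move: (sin _) => z; lra.
exists (fun v => bern n.+1 (fun k => t k v) (x v)).
  apply: istrig_bern; first by move=> k; case: (ht k).
  apply: istrigM; last exact: istrig_cst.
  by apply: istrigD; [exact: istrig_cst|exact: istrig_sin].
move=> v.
pose h y := f (partw w s (gk y) v).
have hK a b : `|h a - h b| <= K2 * `|a - b|.
  apply: (le_trans (fK _ _)); rewrite /K2 -mulrA ler_wpM2l//.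
  rewrite (bigD1 i)//= big1 ?addr0.
    rewrite /partw (negbTE ins) /gk eqxx /val -mulrBl normrM (gtr0_norm (_ : 0 < w^-1)) ?invr_gt0//.
    rewrite (_ : 2 * a - 1 - (2 * b - 1) = 2 * (a - b)); last by ring.
    by rewrite normrM gtr0_norm// mulrAC.
  by move=> j ji; rewrite /partw /gk (negbTE ji) subrr normr0.
have hx : h (x v) = f (partw w (i :: s) g v).
  congr f; apply/funext => j; rewrite /partw inE /gk; case: eqP => [->|_] //=.
  rewrite (negbTE ins) /val /x /sinw; congr (_ / _); by field.
have B := bern_approx n (x01 v) de0 K20 hK.
rewrite hx in B.
have B1 : `|f (partw w (i :: s) g v) - bern n.+1 (fun k => h (k%:R / n.+1%:R)) (x v)| <= e / 2.
  apply: (le_trans B); apply: (@le_trans _ _ (K2 * (de + de))); first by rewrite ler_wpM2l// lerD2l.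
  rewrite /de (_ : K2 * _ = (K2 / (K2 + 1)) * (e / 2)); last first.
    by field; rewrite gt_eqF// ltr_wpDl.
  by rewrite ler_piMl ?(ltW e20)// ler_pdivrMr ?ltr_wpDl// mul1r lerDl.
have B2 : `|bern n.+1 (fun k => h (k%:R / n.+1%:R)) (x v) - bern n.+1 (fun k => t k v) (x v)| <= e / 2.
  rewrite -bernB -[leRHS](bern_cst n.+1 _ (x v)); apply: bern_abs => // k.
  by have [_ /(_ v)] := ht k.
have := lerD B1 B2; rewrite -splitr; apply: le_trans.
by rewrite -[X in `|X| <= _](subrKA (bern n.+1 (fun k => h (k%:R / n.+1%:R)) (x v))) ler_normD.
Qed.

Lemma trig_approx f (K w e : R) : lip f K -> 0 <= K -> 0 < w -> 0 < e ->
  exists2 t, istrig t & forall v, `|f (fun j => sinw w (v j)) - t v| <= e.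
Proof.
move=> fK K0 w0 e0.
have [t tt h] := trig_approx_seq (fun=> 0) (index_enum_uniq J) fK K0 w0 e0.
exists t => // v; have := h v; congr (`|f _ - _| <= _).
by apply/funext => j; rewrite /partw mem_index_enum.
Qed.

Lemma sinw_approx (w x : R) : 0 < w -> `|sinw w x - x| <= w ^+ 2 * `|x| ^+ 3.
Proof.
move=> w0; rewrite (_ : sinw w x - x = (sin (w * x) - w * x) / w); last first.
  by rewrite /sinw; field; rewrite gt_eqF.
rewrite normrM (gtr0_norm (_ : 0 < w^-1)) ?invr_gt0// ler_pdivrMr//.
apply: (le_trans (sin_sub _)); rewrite normrM (gtr0_norm w0) le_eqVlt; apply/orP; left; apply/eqP; ring.
Qed.

Lemma measurable_tsum {d} {O : measurableType d} (Y : O -> J -> R) t :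
  (forall j, measurable_fun setT (fun w => Y w j)) -> istrig t -> bmeas (fun w => t (Y w)).
Proof.
move=> mY [s hs]; under eq_fun do rewrite hs /tsum.
apply: bmeas_sum => x; apply: bmeasZ; apply: bmeas_cos; apply: measurable_funD => //.
by apply: measurable_sum => j; exact: measurable_funM.
Qed.

Lemma sinw_cvg (x : R) : (fun k => sinw k.+1%:R^-1 x) @ \oo --> x.
Proof.
apply/cvgrPdist_le => /= e e0; near=> k.
have k0 : 0 < k.+1%:R^-1 :> R by rewrite invr_gt0.
rewrite distrC; apply: (le_trans (sinw_approx x k0)).
have xe : 0 < `|x| ^+ 3 / e + 1 by rewrite ltr_wpDl// divr_ge0 ?(ltW e0)// exprn_ge0.
have : `|x| ^+ 3 / e + 1 <= k%:R by near: k; exact: nbhs_infty_ger.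
have kk : k%:R <= k.+1%:R :> R by rewrite ler_nat.
move=> /le_trans /(_ kk) hk.
have : `|x| ^+ 3 / e <= k.+1%:R by apply: le_trans hk; rewrite lerDl.
rewrite ler_pdivrMr// => h.
apply: (@le_trans _ _ (k.+1%:R^-1 * `|x| ^+ 3)).
  rewrite ler_wpM2r ?exprn_ge0// expr2 ler_piMl ?(ltW k0)// invf_le1// ler1n//.
by rewrite ler_pdivrMl.
Unshelve. all: by end_near. Qed.

Lemma lip_sinw_cvg f K v : lip f K ->
  (fun k => f (fun j => sinw k.+1%:R^-1 (v j))) @ \oo --> f v.
Proof.
move=> fK; have : (fun k => K * \sum_j `|sinw k.+1%:R^-1 (v j) - v j|) @ \oo --> K * \sum_(j : J) (0 : R).
  apply: cvgM; first exact: cvg_cst.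
  apply: cvg_sumR => j; rewrite -[X in _ --> X](normr0 R) -[X in `|X|](subrr (v j)).
  by apply: cvg_norm; apply: cvgB; [exact: sinw_cvg|exact: cvg_cst].
rewrite big1// mulr0 => h.
apply: cvg_zero; apply: norm_cvg0.
apply: squeeze_cvgr h; last exact: cvg_cst.
by apply: nearW => k; rewrite normr_ge0 /= !fctE fK.
Qed.

(** A Lipschitz function of finitely many coordinates is an iterated limit of trigonometric
    polynomials, so its measurability follows from that of the coordinates. *)
Lemma measurable_lip {d} {O : measurableType d} (Y : O -> J -> R) f K :
  (forall j, measurable_fun setT (fun w => Y w j)) -> lip f K -> 0 <= K ->
  measurable_fun setT (fun w => f (Y w)).
Proof.
move=> mY fK K0.
have mw (w : R) : 0 < w -> measurable_fun setT (fun x => f (fun j => sinw w (Y x j))).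
  move=> w0; have H (k : nat) : exists t, istrig t /\ forall v, `|f (fun j => sinw w (v j)) - t v| <= k.+1%:R^-1.
    have k0 : 0 < k.+1%:R^-1 :> R by rewrite invr_gt0.
    by have [t h1 h2] := trig_approx fK K0 w0 k0; exists t.
  have [t ht] := choice H.
  have mt k : measurable_fun setT (fun x => t k (Y x)).
    by have [tk _] := ht k; have [] := measurable_tsum mY tk.
  apply: (measurable_fun_cvg mt) => x _.
  apply/cvgrPdist_le => /= e e0; near=> k.
  have [_ h] := ht k; apply: (le_trans (h _)); apply: ltW.
  by near: k; exact: near_infty_natSinv_lt (PosNum e0).
have mt (k : nat) : measurable_fun setT (fun x => f (fun j => sinw k.+1%:R^-1 (Y x j))).
  by apply: mw; rewrite invr_gt0.
apply: (measurable_fun_cvg mt) => x _.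
exact: (@lip_sinw_cvg f K (Y x) fK).
Unshelve. all: by end_near. Qed.

Lemma bmeas_lip {d} {O : measurableType d} (Y : O -> J -> R) f (K B : R) :
  (forall j, measurable_fun setT (fun w => Y w j)) -> lip f K -> 0 <= K ->
  (forall v, `|f v| <= B) -> bmeas (fun w => f (Y w)).
Proof. by move=> mY fK K0 fB; split; [exact: (measurable_lip mY fK)|exists B]. Qed.

Definition tight_at {d} {O : measurableType d} (P : probability O R) (Y : O -> J -> R) (B e : R) :=
  small P [set w | exists j, B < `|Y w j|] e.

Lemma tight_rv {d} {W : measurableType d} (Q : probability W R) (Z : W -> J -> R) (e' : R) :
  (forall j, measurable_fun setT (fun w => Z w j)) -> 0 < e' -> exists B : R, tight_at Q Z B e'.
Proof.
move=> mZ e'0.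
pose A n := [set w : W | exists j, n%:R < `|Z w j|].
have mA n : measurable (A n).
  rewrite (_ : A n = \big[setU/set0]_(j : J) [set w | n%:R < `|Z w j|]).
    apply: bigsetU_measurable => j _; rewrite -[X in measurable X]setTI.
    have mZj : measurable_fun setT (fun w => `|Z w j|) by exact: measurableT_comp.
    have := mZj measurableT `]n%:R, +oo[%classic (measurable_itv _).
    by congr (measurable (_ `&` _)); apply/seteqP; split => w /=; rewrite in_itv/= andbT.
  rewrite -bigcup_seq; apply/seteqP; split => w /= [j]; first by move=> h; exists j => //=; rewrite mem_index_enum.
  by move=> _ h; exists j.
have A0 : \bigcap_n A n = set0.
  apply/seteqP; split => // w /= h.
  pose M := \sum_j `|Z w j|.
  have [j hj] := h (Num.bound M) I.
  have : M < (Num.bound M)%:R by apply: archi_boundP; apply: sumr_ge0.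
  move=> /lt_trans /(_ hj); apply/negP; rewrite -leNgt /M (bigD1 j)//= lerDl.
  exact: sumr_ge0.
have c := @nonincreasing_cvg_mu _ _ _ Q A _ mA.
have {}c : (Q \o A) n @[n --> \oo] --> Q (\bigcap_n A n).
  apply: c; first by rewrite -ge0_fin_numE// fin_num_measure.
  - by rewrite A0.
  - move=> n n' nn'; apply/subsetPset => w [j h]; exists j; apply: le_lt_trans h.
    by rewrite ler_nat.
rewrite A0 measure0 in c.
have := c => /fine_cvgP[_ /cvgrPdist_le /(_ e' e'0)] [n _ /(_ n (leqnn _))] /= h.
exists n%:R; exists (A n); split => //.
have Qf : Q (A n) \is a fin_num by exact: fin_num_measure.
rewrite -[leLHS](fineK Qf) lee_fin; apply: le_trans h.
by rewrite sub0r normrN ger0_norm// fine_ge0.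
Qed.

(** Where all coordinates are at most [B], the substitution costs [w^2 B^3] per coordinate;
    elsewhere it costs at most [2 C]. *)
Lemma Ex_sinw {d} {O : measurableType d} (P : probability O R) (Y : O -> J -> R) f (K C B w e : R) :
  (forall j, measurable_fun setT (fun w => Y w j)) -> lip f K -> 0 <= K ->
  (forall v, `|f v| <= C) -> 0 < w -> 0 <= B -> tight_at P Y B e ->
  `|Ex P (fun x => f (Y x)) - Ex P (fun x => f (fun j => sinw w (Y x j)))| <=
  K * (#|J|%:R * (w ^+ 2 * B ^+ 3)) + 2 * C * e.
Proof.
move=> mY fK K0 fC w0 B0 [A [mA YA PA]].
have bf := bmeas_lip mY fK K0 fC.
have msw j : measurable_fun setT (fun x => sinw w (Y x j)).
  apply: measurable_funM => //; apply: measurableT_comp; first by apply: continuous_measurable_fun; exact: continuous_sin.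
  exact: measurable_funM.
have bg : bmeas (fun x => f (fun j => sinw w (Y x j))).
  exact: (bmeas_lip msw fK K0 fC).
set a := K * _.
have a0 : 0 <= a by rewrite !mulr_ge0// ?exprn_ge0// ltW.
have C0 : 0 <= C by exact: le_trans (normr_ge0 _) (fC (fun=> 0)).
have bA : bmeas (fun x : O => (x \in A)%:R : R).
  by split; [exact: measurable_indic|exists 1 => x; case: (_ \in _); rewrite ?normr1 ?normr0].
rewrite -ExB//; apply: (le_trans (Ex_norm_le P (bmeasB bf bg))).
apply: (@le_trans _ _ (Ex P (fun x => a + 2 * C * (x \in A)%:R))).
  apply: le_Ex; [exact/bmeas_norm/bmeasB|by apply: bmeasD; [exact: bmeas_cst|exact: bmeasZ]|].
  move=> x; case: (boolP (x \in A)) => xA.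
    rewrite mulr1; apply: (le_trans (ler_normB _ _)).
    by have := fC (Y x); have := fC (fun j => sinw w (Y x j)); lra.
  rewrite mulr0 addr0; apply: (le_trans (fK _ _)); rewrite ler_wpM2l//.
  rewrite -[X in X * _](_ : \sum_(j : J) 1 = #|J|%:R); last by rewrite sumr_const.
  rewrite mulr_suml; apply: ler_sum => j _; rewrite mul1r distrC.
  have YB : `|Y x j| <= B.
    by rewrite leNgt; apply/negP => h; move/negP : xA; apply; rewrite inE; apply: YA; exists j.
  apply: (le_trans (sinw_approx _ w0)).
  by rewrite ler_wpM2l ?sqr_ge0// lerXn2r ?nnegrE.
rewrite ExD; [|exact: bmeas_cst|exact: bmeasZ].
rewrite Ex_cst ExZ// lerD2l.
rewrite ler_wpM2l ?mulr_ge0 ?C0//.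
by rewrite -lee_fin Ex_EFin// integral_indic// setIT.
Qed.

Section convergence.
Variables (dd : nat -> measure_display) (O : forall k, measurableType (dd k)).
Variables (P : forall k, probability (O k) R) (Y : forall k, O k -> J -> R).
Variables (d : measure_display) (W : measurableType d) (Q : probability W R) (Z : W -> J -> R).
Hypothesis mY : forall (k : nat) (j : J), measurable_fun setT (fun w : O k => Y w j).
Hypothesis mZ : forall j, measurable_fun setT (fun w => Z w j).
Hypothesis cvg_cos : forall c th, (fun k => Ex (P k) (fun w => cos (th + lin c (Y w)))) @ \oo -->
  Ex Q (fun w => cos (th + lin c (Z w))).
Hypothesis tY : forall e : R, 0 < e -> exists B : R, \forall k \near \oo, tight_at (P k) (@Y k) B e.

Lemma istrig_cvg t : istrig t -> (fun k => Ex (P k) (fun w => t (Y w))) @ \oo --> Ex Q (fun w => t (Z w)).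
Proof.
move=> [s hs].
have E d' (O' : measurableType d') (P' : probability O' R) (Y' : O' -> J -> R) (mY' : forall j, measurable_fun setT (fun w => Y' w j)) :
  Ex P' (fun w => t (Y' w)) = \sum_(x <- s) x.1.1 * Ex P' (fun w => cos (x.2 + lin x.1.2 (Y' w))).
  have bc (x : R * (J -> R) * R) : bmeas (fun w => cos (x.2 + lin x.1.2 (Y' w))).
    apply: bmeas_cos; apply: measurable_funD => //.
    by apply: measurable_sum => j; exact: measurable_funM.
  under eq_Ex do rewrite hs /tsum.
  rewrite Ex_sum; last by move=> x; exact: bmeasZ.
  by apply: eq_bigr => x _; rewrite ExZ.
rewrite E//; under eq_fun do rewrite E//.
by apply: cvg_sumR => x; apply: cvgM; [exact: cvg_cst|exact: cvg_cos].
Qed.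

(** Levy's continuity theorem for bounded Lipschitz functions: tightness allows the coordinates to
    be replaced by bounded sines, and the result is uniformly close to a trigonometric polynomial,
    whose expectations converge by assumption. *)
Lemma lip_cvg f (K C : R) : lip f K -> 0 <= K -> (forall v, `|f v| <= C) ->
  (fun k => Ex (P k) (fun w => f (Y w))) @ \oo --> Ex Q (fun w => f (Z w)).
Proof.
move=> fK K0 fC; apply/cvgrPdist_le => /= e e0.
have C0 : 0 <= C by exact: le_trans (normr_ge0 _) (fC (fun=> 0)).
(* The budget is [e / 4] for the tails, [e / 8] for the sines and [e / 32] for the polynomial, all
   of them twice, and [e / 16] for the convergence of the polynomial. *)
pose e' := e / (8 * (C + 1)).
have e'0 : 0 < e' by rewrite divr_gt0// mulr_gt0// ltr_wpDl.
have eC : 2 * C * e' <= e / 4.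
  rewrite /e' (_ : 2 * C * _ = (C / (C + 1)) * (e / 4)); last by field; rewrite gt_eqF// ltr_wpDl.
  by rewrite ler_piMl ?divr_ge0 ?(ltW e0)// ler_pdivrMr ?ltr_wpDl// mul1r lerDl.
have [B1 hB1] := tY e'0.
have [B2 hB2] := tight_rv Q mZ e'0.
pose B := Num.max 0 (Num.max B1 B2).
have B0 : 0 <= B by rewrite /B le_max lexx.
have tmono d' (O' : measurableType d') (P' : probability O' R) (Y' : O' -> J -> R) b :
    b <= B -> tight_at P' Y' b e' -> tight_at P' Y' B e'.
  move=> bB; apply: small_sub => // w /= [j h]; exists j; exact: le_lt_trans h.
have tQ : tight_at Q Z B e' by apply: tmono hB2; rewrite /B !le_max lexx !orbT.
pose X := K * (#|J|%:R * B ^+ 3) + 1.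
have X0 : 0 < X by rewrite ltr_wpDl// !mulr_ge0// exprn_ge0.
pose w := Num.min 1 (e / (8 * X)).
have w0 : 0 < w by rewrite /w lt_min ltr01 divr_gt0// mulr_gt0.
have w1 : w <= 1 by rewrite /w ge_min lexx.
have wX : K * (#|J|%:R * (w ^+ 2 * B ^+ 3)) <= e / 8.
  apply: (@le_trans _ _ (w * X)).
    rewrite (_ : K * _ = w * (w * (K * (#|J|%:R * B ^+ 3)))); last by ring.
    rewrite ler_pM2l//; apply: (@le_trans _ _ (K * (#|J|%:R * B ^+ 3))); last by rewrite lerDl.
    by rewrite ler_piMl// !mulr_ge0// exprn_ge0.
  rewrite -ler_pdivlMr// /w ge_min; apply/orP; right.
  by rewrite le_eqVlt; apply/orP; left; apply/eqP; field; rewrite gt_eqF.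
have e40 : 0 < e / 32 by rewrite divr_gt0.
have [t tt ht] := trig_approx fK K0 w0 e40.
have key d' (O' : measurableType d') (P' : probability O' R) (Y' : O' -> J -> R)
    (mY' : forall j, measurable_fun setT (fun w => Y' w j)) : tight_at P' Y' B e' ->
    `|Ex P' (fun x => f (Y' x)) - Ex P' (fun x => t (Y' x))| <= e / 4 + e / 8 + e / 32.
  move=> tP; have h1 := Ex_sinw mY' fK K0 fC w0 B0 tP.
  have msw j : measurable_fun setT (fun x => sinw w (Y' x j)).
    apply: measurable_funM => //; apply: measurableT_comp; first by apply: continuous_measurable_fun; exact: continuous_sin.
    exact: measurable_funM.
  have bg : bmeas (fun x => f (fun j => sinw w (Y' x j))) by exact: (bmeas_lip msw fK K0 fC).
  have h2 := Ex_sub_norm P' bg (measurable_tsum mY' tt) (fun x => ht (Y' x)).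
  have := ler_distD (Ex P' (fun x => f (fun j => sinw w (Y' x j)))) (Ex P' (fun x => f (Y' x))) (Ex P' (fun x => t (Y' x))).
  lra.
have hQ := key _ _ Q Z mZ tQ.
have /cvgrPdist_le /(_ (e / 16)) := istrig_cvg tt.
rewrite divr_gt0// => /(_ isT) hcv.
near=> k.
have hk : tight_at (P k) (@Y k) B e'.
  have : tight_at (P k) (@Y k) B1 e' by near: k; exact: hB1.
  by apply: tmono; rewrite /B !le_max lexx !orbT.
have hP := key _ _ (P k) (@Y k) (@mY k) hk.
have ht' : `|Ex Q (fun w => t (Z w)) - Ex (P k) (fun w => t (Y w))| <= e / 16.
  by near: k; exact: hcv.
have := ler_distD (Ex Q (fun x => t (Z x))) (Ex Q (fun x => f (Z x))) (Ex (P k) (fun x => f (Y x))).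
have := ler_distD (Ex (P k) (fun x => t (Y x))) (Ex Q (fun x => t (Z x))) (Ex (P k) (fun x => f (Y x))).
rewrite (distrC (Ex (P k) (fun x => t (Y x))) (Ex (P k) (fun x => f (Y x)))).
lra.
Unshelve. all: by end_near. Qed.

End convergence.

(** The uniqueness theorem, as the case of a constant sequence in the continuity theorem. *)
Lemma lip_law {d d'} {O : measurableType d} {O' : measurableType d'}
    (P : probability O R) (Q : probability O' R) (Y : O -> J -> R) (Z : O' -> J -> R) f (K C : R) :
  (forall j, measurable_fun setT (fun w => Y w j)) ->
  (forall j, measurable_fun setT (fun w => Z w j)) ->
  (forall c th, Ex P (fun w => cos (th + lin c (Y w))) = Ex Q (fun w => cos (th + lin c (Z w)))) ->
  lip f K -> 0 <= K -> (forall v, `|f v| <= C) ->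
  Ex P (fun w => f (Y w)) = Ex Q (fun w => f (Z w)).
Proof.
move=> mY mZ E fK K0 fC.
have cc c th : (fun=> Ex P (fun w => cos (th + lin c (Y w))) : R) @ \oo --> Ex Q (fun w => cos (th + lin c (Z w))).
  by move=> k; rewrite E; exact: cvg_cst.
have tY e : 0 < e -> exists B : R, \forall k \near \oo, tight_at P Y B e.
  by move=> e0; have [B hB] := tight_rv P mY e0; exists B; exact: nearW.
have := @lip_cvg (fun=> d) (fun=> O) (fun=> P) (fun=> Y) _ _ Q Z (fun=> mY) mZ cc tY f K C fK K0 fC.
by move=> /cvg_lim <- //; rewrite lim_cst.
Qed.

End trig_approximation.

Lemma cvg_close {R : realType} (f g : nat -> R) (l : R) :
  (fun k => f k - g k) @ \oo --> (0 : R) -> g @ \oo --> l -> f @ \oo --> l.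
Proof.
move=> fg gl; rewrite -[l]add0r (_ : f = fun k => (f k - g k) + g k).
  exact: cvgD.
by apply/funext => k; rewrite subrK.
Qed.

(** * Weighted empirical process of one sample: equicontinuity and finite-dimensional limits *)

Section one_sample.
Context {R : realType} {m : nat}.
Notation X := (xvec R m).
Variables (n : nat -> nat) (mu : nat -> nat -> probability X R) (c : nat -> nat -> R).
Variables (F : X -> R) (V : R).

(** The coefficients are uniformly negligible and their squares sum to [V] in the limit. The
    deviations [e k i] of the individual distribution functions from [F] vanish only on weighted
    average, since the first few observations may stay far from [F]. *)
Definition sample_array :=
  [/\ exists2 b : nat -> R, b @ \oo --> 0 &
        forall k, 0 <= b k /\ forall i, (i < n k)%N -> 0 <= c k i <= b k,
      exists2 e : nat -> nat -> R, (fun k => \sum_(i < n k) c k i ^+ 2 * e k i) @ \oo --> 0 &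
        forall k i x, (i < n k)%N -> `|edf (mu k) x i - F x| <= e k i,
      (fun k => \sum_(i < n k) c k i ^+ 2) @ \oo --> V
    & forall x, `|F x| <= 1].

Hypothesis arr : sample_array.

Lemma tight_eproc : unif_cont_xvec F -> forall w e : R, 0 < w -> 0 < e ->
  \forall p \near \oo, \forall k \near \oo, small (prod_law (mu k) (n k))
    [set y | exists x, w < `|eproc (mu k) (c k) y x - eproc (mu k) (c k) y (gpi p x)|] e.
Proof.
move=> ucF w e w0 e0; case: arr => -[b b0 cb] [ee ee0 eeF] cV F1.
pose C : R := 2 ^+ m * 48 * m%:R / (w / m.+1%:R) ^+ 4.
have C0 : 0 <= C.
  by rewrite divr_ge0 ?mulr_ge0 ?exprn_ge0// ?divr_ge0 ?(ltW w0)// ?ler0n.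
(* Oscillation of [F] across a slab that makes the limit [C w' V^2] of the bound less than [e]. *)
pose w' := e / (2 * (C * V ^+ 2 + 1)).
have D0 : 0 < C * V ^+ 2 + 1 by rewrite ltr_wpDl// mulr_ge0// sqr_ge0.
have w'0 : 0 < w' by rewrite divr_gt0// mulr_gt0.
have : \forall p \near \oo, forall k j, `|F (coordv k (gpt p j.+1)) - F (coordv k (gpt p j))| <= w'.
  exact: unif_cont_grid.
apply: filterS => p hp.
pose Vk k := \sum_(i < n k) c k i ^+ 2.
pose Ek k := \sum_(i < n k) c k i ^+ 2 * ee k i.
have lim : (fun k => C * (((2 * Ek k + w' * Vk k) + b k ^+ 2) * Vk k)) @ \oo --> C * (((2 * 0 + w' * V) + 0 ^+ 2) * V).
  apply: cvgM; first exact: cvg_cst.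
  apply: cvgM => //; apply: cvgD.
    by apply: cvgD; apply: cvgM => //; exact: cvg_cst.
  by rewrite expr2; under eq_fun do rewrite expr2; apply: cvgM.
have lt : C * (((2 * 0 + w' * V) + 0 ^+ 2) * V) < e.
  rewrite mulr0 add0r expr0n addr0 /w' (_ : C * _ = (C * V ^+ 2 / (C * V ^+ 2 + 1)) * (e / 2)); last by field; rewrite gt_eqF.
  apply: (@le_lt_trans _ _ (e / 2)); last by rewrite ltr_pdivrMr// ltr_pMr// ltr1n.
  by rewrite ler_piMl ?divr_ge0 ?(ltW e0)// ler_pdivrMr// mul1r lerDl.
near=> k.
have hk : C * (((2 * Ek k + w' * Vk k) + b k ^+ 2) * Vk k) < e.
  by near: k; apply: cvgr_lt lim _ lt.
have [bk ck] := cb k.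
have := small_eproc ck (eeF k) hp w0.
apply: small_sub => //; apply: ltW; apply: le_lt_trans hk.
by rewrite le_eqVlt; apply/orP; left; apply/eqP; rewrite /C /Ek /Vk; ring.
Unshelve. all: by end_near. Qed.

Lemma measurable_eproc (k : nat) x : measurable_fun setT (fun y : (n k).-tuple X => eproc (mu k) (c k) y x).
Proof.
apply: measurable_sum => i; have [h _] : bmeas (fun y : (n k).-tuple X => c k i * ((lev (tnth y i) x)%:R - edf (mu k) x i)).
  apply: bmeasZ; apply: bmeasB; last exact: bmeas_cst.
  exact: (bmeas_tnth i (bmeas_lev x)).
exact: h.
Qed.

Lemma bmeas_eproc (k : nat) x : bmeas (fun y : (n k).-tuple X => eproc (mu k) (c k) y x).
Proof.
apply: bmeas_sum => i; apply: bmeasZ; apply: bmeasB; last exact: bmeas_cst.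
exact: (bmeas_tnth i (bmeas_lev x)).
Qed.

Lemma lev_minv (w x y : X) : lev w (minv x y) = lev w x && lev w y.
Proof.
apply/forallP/andP => [h|[/forallP h1 /forallP h2] k].
  by split; apply/forallP => k; have := h k; rewrite tnth_mktuple le_min => /andP[].
by rewrite tnth_mktuple le_min h1 h2.
Qed.

Lemma edf_ge0 (k : nat) x i : 0 <= edf (mu k) x i.
Proof. by apply: Ex_ge0 => w; exact: ler0n. Qed.

Lemma edf_le1 (k : nat) x i : `|edf (mu k) x i| <= 1.
Proof. by apply: Ex_le_bound (bmeas_lev x) _ => w; case: lev; rewrite ?normr0 ?normr1. Qed.

(** A linear combination of values of the process is again a sum of independent centered terms, to
    which [clt_cos] applies. The threshold for [k] is common to all phases [th]: with two samples,
    the value of the first one enters the phase of the second. *)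
Lemma fdd_eproc (J : finType) (x : J -> X) (a : J -> R) (e : R) : 0 < e ->
  \forall k \near \oo, forall th,
    `|Ex (prod_law (mu k) (n k)) (fun y => cos (th + lin a (fun j => eproc (mu k) (c k) y (x j)))) -
      expR (- (V * (\sum_j \sum_l a j * a l * (F (minv (x j) (x l)) - F (x j) * F (x l))) / 2)) * cos th| <= e.
Proof.
move=> e0; case: arr => -[b b0 cb] [ee ee0 eeF] cV F1.
set G := \sum_j _.
pose A := \sum_j `|a j|.
have A0 : 0 <= A by apply: sumr_ge0.
pose h w := \sum_j a j * (lev w (x j))%:R.
have mh : bmeas h by apply: bmeas_sum => j; apply: bmeasZ; exact: bmeas_lev.
have hA w : `|h w| <= A.
  apply: (le_trans (ler_norm_sum _ _ _)); apply: ler_sum => j _; rewrite normrM ler_piMr//.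
  by case: lev; rewrite ?normr0 ?normr1.
pose Eh k i := Ex (mu k i) h.
have EhA k i : `|Eh k i| <= A by apply: Ex_le_bound.
have EhE k i : Eh k i = \sum_j a j * edf (mu k) (x j) i.
  rewrite /Eh /h Ex_sum; last by move=> j; apply: bmeasZ; exact: bmeas_lev.
  by apply: eq_bigr => j _; rewrite ExZ//; exact: bmeas_lev.
pose z k i w := c k i * (h w - Eh k i).
have mz k i : bmeas (z k i) by apply: bmeasZ; apply: bmeasB => //; exact: bmeas_cst.
have zb k i w : (i < n k)%N -> `|z k i w| <= b k * (2 * A).
  move=> ik; have [bk /(_ i ik)/andP[c0 cbk]] := cb k.
  rewrite normrM (ger0_norm c0) ler_pM//.
  by apply: (le_trans (ler_normB _ _)); have := hA w; have := EhA k i; lra.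
have z0 k i : Ex (mu k i) (z k i) = 0.
  rewrite ExZ; last by apply: bmeasB => //; exact: bmeas_cst.
  by rewrite ExB// ?Ex_cst ?subrr ?mulr0//; exact: bmeas_cst.
have Ez2 k i : Ex (mu k i) (fun w => z k i w ^+ 2) = c k i ^+ 2 * (Ex (mu k i) (fun w => h w ^+ 2) - Eh k i ^+ 2).
  have mh2 := bmeasX 2 mh.
  have -> : Ex (mu k i) (fun w => z k i w ^+ 2) = Ex (mu k i) (fun w => c k i ^+ 2 * ((h w ^+ 2 - (2 * Eh k i) * h w) + Eh k i ^+ 2)).
    by apply: eq_Ex => w; rewrite /z; ring.
  have mZ := bmeasZ (2 * Eh k i) mh.
  have mB := bmeasB mh2 mZ.
  have mc : bmeas (fun _ : X => Eh k i ^+ 2) by exact: bmeas_cst.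
  have mD := bmeasD mB mc.
  rewrite ExZ// (ExD _ mB mc) (ExB _ mh2 mZ) ExZ// Ex_cst -/(Eh k i); ring.
have Eh2 k i : Ex (mu k i) (fun w => h w ^+ 2) = \sum_j \sum_l a j * a l * edf (mu k) (minv (x j) (x l)) i.
  have hE w : h w ^+ 2 = \sum_j \sum_l a j * a l * (lev w (minv (x j) (x l)))%:R.
    rewrite expr2 /h mulr_suml; apply: eq_bigr => j _; rewrite mulr_sumr; apply: eq_bigr => l _.
    by rewrite lev_minv natr_and; ring.
  under eq_Ex do rewrite hE.
  rewrite Ex_sum; last by move=> j; apply: bmeas_sum => l; apply: bmeasZ; exact: bmeas_lev.
  apply: eq_bigr => j _; rewrite Ex_sum; last by move=> l; apply: bmeasZ; exact: bmeas_lev.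
  by apply: eq_bigr => l _; rewrite ExZ//; exact: bmeas_lev.
pose M := \sum_j a j * F (x j).
have MA : `|M| <= A.
  apply: (le_trans (ler_norm_sum _ _ _)); apply: ler_sum => j _.
  by rewrite normrM ler_piMr.
have GE : G = \sum_j \sum_l a j * a l * F (minv (x j) (x l)) - M ^+ 2.
  rewrite /G expr2 /M mulr_suml -sumrB; apply: eq_bigr => j _; rewrite mulr_sumr -sumrB.
  by apply: eq_bigr => l _; ring.
have var k i : (i < n k)%N -> `|Ex (mu k i) (fun w => h w ^+ 2) - Eh k i ^+ 2 - G| <= 3 * A ^+ 2 * ee k i.
  move=> ik.
  have e1 : `|Ex (mu k i) (fun w => h w ^+ 2) - \sum_j \sum_l a j * a l * F (minv (x j) (x l))| <= A ^+ 2 * ee k i.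
    rewrite Eh2 -sumrB; apply: (le_trans (ler_norm_sum _ _ _)).
    rewrite expr2 {1}/A !mulr_suml; apply: ler_sum => j _.
    rewrite -sumrB; apply: (le_trans (ler_norm_sum _ _ _)).
    rewrite /A mulr_sumr mulr_suml; apply: ler_sum => l _.
    by rewrite -mulrBr !normrM ler_wpM2l ?mulr_ge0 ?normr_ge0//; exact: eeF.
  have e2 : `|Eh k i - M| <= A * ee k i.
    rewrite EhE -sumrB; apply: (le_trans (ler_norm_sum _ _ _)).
    rewrite /A mulr_suml; apply: ler_sum => j _.
    by rewrite -mulrBr normrM ler_wpM2l//; exact: eeF.
  have e3 : `|Eh k i ^+ 2 - M ^+ 2| <= 2 * A ^+ 2 * ee k i.
    rewrite subr_sqr normrM (_ : 2 * A ^+ 2 * _ = A * ee k i * (A + A)); last by ring.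
    by rewrite ler_pM//; apply: (le_trans (ler_normD _ _)); rewrite lerD.
  rewrite GE (_ : _ - _ = (Ex (mu k i) (fun w => h w ^+ 2) - \sum_j \sum_l a j * a l * F (minv (x j) (x l))) - (Eh k i ^+ 2 - M ^+ 2)); last by ring.
  by apply: (le_trans (ler_normB _ _)); have := lerD e1 e3; congr (_ <= _); ring.
pose v k := \sum_(i < n k) Ex (mu k i) (fun w => z k i w ^+ 2).
have vV : v @ \oo --> V * G.
  have c1 : (fun k => (\sum_(i < n k) c k i ^+ 2) * G) @ \oo --> V * G.
    by apply: cvgM => //; exact: cvg_cst.
  have c2 : (fun k => v k - (\sum_(i < n k) c k i ^+ 2) * G) @ \oo --> (0 : R).
    apply: norm_cvg0.
    have c3 : (fun k => 3 * A ^+ 2 * \sum_(i < n k) c k i ^+ 2 * ee k i) @ \oo --> 3 * A ^+ 2 * 0.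
      by apply: cvgM => //; exact: cvg_cst.
    rewrite mulr0 in c3.
    apply: squeeze_cvgr c3; last exact: cvg_cst.
    apply: nearW => k; rewrite normr_ge0 /= /v mulr_suml -sumrB.
    apply: (le_trans (ler_norm_sum _ _ _)); rewrite mulr_sumr; apply: ler_sum => i _.
    rewrite Ez2 -mulrBr normrM ger0_norm ?sqr_ge0// mulrCA ler_wpM2l ?sqr_ge0//.
    exact: var.
  exact: cvg_close c2 c1.
have expc : (fun k => expR (- (v k / 2))) @ \oo --> expR (- (V * G / 2)).
  apply: (@cvg_comp _ _ _ (fun k => - (v k / 2)) expR _ (nbhs (- (V * G / 2)))); last exact: continuous_expR.
  by apply: cvgN; apply: cvgM => //; exact: cvg_cst.
have bc : (fun k => 3 * (b k * (2 * A)) * v k) @ \oo --> 3 * (0 * (2 * A)) * (V * G).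
  apply: cvgM => //; apply: cvgM; first exact: cvg_cst.
  by apply: cvgM => //; exact: cvg_cst.
rewrite mul0r mulr0 mul0r in bc.
have b1 : (fun k => b k * (2 * A)) @ \oo --> 0 * (2 * A) by apply: cvgM => //; exact: cvg_cst.
rewrite mul0r in b1.
have e20 : 0 < e / 2 by rewrite divr_gt0.
near=> k.
have hb1 : b k * (2 * A) <= 1 by apply: ltW; near: k; exact: (cvgr_lt 0 b1).
have hbc : 3 * (b k * (2 * A)) * v k <= e / 2 by apply: ltW; near: k; exact: (cvgr_lt 0 bc).
have hexp : `|expR (- (V * G / 2)) - expR (- (v k / 2))| <= e / 2.
  by near: k; move/cvgrPdist_le : expc; exact.
move=> th.
have [bk _] := cb k.
have hb0 : 0 <= b k * (2 * A) by rewrite !mulr_ge0.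
have H := clt_cos th hb0 hb1 (mz k) (fun i x ik => zb k i x ik) (z0 k).
have linE (y : (n k).-tuple X) : lin a (fun j => eproc (mu k) (c k) y (x j)) = \sum_(i < n k) z k i (tnth y i).
  rewrite /lin /eproc; under eq_bigr do rewrite mulr_sumr.
  rewrite exchange_big/=; apply: eq_bigr => i _; rewrite /z EhE -sumrB mulr_sumr.
  by apply: eq_bigr => j _; ring.
under eq_Ex do rewrite linE.
have H2 : `|expR (- (v k / 2)) * cos th - expR (- (V * G / 2)) * cos th| <= e / 2.
  rewrite -mulrBl normrM distrC; apply: le_trans hexp.
  by rewrite ler_piMr// cos_bound.
rewrite -/(v k) in H.
have := ler_distD (expR (- (v k / 2)) * cos th) (Ex (prod_law (mu k) (n k)) (fun y => cos (th + \sum_(i < n k) z k i (tnth y i)))) (expR (- (V * G / 2)) * cos th).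
lra.
Unshelve. all: by end_near. Qed.

Lemma chebyshev_eproc (k : nat) x (B : R) : 0 < B ->
  small (prod_law (mu k) (n k)) [set y | B < `|eproc (mu k) (c k) y x|]
    ((\sum_(i < n k) c k i ^+ 2) / B ^+ 2).
Proof.
move=> B0; set P := prod_law _ _.
have m2 := bmeasX 2 (bmeas_eproc k x).
exists [set y | B ^+ 2 <= eproc (mu k) (c k) y x ^+ 2]; split.
- have [mf _] := m2; have := mf measurableT `[B ^+ 2, +oo[%classic (measurable_itv _).
  rewrite setTI; congr measurable; apply/seteqP; split => y /=; by rewrite in_itv/= andbT.
- move=> y /= h; rewrite -(real_normK (num_real (eproc _ _ _ _))).
  by rewrite lerXn2r// ?nnegrE ?(ltW B0)// ltW.
have := Ex_markov P m2 (fun y => sqr_ge0 _) (exprn_gt0 2 B0).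
move=> /le_trans; apply; rewrite lee_fin ler_wpM2r ?invr_ge0 ?exprn_ge0 ?(ltW B0)//.
pose D i (w : X) : R := c k i * ((lev w x)%:R - edf (mu k) x i).
have mD i : bmeas (D i).
  by apply: bmeasZ; apply: bmeasB; [exact: bmeas_lev|exact: bmeas_cst].
have := Ex_sqr_sum (n k) (mu k) 0 mD.
have -> : Ex (prod_law (mu k) (n k)) (fun y => (0 + \sum_(i < n k) D i (tnth y i)) ^+ 2) =
    Ex P (fun y => eproc (mu k) (c k) y x ^+ 2).
  by apply: eq_Ex => y; rewrite add0r.
have D0 i : Ex (mu k i) (D i) = 0.
  rewrite ExZ; last by apply: bmeasB; [exact: bmeas_lev|exact: bmeas_cst].
  by rewrite ExB ?Ex_cst ?subrr ?mulr0//; [exact: bmeas_lev|exact: bmeas_cst].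
rewrite big1 ?addr0 ?expr0n/= ?add0r; last by move=> i _; exact: D0.
move=> /le_trans; apply; apply: ler_sum => i _.
rewrite -[leRHS](Ex_cst (mu k i)); apply: le_Ex; [exact: bmeasX|exact: bmeas_cst|].
move=> w; rewrite /D exprMn ler_piMr ?sqr_ge0// -real_normK ?num_real// expr_le1//.
have := edf_ge0 k x i; have := edf_le1 k x i; rewrite ler_norml => /andP[_ h1] h0.
by rewrite ler_norml; case: lev => /=; lra.
Qed.

End one_sample.

(* The maps [gproj g p] below have finite range; that they approach the identity
   as [p] grows is only expressed along functions, by [nice]. *)
Record grid_on (K : Type) := Grid {
  gJ : nat -> finType;
  gto : forall p, K -> gJ p;
  gof : forall p, gJ p -> K }.

Definition gproj {K} (g : grid_on K) p (x : K) : K := gof (gto g p x).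

Definition grid_sum {K K'} (g : grid_on K) (g' : grid_on K') : grid_on (K + K') :=
  @Grid (K + K') (fun p => (gJ g p + gJ g' p)%type : finType)
    (fun p x => match x with inl x => inl (gto g p x) | inr x => inr (gto g' p x) end)
    (fun p x => match x with inl x => inl (gof x) | inr x => inr (gof x) end).

Definition gridX {R : realType} m : grid_on (xvec R m) :=
  @Grid (xvec R m) (fun p => (m.-tuple 'I_(gN p).+1 : finType)) (@gid R m) (@gval R m).

(** * Functionals of processes *)

Section sup_lipschitz.
Context {R : realType} {K : Type}.
Implicit Types (f : K -> R) (h : (K -> R) -> R).

Definition bnd f := exists B : R, forall x, `|f x| <= B.

Definition suplip h (C : R) := forall f f' (B : R), bnd f -> bnd f' ->
  (forall x, `|f x - f' x| <= B) -> `|h f - h f'| <= C * B.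

(** A seminorm on bounded functions together with a bound [C] of its norm; on unbounded functions
    only nonnegativity is asked for. *)
Record bseminorm (q : (K -> R) -> R) (C : R) : Prop := BSeminorm {
  bs_ge0 : forall f, 0 <= q f;
  bsD : forall f f', bnd f -> bnd f' -> q (fun x => f x + f' x) <= q f + q f';
  bsZ : forall (a : R) f, bnd f -> q (fun x => a * f x) = `|a| * q f;
  bs_le : forall f (B : R), (forall x, `|f x| <= B) -> q f <= C * B }.

Lemma bndD f f' : bnd f -> bnd f' -> bnd (fun x => f x + f' x).
Proof.
move=> [B hB] [B' hB']; exists (B + B') => x.
by apply: (le_trans (ler_normD _ _)); rewrite lerD.
Qed.

Lemma bndZ (a : R) f : bnd f -> bnd (fun x => a * f x).
Proof. by move=> [B hB]; exists (`|a| * B) => x; rewrite normrM ler_wpM2l. Qed.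

Lemma bndB f f' : bnd f -> bnd f' -> bnd (fun x => f x - f' x).
Proof.
move=> h h'; rewrite (_ : (fun x => _) = fun x => f x + -1 * f' x); first exact/bndD/bndZ.
by apply/funext => x; rewrite mulN1r.
Qed.

Lemma bndC (K' : Type) (i : K' -> K) f : bnd f -> exists B : R, forall x, `|f (i x)| <= B.
Proof. by move=> [B hB]; exists B. Qed.

Lemma bsB (q : (K -> R) -> R) C f f' : bseminorm q C -> bnd f -> bnd f' -> q f <= q (fun x => f x - f' x) + q f'.
Proof.
move=> qs bf bf'; rewrite [X in q X <= _](_ : _ = fun x => (f x - f' x) + f' x); last first.
  by apply/funext => x; rewrite subrK.
by apply: (bsD qs) => //; exact: bndB.
Qed.

Lemma bseminorm_lip q C : bseminorm q C -> suplip q C.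
Proof.
move=> qs f f' B bf bf' ff'; rewrite ler_norml; apply/andP; split.
  rewrite lerBrDr addrC lerBlDr; apply: (le_trans (bsB qs bf' bf)).
  by rewrite [X in _ <= X]addrC lerD2r; apply: (bs_le qs) => x; rewrite distrC.
rewrite lerBlDr; apply: (le_trans (bsB qs bf bf')).
by rewrite lerD2r; apply: (bs_le qs).
Qed.

Lemma suplip_comp (phi : R -> R) (c C : R) h : 0 <= c -> (forall x y, `|phi x - phi y| <= c * `|x - y|) ->
  suplip h C -> suplip (fun f => phi (h f)) (c * C).
Proof.
move=> c0 hp hh f f' B bf bf' ff'; apply: (le_trans (hp _ _)).
by rewrite -mulrA ler_wpM2l// hh.
Qed.

Lemma suplipM h h' (C C' D D' : R) : 0 <= D -> 0 <= D' -> suplip h C -> suplip h' C' ->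
  (forall f, `|h f| <= D) -> (forall f, `|h' f| <= D') ->
  suplip (fun f => h f * h' f) (D * C' + D' * C).
Proof.
move=> D0 D'0 hh hh' hD hD' f f' B bf bf' ff'.
rewrite (_ : _ - _ = h f * (h' f - h' f') + h' f' * (h f - h f')); last by ring.
apply: (le_trans (ler_normD _ _)); rewrite !normrM mulrDl -!mulrA.
by rewrite lerD// ler_pM// ?hh ?hh'.
Qed.

Lemma suplip_ge0 h (C : R) : suplip h C -> 0 <= C.
Proof.
move=> hh; rewrite -[C]mulr1; apply: le_trans (hh (fun=> 0) (fun=> 0) 1 _ _ _); rewrite ?normr_ge0//.
- by exists 0 => x; rewrite normr0.
- by exists 0 => x; rewrite normr0.
- by move=> x; rewrite subrr normr0.
Qed.

End sup_lipschitz.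

Lemma suplip_precomp {R : realType} {K K' : Type} (h : (K -> R) -> R) (C D : R) (u : (K' -> R) -> (K -> R)) :
  suplip h C -> 0 <= D -> (forall f, bnd f -> bnd (u f)) ->
  (forall f f' (B : R), (forall x, `|f x - f' x| <= B) -> forall x, `|u f x - u f' x| <= D * B) ->
  suplip (fun f => h (u f)) (C * D).
Proof.
move=> hh D0 ub uD f f' B bf bf' ff'; rewrite -mulrA.
by apply: hh; [exact: ub|exact: ub|exact: uD].
Qed.

Section nice_processes.
Context {R : realType} {K : Type} (g : grid_on K).

(** Plays the role of a tight law on bounded functions: paths are uniform limits of their grid
    projections, so a sup-Lipschitz functional of the path is a limit of Lipschitz functions of
    finitely many coordinates. *)
Definition nice {d} {O : measurableType d} (Y : O -> K -> R) :=
  [/\ forall x, measurable_fun setT (fun w => Y w x), forall w, bnd (Y w) &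
      forall w (e : R), 0 < e -> \forall p \near \oo, forall x, `|Y w x - Y w (gproj g p x)| <= e].

Definition charE {d d'} {O : measurableType d} {O' : measurableType d'}
    (P : probability O R) (Q : probability O' R) (Y : O -> K -> R) (Z : O' -> K -> R) :=
  forall (J : finType) (x : J -> K) (c : J -> R) (th : R),
  Ex P (fun w => cos (th + lin c (fun j => Y w (x j)))) = Ex Q (fun w => cos (th + lin c (fun j => Z w (x j)))).

Lemma bnd_grid (J : finType) (i : K -> J) (v : J -> R) : bnd (fun x => v (i x)).
Proof.
exists (\sum_j `|v j|) => x; rewrite (bigD1 (i x))//= lerDl; exact: sumr_ge0.
Qed.

Lemma suplip_lip h (C : R) (J : finType) (i : K -> J) : suplip h C ->
  lip (fun v : J -> R => h (fun x => v (i x))) C.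
Proof.
move=> hh v v'; apply: hh; [exact: bnd_grid|exact: bnd_grid|].
by move=> x; rewrite (bigD1 (i x))//= lerDl; exact: sumr_ge0.
Qed.

Lemma grid_meas {d} {O : measurableType d} (Y : O -> K -> R) h (C : R) p :
  (forall x, measurable_fun setT (fun w => Y w x)) -> suplip h C ->
  measurable_fun setT (fun w => h (fun x => Y w (gproj g p x))).
Proof.
move=> mY hh.
exact: (measurable_lip (Y := fun w (j : gJ g p) => Y w (gof j)) (f := fun v => h (fun x => v (gto g p x))) _ (suplip_lip _ hh) (suplip_ge0 hh)).
Qed.

Lemma nice_cvg {d} {O : measurableType d} (Y : O -> K -> R) h (C : R) : nice Y -> suplip h C ->
  forall w, (fun p => h (fun x => Y w (gproj g p x))) @ \oo --> h (Y w).
Proof.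
move=> [mY bY cY] hh w; apply/cvgrPdist_le => /= e e0.
have C1 : 0 < C + 1 by rewrite ltr_wpDl// (suplip_ge0 hh).
have := cY w (e / (C + 1)); rewrite divr_gt0// => /(_ isT).
apply: filterS => p hp; apply: (le_trans (hh _ _ _ (bY w) (bndC _ (bY w)) hp)).
by rewrite mulrA ler_pdivrMr// mulrC ler_pM2l// lerDl.
Qed.

Lemma measurable_suplip {d} {O : measurableType d} (Y : O -> K -> R) h (C : R) : nice Y -> suplip h C ->
  measurable_fun setT (fun w => h (Y w)).
Proof.
move=> nY hh; have [mY bY cY] := nY.
have mp p : measurable_fun setT (fun w => h (fun x => Y w (gproj g p x))) by exact: (grid_meas p mY hh).
by apply: (measurable_fun_cvg mp) => w _; exact: (nice_cvg nY hh).
Qed.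

(** Grid projections reduce the claim to [lip_law], and bounded convergence removes them. *)
Lemma suplip_law {d d'} {O : measurableType d} {O' : measurableType d'}
    (P : probability O R) (Q : probability O' R) (Y : O -> K -> R) (Z : O' -> K -> R) h (C D : R) :
  nice Y -> nice Z -> charE P Q Y Z -> suplip h C -> (forall f, `|h f| <= D) ->
  Ex P (fun w => h (Y w)) = Ex Q (fun w => h (Z w)).
Proof.
move=> nY nZ E hh hD; have [mY bY cY] := nY; have [mZ bZ cZ] := nZ.
have [_ c1] := Ex_bounded_cvg P (fun p => grid_meas p mY hh) (fun p w => hD _) (nice_cvg nY hh).
have [_ c2] := Ex_bounded_cvg Q (fun p => grid_meas p mZ hh) (fun p w => hD _) (nice_cvg nZ hh).
apply: (cvg_unique _ c1) => //.
rewrite (_ : (fun n => _) = fun p => Ex Q (fun w => h (fun x => Z w (gproj g p x)))) //.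
apply/funext => p.
apply: (lip_law (Y := fun w (j : gJ g p) => Y w (gof j)) (Z := fun w (j : gJ g p) => Z w (gof j)) _ _ _ (suplip_lip (@gto _ g p) hh) (suplip_ge0 hh) (fun v => hD _)) => //.
Qed.

End nice_processes.

(** An ultrafilter yields limits at all points of an uncountable index set simultaneously, where
    extraction of subsequences would handle only countably many. *)
Lemma ultra_lim {R : realType} (U : set_system nat) (u : nat -> R) (B : R) : UltraFilter U ->
  (forall n, `|u n| <= B) -> exists l : R, forall e : R, 0 < e -> U [set n | `|u n - l| <= e].
Proof.
move=> UU uB; have PU : ProperFilter U by exact: ultra_proper.
have := @segment_compact R (- B) B (u @ U) _.
case.
  suff : U [set n | `[- B, B]%classic (u n)] by [].
  by apply: filterS filterT => n _ /=; have := uB n; rewrite ler_norml in_itv.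
move=> l0 [_ cl]; pose l : R := l0; exists l => e e0.
have [//|h] := @in_ultra_setVsetC _ U [set n | `|u n - l| <= e] UU.
exfalso.
have := cl (u @` ~` [set n | `|u n - l| <= e]) (ball l e).
case.
- suff : U [set n | (u @` ~` [set n | `|u n - l| <= e]) (u n)] by [].
  by apply: filterS h => n hn; exists n.
- exact: nbhsx_ballx.
- move=> _ [[n hn <-]] hb; have {}hb : `|l - u n| < e := hb.
  by apply: hn; rewrite /= distrC; exact: ltW.
Qed.

(* Arzela-Ascoli for the equicontinuity modulus given by the finite-range projections. *)
Lemma sup_compact {R : realType} {K : Type} (g : grid_on K) (f : nat -> K -> R) (B : R) (p : nat -> nat) :
  (forall n x, `|f n x| <= B) ->
  (forall j n x, (j <= n)%N -> `|f n x - f n (gproj g (p j) x)| <= j.+1%:R^-1) ->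
  exists L : K -> R, (forall x, `|L x| <= B) /\
    forall i, exists2 n, (i <= n)%N & sup_close (f n) L i.+1%:R^-1.
Proof.
move=> fB fp.
have [U [UU sU]] := @ultraFilterLemma _ (\oo : set_system nat) _.
have PU : ProperFilter U by exact: ultra_proper.
have [L hL] := choice (fun x => ultra_lim UU (fun n => fB n x)).
have ge_in i : U [set n | (i <= n)%N] by apply: sU; exact: nbhs_infty_ge.
have Lp j x : `|L x - L (gproj g (p j) x)| <= j.+1%:R^-1.
  have H (e : R) : 0 < e -> `|L x - L (gproj g (p j) x)| <= j.+1%:R^-1 + e.
    move=> e0; have e2 : 0 < e / 2 by rewrite divr_gt0.
    have [n [[/= h1 h2] h3]] := filter_ex (filterI (filterI (hL x _ e2) (hL (gproj g (p j) x) _ e2)) (ge_in j)).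
    have h4 := fp j n x h3.
    have := ler_distD (f n x) (L x) (L (gproj g (p j) x)).
    have := ler_distD (f n (gproj g (p j) x)) (f n x) (L (gproj g (p j) x)).
    rewrite (distrC (L x) (f n x)); move: (j.+1%:R^-1) h4 => t h4; lra.
  by apply/ler_addgt0Pr => e; exact: H.
exists L; split.
  move=> x; apply/ler_addgt0Pr => e e0.
  have [n /= h] := filter_ex (hL x e e0).
  have := ler_normB (f n x) (f n x - L x); rewrite opprB addrC subrK => /le_trans; apply.
  by rewrite lerD.
(* Three errors are added: the modulus of [f n], that of [L] and the distance on the finite grid.
   Each is at most a third of [i.+1%:R^-1]. *)
move=> i; pose j := (3 * i.+1)%N.
have i0 : 0 < (3 * i.+1%:R)^-1 :> R by rewrite invr_gt0 mulr_gt0.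
have ij : j.+1%:R^-1 <= (3 * i.+1%:R)^-1 :> R.
  by rewrite lef_pV2 ?posrE ?mulr_gt0// -natrM ler_nat.
have hG : U [set n | forall v : gJ g (p j), `|f n (gof v) - L (gof v)| <= (3 * i.+1%:R)^-1].
  by apply: filter_forall => v; exact: hL.
have [n [[/= h1 h2] h3]] := filter_ex (filterI (filterI hG (ge_in i)) (ge_in j)).
exists n => // x.
have a1 := fp j n x h3; have a2 := Lp j x; have a3 := h1 (gto g (p j) x).
rewrite -/(gproj g (p j) x) in a3.
have e3 : (3 * i.+1%:R)^-1 = i.+1%:R^-1 / 3 :> R by rewrite invfM mulrC.
rewrite e3 in a3 ij.
have := ler_distD (f n (gproj g (p j) x)) (f n x) (L x).
have := ler_distD (L (gproj g (p j) x)) (f n (gproj g (p j) x)) (L x).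
rewrite (distrC (L (gproj g (p j) x)) (L x)).
have {}a1 := le_trans a1 ij; have {}a2 := le_trans a2 ij.
move: (i.+1%:R^-1) a1 a2 a3 => t; lra.
Qed.

(** * Extended continuous mapping for statistics that need not be measurable *)

Section continuous_mapping.
Context {R : realType} {K : Type} (g : grid_on K).
Variables (dd : nat -> measure_display) (O : forall k, measurableType (dd k)).
Variables (P : forall k, probability (O k) R) (L : forall k, O k -> K -> R).
Arguments L {k}.
Variables (d : measure_display) (W : measurableType d) (Q : probability W R) (N : W -> K -> R).
Variables (q : (K -> R) -> R) (C : R) (Th : forall k, O k -> R) (K0 : nat).
Arguments Th {k}.
Hypothesis mL : forall k x, measurable_fun setT (fun y : O k => L y x).
Hypothesis bL : forall k (y : O k), bnd (L y).
Hypothesis tL : forall w e : R, 0 < w -> 0 < e -> \forall p \near \oo, \forall k \near \oo,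
  small (P k) [set y : O k | exists x, w < `|L y x - L y (gproj g p x)|] e.
Hypothesis pL : forall x (e : R), 0 < e -> exists B : R, \forall k \near \oo,
  small (P k) [set y : O k | B < `|L y x|] e.
Hypothesis cL : forall (J : finType) (x : J -> K) c th,
  (fun k => Ex (P k) (fun y => cos (th + lin c (fun j => L y (x j))))) @ \oo -->
  Ex Q (fun w => cos (th + lin c (fun j => N w (x j)))).
Hypothesis nN : nice g N.
Hypothesis qs : bseminorm q C.
Hypothesis stat : forall z : nat -> {k & O k}, (forall i, (K0 + i <= tag (z i))%N) -> forall f, bnd f ->
  (forall e : R, 0 < e -> \forall i \near \oo, sup_close (L (tagged (z i))) f e) ->
  (fun i => Th (tagged (z i))) @ \oo --> q f.

Lemma tight_grid p (e : R) : 0 < e -> exists B : R, \forall k \near \oo,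
  tight_at (P k) (fun y (j : gJ g p) => L y (gof j)) B e.
Proof.
move=> e0; pose e' : R := e / (#|gJ g p|%:R + 1).
have n0 : 0 < #|gJ g p|%:R + 1 :> R by rewrite ltr_wpDl.
have e'0 : 0 < e' by rewrite divr_gt0.
have [B hB] := choice (fun j : gJ g p => pL (gof j) e'0).
exists (\sum_j `|B j|).
have : \forall k \near \oo, forall j : gJ g p, small (P k) [set y : O k | B j < `|L y (gof j)|] e'.
  exact: filter_forall.
apply: filterS => k /= h.
have := @small_big R _ _ (P k) _ (index_enum (gJ g p)) (fun j => [set y : O k | B j < `|L y (gof j)|]) (fun=> e') h.
apply: small_sub.
  rewrite -bigcup_seq => y /= [j hj]; exists j => /=; first exact: mem_index_enum.
  apply: le_lt_trans hj; apply: (le_trans (ler_norm _)); rewrite (bigD1 j)//= lerDl; exact: sumr_ge0.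
rewrite sumr_const /e' -[_ *+ _]mulr_natr mulrAC ler_pdivrMr// ler_wpM2l ?(ltW e0)//.
by have : #|gJ g p|%:R <= #|gJ g p|%:R + 1 :> R by rewrite lerDl.
Qed.

Lemma tight_sup (e : R) : 0 < e -> exists2 B : R, 0 <= B & \forall k \near \oo,
  small (P k) [set y : O k | exists x, B < `|L y x|] e.
Proof.
move=> e0; have e2 : 0 < e / 2 by rewrite divr_gt0.
have [p _ /(_ p (leqnn p)) hp] := tL ltr01 e2.
have [B hB] := tight_grid p e2.
exists (`|B| + 1); first by rewrite addr_ge0.
near=> k.
have h1 : small (P k) [set y : O k | exists x, 1 < `|L y x - L y (gproj g p x)|] (e / 2) by near: k; exact: hp.
have h2 : tight_at (P k) (fun y (j : gJ g p) => L y (gof j)) B (e / 2) by near: k; exact: hB.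
have := smallU h1 h2; rewrite -splitr; apply: small_sub => // y [x hx].
have [h|h] := ltP 1 (`|L y x - L y (gproj g p x)|); first by left; exists x.
right; exists (gto g p x); rewrite -/(gproj g p x).
have := ler_normD (L y x - L y (gproj g p x)) (L y (gproj g p x)); rewrite subrK => h'.
have := ler_norm B; lra.
Unshelve. all: by end_near. Qed.

(** Extended continuous mapping theorem, by contradiction. Outside a set of probability [e] the
    paths obey one bound and, up to depth [M], one sequence of grid moduli. If the claim failed at
    every depth, the offending sample points would have a uniformly convergent subsequence by
    [sup_compact], along which [Th] tends to [q] of the limit. One depth [M] suffices, so only
    finitely many events are excluded and this works for all large [k]. *)
Lemma linearization (e : R) p0 : 0 < e -> exists2 p, (p0 <= p)%N &
  \forall k \near \oo, small (P k) [set y : O k | e < `|Th y - q (fun x => L y (gproj g p x))|] e.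
Proof.
move=> e0.
(* Geometric weights: half of [e] is shared among the moduli, the other half is kept for the
   bound. *)
have ej j : 0 < e / 2 / 2 ^+ j.+1 by rewrite !divr_gt0// exprn_gt0.
have wj (j : nat) : 0 < j.+1%:R^-1 :> R by rewrite invr_gt0.
have pj j : exists p, (p0 <= p)%N /\ \forall k \near \oo,
    small (P k) [set y : O k | exists x, j.+1%:R^-1 < `|L y x - L y (gproj g p x)|] (e / 2 / 2 ^+ j.+1).
  have [M _ h] := tL (wj j) (ej j).
  exists (maxn p0 M); split; first exact: leq_maxl.
  by apply: h; exact: leq_maxr.
have [p hp] := choice pj.
have e2 : 0 < e / 2 by rewrite divr_gt0.
have [B B0 hB] := tight_sup e2.
pose good M (z : {k & O k}) := (forall x, `|L (tagged z) x| <= B) /\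
  (forall j x, (j <= M)%N -> `|L (tagged z) x - L (tagged z) (gproj g (p j) x)| <= j.+1%:R^-1).
have [M hM] : exists M, forall z, (K0 + M <= tag z)%N -> good M z ->
    `|Th (tagged z) - q (fun x => L (tagged z) (gproj g (p M) x))| <= e.
  apply: contrapT => /forallNP h.
  have [z hz] : exists z : nat -> {k & O k}, forall M, [/\ (K0 + M <= tag (z M))%N, good M (z M) &
      e < `|Th (tagged (z M)) - q (fun x => L (tagged (z M)) (gproj g (p M) x))|].
    suff zM M : exists z, [/\ (K0 + M <= tag z)%N, good M z &
      e < `|Th (tagged z) - q (fun x => L (tagged z) (gproj g (p M) x))|].
      by have [z hz] := choice zM; exists z.
    have := h M => /existsNP [z /not_implyP[h1 /not_implyP[h2 h3]]].
    by exists z; split => //; rewrite ltNge; apply/negP.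
  have fB n x : `|L (tagged (z n)) x| <= B by have [_ [+ _] _] := hz n; exact.
  have fp j n x : (j <= n)%N -> `|L (tagged (z n)) x - L (tagged (z n)) (gproj g (p j) x)| <= j.+1%:R^-1.
    by have [_ [_ +] _] := hz n; exact.
  have [f [bf hf]] := sup_compact fB fp.
  have si i : exists n, (i <= n)%N /\ sup_close (L (tagged (z n))) f i.+1%:R^-1.
    by have [n h1 h2] := hf i; exists n.
  have [s hs] := choice si.
  have bnf : bnd f by exists B.
  have inv0 (a : R) : 0 < a -> \forall i \near \oo, (i.+1%:R^-1 : R) < a.
    by move=> a0; exact: (near_infty_natSinv_lt (PosNum a0)).
  have cv : (fun i => Th (tagged (z (s i)))) @ \oo --> q f.
    apply: (stat (z := fun i => z (s i))) => //.
      by move=> i; have [h1 _ _] := hz (s i); apply: leq_trans h1; rewrite leq_add2l; have [] := hs i.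
    move=> a a0; have := inv0 a a0; apply: filterS => i hi x.
    by have [_ h2] := hs i; apply: (le_trans (h2 x)); exact: ltW.
  have C0 : 0 <= C := suplip_ge0 (bseminorm_lip qs).
  have C1 : 0 < 4 * (C + 1) by rewrite mulr_gt0// ltr_wpDl.
  move/cvgrPdist_lt : cv => /(_ _ e2) hi2; have := inv0 (e / (4 * (C + 1))); rewrite divr_gt0// => /(_ isT) hi1.
  have [i [/= a1 a2]] := filter_ex (filterI hi1 hi2).
  have [_ [b1 b2] b3] := hz (s i); have [c1 c2] := hs i.
  have dist x : `|L (tagged (z (s i))) (gproj g (p (s i)) x) - f x| <= 2 * (e / (4 * (C + 1))).
    have := b2 (s i) x (leqnn _); have := c2 x.
    have sip : (s i).+1%:R^-1 <= i.+1%:R^-1 :> R by rewrite lef_pV2 ?posrE// ler_nat.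
    have := ler_distD (L (tagged (z (s i))) x) (L (tagged (z (s i))) (gproj g (p (s i)) x)) (f x).
    rewrite (distrC (L (tagged (z (s i))) (gproj g (p (s i)) x)) (L (tagged (z (s i))) x)).
    move: a1 sip; move: (e / (4 * (C + 1))) ((s i).+1%:R^-1) (i.+1%:R^-1) => t1 t2 t3; lra.
  have := bseminorm_lip qs (bndC (gproj g (p (s i))) (bL (tagged (z (s i))))) bnf dist.
  have -> : C * (2 * (e / (4 * (C + 1)))) = (C / (C + 1)) * (e / 2) by field; rewrite gt_eqF// ltr_wpDl.
  have : (C / (C + 1)) * (e / 2) <= e / 2 by rewrite ler_piMl ?(ltW e2)// ler_pdivrMr ?ltr_wpDl// mul1r lerDl.
  have := ler_distD (q f) (Th (tagged (z (s i)))) (q (fun x => L (tagged (z (s i))) (gproj g (p (s i)) x))).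
  rewrite (distrC (q f) (q _)) (distrC (q f)) in a2 *.
  lra.
exists (p M); first by have [] := hp M.
near=> k.
have h1 : small (P k) [set y : O k | exists x, B < `|L y x|] (e / 2) by near: k; exact: hB.
have h2 : forall j : 'I_M.+1, small (P k) [set y : O k | exists x, j.+1%:R^-1 < `|L y x - L y (gproj g (p j) x)|] (e / 2 / 2 ^+ j.+1).
  near: k; apply: filter_forall => j.
  by have [] := hp j.
have kM : (K0 + M <= k)%N by near: k; exact: nbhs_infty_ge.
have h3 := small_big (index_enum 'I_M.+1) h2.
have := smallU h1 h3; apply: small_sub.
  move=> y /= hy; apply: contrapT => /not_orP[n1 n2].
  have gz : good M (existT O k y).
    split => /=; first by move=> x; rewrite leNgt; apply/negP => hx; apply: n1; exists x.
    move=> j x jM; rewrite leNgt; apply/negP => hx; apply: n2.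
    by rewrite -bigcup_seq; exists (Ordinal (jM : (j < M.+1)%N)) => /=; [exact: mem_index_enum|exists x].
  by have := hM (existT O k y) kM gz; rewrite /= leNgt hy.
have geo M' : \sum_(j < M') e / 2 / 2 ^+ j.+1 = e / 2 - e / 2 / 2 ^+ M'.
  elim: M' => [|M' IH]; first by rewrite big_ord0 expr0 divr1 subrr.
  by rewrite big_ord_recr/= IH exprS; field; rewrite expf_neq0.
rewrite geo; have := ltW (ej M); move: (_ / _ ^+ _) => t; lra.
Unshelve. all: by end_near. Qed.

(** Half of the portmanteau theorem: [phi] is Lipschitz and at least 1 on the [w]-neighborhood of
    [A]. Passing from [Th] to the linearized statistic costs at most [e / 4], and so do the
    convergence in [k] at a fixed grid and the removal of the grid. *)
Lemma stat_bound (phi : R -> R) (c D w e : R) (A : set R) : 0 <= c ->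
  (forall x y, `|phi x - phi y| <= c * `|x - y|) -> (forall x, 0 <= phi x <= D) ->
  0 < w -> (forall x y, A x -> `|x - y| <= w -> 1 <= phi y) -> 0 < e ->
  \forall k \near \oo, small (P k) [set y : O k | A (Th y)] (Ex Q (fun v => phi (q (N v))) + e).
Proof.
move=> c0 phic phiD w0 Aphi e0.
have hl := suplip_comp c0 phic (bseminorm_lip qs).
have hD f : `|phi (q f)| <= D by have /andP[a b] := phiD (q f); rewrite ger0_norm.
have e4 : 0 < Num.min w (e / 4) by rewrite lt_min w0 divr_gt0.
have [mN bN aN] := nN.
have [_ cN] := @Ex_bounded_cvg _ _ _ Q (fun p v => phi (q (fun x => N v (gproj g p x)))) (fun v => phi (q (N v))) D
  (fun p => grid_meas g p mN hl) (fun p v => hD _) (nice_cvg nN hl).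
have e40 : 0 < e / 4 by rewrite divr_gt0.
move/cvgrPdist_le : cN => /(_ _ e40)[p0 _ hp0].
have [p pp0 hp] := linearization p0 e4.
have lp := suplip_lip (@gto _ g p) hl.
have tY a : 0 < a -> exists B : R, \forall k \near \oo, tight_at (P k) (fun y (j : gJ g p) => L y (gof j)) B a.
  exact: tight_grid.
have cv : (fun k => Ex (P k) (fun y => phi (q (fun x => L y (gproj g p x))))) @ \oo -->
    Ex Q (fun v => phi (q (fun x => N v (gproj g p x)))).
  have mLp k (j : gJ g p) : measurable_fun setT (fun y : O k => L y (gof j)) by exact: mL.
  have mNp (j : gJ g p) : measurable_fun setT (fun v => N v (gof j)) by exact: mN.
  have cLp (c' : gJ g p -> R) th : (fun k => Ex (P k) (fun y => cos (th + lin c' (fun j => L y (gof j))))) @ \oo -->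
    Ex Q (fun v => cos (th + lin c' (fun j => N v (gof j)))) by exact: cL.
  exact: (lip_cvg (Y := fun k y (j : gJ g p) => L y (gof j)) (Z := fun v (j : gJ g p) => N v (gof j)) mLp mNp cLp tY lp (suplip_ge0 hl) (fun v => hD _)).
move/cvgrPdist_le : cv => /(_ _ e40) cv.
near=> k.
have h1 : small (P k) [set y : O k | Num.min w (e / 4) < `|Th y - q (fun x => L y (gproj g p x))|] (Num.min w (e / 4)) by near: k; exact: hp.
have h2 : `|Ex Q (fun v => phi (q (fun x => N v (gproj g p x)))) - Ex (P k) (fun y => phi (q (fun x => L y (gproj g p x))))| <= e / 4.
  by near: k; exact: cv.
have h3 : `|Ex Q (fun v => phi (q (N v))) - Ex Q (fun v => phi (q (fun x => N v (gproj g p x))))| <= e / 4.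
  exact: hp0.
have bm : bmeas (fun y : O k => phi (q (fun x => L y (gproj g p x)))).
  split; last by exists D.
  exact: (grid_meas g p (@mL k) hl).
have h4 : small (P k) [set y : O k | 1 <= phi (q (fun x => L y (gproj g p x)))] (Ex (P k) (fun y => phi (q (fun x => L y (gproj g p x))))).
  exists [set y : O k | 1 <= phi (q (fun x => L y (gproj g p x)))]; split => //.
    have [mf _] := bm; have := mf measurableT `[1, +oo[%classic (measurable_itv _).
    by rewrite setTI; congr measurable; apply/seteqP; split => y /=; rewrite in_itv/= andbT.
  have := Ex_markov (P k) bm (fun y => proj1 (andP (phiD _))) ltr01.
  by rewrite divr1.
have := smallU h1 h4; apply: small_sub.
  move=> y /= Ay; have [h|h] := ltP (Num.min w (e / 4)) (`|Th y - q (fun x => L y (gproj g p x))|); first by left.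
  by right; apply: (Aphi _ _ Ay); apply: (le_trans h); rewrite ge_min lexx.
have m4 : Num.min w (e / 4) <= e / 4 by rewrite ge_min lexx orbT.
move: h2 h3 m4; rewrite !ler_norml => /andP[a1 a2] /andP[a3 a4]; lra.
Unshelve. all: by end_near. Qed.

End continuous_mapping.

(** * The two-sample process *)

Section two_samples.
Context {R : realType} {m s : nat}.
Notation I := (xvec R m + xvec R s)%type.

Definition gridI : grid_on I := grid_sum (gridX m) (gridX s).

(* Covariance of the limit of the weighted two-sample empirical process. *)
Definition gam (V : R) (F : xvec R m -> R) (V' : R) (G : xvec R s -> R) (i i' : I) : R :=
  match i, i' with
  | inl x, inl y => V * (F (minv x y) - F x * F y)
  | inr x, inr y => V' * (G (minv x y) - G x * G y)
  | _, _ => 0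
  end.

Lemma small_fst {d1 d2} {T1 : measurableType d1} {T2 : measurableType d2}
    (P1 : probability T1 R) (P2 : probability T2 R) A e :
  small P1 A e -> small (P1 \x P2)%E [set y | A y.1] e.
Proof.
move=> h; apply: (small_preimage (Q := P1) (X := fst)) => // B mB.
rewrite (_ : fst @^-1` B = B `*` setT); last by apply/seteqP; split => -[x y] //= [].
transitivity (P1 B * P2 setT)%E; first exact: product_measure1E.
by rewrite probability_setT mule1.
Qed.

Lemma small_snd {d1 d2} {T1 : measurableType d1} {T2 : measurableType d2}
    (P1 : probability T1 R) (P2 : probability T2 R) A e :
  small P2 A e -> small (P1 \x P2)%E [set y | A y.2] e.
Proof.
move=> h; apply: (small_preimage (Q := P2) (X := snd)) => // B mB.
rewrite (_ : snd @^-1` B = setT `*` B); last by apply/seteqP; split => -[x y] //= [].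
transitivity (P1 setT * P2 B)%E; first exact: product_measure1E.
by rewrite probability_setT mul1e.
Qed.

Variables (n r : nat -> nat) (mu : nat -> nat -> probability (xvec R m) R)
  (nu : nat -> nat -> probability (xvec R s) R) (c c' : nat -> nat -> R)
  (F : xvec R m -> R) (G : xvec R s -> R) (V V' : R).
Hypothesis arr1 : sample_array n mu c F V.
Hypothesis arr2 : sample_array r nu c' G V'.
Hypothesis ucF : unif_cont_xvec F.
Hypothesis ucG : unif_cont_xvec G.

Definition law2 k : probability _ R := (prod_law (mu k) (n k) \x prod_law (nu k) (r k))%E.

Definition proc2 k (y : (n k).-tuple (xvec R m) * (r k).-tuple (xvec R s)) (i : I) : R :=
  match i with
  | inl x => eproc (mu k) (c k) y.1 x
  | inr x => eproc (nu k) (c' k) y.2 x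
  end.

Lemma measurable_proc2 k i : measurable_fun setT (fun y => @proc2 k y i).
Proof.
case: i => x /=.
  apply: (measurableT_comp (f := fun y => eproc (mu k) (c k) y x)) => //.
  exact: measurable_eproc.
apply: (measurableT_comp (f := fun y => eproc (nu k) (c' k) y x)) => //.
exact: measurable_eproc.
Qed.

Lemma eproc_bnd {l} n0 (mu0 : nat -> probability (xvec R l) R) c0 (y : n0.-tuple (xvec R l)) x :
  `|eproc mu0 c0 y x| <= \sum_(i < n0) `|c0 i| * 2.
Proof.
apply: (le_trans (ler_norm_sum _ _ _)); apply: ler_sum => i _; rewrite normrM ler_wpM2l//.
apply: (le_trans (ler_normB _ _)).
have : `|edf mu0 x i| <= 1.
  by apply: Ex_le_bound (bmeas_lev x) _ => w; case: lev; rewrite ?normr0 ?normr1.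
by case: lev; rewrite ?normr0 ?normr1; lra.
Qed.

Lemma bnd_proc2 k y : bnd (@proc2 k y).
Proof.
exists (\sum_(i < n k) `|c k i| * 2 + \sum_(i < r k) `|c' k i| * 2) => -[x|x] /=.
  apply: (le_trans (eproc_bnd _ _ _ _)); rewrite lerDl; apply: sumr_ge0 => i _; exact: mulr_ge0.
apply: (le_trans (eproc_bnd _ _ _ _)); rewrite lerDr; apply: sumr_ge0 => i _; exact: mulr_ge0.
Qed.

Lemma tight_proc2 : forall w e : R, 0 < w -> 0 < e -> \forall p \near \oo, \forall k \near \oo,
  small (law2 k) [set y | exists i, w < `|@proc2 k y i - @proc2 k y (gproj gridI p i)|] e.
Proof.
move=> w e w0 e0; have e2 : 0 < e / 2 by rewrite divr_gt0.
move: (tight_eproc arr1 ucF w0 e2) (tight_eproc arr2 ucG w0 e2); apply: filterS2 => p.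
apply: filterS2 => k h1 h2.
have := smallU (small_fst (prod_law (nu k) (r k)) h1) (small_snd (prod_law (mu k) (n k)) h2).
rewrite -splitr; apply: small_sub => // y [[x|x] hx]; by [left; exists x|right; exists x].
Qed.

Lemma point_tight_eproc {l} (n0 : nat -> nat) (mu0 : nat -> nat -> probability (xvec R l) R) c0 F0 V0 x (e : R) :
  sample_array n0 mu0 c0 F0 V0 -> 0 < e -> exists B : R, \forall k \near \oo,
    small (prod_law (mu0 k) (n0 k)) [set y | B < `|eproc (mu0 k) (c0 k) y x|] e.
Proof.
move=> [_ _ cV _] e0.
have V1 : 0 < `|V0| + 1 by rewrite ltr_wpDl.
pose B : R := Num.sqrt ((`|V0| + 1) / e).
have B0 : 0 < B by rewrite sqrtr_gt0 divr_gt0.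
exists B; near=> k.
have h : \sum_(i < n0 k) c0 k i ^+ 2 < `|V0| + 1.
  by near: k; apply: (cvgr_lt V0 cV); rewrite (le_lt_trans (ler_norm _))// ltrDl.
have := chebyshev_eproc n0 mu0 c0 k x B0; apply: small_sub => //.
rewrite sqr_sqrtr ?divr_ge0 ?(ltW e0) ?(ltW V1)// ler_pdivrMr ?divr_gt0//.
by rewrite mulrCA divff ?gt_eqF// mulr1 ltW.
Unshelve. all: by end_near. Qed.

Lemma point_tight_proc2 i (e : R) : 0 < e -> exists B : R, \forall k \near \oo,
  small (law2 k) [set y | B < `|@proc2 k y i|] e.
Proof.
move=> e0; case: i => x.
  have [B hB] := point_tight_eproc x arr1 e0; exists B; apply: filterS hB => k h.
  exact: (small_fst _ h).
have [B hB] := point_tight_eproc x arr2 e0; exists B; apply: filterS hB => k h.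
exact: (small_snd _ h).
Qed.

(** With the first sample fixed, its contribution is a phase for the second one; hence the need for
    bounds uniform in the phase. *)
Lemma fdd_proc2 (J : finType) (x : J -> I) (a : J -> R) (th : R) :
  (fun k => Ex (law2 k) (fun y => cos (th + lin a (fun j => @proc2 k y (x j))))) @ \oo -->
  expR (- ((\sum_j \sum_l a j * a l * gam V F V' G (x j) (x l)) / 2)) * cos th.
Proof.
(* Indices of the other sample get the filler [topv] together with the coefficient 0. *)
pose x1 j := if x j is inl y then y else topv.
pose x2 j := if x j is inr y then y else topv.
pose a1 j := if x j is inl y then a j else 0.
pose a2 j := if x j is inr y then a j else 0.
pose G1 := \sum_j \sum_l a1 j * a1 l * (F (minv (x1 j) (x1 l)) - F (x1 j) * F (x1 l)).
pose G2 := \sum_j \sum_l a2 j * a2 l * (G (minv (x2 j) (x2 l)) - G (x2 j) * G (x2 l)).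
have GE : \sum_j \sum_l a j * a l * gam V F V' G (x j) (x l) = V * G1 + V' * G2.
  rewrite /G1 /G2 !mulr_sumr -big_split; apply: eq_bigr => j _ /=.
  rewrite !mulr_sumr -big_split; apply: eq_bigr => l _ /=.
  by rewrite /gam /a1 /a2 /x1 /x2; case: (x j) => y; case: (x l) => z; ring.
rewrite GE.
have linE k y : lin a (fun j => @proc2 k y (x j)) =
    lin a1 (fun j => eproc (mu k) (c k) y.1 (x1 j)) + lin a2 (fun j => eproc (nu k) (c' k) y.2 (x2 j)).
  rewrite /lin -big_split; apply: eq_bigr => j _ /=.
  by rewrite /proc2 /a1 /a2 /x1 /x2; case: (x j) => z; ring.
apply/cvgrPdist_le => /= e e0.
have e2 : 0 < e / 2 by rewrite divr_gt0.
pose E1 := expR (- (V * G1 / 2)); pose E2 := expR (- (V' * G2 / 2)).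
have E20 : 0 < E2 by exact: expR_gt0.
have e1 : 0 < e / 2 / E2 by rewrite divr_gt0.
move: (fdd_eproc arr1 x1 a1 e1) (fdd_eproc arr2 x2 a2 e2); apply: filterS2 => k h1 h2.
rewrite -/G1 -/E1 in h1; rewrite -/G2 -/E2 in h2.
pose P1 := prod_law (mu k) (n k); pose P2 := prod_law (nu k) (r k).
pose l1 (y : (n k).-tuple (xvec R m)) : R := lin a1 (fun j => eproc (mu k) (c k) y (x1 j)).
pose l2 (y : (r k).-tuple (xvec R s)) : R := lin a2 (fun j => eproc (nu k) (c' k) y (x2 j)).
have ml1 : measurable_fun setT l1.
  by apply: measurable_sum => j; apply: measurable_funM => //; exact: measurable_eproc.
have ml2 : measurable_fun setT l2.
  by apply: measurable_sum => j; apply: measurable_funM => //; exact: measurable_eproc.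
have bc : bmeas (fun y => cos (th + lin a (fun j => @proc2 k y (x j)))).
  apply: bmeas_cos; apply: measurable_funD => //; apply: measurable_sum => j.
  by apply: measurable_funM => //; exact: measurable_proc2.
have -> : expR (- ((V * G1 + V' * G2) / 2)) = E2 * E1.
  by rewrite /E1 /E2 -expRD; congr expR; ring.
rewrite distrC /law2 (Ex_fubini1 P1 P2 bc).
pose in2 y1 := Ex P2 (fun y2 => cos (th + lin a (fun j => @proc2 k (y1, y2) (x j)))).
have b2 : bmeas in2 by exact: (bmeas_Ex2 P2 bc).
have b1 : bmeas (fun y1 => cos (th + l1 y1)) by apply: bmeas_cos; exact: measurable_funD.
have h2' y1 : `|in2 y1 - E2 * cos (th + l1 y1)| <= e / 2.
  have -> : in2 y1 = Ex P2 (fun y2 => cos ((th + l1 y1) + l2 y2)).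
    by apply: eq_Ex => y2; rewrite linE /= addrA.
  exact: h2.
have h3 := Ex_sub_norm P1 b2 (bmeasZ E2 b1) h2'.
rewrite ExZ// in h3.
have h4 : `|E2 * Ex P1 (fun y1 => cos (th + l1 y1)) - E2 * E1 * cos th| <= e / 2.
  have {}h1 : `|Ex P1 (fun y1 => cos (th + l1 y1)) - E1 * cos th| <= e / 2 / E2 := h1 th.
  rewrite -mulrA -mulrBr normrM (gtr0_norm E20).
  apply: (le_trans (ler_wpM2l (ltW E20) h1)).
  by rewrite mulrCA divff ?gt_eqF// mulr1.
have := ler_distD (E2 * Ex P1 (fun y1 => cos (th + l1 y1))) (Ex P1 in2) (E2 * E1 * cos th).
lra.
Qed.

End two_samples.

(** * Absence of atoms *)

Section hat_functions.
Context {R : realType}.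
Implicit Types x y c : R.

(** Lipschitz approximations of indicators: [hat] decreases to that of the point [c], and [ramp]
    increases to that of the open half-line below [c]. *)
Definition hat (n : nat) c x : R := Num.max 0 (1 - n%:R * `|x - c|).
Definition ramp (n : nat) c x : R := Num.min 1 (n%:R * Num.max 0 (c - x)).

Lemma hat_lip n c x y : `|hat n c x - hat n c y| <= n%:R * `|x - y|.
Proof.
have h : `|n%:R * `|x - c| - n%:R * `|y - c| | <= n%:R * `|x - y|.
  rewrite -mulrBr normrM ger0_norm// ler_wpM2l//.
  by apply: (le_trans (ler_dist_dist _ _)); rewrite opprB addrA subrK.
rewrite /hat; move: (n%:R * `|x - c|) (n%:R * `|y - c|) h => u v h.
apply: le_trans h; rewrite !maxEle.
by case: (leP 0 (1 - u)); case: (leP 0 (1 - v)); rewrite !ler_norml => h1 h2;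
  have := ler_norm (u - v); have := ler_norm (v - u); rewrite (distrC v u); move: (`|u - v|) => t; lra.
Qed.

Lemma ramp_lip n c x y : `|ramp n c x - ramp n c y| <= n%:R * `|x - y|.
Proof.
have h : `|n%:R * Num.max 0 (c - x) - n%:R * Num.max 0 (c - y)| <= n%:R * `|x - y|.
  rewrite -mulrBr normrM ger0_norm// ler_wpM2l// !maxEle.
  by case: (leP 0 (c - x)); case: (leP 0 (c - y)) => h1 h2; rewrite !ler_norml;
  have := ler_norm (x - y); have := ler_norm (y - x); rewrite (distrC y x); move: (`|x - y|) => t; lra.
rewrite /ramp; move: (n%:R * Num.max 0 (c - x)) (n%:R * Num.max 0 (c - y)) h => u v h.
apply: le_trans h; rewrite !minEle.
by case: (leP 1 u); case: (leP 1 v); rewrite !ler_norml => h1 h2;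
  have := ler_norm (u - v); have := ler_norm (v - u); rewrite (distrC v u); move: (`|u - v|) => t; lra.
Qed.

Lemma hat_bound n c x : `|hat n c x| <= 1.
Proof.
have h : 0 <= n%:R * `|x - c| by rewrite mulr_ge0.
rewrite /hat maxEle; case: (leP 0 (1 - n%:R * `|x - c|)) => h'; last by rewrite normr0.
by rewrite ger0_norm//; lra.
Qed.

Lemma ramp_ge0 n c x : 0 <= ramp n c x.
Proof. by rewrite /ramp le_min ler01/= mulr_ge0// le_max lexx. Qed.

Lemma ramp_bound n c x : `|ramp n c x| <= 1.
Proof. by rewrite ger0_norm ?ramp_ge0// /ramp ge_min lexx. Qed.

Lemma hat_cvg c x : (fun n => hat n c x) @ \oo --> ((x == c)%:R : R).
Proof.
have [->|xc] := eqVneq x c.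
  by under eq_fun do rewrite /hat subrr normr0 mulr0 subr0 maxEle ler01; exact: cvg_cst.
have d0 : 0 < `|x - c| by rewrite normr_gt0 subr_eq0.
apply: (@cvg_trans _ ((fun=> 0 : R) @ \oo)); last exact: cvg_cst.
apply: near_eq_cvg; near=> n.
have h1 : 1 <= n%:R * `|x - c|.
  by rewrite -ler_pdivrMr// div1r; near: n; exact: nbhs_infty_ger.
rewrite /hat maxEle; case: leP => // h.
by apply/eqP; rewrite eq_le; apply/andP; split; lra.
Unshelve. all: by end_near. Qed.

Lemma ramp_cvg c x : (fun n => ramp n c x) @ \oo --> ((x < c)%R%:R : R).
Proof.
have [xc|xc] := ltP x c; last first.
  under eq_fun do rewrite /ramp; have -> : Num.max 0 (c - x) = 0 by apply/max_idPl; rewrite subr_le0.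
  by under eq_fun do rewrite mulr0 minEle ler10; exact: cvg_cst.
have d0 : 0 < c - x by rewrite subr_gt0.
apply: (@cvg_trans _ ((fun=> 1 : R) @ \oo)); last exact: cvg_cst.
apply: near_eq_cvg; near=> n; rewrite /ramp; have -> : Num.max 0 (c - x) = c - x by apply/max_idPr; exact: ltW.
apply/esym/min_idPl; rewrite -ler_pdivrMr// div1r.
by near: n; exact: nbhs_infty_ger.
Unshelve. all: by end_near. Qed.

End hat_functions.

Section pair_law.
Context {R : realType} {K : Type} (g : grid_on K).
Context {d d'} {O : measurableType d} {O' : measurableType d'}.
Variables (P : probability O R) (P' : probability O' R) (Y : O -> K -> R) (Z : O' -> K -> R).
Hypotheses (nY : nice g Y) (nZ : nice g Z) (E : charE P P' Y Z).

(** Products of [hat] and [ramp] converge pointwise to the indicator, which gives both its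
    measurability and the equality of the probabilities. *)
Lemma bmeas_event (h1 h2 : (K -> R) -> R) (C1 C2 c c' : R) : suplip h1 C1 -> suplip h2 C2 ->
  bmeas (fun w => ((h1 (Y w) == c) && (h2 (Y w) < c'))%:R : R) /\
  Ex P (fun w => ((h1 (Y w) == c) && (h2 (Y w) < c'))%:R) =
  Ex P' (fun w => ((h1 (Z w) == c) && (h2 (Z w) < c'))%:R).
Proof.
move=> s1 s2; pose Fn n f := hat n c (h1 f) * ramp n c' (h2 f).
have l1 (n : nat) : suplip (fun f => hat n c (h1 f)) (n%:R * C1) by apply: suplip_comp => // x y; exact: hat_lip.
have l2 (n : nat) : suplip (fun f => ramp n c' (h2 f)) (n%:R * C2) by apply: suplip_comp => // x y; exact: ramp_lip.
have lF n := suplipM ler01 ler01 (l1 n) (l2 n) (fun f => hat_bound n c _) (fun f => ramp_bound n c' _).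
have Fb n f : `|Fn n f| <= 1 by rewrite normrM -[leRHS]mulr1 ler_pM ?hat_bound ?ramp_bound.
have Fc f : (fun n => Fn n f) @ \oo --> (((h1 f == c) && (h2 f < c'))%:R : R).
  by rewrite natr_and; apply: cvgM; [exact: hat_cvg|exact: ramp_cvg].
have [b1 c1] := Ex_bounded_cvg P (fun n => measurable_suplip nY (lF n)) (fun n w => Fb n _) (fun w => Fc (Y w)).
have [b2 c2] := Ex_bounded_cvg P' (fun n => measurable_suplip nZ (lF n)) (fun n w => Fb n _) (fun w => Fc (Z w)).
split => //; apply: (cvg_unique _ c1) => //.
rewrite (_ : (fun n => _) = fun n => Ex P' (fun w => Fn n (Z w))) //.
by apply/funext => n; apply: (suplip_law nY nZ E (lF n)) => f; exact: Fb.
Qed.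

End pair_law.

Section rotations.
Context {R : realType} {K : Type} (g : grid_on K) {d} {W : measurableType d} (Q : probability W R).
Variables (N : W -> K -> R) (Gam : K -> K -> R) (q : (K -> R) -> R) (C : R).
Hypothesis nN : nice g N.
Hypothesis charN : forall (J : finType) (x : J -> K) c th,
  Ex Q (fun w => cos (th + lin c (fun j => N w (x j)))) =
  expR (- ((\sum_j \sum_l c j * c l * Gam (x j) (x l)) / 2)) * cos th.
Hypothesis qs : bseminorm q C.

(** Rotation of two independent copies. The pair is a single process on [K + K], so that the results
    for one process apply to it. *)
Definition rot (al be : R) (w : W * W) (x : K + K) : R :=
  match x with
  | inl x => al * N w.1 x + be * N w.2 x
  | inr x => - be * N w.1 x + al * N w.2 x
  end.

Lemma nice_rot al be : nice (grid_sum g g) (rot al be).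
Proof.
have aux (u v a b c e : R) : u <= a -> v <= e -> 0 <= b -> 0 <= c -> u + v <= a + b + (c + e) by lra.
have aux2 (u v a b c e : R) : u <= c -> v <= b -> 0 <= a -> 0 <= e -> u + v <= a + b + (c + e) by lra.
have [mN bN aN] := nN.
have m1 x : measurable_fun setT (fun w : W * W => N w.1 x) by exact: (measurableT_comp (mN x)).
have m2 x : measurable_fun setT (fun w : W * W => N w.2 x) by exact: (measurableT_comp (mN x)).
split.
- by case=> x /=; apply: measurable_funD; apply: measurable_funM.
- move=> w; have [B1 h1] := bN w.1; have [B2 h2] := bN w.2.
  have B10 (x : K) : 0 <= B1 by apply: le_trans (h1 x).
  have B20 (x : K) : 0 <= B2 by apply: le_trans (h2 x).
  exists ((`|al| + `|be|) * (B1 + B2)) => -[x|x] /=; apply: (le_trans (ler_normD _ _)).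
    rewrite !normrM mulrDl !mulrDr.
    apply: aux; [exact: ler_wpM2l|exact: ler_wpM2l|exact: (mulr_ge0 _ (B20 x))|exact: (mulr_ge0 _ (B10 x))].
  rewrite !normrM normrN mulrDl !mulrDr.
  apply: aux2; [exact: ler_wpM2l|exact: ler_wpM2l|exact: (mulr_ge0 _ (B10 x))|exact: (mulr_ge0 _ (B20 x))].
move=> w e e0; pose e' := e / (`|al| + `|be| + 1).
have D0 : 0 < `|al| + `|be| + 1 by rewrite ltr_wpDl// addr_ge0.
have e'0 : 0 < e' by rewrite divr_gt0.
have eE : (`|al| + `|be|) * e' <= e.
  by rewrite /e' mulrA ler_pdivrMr// mulrC ler_wpM2l ?(ltW e0)// lerDl.
move: (aN w.1 e' e'0) (aN w.2 e' e'0); apply: filterS2 => p h1 h2 [x|x] /=.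
  rewrite (_ : _ - _ = al * (N w.1 x - N w.1 (gproj g p x)) + be * (N w.2 x - N w.2 (gproj g p x))); last by rewrite /gproj; ring.
  apply: (le_trans (ler_normD _ _)); apply: le_trans eE; rewrite !normrM mulrDl.
  by rewrite lerD// ler_wpM2l.
rewrite (_ : _ - _ = - be * (N w.1 x - N w.1 (gproj g p x)) + al * (N w.2 x - N w.2 (gproj g p x))); last by rewrite /gproj; ring.
apply: (le_trans (ler_normD _ _)); apply: le_trans eE; rewrite !normrM normrN mulrDl addrC.
by rewrite lerD// ler_wpM2l.
Qed.

Lemma char_rot al be (J : finType) (x : J -> K + K) (c : J -> R) th : al ^+ 2 + be ^+ 2 = 1 ->
  Ex (Q \x Q)%E (fun w => cos (th + lin c (fun j => rot al be w (x j)))) =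
  expR (- ((\sum_j \sum_l c j * c l * (match x j, x l with inl y, inl z => Gam y z | inr y, inr z => Gam y z | _, _ => 0 end)) / 2)) * cos th.
Proof.
move=> ab; have [mN _ _] := nN.
pose y j := match x j with inl y => y | inr y => y end.
pose c1 j := match x j with inl _ => al * c j | inr _ => - be * c j end.
pose c2 j := match x j with inl _ => be * c j | inr _ => al * c j end.
have linE w : lin c (fun j => rot al be w (x j)) = lin c1 (fun j => N w.1 (y j)) + lin c2 (fun j => N w.2 (y j)).
  rewrite /lin -big_split; apply: eq_bigr => j _ /=.
  by rewrite /rot /c1 /c2 /y; case: (x j) => z; ring.
have bc : bmeas (fun w => cos (th + lin c (fun j => rot al be w (x j)))).
  apply: bmeas_cos; apply: measurable_funD => //; apply: measurable_sum => j.
  by apply: measurable_funM => //; have [+ _ _] := nice_rot al be; exact.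
rewrite (Ex_fubini1 Q Q bc).
have b1 : bmeas (fun w => cos (th + lin c1 (fun j => N w (y j)))).
  apply: bmeas_cos; apply: measurable_funD => //; apply: measurable_sum => j.
  exact: measurable_funM.
rewrite (@eq_Ex _ _ _ _ _ (fun w => expR (- ((\sum_j \sum_l c2 j * c2 l * Gam (y j) (y l)) / 2)) * cos (th + lin c1 (fun j => N w (y j))))); last first.
  by move=> w1; rewrite -charN; apply: eq_Ex => w2; rewrite linE /= addrA.
rewrite ExZ// charN mulrA -expRD; congr (expR _ * _).
rewrite -opprD -mulrDl -big_split; congr (- (_ / _)); apply: eq_bigr => j _ /=.
rewrite -big_split; apply: eq_bigr => l _ /=.
have bb : be ^+ 2 = 1 - al ^+ 2 by rewrite -ab; ring.
rewrite /c1 /c2 /y; case: (x j) => z; case: (x l) => z'.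
- transitivity ((al ^+ 2 + be ^+ 2) * (c j * c l * Gam z z')); [ring|by rewrite ab mul1r].
- ring.
- ring.
- transitivity ((al ^+ 2 + be ^+ 2) * (c j * c l * Gam z z')); [ring|by rewrite ab mul1r].
Qed.

Lemma charE_rot al be al' be' : al ^+ 2 + be ^+ 2 = 1 -> al' ^+ 2 + be' ^+ 2 = 1 ->
  charE (Q \x Q)%E (Q \x Q)%E (rot al be) (rot al' be').
Proof. by move=> h h' J x c th; rewrite !char_rot. Qed.

Lemma disjoint_null {d'} {O : measurableType d'} (P : probability O R) (E : nat -> O -> bool) (p : R) :
  (forall i, bmeas (fun w => (E i w)%:R : R)) -> (forall i, Ex P (fun w => (E i w)%:R) = p) ->
  (forall i j w, (i < j)%N -> E i w -> E j w -> False) -> p <= 0.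
Proof.
move=> mE Ep dE; rewrite leNgt; apply/negP => p0.
have le1 n w : \sum_(i < n) (E i w)%:R <= 1 :> R.
  have [[i Ei]|/forallNP h] := pselect (exists i : 'I_n, E i w); last first.
    by rewrite big1// => i _; have /negP/negbTE -> := h i.
  rewrite (bigD1 i)//= Ei big1 ?addr0// => j ji.
  have [ij|ij|ij] := ltngtP i j; last by move: ji; rewrite (val_inj ij) eqxx.
    by case: (boolP (E j w)) => // Ej; case: (dE _ _ _ ij Ei Ej).
  by case: (boolP (E j w)) => // Ej; case: (dE _ _ _ ij Ej Ei).
pose n := (Num.bound (p^-1)).
have h : n%:R * p <= 1.
  have := le_Ex P (bmeas_sum (index_enum 'I_n) predT (fun i => mE i)) (bmeas_cst 1) (fun w => le1 n w).
  rewrite Ex_cst Ex_sum; last by move=> i; exact: mE.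
  rewrite (eq_bigr (fun=> p)) => [|i _]; last exact: Ep.
  by rewrite (_ : \sum_(i | predT i) p = \sum_(i < n) p)// sumr_const card_ord mulr_natl.
have : p^-1 < n%:R by apply: archi_boundP; rewrite invr_ge0 ltW.
by rewrite -[X in X < _]mul1r ltr_pdivrMr// ltNge h.
Qed.

(** Infinitely many decreasing angles in []0, 1/2]], so that the differences satisfy
    [0 < sin <= cos <= 1]. *)
Definition ang (i : nat) : R := (i.+2%:R)^-1.

Lemma ang_diff i j : (i < j)%N ->
  [/\ 0 < sin (ang i - ang j), sin (ang i - ang j) <= cos (ang i - ang j) & cos (ang i - ang j) <= 1].
Proof.
move=> ij; set f := _ - _.
have ji : ang j < ang i by rewrite /ang ltf_pV2 ?posrE// ltr_nat.
have f0 : 0 < f by rewrite subr_gt0.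
have f1 : f <= 1 / 2.
  rewrite /f lerBlDr; apply: (@le_trans _ _ (ang 0 + 0)).
    by rewrite addr0 /ang lef_pV2 ?posrE// ler_nat.
  by rewrite /ang lerD// ?div1r// invr_ge0.
have s0 : 0 < sin f.
  by apply: sin_gt0_pi; rewrite f0/=; apply: (le_lt_trans f1); have := @pi_ge2 R; lra.
have cf : cos f <= 1 by apply: le_trans (cos_bound f); exact: ler_norm.
split => //.
have h1 := sin_lip f; have h2 := cos_sub1 f.
rewrite (gtr0_norm f0) in h1; rewrite ler_norml in h2; case/andP: h2 => h2 _.
have : sin f <= f by apply: le_trans (ler_norm _) h1.
have : f ^+ 2 <= 1 / 2 * f by rewrite expr2 ler_wpM2r// ltW.
lra.
Qed.

Lemma rot_shift (i j : nat) w x : let fi := ang i - ang j in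
  rot (cos (ang j)) (sin (ang j)) w (inl x) =
  cos fi * rot (cos (ang i)) (sin (ang i)) w (inl x) - sin fi * rot (cos (ang i)) (sin (ang i)) w (inr x).
Proof.
move=> fi; have -> : ang j = ang i - fi by rewrite /fi opprB addrC subrK.
rewrite /= cosB sinB; ring.
Qed.

Let bl al be w : bnd (fun x => rot al be w (inl x)).
Proof. by have [_ b _] := nice_rot al be; have [B hB] := b w; exists B. Qed.
Let br al be w : bnd (fun x => rot al be w (inr x)).
Proof. by have [_ b _] := nice_rot al be; have [B hB] := b w; exists B. Qed.

Let qL (f : K + K -> R) := q (fun x => f (inl x)).
Let qB (f : K + K -> R) := q (fun x => f (inl x) - f (inr x)).
Let qN (f : K + K -> R) := - q (fun x => f (inr x)).

Let lL : suplip qL (C * 1).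
Proof.
apply: (suplip_precomp (u := fun (f : K + K -> R) x => f (inl x)) (bseminorm_lip qs) ler01).
  by move=> f [B hB]; exists B.
by move=> f f' B h x; rewrite mul1r.
Qed.

Let lB : suplip qB (C * 2).
Proof.
apply: (suplip_precomp (u := fun (f : K + K -> R) x => f (inl x) - f (inr x)) (bseminorm_lip qs)) => //.
  by move=> f [B hB]; apply: bndB; exists B.
move=> f f' B h x; rewrite (_ : _ - _ = (f (inl x) - f' (inl x)) - (f (inr x) - f' (inr x))); last by ring.
by apply: (le_trans (ler_normB _ _)); have := h (inl x); have := h (inr x); lra.
Qed.

Let lN : suplip qN (C * 1).
Proof.
have h : suplip (fun f : K + K -> R => q (fun x => f (inr x))) (C * 1).
  apply: (suplip_precomp (u := fun (f : K + K -> R) x => f (inr x)) (bseminorm_lip qs) ler01).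
    by move=> f [B hB]; exists B.
  by move=> f f' B h x; rewrite mul1r.
by move=> f f' B bf bf' ff'; rewrite /qN -opprD normrN; exact: h.
Qed.

Lemma unit_ang i : cos (ang i) ^+ 2 + sin (ang i) ^+ 2 = 1.
Proof. exact: cos2Dsin2. Qed.

Lemma unit10 : (1 : R) ^+ 2 + 0 ^+ 2 = 1.
Proof. by rewrite expr1n expr0n addr0. Qed.

(* The events at the angles [ang k] are disjoint, and equiprobable by rotation
   invariance. *)
Lemma rot_null (h1 h2 : (K + K -> R) -> R) (C1 C2 c c' : R) : suplip h1 C1 -> suplip h2 C2 ->
  (forall i j w, (i < j)%N -> let Y k := rot (cos (ang k)) (sin (ang k)) w in
     h1 (Y i) = c -> h2 (Y i) < c' -> h1 (Y j) = c -> False) ->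
  Ex (Q \x Q)%E (fun w => ((h1 (rot 1 0 w) == c) && (h2 (rot 1 0 w) < c'))%:R) = 0.
Proof.
move=> s1 s2 dis; apply/eqP; rewrite eq_le; apply/andP; split; last first.
  by apply: Ex_ge0 => w; exact: ler0n.
pose E i w := (h1 (rot (cos (ang i)) (sin (ang i)) w) == c) && (h2 (rot (cos (ang i)) (sin (ang i)) w) < c').
have H i := @bmeas_event R _ _ _ _ _ _ (Q \x Q)%E (Q \x Q)%E _ _ (nice_rot (cos (ang i)) (sin (ang i))) (nice_rot 1 0) (charE_rot (unit_ang i) unit10) h1 h2 C1 C2 c c' s1 s2.
apply: (@disjoint_null _ _ (Q \x Q)%E E).
- by move=> i; have [] := H i.
- by move=> i; have [_] := H i.
move=> i j w ij /andP[/eqP a1 a2] /andP[/eqP b1 _].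
exact: (dis i j w ij).
Qed.

(** Let [L] and [R] be the two components at one angle. The first component at an angle of larger
    index is [(cos - sin) L + sin (L - R)], with the cosine and sine of the difference. If [q L = c]
    and [q (L - R) < c], the triangle inequality makes its seminorm less than [cos * c <= c], so the
    events are disjoint. *)
Lemma rot_close (c : R) : 0 < c ->
  Ex (Q \x Q)%E (fun w => ((q (N w.1) == c) && (q (fun x => N w.1 x - N w.2 x) < c))%:R) = 0.
Proof.
move=> c0.
have := @rot_null qL qB _ _ c c lL lB; set lhs := Ex _ _ => h.
rewrite -[RHS]h.
  apply: eq_Ex => w.
  have -> : qL (rot 1 0 w) = q (N w.1) by congr q; apply/funext => x /=; ring.
  by have -> : qB (rot 1 0 w) = q (fun x => N w.1 x - N w.2 x) by congr q; apply/funext => x /=; ring.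
move=> i j w ij Y h1 h2 h3.
have [s0 sc c1] := ang_diff ij.
move: h3; rewrite /qL (_ : (fun x => _) = fun x => (cos (ang i - ang j) - sin (ang i - ang j)) * Y i (inl x) + sin (ang i - ang j) * (Y i (inl x) - Y i (inr x))); last first.
  by apply/funext => x; rewrite /Y (rot_shift i j); ring.
move: s0 sc c1; set sn := sin _; set cs := cos (_ - _) => s0 sc c1 h3.
have := bsD qs (bndZ (cs - sn) (bl (cos (ang i)) (sin (ang i)) w)) (bndZ sn (bndB (bl (cos (ang i)) (sin (ang i)) w) (br (cos (ang i)) (sin (ang i)) w))).
rewrite h3 !(bsZ qs); [|exact: bndB|exact: bl].
rewrite (gtr0_norm s0) ger0_norm ?subr_ge0//.
rewrite -/(qB (Y i)) -/(qL (Y i)) h1 => h4.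
have : sn * qB (Y i) < sn * c by rewrite ltr_pM2l.
have : cs * c <= c by rewrite ler_piMl// ltW.
lra.
Qed.

(** Here [sin R] is a combination of the first components at two angles; if both have seminorm 0, so
    does [R], and the events are disjoint. The condition [0 < q R] is written [- q R < 0] to fit the
    form required by [rot_null]. *)
Lemma rot_zero :
  Ex (Q \x Q)%E (fun w => ((q (N w.1) == 0) && (0 < q (N w.2)))%:R) = 0.
Proof.
have := @rot_null qL qN _ _ 0 0 lL lN; set lhs := Ex _ _ => h.
rewrite -[RHS]h.
  apply: eq_Ex => w.
  have -> : qL (rot 1 0 w) = q (N w.1) by congr q; apply/funext => x /=; ring.
  by rewrite /qN oppr_lt0 (_ : (fun x => rot 1 0 w (inr x)) = N w.2)//; apply/funext => x /=; ring.
move=> i j w ij Y h1 h2 h3.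
have [s0 sc c1] := ang_diff ij; move: h2; rewrite /qN oppr_lt0 => h2.
move: s0 sc c1; set sn := sin _; set cs := cos (_ - _) => s0 sc c1.
have : sn * q (fun x => Y i (inr x)) <= 0.
  rewrite -[sn in X in X <= _](gtr0_norm s0) -(bsZ qs); last exact: br.
  rewrite (_ : (fun x => _) = fun x => cs * Y i (inl x) + -1 * Y j (inl x)); last first.
    by apply/funext => x; rewrite /Y (rot_shift i j) -/sn -/cs; ring.
  have := bsD qs (bndZ cs (bl (cos (ang i)) (sin (ang i)) w)) (bndZ (-1) (bl (cos (ang j)) (sin (ang j)) w)) => /le_trans; apply.
  rewrite !(bsZ qs); [|exact: bl|exact: bl].
  by rewrite -/(qL (Y i)) -/(qL (Y j)) h1 h3 !mulr0 addr0.
by rewrite leNgt mulr_gt0.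
Qed.

Lemma measurable_q : measurable_fun setT (fun w => q (N w)).
Proof. exact: (measurable_suplip nN (bseminorm_lip qs)). Qed.

Lemma Ex_square (A : W -> bool) : measurable [set w | A w] ->
  Ex (Q \x Q)%E (fun w => (A w.1 && A w.2)%:R) = Ex Q (fun w => (A w)%:R) ^+ 2.
Proof.
move=> mA.
have bA : bmeas (fun w => (A w)%:R : R) by exact: bmeas_ind.
have b1 : bmeas (fun w : W * W => (A w.1)%:R : R) by exact: (bmeas_comp bA measurable_fst).
have b2 : bmeas (fun w : W * W => (A w.2)%:R : R) by exact: (bmeas_comp bA measurable_snd).
under eq_Ex do rewrite natr_and.
rewrite Ex_fubini1; last exact: bmeasM.
rewrite (@eq_Ex _ _ _ _ _ (fun w => (A w)%:R * Ex Q (fun w => (A w)%:R))); last by move=> w /=; rewrite ExZ.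
by rewrite ExZr// expr2.
Qed.

Lemma measurable_eqset (f : W -> R) (c : R) : measurable_fun setT f -> measurable [set w | f w == c].
Proof.
move=> mf; have := mf measurableT [set c] (measurable_set1 c); rewrite setTI.
by congr measurable; apply/seteqP; split => w /= /eqP.
Qed.

Lemma measurable_ltset (f : W -> R) (c : R) : measurable_fun setT f -> measurable [set w | (f w < c)%R].
Proof.
move=> mf; have := mf measurableT `]-oo, c[%classic (measurable_itv _); rewrite setTI.
by congr measurable; apply/seteqP; split => w /=; rewrite in_itv.
Qed.

(* Two independent copies of [N] are close with positive probability, hence
   [rot_close] leaves no room for an atom. *)
Lemma no_atom (c : R) : 0 < c -> Q [set w | q (N w) == c] = 0%E.
Proof.
move=> c0; have [mN bN aN] := nN.
have C0 : 0 <= C := suplip_ge0 (bseminorm_lip qs).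
(* Ensures [C * e <= c / 4]; the difference of two paths in a common set [A p z] then has seminorm
   less than [c / 3 + c / 4 + c / 3 < c]. *)
pose e := c / (4 * (C + 1)).
have D0 : 0 < 4 * (C + 1) by rewrite mulr_gt0// ltr_wpDl.
have e0 : 0 < e by rewrite divr_gt0.
have Ce : C * e <= c / 4.
  rewrite /e (_ : _ * _ = (C / (C + 1)) * (c / 4)); last by field; rewrite gt_eqF// ltr_wpDl.
  by rewrite ler_piMl ?divr_ge0 ?(ltW c0)// ler_pdivrMr ?ltr_wpDl// mul1r lerDl.
have C4 : c / 4 < c by rewrite ltr_pdivrMr// ltr_pMr// ltr1n.
pose D p w := q (fun x => N w x - N w (gproj g p x)).
have mD p : measurable_fun setT (D p).
  have hl : suplip (fun f => q (fun x => f x - f (gproj g p x))) (C * 2).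
    apply: (suplip_precomp (u := fun f x => f x - f (gproj g p x)) (bseminorm_lip qs)) => //.
      by move=> f bf; exact: (bndB bf (bndC (gproj g p) bf)).
    move=> f f' B h x; rewrite (_ : _ - _ = (f x - f' x) - (f (gproj g p x) - f' (gproj g p x))); last by ring.
    by apply: (le_trans (ler_normB _ _)); have := h x; have := h (gproj g p x); lra.
  exact: (measurable_suplip nN hl).
(* The level set is covered by countably many such sets: [p] is a grid fine enough for the path, [z]
   a rational approximation of its grid values. By independence, the square of the probability of
   [A p z] is bounded by the probability in [rot_close]. *)
pose A p (z : {ffun gJ g p -> rat}) w := [&& q (N w) == c, D p w < c / 3 &
  [forall j, `|N w (gof j) - ratr (z j)| < e / 2]].
have mA p z : measurable [set w | A p z w].
  rewrite (_ : [set w | A p z w] = [set w | q (N w) == c] `&` ([set w | (D p w < c / 3)%R] `&`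
    \big[setI/setT]_(j : gJ g p) [set w | (`|N w (gof j) - ratr (z j)| < e / 2)%R])).
    apply: measurableI; first exact: (measurable_eqset _ measurable_q).
    apply: measurableI; first exact: (measurable_ltset _ (mD p)).
    apply: bigsetI_measurable => j _; apply: measurable_ltset.
    by apply: measurableT_comp => //; apply: measurable_funB.
  rewrite -bigcap_seq; apply/seteqP; split => w /=.
    by move=> /and3P[h1 h2 /forallP h3]; split => //; split => // j _; exact: h3.
  by move=> [h1 [h2 h3]]; apply/and3P; split => //; apply/forallP => j; apply: h3; rewrite /= mem_index_enum.
have A0 p z : Q [set w | A p z w] = 0%E.
  rewrite -Ex_ind//; congr EFin; apply/eqP; rewrite -[_ == 0](@expf_eq0 _ _ 2) -Ex_square// eq_le; apply/andP; split; last first.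
    by apply: Ex_ge0 => w; exact: ler0n.
  rewrite -(rot_close c0); apply: le_Ex.
  - apply: bmeas_ind; rewrite (_ : [set w | _] = [set w | A p z w] `*` [set w | A p z w]); first exact: measurableX.
    by apply/seteqP; split => -[w w'] /=; [move/andP|move=> [? ?]; apply/andP].
  - have s1 := lL; have := @bmeas_event R _ _ _ _ _ _ (Q \x Q)%E (Q \x Q)%E _ _ (nice_rot 1 0) (nice_rot 1 0) (charE_rot unit10 unit10) qL qB _ _ c c lL lB => -[+ _].
    congr bmeas; apply/funext => w.
    have -> : qL (rot 1 0 w) = q (N w.1) by congr q; apply/funext => x /=; ring.
    by have -> : qB (rot 1 0 w) = q (fun x => N w.1 x - N w.2 x) by congr q; apply/funext => x /=; ring.
  move=> [w w'] /=; case: (boolP (A p z w)) => //= /and3P[a1 a2 /forallP a3].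
  case: (boolP (A p z w')) => //= /and3P[b1 b2 /forallP b3]; rewrite a1/=.
  rewrite (_ : (_ < c) = true)//.
  have dist x : `|N w (gproj g p x) - N w' (gproj g p x)| <= e.
    have := a3 (gto g p x); have := b3 (gto g p x); rewrite /gproj.
    have := ler_distD (ratr (z (gto g p x))) (N w (gof (gto g p x))) (N w' (gof (gto g p x))).
    rewrite (distrC (ratr _) (N w' _)); lra.
  have h1 := bsD qs (bndB (bN w) (bndC (gproj g p) (bN w))) (bndB (bndC (gproj g p) (bN w)) (bN w')).
  have h2 := bsD qs (bndB (bndC (gproj g p) (bN w)) (bndC (gproj g p) (bN w'))) (bndZ (-1) (bndB (bN w') (bndC (gproj g p) (bN w')))).
  have h3 := bs_le qs dist.
  rewrite (bsZ qs) ?normrN1 ?mul1r in h2; last exact: (bndB (bN w') (bndC (gproj g p) (bN w'))).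
  have e1 : (fun x => N w x - N w (gproj g p x) + (N w (gproj g p x) - N w' x)) = fun x => N w x - N w' x.
    by apply/funext => x; ring.
  have e2 : (fun x => N w (gproj g p x) - N w' (gproj g p x) + -1 * (N w' x - N w' (gproj g p x))) = fun x => N w (gproj g p x) - N w' x.
    by apply/funext => x; ring.
  rewrite e1 in h1; rewrite e2 in h2.
  by move: a2 b2; rewrite /D; lra.
pose S (k : nat) : set W := if (choice.unpickle k : option (nat * nat)%type) is Some (p, i) then
  (if (choice.unpickle i : option {ffun gJ g p -> rat}) is Some z then [set w | A p z w] else set0) else set0.
have nS : Q.-negligible (\bigcup_k S k).
  apply: negligible_bigcup => k; rewrite /S; case: choice.unpickle => [[p i]|]; last exact: negligible_set0.
  case: choice.unpickle => [z|]; last exact: negligible_set0.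
  by exists [set w | A p z w]; split; [exact: mA|exact: A0|].
have sub : [set w | q (N w) == c] `<=` \bigcup_k S k.
  move=> w /= wc.
  have e40 : 0 < c / 4 by rewrite divr_gt0.
  have [p _ /(_ p (leqnn p)) hp] := aN w e e0.
  have Dp : D p w < c / 3.
    by apply: (le_lt_trans (bs_le qs hp)); apply: (le_lt_trans Ce); rewrite ltr_pM2l// ltf_pV2 ?posrE// ltr_nat.
  have ez : 0 < e / 2 by rewrite divr_gt0.
  have H (j : gJ g p) : exists r : rat, `|N w (gof j) - ratr r| < e / 2.
    have lt : N w (gof j) - e / 2 < N w (gof j) + e / 2 by lra.
    have [r] := rat_in_itvoo lt.
    by rewrite in_itv/= => /andP[r1 r2]; exists r; rewrite ltr_norml; lra.
  have [z hz] := choice H.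
  exists (choice.pickle (p, choice.pickle [ffun j => z j])) => //.
  rewrite /S !choice.pickleK /= /A wc Dp/=; apply/forallP => j; rewrite ffunE; exact: hz.
have mq := measurable_eqset c measurable_q.
have [B [mB QB sB]] := nS.
apply: (subset_measure0 mq mB _ QB); exact: subset_trans sB.
Qed.

(** By independence, [rot_zero] says that [p (1 - p) = 0] for the probability [p] of the event. *)
Lemma zero_one : Q [set w | q (N w) == 0] = 0%E \/ Q [set w | q (N w) == 0] = 1%E.
Proof.
have m0 := measurable_eqset 0 measurable_q.
have b0 : bmeas (fun w => (q (N w) == 0)%:R : R) by exact: bmeas_ind.
have := rot_zero.
have E w : ((q (N w.1) == 0) && (0 < q (N w.2)))%:R = (q (N w.1) == 0)%:R * (1 - (q (N w.2) == 0)%:R) :> R.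
  by rewrite natr_and lt0r (bs_ge0 qs) andbT; case: (q (N w.2) == 0); rewrite ?subrr ?subr0.
under eq_Ex do rewrite E.
have b1 : bmeas (fun w : W * W => (q (N w.1) == 0)%:R : R) by exact: (bmeas_comp b0 measurable_fst).
have b2 : bmeas (fun w : W * W => (q (N w.2) == 0)%:R : R) by exact: (bmeas_comp b0 measurable_snd).
rewrite Ex_fubini1; last by apply: bmeasM => //; apply: bmeasB => //; exact: bmeas_cst.
set p := Ex Q (fun w => (q (N w) == 0)%:R).
rewrite (@eq_Ex _ _ _ _ _ (fun w => (q (N w) == 0)%:R * (1 - p))); last first.
  by move=> w /=; rewrite ExZ ?ExB ?Ex_cst//; [exact: bmeas_cst|apply: bmeasB => //; exact: bmeas_cst].
rewrite ExZr// -/p => /eqP; rewrite mulf_eq0 subr_eq0 => /orP[/eqP h|/eqP h].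
  by left; rewrite -Ex_ind// -/p h.
by right; rewrite -Ex_ind// -/p -h.
Qed.

End rotations.

(** * The limit process *)

Section integrable_expectation.
Context {R : realType} {d} {W : measurableType d} (P : probability W R).
Implicit Types f g : W -> R.

(** Gaussian variables are unbounded, so [bmeas] does not apply to them. *)
Definition intg f := P.-integrable setT (EFin \o f).

Lemma intgD f g : intg f -> intg g -> intg (fun x => f x + g x).
Proof. by move=> mf mg; have := integrableD measurableT mf mg. Qed.

Lemma intgZ (c : R) f : intg f -> intg (fun x => c * f x).
Proof. by move=> mf; have := integrableZl measurableT c mf. Qed.

Lemma intg_cst (c : R) : intg (fun=> c).
Proof. by apply: bmeas_int; exact: bmeas_cst. Qed.

Lemma intg_sum I (r : seq I) (F : I -> W -> R) : (forall i, intg (F i)) ->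
  intg (fun x => \sum_(i <- r) F i x) /\
  Ex P (fun x => \sum_(i <- r) F i x) = \sum_(i <- r) Ex P (F i).
Proof.
move=> mF; elim: r => [|i r [IH1 IH2]].
  rewrite big_nil; split; first by under eq_fun do rewrite big_nil; exact: intg_cst.
  by under eq_Ex do rewrite big_nil; exact: Ex_cst.
have E : (fun x => \sum_(j <- i :: r) F j x) = fun x => F i x + \sum_(j <- r) F j x.
  by apply/funext => x; rewrite big_cons.
rewrite E big_cons -IH2; split; first exact: intgD.
exact: (RintegralD measurableT (mF i) IH1).
Qed.

Lemma intg_dom f g : measurable_fun setT f -> (forall x, `|f x| <= g x) -> intg g -> intg f.
Proof.
move=> mf fg ig; apply: le_integrable ig => //; first exact/measurable_EFinP.
by move=> x _ /=; rewrite lee_fin; apply: (le_trans (fg x)); exact: ler_norm.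
Qed.

Lemma eq_Ex_law {d'} {T : measurableType d'} (Q Q' : probability T R) (f : T -> R) :
  (forall A, measurable A -> Q A = Q' A) -> Ex Q f = Ex Q' f.
Proof.
move=> QQ; rewrite /Ex /Rintegral; congr fine; apply: eq_measure_integral => A mA _; exact: QQ.
Qed.

End integrable_expectation.

(* [normal_prob] lives on a copy of the Borel sigma-algebra with another display. *)
Section normal_borel.
Context {R : realType} (a s : R).

Notation sigmaR := (g_sigma_algebraType (R.-ocitv.-measurable)).

Lemma measurable_borel_id : measurable_fun (setT : set sigmaR) (idfun : sigmaR -> R).
Proof. by move=> _ B mB; rewrite setTI. Qed.

Definition normal_borel : probability R R := distribution (normal_prob a s) (mfun_of measurable_borel_id).

Lemma Ex_normal_borel (f : R -> R) : bmeas f -> Ex normal_borel f = Ex (normal_prob a s) f.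
Proof. by move=> bf; rewrite Ex_distribution. Qed.

End normal_borel.

Section normal_variable.
Context {R : realType} {d} {W : measurableType d} (P : probability W R).
Variables (A : {RV P >-> R}) (a s : R).
Hypothesis lawA : forall B, measurable B -> P (A @^-1` B) = normal_law a s B.

Lemma normal_sqr (b : R) : (\int[P]_w ((A w - b) ^+ 2)%:E = (s ^+ 2 + (a - b) ^+ 2)%:E)%E.
Proof.
have mf : measurable_fun setT (fun x : R => ((x - b) ^+ 2)%:E).
  by apply/measurable_EFinP; apply: measurable_funX; exact: measurable_funB.
transitivity (\int[distribution P A]_x ((x - b) ^+ 2)%:E)%E.
  by rewrite ge0_integral_distribution// => x; rewrite lee_fin sqr_ge0.
have [s0|s0] := eqVneq s 0.
  rewrite (@eq_measure_integral _ _ _ _ (\d_ a)); last first.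
    by move=> B mB _; rewrite -[LHS]/(P (A @^-1` B)) lawA// /normal_law s0 eqxx.
  by rewrite integral_dirac// diracT mul1e s0 expr0n add0r.
transitivity (\int[normal_borel a s]_x ((x - b) ^+ 2)%:E)%E; last first.
  rewrite ge0_integral_distribution//; first exact: normal_prob_sqr.
  by move=> x; rewrite lee_fin sqr_ge0.
apply: eq_measure_integral => B mB _.
by rewrite -[LHS]/(P (A @^-1` B)) lawA// /normal_law (negbTE s0).
Qed.

Lemma normal_char (th : R) : Ex P (fun w => cos (th + A w)) = cos (th + a) * expR (- (s ^+ 2 / 2)).
Proof.
have bf : bmeas (fun x : R => cos (th + x)) by apply: bmeas_cos; exact: measurable_funD.
transitivity (Ex (distribution P A) (fun x => cos (th + x))); first by rewrite Ex_distribution.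
have [s0|s0] := eqVneq s 0.
  rewrite (@eq_Ex_law _ _ _ _ (\d_ a)); last first.
    by move=> B mB; rewrite -[LHS]/(P (A @^-1` B)) lawA// /normal_law s0 eqxx.
  rewrite /Ex /Rintegral integral_dirac//; last by apply/measurable_EFinP; have [] := bf.
  by rewrite diracT mul1e/= s0 expr0n mul0r oppr0 expR0 mulr1.
transitivity (Ex (normal_borel a s) (fun x => cos (th + x))).
  apply: eq_Ex_law => B mB.
  by rewrite -[LHS]/(P (A @^-1` B)) lawA// /normal_law (negbTE s0).
rewrite Ex_normal_borel//.
have := @normal_prob_cos R a s th 1 s0; rewrite mul1r expr1n mulr1 => <-.
by apply: eq_Ex => x; rewrite mul1r.
Qed.

Lemma normal_intg_sqr : intg P (fun w => A w ^+ 2).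
Proof.
apply/integrableP; split.
  by apply/measurable_EFinP; exact: measurable_funX.
rewrite (eq_integral (fun w => ((A w - 0) ^+ 2)%:E)).
  by rewrite normal_sqr ltry.
by move=> w _; rewrite /= subr0 ger0_norm// sqr_ge0.
Qed.

End normal_variable.

Section gaussian_char.
Context {R : realType} {d} {W : measurableType d} (P : probability W R) {I : Type}.
Variables (M : I -> {RV P >-> R}) (Cv : I -> I -> R).
Hypothesis gM : gaussian_process M.
Hypothesis EM : forall x, ('E_P[M x] = 0)%E.
Hypothesis cM : forall x y, covariance P (M x) (M y) = (Cv x y)%:E.

Lemma gaussian_intg2 x : intg P (fun w => M x w ^+ 2).
Proof.
have [a [s h]] := gM (fun _ : 'I_1 => x) (fun=> 1).
have E : (fun w => \sum_(i < 1) 1 * M x w) = M x by apply/funext => w; rewrite big_ord1 mul1r.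
by rewrite E in h; exact: (normal_intg_sqr h).
Qed.

Lemma gaussian_intgM x y : intg P (fun w => M x w * M y w).
Proof.
apply: (intg_dom (g := fun w => M x w ^+ 2 + M y w ^+ 2)); first exact: measurable_funM.
  move=> w; rewrite normrM -(real_normK (num_real (M x w))) -(real_normK (num_real (M y w))).
  move: (normr_ge0 (M x w)) (normr_ge0 (M y w)); move: (`|M x w|) (`|M y w|) => u v u0 v0; nra.
by apply: intgD; exact: gaussian_intg2.
Qed.

Lemma gaussian_intg1 x : intg P (fun w => M x w).
Proof.
apply: (intg_dom (g := fun w => 1 + M x w ^+ 2)) => //.
  move=> w; rewrite -(real_normK (num_real (M x w))).
  move: (normr_ge0 (M x w)); move: (`|M x w|) => u u0; nra.
by apply: intgD; [exact: intg_cst|exact: gaussian_intg2].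
Qed.

Lemma gaussian_mean x : Ex P (M x) = 0.
Proof. by have := EM x; rewrite unlock /Ex /Rintegral => ->. Qed.

Lemma gaussian_cov x y : Ex P (fun w => M x w * M y w) = Cv x y.
Proof.
have := cM x y; rewrite covariance.unlock expectation.unlock => h; rewrite /Ex /Rintegral.
have E0 z : (\int[P]_w (M z w)%:E)%E = 0%E by have := EM z; rewrite unlock.
have e : (\int[P]_w (M x w * M y w)%:E = (Cv x y)%:E)%E.
  rewrite -h; apply: eq_integral => w _; congr EFin.
  by rewrite /= !E0; change (M x w * M y w = (M x w - 0) * (M y w - 0)); rewrite !subr0.
by rewrite e.
Qed.

(** A linear combination has a normal law with unknown parameters [a] and [s]. Its mean square about
    [b] is [s^2 + (a - b)^2] by normality and [v + b^2] by the covariances; the values [b = 0] and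
    [b = 1] give [a = 0] and [s^2 = v]. *)
Lemma gaussian_char (J : finType) (x : J -> I) (c : J -> R) th :
  Ex P (fun w => cos (th + lin c (fun j => M (x j) w))) =
  expR (- ((\sum_j \sum_l c j * c l * Cv (x j) (x l)) / 2)) * cos th.
Proof.
pose n := #|J|; pose t (i : 'I_n) := x (enum_val i); pose c' (i : 'I_n) := c (enum_val i).
have [a [s h]] := gM t c'.
pose A w := \sum_(i < n) c' i * M (t i) w.
have mA : measurable_fun setT A by apply: measurable_sum => i; exact: measurable_funM.
have lE w : lin c (fun j => M (x j) w) = A w.
  by rewrite /lin /A (big_enum_val (A := J) (fun j => c j * M (x j) w)).
under eq_Ex do rewrite lE.
have hA : forall B, measurable B -> P (mfun_of mA @^-1` B) = normal_law a s B by exact: h.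
pose v := \sum_j \sum_l c j * c l * Cv (x j) (x l).
have EA (b : R) : Ex P (fun w => (A w - b) ^+ 2) = v + b ^+ 2.
  have i1 j : intg P (fun w => \sum_l (c j * c l) * (M (x j) w * M (x l) w)).
    by have [] := intg_sum (index_enum J) (fun l => intgZ (c j * c l) (gaussian_intgM (x j) (x l))).
  have [i2 e2] := intg_sum (index_enum J) i1.
  have [i3 e3] := intg_sum (index_enum J) (fun j => intgZ (- 2 * b * c j) (gaussian_intg1 (x j))).
  have i4 := intg_cst P (b ^+ 2).
  have -> : Ex P (fun w => (A w - b) ^+ 2) = Ex P (fun w => \sum_j \sum_l c j * c l * (M (x j) w * M (x l) w) +
      (\sum_j - 2 * b * c j * M (x j) w + b ^+ 2)).
    apply: eq_Ex => w; rewrite -lE /lin.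
    set S := \sum_j c j * M (x j) w.
    rewrite (_ : \sum_j - 2 * b * c j * M (x j) w = - 2 * b * S); last first.
      by rewrite /S mulr_sumr; apply: eq_bigr => j _; ring.
    rewrite (_ : \sum_j \sum_l _ = S * S); first by ring.
    by rewrite /S mulr_suml; apply: eq_bigr => j _; rewrite mulr_sumr; apply: eq_bigr => l _; ring.
  rewrite [LHS]RintegralD//; last exact: intgD.
  rewrite -!/(Ex _ _) e2 [X in _ + X = _]RintegralD// -!/(Ex _ _) e3 Ex_cst.
  rewrite [X in _ + (X + _) = _]big1 ?add0r; last first.
    move=> j _; rewrite [LHS]RintegralZl//; last exact: gaussian_intg1.
    by rewrite -/(Ex _ _) gaussian_mean mulr0.
  congr (_ + _); apply: eq_bigr => j _.
  have [_ ->] := intg_sum (index_enum J) (fun l => intgZ (c j * c l) (gaussian_intgM (x j) (x l))).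
  apply: eq_bigr => l _; rewrite [LHS]RintegralZl//; last exact: gaussian_intgM.
  by rewrite -/(Ex _ _) gaussian_cov.
have key b : s ^+ 2 + (a - b) ^+ 2 = v + b ^+ 2.
  by rewrite -EA /Ex /Rintegral (normal_sqr (A := mfun_of mA) hA).
have a0 : a = 0.
  have := key 0; have := key 1; rewrite !expr2; lra.
have sv : s ^+ 2 = v by have := key 0; rewrite a0 subr0 expr0n !addr0.
by rewrite (normal_char (A := mfun_of mA) hA) a0 addr0 sv mulrC.
Qed.

End gaussian_char.

Section sigma_families.
Context {R : realType} {d} {W : measurableType d}.

Lemma sigma_of_preimage {d1} {T1 : measurableType d1} {d2} {T2 : measurableType d2} {I : Type}
  (X : I -> W -> T1) (f : W -> T2) (B : set T2) :
  measurable_fun (setT : set (g_sigma_algebraType (\bigcup_i preimage_set_system setT (X i) measurable))) f ->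
  measurable B -> sigma_of X (f @^-1` B).
Proof. by move=> mf mB; have := mf measurableT B mB; rewrite setTI. Qed.

Lemma sigma_of_measurable {d1} {T1 : measurableType d1} {I : Type} (X : I -> W -> T1) i :
  measurable_fun (setT : set (g_sigma_algebraType (\bigcup_i preimage_set_system setT (X i) measurable))) (X i).
Proof.
by move=> _ B mB; apply: sub_sigma_algebra; exists i => //; exists B.
Qed.

Variable P : probability W R.

(** The joint law of [A] and [B] is the product of their laws, because each is measurable with
    respect to one of the independent families; the variable [w'] is an independent copy. *)
Lemma indep_cos {d1 d2} {T1 : measurableType d1} {T2 : measurableType d2} {I1 I2 : Type}
  (X : I1 -> W -> T1) (Y : I2 -> W -> T2) (A B : W -> R) th :
  indep_families P X Y -> measurable_fun setT A -> measurable_fun setT B ->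
  measurable_fun (setT : set (g_sigma_algebraType (\bigcup_i preimage_set_system setT (X i) measurable))) A ->
  measurable_fun (setT : set (g_sigma_algebraType (\bigcup_i preimage_set_system setT (Y i) measurable))) B ->
  Ex P (fun w => cos (th + (A w + B w))) =
  Ex P (fun w => Ex P (fun w' => cos ((th + A w) + B w'))).
Proof.
move=> ind mA mB sA sB.
pose Z := mfun_of (measurable_fun_pair mA mB).
pose Q1 : probability R R := distribution P (mfun_of mA).
pose Q2 : probability R R := distribution P (mfun_of mB).
have law : forall C, measurable C -> P (Z @^-1` C) = (Q1 \x Q2)%E C.
  apply: pair_law_unique => C D mC mD.
  rewrite (_ : Z @^-1` (C `*` D) = A @^-1` C `&` B @^-1` D)//.
  by apply: ind; apply: sigma_of_preimage.
have bf : bmeas (fun y : R * R => cos (th + (y.1 + y.2))).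
  by apply: bmeas_cos; apply: measurable_funD => //; exact: measurable_funD.
transitivity (Ex (distribution P Z) (fun y : R * R => cos (th + (y.1 + y.2)))).
  by rewrite Ex_distribution.
rewrite (eq_Ex_law (Q' := (Q1 \x Q2)%E)); last exact: law.
rewrite Ex_fubini1// [LHS]Ex_distribution; last exact: (bmeas_Ex2 Q2 bf).
apply: eq_Ex => w; rewrite /= Ex_distribution; last exact: (bmeas_pair1 (A w) bf).
by apply: eq_Ex => w'; rewrite /= addrA.
Qed.

End sigma_families.

Section rho_grid.
Context {R : realType}.
Notation sigmaR := (g_sigma_algebraType (R.-ocitv.-measurable)).

Definition cell (p j : nat) : set sigmaR := [set t : R | (gpt p j < t%:E <= gpt p j.+1)%E].

Lemma measurable_sigma_EFin : measurable_fun (setT : set sigmaR) (fun t : sigmaR => (t : R)%:E).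
Proof. exact: (measurableT_comp (f := EFin) _ (@measurable_borel_id R)). Qed.

Lemma measurable_sigma_xvec l : measurable_fun (setT : set (l.-tuple sigmaR)) (fun w => @xvec_of R l w).
Proof.
apply/measurable_fun_tnthP => i.
rewrite (_ : _ \o _ = (fun t : sigmaR => (t : R)%:E) \o (fun w => tnth w i)); last first.
  by apply/funext => w /=; rewrite tnth_map.
by apply: measurableT_comp; [exact: measurable_sigma_EFin|exact: measurable_tnth].
Qed.

Lemma measurable_cell p j : measurable (cell p j).
Proof.
rewrite (_ : cell p j = (fun t : sigmaR => (t : R)%:E) @^-1` `]gpt p j, gpt p j.+1]).
  by rewrite -[X in measurable X]setTI; apply: measurable_sigma_EFin => //; exact: emeasurable_itv.
by apply/seteqP; split => t /=; rewrite in_itv.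
Qed.

Lemma normal_itv (a b : R) : a <= b -> (normal_prob 0 1 `]a, b] <= (normal_peak 1 * (b - a))%:E)%E.
Proof.
move=> ab.
have pk0 : 0 <= normal_peak (1 : R) by exact: normal_peak_ge0.
apply: (@le_trans _ _ (\int[lebesgue_measure]_(x in `]a, b]%classic) (normal_peak 1)%:E)%E).
  apply: ge0_le_integral => //.
  - by move=> x _; rewrite lee_fin normal_pdf_ge0.
  - apply: measurable_funTS; apply/measurable_EFinP; exact: measurable_normal_pdf.
  - by move=> x _; rewrite lee_fin normal_pdf_ub.
rewrite integral_cst//= lebesgue_measure_itv/= lte_fin; case: ltP => [_|ba]; first by rewrite EFinM.
by rewrite mule0 lee_fin mulr_ge0// subr_ge0.
Qed.

(** Bounded cells have length [1 / (p + 1)] and the normal density is bounded; the two outer cells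
    lie in the tails. *)
Lemma cell_small (e : R) : 0 < e -> \forall p \near \oo, forall j, (normal_prob 0 1 (cell p j) <= e%:E)%E.
Proof.
move=> e0.
have mZ (j : unit) : measurable_fun (setT : set sigmaR) (fun t : sigmaR => t : R) by exact: measurable_borel_id.
have [B [A [mA sA PA]]] := tight_rv (normal_prob 0 1) (Z := fun (t : sigmaR) (_ : unit) => t : R) mZ e0.
near=> p.
have pB : B < p.+1%:R.
  by apply: (@lt_trans _ _ p%:R); [near: p; exact: nbhs_infty_gtr|rewrite ltr_nat].
have pe : normal_peak 1 / p.+1%:R <= e.
  rewrite ler_pdivrMr// mulrC -ler_pdivrMr//; apply: (@le_trans _ _ p%:R); last by rewrite ler_nat.
  by near: p; exact: nbhs_infty_ger.
have out j : (forall t : R, cell p j t -> B < `|t|) -> (normal_prob 0 1 (cell p j) <= e%:E)%E.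
  move=> h; apply: le_trans PA; apply: le_measure; rewrite ?inE//; first exact: measurable_cell.
  by move=> t ct; apply: sA; exists tt; exact: h.
have p0 : p.+1%:R != 0 :> R by rewrite pnatr_eq0.
case => [|j].
  have g1 : gpt p 1 = (- p.+1%:R : R)%:E.
    have hN : (1 < gN p)%N by rewrite /gN addn2.
    by rewrite /gpt hN /= mul0r sub0r.
  apply: out => t; rewrite /cell /= g1 lee_fin => /andP[_ h].
  apply: (lt_le_trans pB); rewrite -normrN; apply: le_trans (ler_norm (- t)).
  by rewrite lerNr.
have [jN|jN] := ltnP j.+2 (gN p).
  have jN' : (j.+1 < gN p)%N by exact: ltnW.
  pose a : R := j%:R / p.+1%:R - p.+1%:R; pose b : R := j.+1%:R / p.+1%:R - p.+1%:R.
  have -> : cell p j.+1 = `]a, b]%classic.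
    by apply/seteqP; split => t; rewrite /cell /= in_itv/= /gpt /= jN jN' lte_fin lee_fin.
  have ba : b - a = p.+1%:R^-1 by rewrite /a /b opprB addrA subrK -mulrBl -natr1 addrAC subrr add0r mul1r.
  have ab : a <= b by rewrite -subr_ge0 ba invr_ge0.
  by apply: (le_trans (normal_itv ab)); rewrite lee_fin ba.
have [jN'|jN'] := ltnP j.+1 (gN p).
  have jE : j = (2 * (p.+1 * p.+1))%N by move: jN jN'; rewrite /gN; lia.
  apply: out => t; rewrite /cell /= /gpt /= jN' jE => /andP[+ _]; rewrite lte_fin.
  rewrite (_ : (2 * (p.+1 * p.+1))%:R / p.+1%:R - p.+1%:R = p.+1%:R :> R); last first.
    by rewrite natrM natrM; field.
  by move=> h; apply: (lt_trans pB); apply: (lt_le_trans h); exact: ler_norm.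
have gy : gpt p j.+1 = +oo%E :> \bar R by rewrite /gpt ltnNge jN'.
by apply: out => t; rewrite /cell /= gy ltNge leey.
Unshelve. all: by end_near. Qed.

Lemma Ex_slab l p (k : 'I_l) j (e : R) : (normal_prob 0 1 (cell p j) <= e%:E)%E ->
  bmeas (fun w : l.-tuple sigmaR => (slab p k j (xvec_of w))%:R : R) /\
  Ex (iid_law (normal_prob 0 1) l) (fun w => (slab p k j (xvec_of w))%:R) <= e.
Proof.
move=> h; have E w : slab p k j (xvec_of w) = ((gpt p j < (tnth w k)%:E <= gpt p j.+1)%E).
  by rewrite /slab tnth_map.
have mS : measurable [set w : l.-tuple sigmaR | slab p k j (xvec_of w)].
  rewrite (_ : [set w | _] = (fun w => tnth w k) @^-1` cell p j).
    by rewrite -[X in measurable X]setTI; apply: measurable_tnth => //; exact: measurable_cell.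
  by apply/seteqP; split => w /=; rewrite E.
split; first exact: bmeas_ind.
rewrite -lee_fin Ex_ind// iid_lawE; apply: le_trans h.
pose A (i : nat) : set sigmaR := if i == k then cell p j else setT.
have mA i : measurable (A i) by rewrite /A; case: ifP => // _; exact: measurable_cell.
have := prod_law_rect (fun=> normal_prob 0 1) l mA.
rewrite (_ : [set y | _] = [set w : l.-tuple sigmaR | slab p k j (xvec_of w)]) => [->|].
  rewrite (bigD1 k)//= /A eqxx big1 ?mule1// => i ik.
  rewrite (_ : (i == k :> nat) = false); last exact: (negbTE ik).
  exact: probability_setT.
apply/seteqP; split => w /= hw.
  by have := hw k; rewrite /A eqxx E.
by move=> i; rewrite /A; case: eqP => // /val_inj ->; rewrite /cell /= -E.
Qed.

(** The indicators of the two orthants differ only on the slabs crossed by rounding, whose normal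
    probabilities are uniformly small. Uniform [rho]-continuity of a path thus makes it approximable
    along grids, as [nice] demands. *)
Lemma rho_gpi l (e : R) : 0 < e -> \forall p \near \oo, forall x : xvec R l, rho x (gpi p x) <= e.
Proof.
move=> e0; have e1 : 0 < e / l.+1%:R by rewrite divr_gt0.
have := cell_small e1; apply: filterS => p hp x.
have bl y : bmeas (fun w : l.-tuple sigmaR => (lev (xvec_of w) y)%:R : R).
  exact: (bmeas_comp (bmeas_lev y) (@measurable_sigma_xvec l)).
have hs k := Ex_slab k (hp (gidx p (tnth x k))).
have bs : bmeas (fun w : l.-tuple sigmaR => \sum_(k < l) (slab p k (gidx p (tnth x k)) (xvec_of w))%:R : R).
  by apply: bmeas_sum => k; have [] := hs k.
rewrite -[rho _ _]/(Ex (iid_law (normal_prob 0 1) l) (fun w => `|(lev (xvec_of w) x)%:R - (lev (xvec_of w) (gpi p x))%:R|)).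
apply: (@le_trans _ _ (Ex (iid_law (normal_prob 0 1) l) (fun w => \sum_(k < l) (slab p k (gidx p (tnth x k)) (xvec_of w))%:R))).
  apply: le_Ex => //; first exact/bmeas_norm/bmeasB.
  move=> w; rewrite -[in leLHS](mixvm p x) -{1}(mixv0 p x).
  have tel : (lev (xvec_of w) (mixv p x 0))%:R - (lev (xvec_of w) (mixv p x l))%:R =
      \sum_(k < l) (slab p k (gidx p (tnth x k)) (xvec_of w) && lev (xvec_of w) (mixv p x k))%:R :> R.
    rewrite (eq_bigr (fun k : 'I_l => (lev (xvec_of w) (mixv p x k))%:R - (lev (xvec_of w) (mixv p x k.+1))%:R)); last first.
      by move=> k _; rewrite lev_mixvS.
    rewrite -(big_mkord xpredT (fun k => (lev (xvec_of w) (mixv p x k))%:R - (lev (xvec_of w) (mixv p x k.+1))%:R)).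
    rewrite (@telescope_sumr_eq _ _ _ (fun k => - (lev (xvec_of w) (mixv p x k))%:R))//; first by ring.
    by move=> k _; ring.
  rewrite tel ger0_norm ?sumr_ge0//; apply: ler_sum => k _.
  by rewrite ler_nat; case: slab => //=; case: lev.
rewrite Ex_sum; last by move=> k; have [] := hs k.
apply: (@le_trans _ _ (\sum_(k < l) e / l.+1%:R)); first by apply: ler_sum => k _; have [] := hs k.
rewrite sumr_const card_ord -[leLHS]mulr_natl mulrCA ger_pMr// ler_pdivrMr// mul1r ler_nat//.
Qed.

Lemma rho_cont_grid l (f : xvec R l -> R) : unif_rho_cont f -> forall e : R, 0 < e ->
  \forall p \near \oo, forall x, `|f x - f (gproj (gridX l) p x)| <= e.
Proof.
move=> uf e e0; have [de de0 h] := uf e e0.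
have de2 : 0 < de / 2 by rewrite divr_gt0.
have := rho_gpi l de2; apply: filterS => p hp x; apply: ltW; apply: h.
by apply: (le_lt_trans (hp x)); rewrite ltr_pdivrMr// ltr_pMr// ltr1n.
Qed.

End rho_grid.

Section nice_version.
Context {R : realType} {d} {W : measurableType d} (P : probability W R) {l : nat}.
Variable M : xvec R l -> {RV P >-> R}.
Hypothesis cM : {ae P, forall w, unif_rho_cont (fun x => M x w)}.

(** Paths are set to 0 on a measurable null set. Elsewhere uniform [rho]-continuity gives the grid
    approximation, and with it boundedness, because a grid is finite. *)
Lemma nice_version : exists (Mt : W -> xvec R l -> R) (N0 : set W),
  [/\ nice (gridX l) Mt, measurable N0, P N0 = 0%E & forall w, ~ N0 w -> forall x, Mt w x = M x w].
Proof.
have [N0 [mN PN sN]] := cM.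
exists (fun w x => (w \notin N0)%:R * M x w), N0; split => //; last first.
  by move=> w wN x; rewrite (_ : w \notin N0) ?mul1r//; apply/negP; rewrite inE.
have good w : w \notin N0 -> unif_rho_cont (fun x => M x w).
  by move=> /negP wN; apply: contrapT => h; apply: wN; rewrite inE; apply: sN.
split.
- move=> x; apply: measurable_funM => //.
  have : measurable [set w | w \notin N0].
    by rewrite (_ : [set w | _] = ~` N0); [exact: measurableC|apply/seteqP; split => w /=; rewrite notin_setE].
  by move=> /(@bmeas_ind R _ _ (fun w => w \notin N0))[].
- move=> w; case: (boolP (w \notin N0)) => wN; last by exists 0 => x; rewrite mul0r normr0.
  have [p _ /(_ p (leqnn p)) hp] := rho_cont_grid (good w wN) ltr01.
  have [B hB] := bnd_grid (gto (gridX l) p) (fun j => M (gof j) w).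
  exists (B + 1) => x; rewrite mul1r.
  have := ler_normD (M x w - M (gproj (gridX l) p x) w) (M (gproj (gridX l) p x) w); rewrite subrK => /le_trans; apply.
  by rewrite addrC lerD//; exact: hB.
move=> w e e0; case: (boolP (w \notin N0)) => wN; last first.
  by apply: nearW => p x; rewrite !mul0r subrr normr0 ltW.
by have := rho_cont_grid (good w wN) e0; apply: filterS => p h x; rewrite !mul1r.
Qed.

End nice_version.

(** * Distribution functions *)

Section distribution_functions.
Context {R : realType} {l : nat}.
Notation X := (xvec R l).

Lemma is_dfE (mu : probability X R) K : is_df_of mu K <-> forall x, K x = Ex mu (fun w => (lev w x)%:R).
Proof.
split=> h x.
  by have := Ex_ind mu (measurable_lev x); rewrite h => -[].
by rewrite h Ex_ind//; exact: measurable_lev.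
Qed.

Lemma df_probP (K : X -> R) : distfuns R l K -> is_df_of (df_prob K) K.
Proof. by move=> h; rewrite /df_prob; case: pselect => // h'; exact: (svalP (cid h')). Qed.

Lemma df_bound (K : X -> R) x : distfuns R l K -> 0 <= K x <= 1.
Proof.
move=> [mu /is_dfE ->]; apply/andP; split; first by apply: Ex_ge0 => w; exact: ler0n.
apply: le_trans (ler_norm _) _; apply: Ex_le_bound (bmeas_lev x) _ => w.
by case: lev; rewrite ?normr0 ?normr1.
Qed.

Lemma df_norm (K : X -> R) x : distfuns R l K -> `|K x| <= 1.
Proof. by move=> /(df_bound x)/andP[h1 h2]; rewrite ger0_norm. Qed.

Lemma df_bnd (K : X -> R) : distfuns R l K -> bnd K.
Proof. by move=> h; exists 1 => x; exact: df_norm. Qed.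

Lemma df_of_law (mu : probability X R) : distfuns R l (fun x => Ex mu (fun w => (lev w x)%:R)).
Proof. by exists mu; apply/is_dfE. Qed.

Lemma df_convex n (a : nat -> R) (K : nat -> X -> R) :
  (forall i, (i < n)%N -> 0 <= a i) -> \sum_(i < n) a i = 1 ->
  (forall i, (i < n)%N -> distfuns R l (K i)) ->
  distfuns R l (fun x => \sum_(i < n) a i * K i x).
Proof.
move=> a0 a1 dK.
pose m i := mscale (NngNum (normr_ge0 (a i))) (df_prob (K i)).
have mE A : measurable A -> msum m n A = (\sum_(i < n) (a i)%:E * df_prob (K i) A)%E.
  by move=> mA; rewrite /msum; apply: eq_bigr => i _; rewrite -[X in _ = (X%:E * _)%E](ger0_norm (a0 i (ltn_ord i))).
have h1 : msum m n setT = 1%E.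
  rewrite mE// (eq_bigr (fun i : 'I_n => (a i)%:E)) => [|i _]; last by rewrite probability_setT mule1.
  by rewrite sumEFin a1.
pose P : probability X R := HB.pack (msum m n) (Measure_isProbability.Build _ _ _ (msum m n) h1).
exists P => x; rewrite -[LHS]/(msum m n [set w | lev w x]) mE; last exact: measurable_lev.
rewrite -sumEFin; apply: eq_bigr => i _.
by rewrite (df_probP (dK i (ltn_ord i))) EFinM.
Qed.

Lemma measurable_levpair : measurable [set p : X * X | lev p.1 p.2].
Proof.
rewrite (_ : [set p | _] = \big[setI/setT]_(k < l) [set p : X * X | (tnth p.1 k <= tnth p.2 k)%E]).
  apply: bigsetI_measurable => k _; rewrite -[X in measurable X]setTI.
  apply: measurable_lee => //.
    by apply: (measurableT_comp (f := fun x : X => tnth x k)) => //; exact: measurable_tnth.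
  by apply: (measurableT_comp (f := fun x : X => tnth x k)) => //; exact: measurable_tnth.
rewrite -bigcap_seq; apply/seteqP; split => p /=.
  by move=> /forallP h k _; exact: h.
by move=> h; apply/forallP => k; apply: h; rewrite /= mem_index_enum.
Qed.

Lemma bmeas_levpair : bmeas (fun p : X * X => (lev p.1 p.2)%:R : R).
Proof. by apply: bmeas_ind; exact: measurable_levpair. Qed.

Lemma bmeas_df (K : X -> R) : distfuns R l K -> bmeas K.
Proof.
move=> [mu /is_dfE h]; have -> : K = fun x => Ex mu (fun w => (lev w x)%:R) by apply/funext.
exact: (bmeas_Ex1 mu bmeas_levpair).
Qed.

End distribution_functions.

Section orthants.
Context {R : realType} {u : nat}.
Notation Z := (xvec R u).

Lemma below_seq (e : \bar R) : exists s : nat -> \bar R, e = -oo%E \/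
  forall z : \bar R, \forall n \near \oo, (z <= s n)%E = (z < e)%E.
Proof.
case: e => [r||]; last by exists (fun=> -oo%E); left.
- exists (fun n => (r - n.+1%:R^-1)%:E); right => z.
  case: (ltP z r%:E) => h; last first.
    apply: nearW => n; apply/negbTE; rewrite -ltNge; apply: lt_le_trans h.
    by rewrite lte_fin ltrBlDr ltrDl invr_gt0.
  case: z h => [z||] // h; last by apply: nearW => n; rewrite leNye.
  rewrite lte_fin in h; have h0 : 0 < r - z by rewrite subr_gt0.
  have := near_infty_natSinv_lt (PosNum h0); apply: filterS => n /= hn.
  by rewrite lee_fin lerBrDl -lerBrDr ltW.
- exists (fun n => n%:R%:E); right => z.
  case: z => [z||]; last by apply: nearW => n; rewrite leNye ltNye.
    have := nbhs_infty_ger z; apply: filterS => n hn.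
    by rewrite lee_fin hn ltry.
  by apply: nearW => n; rewrite ltxx.
Qed.

Variables (mu mu' : probability Z R) (K K' : Z -> R) (e : R).
Hypotheses (dK : is_df_of mu K) (dK' : is_df_of mu' K') (KK : sup_close K K' e).

(** An orthant open in the coordinates of [S] and unrestricted in the others is a limit of closed
    orthants, approached from below. It is empty if such a coordinate of [y] is [-oo]. *)
Lemma lower_orthant (y : Z) (S : {set 'I_u}) :
  bmeas (fun z : Z => \prod_(k < u) (if k \in S then (tnth z k < tnth y k)%E%:R else 1) : R) /\
  `|Ex mu (fun z => \prod_(k < u) (if k \in S then (tnth z k < tnth y k)%E%:R else 1)) -
    Ex mu' (fun z => \prod_(k < u) (if k \in S then (tnth z k < tnth y k)%E%:R else 1))| <= e.
Proof.
set f := fun z : Z => \prod_(k < u) _.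
have e0 : 0 <= e by apply: le_trans (KK topv).
have [[k [kS yk]]|/forallNP h] := pselect (exists k, k \in S /\ tnth y k = -oo%E).
  have f0 z : f z = 0.
    by rewrite /f (bigD1 k)//= kS yk ltNge leNye mul0r.
  have -> : f = fun=> 0 by apply/funext.
  by rewrite !Ex_cst subrr normr0; split => //; exact: bmeas_cst.
have [s hs] := choice (fun k => below_seq (tnth y k)).
pose x n : Z := [tuple if k \in S then s k n else +oo%E | k < u].
have cv z : (fun n => (lev z (x n))%:R : R) @ \oo --> f z.
  have : \forall n \near \oo, forall k : 'I_u, k \in S -> (tnth z k <= s k n)%E = (tnth z k < tnth y k)%E.
    apply: filter_forall => k; case: (boolP (k \in S)) => kS; last exact: nearW.
    have [yk|hk] := hs k; first by case: (h k).
    by have := hk (tnth z k); apply: filterS => n ->.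
  move=> hn; apply: (@cvg_trans _ ((fun=> f z) @ \oo)); last exact: cvg_cst.
  apply: near_eq_cvg; move: hn; apply: filterS => n hn.
  rewrite /f; case: (boolP (lev z (x n))) => [/forallP L|/forallPn[k L]].
    rewrite big1// => k _; case: ifP => // kS; rewrite -hn//.
    by have := L k; rewrite tnth_mktuple kS => ->.
  rewrite (bigD1 k)//=; move: L; rewrite tnth_mktuple; case: ifP => kS; last by rewrite leey.
  by rewrite hn// => /negbTE ->; rewrite mul0r.
have lb n z : `|(lev z (x n))%:R : R| <= 1 by case: lev; rewrite ?normr0 ?normr1.
have ml n : measurable_fun setT (fun z => (lev z (x n))%:R : R) by have [] := bmeas_lev (x n).
have [b1 c1] := Ex_bounded_cvg mu ml lb cv; have [_ c2] := Ex_bounded_cvg mu' ml lb cv.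
split => //.
have c3 : (fun n => `|Ex mu (fun z => (lev z (x n))%:R) - Ex mu' (fun z => (lev z (x n))%:R)|) @ \oo --> `|Ex mu f - Ex mu' f|.
  by apply: cvg_norm; apply: cvgB.
apply: (cvgr_to_le c3); apply: nearW => n.
by rewrite -((is_dfE mu K).1 dK) -((is_dfE mu' K').1 dK').
Qed.

(** Number of terms, [2 ^ u], in the inclusion-exclusion formula for upper orthants. *)
Definition oc : R := #|{set 'I_u}|%:R.

Lemma upper_orthant (y : Z) : `|Ex mu (fun z => (lev y z)%:R) - Ex mu' (fun z => (lev y z)%:R)| <= oc * e.
Proof.
pose f (S : {set 'I_u}) (z : Z) : R := \prod_(k < u) (if k \in S then (tnth z k < tnth y k)%E%:R else 1).
pose sg (S : {set 'I_u}) : R := \prod_(k < u) (if k \in S then -1 else 1).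
have sg1 S : `|sg S| = 1.
  by rewrite normr_prod big1// => k _; case: ifP => _; rewrite ?normrN1 ?normr1.
have E z : (lev y z)%:R = \sum_(S in {set 'I_u}) sg S * f S z.
  rewrite (_ : (lev y z)%:R = \prod_(k < u) (- (tnth z k < tnth y k)%E%:R + 1) :> R); last first.
    case: (boolP (lev y z)) => [/forallP L|/forallPn[k L]].
      by rewrite big1// => k _; rewrite ltNge L oppr0 add0r.
    by rewrite (bigD1 k)//= ltNge L addNr mul0r.
  rewrite bigA_distr; apply: eq_bigr => S _; rewrite /sg /f -big_split; apply: eq_bigr => k _ /=.
  by case: ifP => _; rewrite ?mulN1r ?mul1r.
have bf S : bmeas (fun z => sg S * f S z) by apply: bmeasZ; have [] := lower_orthant y S.
under eq_Ex do rewrite E; under [X in _ - X]eq_Ex do rewrite E.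
rewrite !Ex_sum// -sumrB; apply: (le_trans (ler_norm_sum _ _ _)).
apply: (@le_trans _ _ (\sum_(S in {set 'I_u}) e)); last first.
  by rewrite sumr_const /oc mulr_natl.
apply: ler_sum => S _; have [b h] := lower_orthant y S.
by rewrite !ExZ// -mulrBr normrM sg1 mul1r.
Qed.

(** Integration by parts through Fubini: the integral of a distribution function is the mean
    probability of an upper orthant, and [upper_orthant] compares these for the two laws. *)
Lemma Ex_df_close {d} {O : measurableType d} (nu : probability O R) (v : O -> Z) :
  bmeas (fun p : O * Z => (lev (v p.1) p.2)%:R : R) ->
  `|Ex mu (fun z => Ex nu (fun o => (lev (v o) z)%:R)) - Ex mu' (fun z => Ex nu (fun o => (lev (v o) z)%:R))| <= oc * e.
Proof.
move=> b; have h1 := Ex_swap nu mu b; have h2 := Ex_swap nu mu' b; rewrite /= in h1 h2.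
rewrite -h1 -h2; apply: Ex_sub_norm; [exact: (bmeas_Ex2 mu b)|exact: (bmeas_Ex2 mu' b)|].
by move=> o; exact: upper_orthant.
Qed.

Definition maxv (x y : Z) : Z := [tuple Order.max (tnth x k) (tnth y k) | k < u].

Lemma lev_maxv x y z : lev (maxv x y) z = lev x z && lev y z.
Proof.
apply/forallP/andP => [h|[/forallP h1 /forallP h2] k].
  by split; apply/forallP => k; have := h k; rewrite tnth_mktuple ge_max => /andP[].
by rewrite tnth_mktuple ge_max h1 h2.
Qed.

(** A product of two distribution functions is the distribution function of the componentwise
    maximum of independent vectors. *)
Lemma Ex_dfM_close (A B : Z -> R) : distfuns R u A -> distfuns R u B ->
  `|Ex mu (fun z => A z * B z) - Ex mu' (fun z => A z * B z)| <= oc * e.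
Proof.
move=> [nA /is_dfE hA] [nB /is_dfE hB].
have bj : bmeas (fun p : (Z * Z) * Z => (lev (maxv p.1.1 p.1.2) p.2)%:R : R).
  under eq_fun do rewrite lev_maxv natr_and.
  apply: bmeasM; apply: (bmeas_comp (h := fun p : (Z * Z) * Z => (_, p.2)) bmeas_levpair).
    by apply: measurable_fun_pair => //; apply: measurableT_comp.
  by apply: measurable_fun_pair => //; apply: measurableT_comp.
have E z : A z * B z = Ex (nA \x nB)%E (fun o : Z * Z => (lev (maxv o.1 o.2) z)%:R).
  have bl : bmeas (fun w : Z => (lev w z)%:R : R) by exact: bmeas_lev.
  under eq_Ex do rewrite lev_maxv natr_and.
  have b1 : bmeas (fun w : Z * Z => (lev w.1 z)%:R : R) by exact: (bmeas_comp bl measurable_fst).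
  have b2 : bmeas (fun w : Z * Z => (lev w.2 z)%:R : R) by exact: (bmeas_comp bl measurable_snd).
  rewrite Ex_fubini1; last exact: bmeasM.
  rewrite (@eq_Ex _ _ _ _ _ (fun w => (lev w z)%:R * B z)); last by move=> w /=; rewrite ExZ// -hB.
  by rewrite ExZr// -hA.
under eq_Ex do rewrite E; under [X in _ - X]eq_Ex do rewrite E.
exact: Ex_df_close.
Qed.

(** The factor 4 is [1 + 2 + 1], from the three terms of the expanded square. *)
Lemma Ex_sqr_close (A B : Z -> R) (c : R) : distfuns R u A -> distfuns R u B ->
  `|Ex mu (fun z => (c * (A z - B z)) ^+ 2) - Ex mu' (fun z => (c * (A z - B z)) ^+ 2)| <= c ^+ 2 * (4 * (oc * e)).
Proof.
move=> dA dB; have bA := bmeas_df dA; have bB := bmeas_df dB.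
have bAA := bmeasM bA bA; have bAB := bmeasM bA bB; have bBB := bmeasM bB bB.
have E (m : probability Z R) : Ex m (fun z => (c * (A z - B z)) ^+ 2) =
   c ^+ 2 * (Ex m (fun z => A z * A z) - 2 * Ex m (fun z => A z * B z) + Ex m (fun z => B z * B z)).
  have b2 := bmeasZ 2 bAB; have b3 := bmeasB bAA b2; have b4 := bmeasD b3 bBB.
  rewrite -(ExZ m 2 bAB) -(ExB m bAA b2) -(ExD m b3 bBB) -(ExZ m _ b4).
  by apply: eq_Ex => z; ring.
rewrite !E -mulrBr normrM (ger0_norm (sqr_ge0 c)) ler_wpM2l ?sqr_ge0//.
have := Ex_dfM_close dA dA; have := Ex_dfM_close dA dB; have := Ex_dfM_close dB dB.
rewrite !ler_norml => /andP[a1 a2] /andP[b1 b2] /andP[c1 c2]; lra.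
Qed.

End orthants.
Arguments oc : clear implicits.

(** Integrand and measure vary together, and proximity of distribution functions controls only
    integrals of distribution functions and of their products. Hence [U] is replaced by the function
    of a fixed index [i0], a multiple of a difference of distribution functions; the measure is
    changed there, and the integrand is moved on to the index [i]. *)
Lemma sqint_cvg {R : realType} {u : nat} (A B K_ : nat -> xvec R u -> R) (a : nat -> R) (K U : xvec R u -> R) :
  (forall i, distfuns R u (A i)) -> (forall i, distfuns R u (B i)) ->
  (forall i, distfuns R u (K_ i)) -> distfuns R u K -> bnd U ->
  (forall e : R, 0 < e -> \forall i \near \oo, sup_close (K_ i) K e) ->
  (forall e : R, 0 < e -> \forall i \near \oo, sup_close (fun z => a i * (A i z - B i z)) U e) ->
  bmeas U /\ (fun i => Ex (df_prob (K_ i)) (fun z => (a i * (A i z - B i z)) ^+ 2)) @ \oo -->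
    Ex (df_prob K) (fun z => U z ^+ 2).
Proof.
move=> dA dB dK_ dK [B0 hB0] cK cU.
pose Ui i z := a i * (A i z - B i z).
have bUi i : bmeas (Ui i) by apply: bmeasZ; apply: bmeasB; exact: bmeas_df.
have bU : bmeas U.
  split; last by exists B0.
  have mU i : measurable_fun setT (Ui i) by have [] := bUi i.
  apply: (measurable_fun_cvg mU) => z _; apply/cvgrPdist_le => /= e e0.
  by have := cU e e0; apply: filterS => i h; rewrite distrC; exact: h.
split => //; apply/cvgrPdist_le => /= e e0.
have Bp : 0 <= B0 by apply: le_trans (hB0 topv).
pose D : R := 2 * B0 + 3.
have D0 : 0 < D by rewrite ltr_wpDl// mulr_ge0.
pose de := Num.min 1 (e / (8 * D)).
have de0 : 0 < de by rewrite lt_min ltr01 divr_gt0// mulr_gt0.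
have de1 : de <= 1 by rewrite ge_min lexx.
have deD : de * D <= e / 8.
  rewrite -ler_pdivlMr// (_ : e / 8 / D = e / (8 * D)); last by field; rewrite gt_eqF.
  by rewrite ge_min lexx orbT.
have [i0 _ /(_ i0 (leqnn i0)) h0] := cU de de0.
have sq (f g : R) (t : R) : 0 <= t -> `|f - g| <= t -> `|f + g| <= D -> `|f ^+ 2 - g ^+ 2| <= t * D.
  by move=> t0 h1 h2; rewrite subr_sqr normrM ler_pM.
have e4 : 0 < e / 4 by rewrite divr_gt0.
pose cc := a i0 ^+ 2 * (4 * oc R u) + 1 : R.
have cc0 : 0 < cc.
  by rewrite ltr_wpDl// mulr_ge0 ?sqr_ge0// mulr_ge0// /oc ler0n.
have ecc : 0 < e / 4 / cc by rewrite divr_gt0.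
move: (cU de de0) (cK _ ecc); apply: filterS2 => i hU hK.
have bnd1 (f : xvec R u -> R) : sup_close f U de -> forall z, `|f z| <= B0 + 1.
  move=> h z; have := h z; have := hB0 z; have := ler_normD (f z - U z) (U z); rewrite subrK; lra.
have nU := bnd1 _ hU; have nV := bnd1 _ h0.
have k1 : `|Ex (df_prob K) (fun z => U z ^+ 2) - Ex (df_prob K) (fun z => Ui i0 z ^+ 2)| <= de * D.
  apply: Ex_sub_norm; [exact: bmeasX|exact: bmeasX|move=> z].
  apply: sq; [exact: ltW|by rewrite distrC; exact: h0|].
  apply: (le_trans (ler_normD _ _)); have := nV z; have := hB0 z; rewrite /D /Ui; lra.
have k2 : `|Ex (df_prob K) (fun z => Ui i0 z ^+ 2) - Ex (df_prob (K_ i)) (fun z => Ui i0 z ^+ 2)| <= e / 4.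
  have hK' : sup_close K (K_ i) (e / 4 / cc) by move=> z; rewrite distrC; exact: hK.
  apply: (le_trans (Ex_sqr_close (df_probP dK) (df_probP (dK_ i)) hK' (a i0) (dA i0) (dB i0))).
  rewrite (_ : _ * (4 * _) = (a i0 ^+ 2 * (4 * oc R u)) / cc * (e / 4)); last by ring.
  rewrite ler_piMl ?(ltW e4)// ler_pdivrMr// mul1r lerDl//.
have k3 : `|Ex (df_prob (K_ i)) (fun z => Ui i0 z ^+ 2) - Ex (df_prob (K_ i)) (fun z => Ui i z ^+ 2)| <= (2 * de) * D.
  apply: Ex_sub_norm; [exact: bmeasX|exact: bmeasX|move=> z].
  apply: sq; first by rewrite mulr_ge0// ltW.
    have a1 : `|Ui i0 z - U z| <= de := h0 z.
    have a2 : `|U z - Ui i z| <= de by rewrite distrC; exact: hU.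
    by have := ler_distD (U z) (Ui i0 z) (Ui i z); move: a1 a2; move: (de) => t; lra.
  apply: (le_trans (ler_normD _ _)); have := nU z; have := nV z; rewrite /D /Ui; lra.
move: k1 k2 k3; rewrite -/(Ui i).
set x1 := Ex _ _; set x2 := Ex _ _; set x3 := Ex _ _; set x4 := Ex _ _.
have := ler_distD x2 x1 x4; have := ler_distD x3 x2 x4.
rewrite -mulrA; move: (de * D) deD => t; lra.
Qed.

(** * The seminorms of the limit statistics *)

Section supremum_norm.
Context {R : realType} {u : nat}.
Implicit Types f g : xvec R u -> R.

Lemma supnorm_le f (B : R) : (forall z, `|f z| <= B) -> supnorm f <= B.
Proof.
move=> h; apply: ge_sup; first by exists `|f topv|, topv.
by move=> _ [z _ <-].
Qed.

Lemma le_supnorm f z : bnd f -> `|f z| <= supnorm f.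
Proof.
move=> [B h]; apply: ub_le_sup; last by exists z.
by exists B => _ [y _ <-].
Qed.

Lemma supnorm_ge0 f : 0 <= supnorm f.
Proof.
have [h|h] := pselect (bnd f); first by apply: le_trans (le_supnorm topv h).
rewrite /supnorm sup_out// => -[_ [B hB]]; apply: h; exists B => z.
by apply: hB; exists z.
Qed.

Lemma supnorm_close f g (e : R) : bnd f -> bnd g -> sup_close f g e -> `|supnorm f - supnorm g| <= e.
Proof.
move=> bf bg fg; rewrite ler_norml; apply/andP; split.
  rewrite lerBrDr addrC lerBlDr; apply: supnorm_le => z.
  have := ler_normD (g z - f z) (f z); rewrite subrK distrC; have := fg z; have := le_supnorm z bf; lra.
rewrite lerBlDr; apply: supnorm_le => z.
have := ler_normD (f z - g z) (g z); rewrite subrK; have := fg z; have := le_supnorm z bg; lra.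
Qed.

End supremum_norm.

(** Homogeneity follows from its upper half, applied to [a] and to [a^-1]. *)
Lemma mk_bseminorm {R : realType} {K : Type} (q : (K -> R) -> R) (C : R) :
  (forall f, 0 <= q f) ->
  (forall f f', bnd f -> bnd f' -> q (fun x => f x + f' x) <= q f + q f') ->
  (forall (a : R) f, bnd f -> q (fun x => a * f x) <= `|a| * q f) ->
  (forall f (B : R), (forall x, `|f x| <= B) -> q f <= C * B) -> bseminorm q C.
Proof.
move=> h0 hD hZ hB; split=> // a f bf; apply/eqP; rewrite eq_le hZ//=.
have [->|a0] := eqVneq a 0; first by rewrite normr0 mul0r.
have := hZ a^-1 _ (bndZ a bf); rewrite (_ : (fun x => _) = f); last by apply/funext => x; rewrite mulKf.
by rewrite normfV ler_pdivlMl ?normr_gt0.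
Qed.

Section seminorms.
Context {R : realType} {K : Type} {u : nat}.
Notation Z := (xvec R u).
Variables (D : (K -> R) -> Z -> R) (C : R) (mu : probability Z R).
Hypothesis C0 : 0 <= C.
Hypothesis DD : forall f f' z, bnd f -> bnd f' -> D (fun x => f x + f' x) z = D f z + D f' z.
Hypothesis DZ : forall (a : R) f z, bnd f -> D (fun x => a * f x) z = a * D f z.
Hypothesis DB : forall f (B : R), (forall x, `|f x| <= B) -> forall z, `|D f z| <= C * B.

Lemma bndDf f : bnd f -> bnd (D f).
Proof. by move=> [B h]; exists (C * B); exact: DB. Qed.

Definition q1 f : R := supnorm (D f).

Lemma q1_bseminorm : bseminorm q1 C.
Proof.
apply: mk_bseminorm.
- by move=> f; exact: supnorm_ge0.
- move=> f f' bf bf'; apply: supnorm_le => z; rewrite DD//.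
  by apply: (le_trans (ler_normD _ _)); rewrite lerD// le_supnorm//; exact: bndDf.
- move=> a f bf; apply: supnorm_le => z; rewrite DZ// normrM ler_wpM2l// le_supnorm//.
  exact: bndDf.
- by move=> f B h; apply: supnorm_le; exact: DB.
Qed.

(* Upper L2 norms, because [D f] need not be measurable. *)
Definition l2bound f : set R := [set c | 0 <= c /\ exists h, [/\ bmeas h, forall z, `|D f z| <= h z &
  Ex mu (fun z => h z ^+ 2) <= c ^+ 2]].

Definition q2 f : R := inf (l2bound f).

Lemma q2_ge0 f : 0 <= q2 f.
Proof.
have [h|h] := pselect (l2bound f !=set0); first by apply: lb_le_inf => // c [].
by rewrite /q2 inf_out// => -[].
Qed.

Lemma q2_le f c : l2bound f c -> q2 f <= c.
Proof. by move=> h; apply: ge_inf => //; exists 0 => y []. Qed.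

Lemma l2bound_cst f (B : R) : (forall x, `|f x| <= B) -> 0 <= C * B -> l2bound f (C * B).
Proof.
move=> h CB; split => //; exists (fun=> C * B); split; [exact: bmeas_cst|exact: DB|].
by rewrite Ex_cst.
Qed.

Lemma l2bound_ne f : bnd f -> l2bound f !=set0.
Proof.
move=> [B h]; exists (C * B); apply: l2bound_cst => //.
by apply: le_trans (DB h topv).
Qed.

(** Strict positivity of [c] allows division by it in the proof of Minkowski's inequality. *)
Lemma l2bound_near f (e : R) : bnd f -> 0 < e -> exists2 c, l2bound f c & 0 < c < q2 f + e.
Proof.
move=> bf e0; have e2 : 0 < e / 2 by rewrite divr_gt0.
have hi : has_inf (l2bound f) by split; [exact: l2bound_ne|exists 0 => y []].
have [c [c0 [h [bh Dh Eh]]] lt] := inf_adherent e2 hi.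
exists (c + e / 2); last by rewrite ltr_wpDl//=; have {}lt : c < q2 f + e / 2 := lt; lra.
split; first by rewrite addr_ge0// ltW.
exists h; split => //; apply: (le_trans Eh).
by rewrite lerXn2r ?nnegrE ?addr_ge0 ?(ltW e2)// lerDl ltW.
Qed.

Lemma q2_bseminorm : bseminorm q2 C.
Proof.
apply: mk_bseminorm.
- exact: q2_ge0.
- move=> f f' bf bf'; apply/ler_addgt0Pr => e e0.
  have e2 : 0 < e / 2 by rewrite divr_gt0.
  have [c [c0 [h [bh Dh Eh]]] /andP[cp lt]] := l2bound_near bf e2.
  have [c' [c'0 [h' [bh' Dh' Eh']]] /andP[cp' lt']] := l2bound_near bf' e2.
  suff : q2 (fun x => f x + f' x) <= c + c' by lra.
  apply: q2_le; split; first exact: addr_ge0.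
  exists (fun z => h z + h' z); split; first exact: bmeasD.
    by move=> z; rewrite DD//; apply: (le_trans (ler_normD _ _)); rewrite lerD.
  have b2 := bmeasX 2 bh; have b2' := bmeasX 2 bh'.
  (* Minkowski's inequality without square roots: these weights turn the bounds [c^2] and [c'^2]
     into exactly [(c + c')^2]. *)
  apply: (@le_trans _ _ (Ex mu (fun z => (1 + c' / c) * h z ^+ 2 + (1 + c / c') * h' z ^+ 2))).
    apply: le_Ex; [exact: (bmeasX 2 (bmeasD bh bh'))|by apply: bmeasD; exact: bmeasZ|].
    move=> z; rewrite -subr_ge0.
    rewrite (_ : _ - _ = (c' * h z - c * h' z) ^+ 2 / (c * c')); last by field; rewrite !gt_eqF.
    by rewrite divr_ge0 ?sqr_ge0// mulr_ge0// ltW.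
  rewrite ExD; [|exact: bmeasZ|exact: bmeasZ].
  rewrite !ExZ//.
  have p1 : 0 <= 1 + c' / c by rewrite addr_ge0// divr_ge0// ltW.
  have p2 : 0 <= 1 + c / c' by rewrite addr_ge0// divr_ge0// ltW.
  apply: (le_trans (lerD (ler_wpM2l p1 Eh) (ler_wpM2l p2 Eh'))).
  by rewrite le_eqVlt; apply/orP; left; apply/eqP; field; rewrite !gt_eqF.
- move=> a f bf; apply/ler_addgt0Pr => e e0.
  have a1 : 0 < `|a| + 1 by rewrite ltr_wpDl.
  have e2 : 0 < e / (`|a| + 1) by rewrite divr_gt0.
  have [c [c0 [h [bh Dh Eh]]] /andP[cp lt]] := l2bound_near bf e2.
  apply: (@le_trans _ _ (`|a| * c)).
    apply: q2_le; split; first exact: mulr_ge0.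
    exists (fun z => `|a| * h z); split; first exact: bmeasZ.
      by move=> z; rewrite DZ// normrM ler_wpM2l.
    rewrite (@eq_Ex _ _ _ _ _ (fun z => `|a| ^+ 2 * h z ^+ 2)); last by move=> z; rewrite exprMn.
    by rewrite ExZ ?exprMn ?ler_wpM2l ?sqr_ge0//; exact: bmeasX.
  apply: (le_trans (ler_wpM2l (normr_ge0 a) (ltW lt))); rewrite mulrDr lerD2l.
  by rewrite mulrA ler_pdivrMr// mulrC ler_wpM2l ?(ltW e0)// lerDl.
- move=> f B h; apply: q2_le; apply: l2bound_cst => //.
  by apply: le_trans (DB h topv).
Qed.

Lemma q2E f : bmeas (D f) -> q2 f = Num.sqrt (Ex mu (fun z => D f z ^+ 2)).
Proof.
move=> bD; apply/eqP; rewrite eq_le; apply/andP; split.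
  apply: q2_le; split; first exact: sqrtr_ge0.
  exists (fun z => `|D f z|); split => //; first exact: bmeas_norm.
  rewrite sqr_sqrtr; last by apply: Ex_ge0 => z; exact: sqr_ge0.
  by under eq_Ex do rewrite real_normK ?num_real//.
apply: lb_le_inf.
  have [_ [B h]] := bD; exists B; split; first exact: le_trans (h topv).
  exists (fun=> B); split => //; first exact: bmeas_cst.
  by rewrite Ex_cst.
move=> c [c0 [h [bh Dh Eh]]].
rewrite -(ger0_norm c0) -sqrtr_sqr ler_wsqrtr//; apply: le_trans Eh.
apply: le_Ex; [exact: bmeasX|exact: bmeasX|move=> z].
by rewrite -[leLHS]real_normK ?num_real// lerXn2r ?nnegrE//; apply: le_trans (Dh z).
Qed.

(** [D f] need not be measurable, yet the integral of its square is a supremum over simple functions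
    below it, and a measurable majorant bounds these. This links the seminorm to the integral in the
    monotonicity assumption on the limit law. *)
Lemma q2_eq0 f : bnd f -> q2 f = 0 -> \int[mu]_(z in setT) (D f z ^+ 2) = 0.
Proof.
move=> bf q0.
have h0 z : (0 <= (D f z ^+ 2)%:E)%E by rewrite lee_fin sqr_ge0.
suff E : (\int[mu]_z (D f z ^+ 2)%:E = 0)%E by rewrite /Rintegral E.
apply/eqP; rewrite eq_le integral_ge0 ?andbT//.
apply/lee_addgt0Pr => e e0; rewrite add0e.
(* From [c < 1] it follows that [c^2 <= c < e]. *)
have e1 : 0 < Num.min 1 e by rewrite lt_min ltr01.
have [c [c0 [h [bh Dh Eh]]] /andP[cp lt]] := l2bound_near bf e1.
rewrite q0 add0r lt_min in lt; case/andP: lt => c1 ce.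
apply: (@le_trans _ _ (\int[mu]_z (h z ^+ 2)%:E)%E).
  rewrite !ge0_integralTE//; last by move=> z; rewrite lee_fin sqr_ge0.
  apply: ereal_sup_le => _ [g hg <-]; exists g => // z; apply: (le_trans (hg z)).
  by rewrite lee_fin -[leLHS]real_normK ?num_real// lerXn2r ?nnegrE//; apply: le_trans (Dh z).
rewrite -Ex_EFin; last exact: bmeasX.
rewrite lee_fin; apply: (le_trans Eh); apply: ltW; apply: le_lt_trans ce.
by rewrite expr2 ler_piMl// ltW.
Qed.

End seminorms.

(** * Hadamard differentiability along arrays *)

Section hadamard.
Context {R : realType} {m s u : nat}.
Notation D2 := (distfuns R m `*` distfuns R s).
Notation I := (xvec R m + xvec R s)%type.
Notation fpair := ((xvec R m -> R) * (xvec R s -> R))%type.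
Variables (T Q : {fun D2 >-> distfuns R u}) (F : xvec R m -> R) (G : xvec R s -> R).
Variables (dT dQ : fpair -> xvec R u -> R).
Hypothesis hadT : unif_hadamard T (F, G) dT.
Hypothesis hadQ : unif_hadamard Q (F, G) dQ.

Definition pairL (f : I -> R) : fpair := (fun x => f (inl x), fun x => f (inr x)).

Definition Du (f : I -> R) (z : xvec R u) : R := dT (pairL f) z - dQ (pairL f) z.

Lemma linf_pairL f : bnd f -> (linf R m `*` linf R s) (pairL f).
Proof. by move=> [B h]; split; apply/linfP; exists B => x; exact: h. Qed.

Lemma Du_lin (a : R) f f' z : bnd f -> bnd f' -> Du (fun x => a * f x + f' x) z = a * Du f z + Du f' z.
Proof.
move=> /linf_pairL bf /linf_pairL bf'; have [lT _] := hadT; have [lQ _] := hadQ.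
rewrite /Du (_ : pairL _ = a *: pairL f + pairL f')//.
by rewrite (cont_linear0 lT)// (cont_linear0 lQ)//; ring.
Qed.

Lemma Du0 z : Du (fun=> 0) z = 0.
Proof.
have b0 : bnd (fun _ : I => 0 : R) by exists 0 => x; rewrite normr0.
have h := Du_lin (-1) z b0 b0.
have E : (fun _ : I => -1 * 0 + 0 : R) = fun=> 0 by rewrite mulr0 addr0.
by rewrite E mulN1r addNr in h.
Qed.

Lemma DuD f f' z : bnd f -> bnd f' -> Du (fun x => f x + f' x) z = Du f z + Du f' z.
Proof.
move=> bf bf'; have := Du_lin 1 z bf bf'; rewrite mul1r => <-; congr Du.
by apply/funext => x; rewrite mul1r.
Qed.

Lemma DuZ (a : R) f z : bnd f -> Du (fun x => a * f x) z = a * Du f z.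
Proof.
move=> bf; have b0 : bnd (fun _ : I => 0 : R) by exists 0 => x; rewrite normr0.
have := Du_lin a z bf b0; rewrite Du0 addr0 => <-; congr Du.
by apply/funext => x; rewrite addr0.
Qed.

Lemma Du_bound : exists2 C : R, 0 <= C & forall f (B : R), (forall x, `|f x| <= B) -> forall z, `|Du f z| <= C * B.
Proof.
have [lT _] := hadT; have [lQ _] := hadQ.
have [C1 C10 h1] := cont_linear_bound lT; have [C2 C20 h2] := cont_linear_bound lQ.
exists (C1 + C2); first by rewrite addr_ge0// ltW.
move=> f B fB z; apply: (le_trans (ler_normB _ _)); rewrite mulrDl.
by rewrite lerD//; [apply: h1|apply: h2] => x; exact: fB.
Qed.

Section sequence.
Variables (Kc Kh : nat -> fpair) (a : nat -> R) (f : I -> R).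
Hypothesis dKc : forall i, D2 (Kc i).
Hypothesis dKh : forall i, D2 (Kh i).
Hypothesis TQ : forall i, T (Kc i) = Q (Kc i).
Hypothesis cK : forall e : R, 0 < e -> \forall i \near \oo, sup_close (Kc i).1 F e /\ sup_close (Kc i).2 G e.
Hypothesis a0 : forall i, 0 < a i.
Hypothesis ainf : (fun i => (a i)^-1) @ \oo --> (0 : R).
Hypothesis bf : bnd f.
Definition side (K : fpair) (x : I) : R := match x with inl x => K.1 x | inr x => K.2 x end.
Hypothesis cf : forall e : R, 0 < e -> \forall i \near \oo, sup_close (fun x => a i * (side (Kh i) x - side (Kc i) x)) f e.

(** The increments are [1 / a], the directions the scaled differences [a (Kh - Kc)], and the base
    points [Kc] move with the index: this is where differentiability has to be uniform. *)
Lemma hadamard_seq (S : {fun D2 >-> distfuns R u}) dS : unif_hadamard S (F, G) dS ->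
  forall e : R, 0 < e -> \forall i \near \oo,
  sup_close (fun z => a i * (S (Kh i) z - S (Kc i) z)) (dS (pairL f)) e.
Proof.
move=> [_ had] e e0.
pose L i := pairL (fun x => a i * (side (Kh i) x - side (Kc i) x)).
have bs K : D2 K -> bnd (side K).
  by move=> [h1 h2]; exists 1 => -[x|x] /=; apply: df_norm.
have bL i : (linf R m `*` linf R s) (L i).
  by apply: linf_pairL; apply: bndZ; apply: bndB; exact: bs.
have KE i : Kc i + (a i)^-1 *: L i = Kh i.
  rewrite [RHS]surjective_pairing; congr pair; apply/funext => x /=.
    change ((Kc i).1 x + (a i)^-1 * (a i * ((Kh i).1 x - (Kc i).1 x)) = (Kh i).1 x).
    by rewrite mulKf ?gt_eqF// addrC subrK.
  change ((Kc i).2 x + (a i)^-1 * (a i * ((Kh i).2 x - (Kc i).2 x)) = (Kh i).2 x).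
  by rewrite mulKf ?gt_eqF// addrC subrK.
have c1 : pair_unif_cvg Kc (F, G).
  by split; apply/unif_cvgP => t t0; have := cK t0; apply: filterS => i [].
have c2 : pair_unif_cvg L (pairL f).
  by split; apply/unif_cvgP => t t0; have := cf t0; apply: filterS => i h x; [exact: (h (inl x))|exact: (h (inr x))].
have p0 i : 0 < (a i)^-1 by rewrite invr_gt0.
have c3 i : D2 (Kc i + (a i)^-1 *: L i) by rewrite KE.
have /unif_cvgP /(_ e e0) := had Kc L (pairL f) (fun i => (a i)^-1) dKc c1 bL (linf_pairL bf) c2 p0 ainf c3.
apply: filterS => i h z; have := h z; rewrite KE invrK; exact.
Qed.

(** The values of the two functionals at the base points cancel by the null hypothesis, which leaves
    the difference of the derivatives. *)
Lemma stat_U (e : R) : 0 < e -> \forall i \near \oo,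
  sup_close (fun z => a i * (T (Kh i) z - Q (Kh i) z)) (Du f) e.
Proof.
move=> e0; have e2 : 0 < e / 2 by rewrite divr_gt0.
move: (hadamard_seq hadT e2) (hadamard_seq hadQ e2); apply: filterS2 => i h1 h2 z.
have := lerD (h1 z) (h2 z); rewrite -splitr TQ; apply: le_trans.
apply: le_trans (ler_normB _ _); rewrite /Du le_eqVlt; apply/orP; left; apply/eqP; congr (`|_|); ring.
Qed.

Lemma bnd_U i : bnd (fun z => a i * (T (Kh i) z - Q (Kh i) z)).
Proof.
apply: bndZ; apply: bndB; apply: df_bnd.
  exact: (@funS _ _ _ _ T _ (dKh i)).
exact: (@funS _ _ _ _ Q _ (dKh i)).
Qed.

Lemma bnd_Du : bnd (Du f).
Proof. by have [C C0 h] := Du_bound; have [B hB] := bf; exists (C * B); exact: h. Qed.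

Lemma stat_KS : (fun i => supnorm (fun z => a i * (T (Kh i) z - Q (Kh i) z))) @ \oo --> q1 Du f.
Proof.
apply/cvgrPdist_le => /= e e0; have := stat_U e0; apply: filterS => i h.
by rewrite distrC; apply: supnorm_close => //; [exact: bnd_U|exact: bnd_Du].
Qed.

Lemma stat_CvM (K' : nat -> xvec R u -> R) (K : xvec R u -> R) : (forall i, distfuns R u (K' i)) ->
  distfuns R u K -> (forall e : R, 0 < e -> \forall i \near \oo, sup_close (K' i) K e) ->
  (fun i => Num.sqrt (sqint (K' i) (fun z => a i * (T (Kh i) z - Q (Kh i) z)))) @ \oo -->
    q2 Du (df_prob K) f.
Proof.
move=> dK' dK cK'.
have dA i : distfuns R u (T (Kh i)) by exact: (@funS _ _ _ _ T _ (dKh i)).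
have dB i : distfuns R u (Q (Kh i)) by exact: (@funS _ _ _ _ Q _ (dKh i)).
have [bD c] := sqint_cvg dA dB dK' dK bnd_Du cK' stat_U.
have [C C0 DB] := Du_bound.
rewrite (q2E _ bD).
apply: (@cvg_comp _ _ _ (fun i => sqint (K' i) (fun z => a i * (T (Kh i) z - Q (Kh i) z))) Num.sqrt _ (nbhs (Ex (df_prob K) (fun z => Du f z ^+ 2)))) => //.
exact: sqrt_continuous.
Qed.

End sequence.
End hadamard.

Lemma near_sub {P : nat -> Prop} (t : nat -> nat) : (\forall k \near \oo, P k) ->
  (forall i, (i <= t i)%N) -> \forall i \near \oo, P (t i).
Proof. by move=> [M _ h] ht; exists M => // i /= Mi; apply: h => /=; exact: leq_trans (ht i). Qed.

Lemma sum_below {R : realType} n i0 : \sum_(i < n) ((i < i0)%N%:R : R) <= i0%:R.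
Proof.
rewrite (_ : \sum_(i < n) ((i < i0)%N%:R : R) = (minn n i0)%:R) ?ler_nat ?geq_minr//.
elim: n => [|n IH]; first by rewrite big_ord0 min0n.
rewrite big_ord_recr/= IH; case: (ltnP n i0) => h.
  by rewrite (minn_idPl h) -natr1.
by rewrite addr0 (minn_idPr (leqW h)).
Qed.

(** * Convergence of the statistics *)

Section one_side.
Context {R : realType} {l : nat}.
Notation X := (xvec R l).
Variables (n : nat -> nat) (mu : nat -> nat -> probability X R) (al : nat -> nat -> R) (kappa : R).
Variables (F : X -> R) (a sc : nat -> R) (sig : R).
Hypothesis ninf : forall M, \forall k \near \oo, (M <= n k)%N.
Hypothesis wal : weights al kappa.
Hypothesis dF : distfuns R l F.
Hypothesis hF : forall e : R, 0 < e -> exists i0, \forall k \near \oo, forall i, (i0 <= i < n k)%N ->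
  forall x, `|edf (mu k) x i - F x| <= e.

Let mx k := \big[Order.max/0]_(i < n k) al (n k) i.

Let ncvg : n @ \oo --> \oo.
Proof. by apply/cvgnyPge => M; exact: ninf. Qed.

Let mx0 k : 0 <= mx k.
Proof. by rewrite /mx; elim/big_rec : _ => // i x _ x0; rewrite le_max x0 orbT. Qed.

Let al_mx k i : (i < n k)%N -> al (n k) i <= mx k.
Proof. by move=> ik; apply: (le_bigmax _ (fun i : 'I_(n k) => al (n k) i) (Ordinal ik)). Qed.

Let cmx : (fun k => Num.sqrt (n k)%:R * mx k) @ \oo --> (0 : R).
Proof. by have [_ _ h _ _] := wal; exact: (cvg_comp n (fun n => Num.sqrt n%:R * \big[Order.max/0]_(i < n) al n i) ncvg h). Qed.

Definition edev k i : R := supnorm (fun x => edf (mu k) x i - F x).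

Let bnd_edev k i : bnd (fun x => edf (mu k) x i - F x).
Proof. by apply: bndB; [exists 1 => x; exact: (edf_le1 mu k x i)|exact: df_bnd]. Qed.

Let le_edev k i x : `|edf (mu k) x i - F x| <= edev k i.
Proof. exact: (le_supnorm x (bnd_edev k i)). Qed.

Let edev_le2 k i : edev k i <= 2.
Proof.
apply: supnorm_le => x; apply: (le_trans (ler_normB _ _)).
by have := edf_le1 mu k x i; have := df_norm x dF; lra.
Qed.

Let edev_split (e : R) : 0 < e -> exists i0, \forall k \near \oo, forall i, (i < n k)%N ->
  edev k i <= e + 2 * (i < i0)%N%:R.
Proof.
move=> e0; have [i0 h] := hF e0; exists i0; move: h; apply: filterS => k h i ik.
case: (ltnP i i0) => ii.
  by rewrite mulr1; apply: (le_trans (edev_le2 k i)); rewrite lerDr ltW.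
by rewrite mulr0 addr0; apply: supnorm_le => x; apply: h; rewrite ii.
Qed.

(** The finitely many early indices, where only the trivial bound 2 is available, carry a total
    weight of at most [i0] times the largest weight, which tends to 0. *)
Lemma wmean_edf_cvg (e : R) : 0 < e ->
  \forall k \near \oo, sup_close (fun x => \sum_(i < n k) al (n k) i * edf (mu k) x i) F e.
Proof.
move=> e0; have e2 : 0 < e / 2 by rewrite divr_gt0.
have [i0 h] := edev_split e2; have [al0 al1 _ _ _] := wal.
have e3 : 0 < e / 2 / (2 * i0.+1%:R) by rewrite divr_gt0// mulr_gt0.
near=> k.
have nk : (0 < n k)%N by near: k; exact: ninf.
have hk : forall i, (i < n k)%N -> edev k i <= e / 2 + 2 * (i < i0)%N%:R by near: k; exact: h.
have mk : mx k <= e / 2 / (2 * i0.+1%:R).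
  apply: (@le_trans _ _ (Num.sqrt (n k)%:R * mx k)).
    rewrite ler_peMl// -[leLHS]sqrtr1 ler_wsqrtr// ler1n//.
  by apply: ltW; near: k; exact: (cvgr_lt 0 cmx).
move=> x; rewrite -[F x]mul1r -(al1 _ nk) mulr_suml -sumrB.
apply: (le_trans (ler_norm_sum _ _ _)).
apply: (@le_trans _ _ (\sum_(i < n k) (al (n k) i * (e / 2) + 2 * mx k * (i < i0)%N%:R))).
  apply: ler_sum => i _; have ali := al0 (n k) i (ltn_ord i).
  rewrite -mulrBr normrM (ger0_norm ali).
  apply: (@le_trans _ _ (al (n k) i * (e / 2 + 2 * (i < i0)%N%:R))).
    by rewrite ler_wpM2l//; apply: (le_trans (le_edev k i x)); exact: hk.
  by rewrite mulrDr lerD2l mulrCA mulrA ler_wpM2r// ler_wpM2l//; exact: al_mx.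
rewrite big_split /= -mulr_suml al1// mul1r -mulr_sumr [leRHS]splitr lerD2l.
apply: (@le_trans _ _ (2 * mx k * i0.+1%:R)).
  rewrite ler_wpM2l ?mulr_ge0 ?mx0//; apply: (le_trans (sum_below _ _)); by rewrite ler_nat.
rewrite (_ : 2 * mx k * _ = mx k * (2 * i0.+1%:R)); last by ring.
by rewrite -ler_pdivlMr// mulr_gt0.
Unshelve. all: by end_near. Qed.

Hypothesis a0 : forall k, 0 <= a k.
Hypothesis asc : \forall k \near \oo, a k ^+ 2 = (n k)%:R * sc k.
Hypothesis scc : sc @ \oo --> sig.

(** [sc] is the ratio [a^2 / n]. Therefore [a * mx] is [sqrt sc] times [sqrt n * mx] and tends to 0,
    and the squared coefficients sum to [sc] times [n] times the sum of the squared weights. *)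
Lemma array_side : sample_array n mu (fun k i => a k * al (n k) i) F (sig * kappa).
Proof.
have [al0 al1 _ al2 _] := wal.
pose b k := a k * mx k.
have b0 k : 0 <= b k by rewrite mulr_ge0.
have cb : b @ \oo --> (0 : R).
  have h : (fun k => Num.sqrt (sc k) * (Num.sqrt (n k)%:R * mx k)) @ \oo --> Num.sqrt sig * 0.
    apply: cvgM => //.
    apply: (@cvg_comp _ _ _ sc Num.sqrt _ (nbhs sig)) => //; exact: sqrt_continuous.
  rewrite mulr0 in h; apply: cvg_trans h; apply: near_eq_cvg.
  move: asc; apply: filterS => k h; rewrite /b -(ger0_norm (a0 k)) -sqrtr_sqr h.
  by rewrite sqrtrM//; ring.
have cV : (fun k => \sum_(i < n k) (a k * al (n k) i) ^+ 2) @ \oo --> sig * kappa.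
  have h : (fun k => sc k * ((n k)%:R * \sum_(i < n k) al (n k) i ^+ 2)) @ \oo --> sig * kappa.
    apply: cvgM => //.
    exact: (cvg_comp n (fun n => n%:R * \sum_(i < n) al n i ^+ 2) ncvg al2).
  apply: cvg_trans h; apply: near_eq_cvg; move: asc; apply: filterS => k h.
  rewrite mulrA [sc k * _]mulrC -h mulr_sumr; apply: eq_bigr => i _; by rewrite exprMn.
split => //.
- exists b => // k; split => // i ik; rewrite mulr_ge0 ?al0//=.
  by rewrite ler_wpM2l// al_mx.
- exists edev; last by move=> k i x _; exact: le_edev.
  apply/cvgrPdist_le => /= e e0.
  pose V : R := `|sig * kappa| + 1.
  have V0 : 0 < V by rewrite ltr_wpDl.
  have eV : 0 < e / 2 / V by rewrite !divr_gt0.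
  have [i0 h] := edev_split eV.
  have cb2 : (fun k => 2 * i0%:R * b k ^+ 2) @ \oo --> 2 * i0%:R * (0 : R) ^+ 2.
    apply: cvgM; first exact: cvg_cst.
    by rewrite expr2; under eq_fun do rewrite expr2; exact: cvgM.
  rewrite expr0n mulr0 in cb2.
  have e2 : 0 < e / 2 by rewrite divr_gt0.
  near=> k.
  have hk : forall i, (i < n k)%N -> edev k i <= e / 2 / V + 2 * (i < i0)%N%:R by near: k; exact: h.
  have Vk : \sum_(i < n k) (a k * al (n k) i) ^+ 2 <= V.
    by apply: ltW; near: k; apply: (cvgr_lt _ cV); rewrite /V (le_lt_trans (ler_norm _))// ltrDl.
  have bk : 2 * i0%:R * b k ^+ 2 <= e / 2 by apply: ltW; near: k; exact: (cvgr_lt 0 cb2).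
  rewrite sub0r normrN ger0_norm; last first.
    by apply: sumr_ge0 => i _; rewrite mulr_ge0 ?sqr_ge0// supnorm_ge0.
  apply: (@le_trans _ _ (\sum_(i < n k) ((a k * al (n k) i) ^+ 2 * (e / 2 / V) + 2 * b k ^+ 2 * (i < i0)%N%:R))).
    apply: ler_sum => i _; have ali := al0 (n k) i (ltn_ord i).
    apply: (@le_trans _ _ ((a k * al (n k) i) ^+ 2 * (e / 2 / V + 2 * (i < i0)%N%:R))).
      by rewrite ler_wpM2l ?sqr_ge0//; exact: hk.
    rewrite mulrDr lerD2l mulrCA mulrA ler_wpM2r// ler_wpM2l//.
    by rewrite lerXn2r ?nnegrE ?mulr_ge0// ler_wpM2l// al_mx.
  rewrite big_split /= -mulr_suml -mulr_sumr [leRHS]splitr lerD//.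
    apply: (le_trans (ler_wpM2r (ltW eV) Vk)).
    by rewrite mulrC divfK ?gt_eqF.
  apply: le_trans bk; rewrite [leRHS]mulrAC ler_wpM2l ?mulr_ge0 ?sqr_ge0//; exact: sum_below.
- by move=> x; exact: df_norm.
Unshelve. all: by end_near. Qed.

End one_side.

(** * Bounds for both tails of the statistics *)

Section tails.
Context {R : realType} {d} {W : measurableType d} (Q : probability W R) (S : W -> R).
Hypothesis mS : measurable_fun setT S.

Definition cdfn (t : R) : R := Ex Q (fun w => (S w <= t)%R%:R).
Definition tailn (t : R) : R := Ex Q (fun w => (t <= S w)%R%:R).

(** The shift [2 / (n + 1)] keeps the ramp equal to 1 up to [t + 1 / (n + 1)]. This leaves room for
    the neighborhood in the portmanteau bound, and the limit is the closed half-line. *)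
Lemma ramp_cvg_le (t x : R) : (fun n => ramp n.+1 (t + 2 / n.+1%:R) x) @ \oo --> ((x <= t)%R%:R : R).
Proof.
case: (leP x t) => h.
  rewrite (_ : (fun n => _) = fun=> 1); first exact: cvg_cst.
  apply/funext => n; rewrite /ramp; apply/min_idPl.
  have n0 : 0 < n.+1%:R :> R by [].
  apply: (@le_trans _ _ (n.+1%:R * (2 / n.+1%:R))).
    by rewrite mulrCA divff ?gt_eqF// mulr1 ler1n.
  rewrite ler_pM2l// le_max; apply/orP; right; move: (2 / n.+1%:R) => v; lra.
have h0 : 0 < (x - t) / 2 by rewrite divr_gt0// subr_gt0.
apply: (@cvg_trans _ ((fun=> 0 : R) @ \oo)); last exact: cvg_cst.
apply: near_eq_cvg; have := near_infty_natSinv_lt (PosNum h0); apply: filterS => n /= hn.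
rewrite /ramp (_ : Num.max 0 _ = 0) ?mulr0; first by apply/esym/min_idPr.
by apply/max_idPl; move: (n.+1%:R^-1) hn => v hn; lra.
Qed.

Lemma measurable_ramp (n : nat) (c : R) (f : W -> R) : measurable_fun setT f ->
  measurable_fun setT (fun w => ramp n c (f w)).
Proof.
move=> mf; apply: measurable_minr => //; apply: measurable_funM => //.
by apply: measurable_maxr => //; exact: measurable_funB.
Qed.

Lemma ramp_tail_cvg (t : R) (f : W -> R) : measurable_fun setT f ->
  (fun n => Ex Q (fun w => ramp n.+1 (t + 2 / n.+1%:R) (f w))) @ \oo --> Ex Q (fun w => (f w <= t)%R%:R).
Proof.
move=> mf; have [] := Ex_bounded_cvg Q (fun n => @measurable_ramp n.+1 (t + 2 / n.+1%:R) f mf)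
  (fun n w => ramp_bound n.+1 _ _) (fun w => @ramp_cvg_le t (f w)).
by [].
Qed.

End tails.

Section uniform_tails.
Context {R : realType}.
Variables (dd : nat -> measure_display) (O : forall k, measurableType (dd k)).
Variables (P : forall k, probability (O k) R) (Th : forall k, O k -> R).
Context {d} {W : measurableType d} (Q : probability W R) (S : W -> R).
Hypothesis mS : measurable_fun setT S.
Hypothesis bound : forall (phi : R -> R) (c D w e : R) (A : set R), 0 <= c ->
  (forall x y, `|phi x - phi y| <= c * `|x - y|) -> (forall x, 0 <= phi x <= D) ->
  0 < w -> (forall x y, A x -> `|x - y| <= w -> 1 <= phi y) -> 0 < e ->
  \forall k \near \oo, small (P k) [set y : O k | A (@Th k y)] (Ex Q (fun v => phi (S v)) + e).

Lemma tails (t e : R) : 0 < e -> \forall k \near \oo,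
  small (P k) [set y : O k | @Th k y <= t] (cdfn Q S t + e) /\
  small (P k) [set y : O k | t <= @Th k y] (tailn Q S t + e).
Proof.
move=> e0; have e2 : 0 < e / 2 by rewrite divr_gt0.
have rb (n : nat) c (x : R) : 0 <= ramp n c x <= 1 by rewrite ramp_ge0 /ramp ge_min lexx.
have r1 (n : nat) (c x : R) : x <= c - n.+1%:R^-1 -> 1 <= ramp n.+1 c x.
  move=> h; rewrite /ramp le_min lexx/=.
  have n0 : 0 < n.+1%:R :> R by [].
  rewrite -ler_pdivrMl// mulr1 le_max; apply/orP; right; move: (n.+1%:R^-1) h => v h; lra.
have Sc := @ramp_tail_cvg _ _ _ Q t S mS.
have mSn : measurable_fun setT (fun w => - S w) by exact: measurableT_comp.
have Sd := @ramp_tail_cvg _ _ _ Q (- t) (fun w => - S w) mSn.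
move/cvgrPdist_le : Sc => /(_ _ e2)[n1 _ /(_ n1 (leqnn n1)) h1].
move/cvgrPdist_le : Sd => /(_ _ e2)[n2 _ /(_ n2 (leqnn n2)) h2].
have w1 : 0 < n1.+1%:R^-1 :> R by rewrite invr_gt0.
have w2 : 0 < n2.+1%:R^-1 :> R by rewrite invr_gt0.
have B1 := bound (phi := ramp n1.+1 (t + 2 / n1.+1%:R)) (A := [set x | x <= t]) (ler0n R n1.+1) (fun x y => ramp_lip _ _ x y) (rb _ _) w1 _ e2.
have lip2 (x y : R) : `|ramp n2.+1 (- t + 2 / n2.+1%:R) (- x) - ramp n2.+1 (- t + 2 / n2.+1%:R) (- y)| <= n2.+1%:R * `|x - y|.
  by apply: (le_trans (ramp_lip _ _ _ _)); rewrite opprK addrC -(distrC y).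
have B2 := bound (phi := fun x => ramp n2.+1 (- t + 2 / n2.+1%:R) (- x)) (A := [set x | t <= x]) (ler0n R n2.+1) lip2 (fun x => rb _ _ _) w2 _ e2.
have {}B1 : \forall k \near \oo, small (P k) [set y : O k | @Th k y <= t] (Ex Q (fun v => ramp n1.+1 (t + 2 / n1.+1%:R) (S v)) + e / 2).
  apply: B1 => x y /= xt; rewrite ler_norml => /andP[a1 a2]; apply: r1.
  rewrite mulrC; move: (n1.+1%:R^-1) a1 a2 => w a1 a2; lra.
have {}B2 : \forall k \near \oo, small (P k) [set y : O k | t <= @Th k y] (Ex Q (fun v => ramp n2.+1 (- t + 2 / n2.+1%:R) (- S v)) + e / 2).
  apply: B2 => x y /= xt; rewrite ler_norml => /andP[a1 a2]; apply: r1.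
  rewrite mulrC; move: (n2.+1%:R^-1) a1 a2 => w a1 a2; lra.
move: B1 B2; apply: filterS2 => k B1 B2; split.
  apply: small_sub B1 => //; rewrite /cdfn; move: h1; rewrite ler_norml => /andP[]; lra.
apply: small_sub B2 => //.
have -> : tailn Q S t = Ex Q (fun w => (- S w <= - t)%R%:R) by apply: eq_Ex => w; rewrite lerN2.
by move: h2; rewrite ler_norml => /andP[]; lra.
Qed.

End uniform_tails.

Section weighted_edf.
Context {R : realType} {l : nat}.

Lemma df_dirac (y : xvec R l) : distfuns R l (fun x => (lev y x)%:R).
Proof.
exists \d_y => x; rewrite -[LHS]/(\d_y [set w | lev w x]) diracE; congr (_%:R%:E); case: (boolP (lev y x)) => h.
  by rewrite mem_set.
by rewrite memNset//; exact/negP.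
Qed.

Lemma df_wedf (a : nat -> nat -> R) kappa n (y : n.-tuple (xvec R l)) : weights a kappa -> (0 < n)%N ->
  distfuns R l (wedf a y).
Proof.
move=> [h0 h1 _ _ _] n0.
have := @df_convex R l n (a n) (fun i x => (lev (nth topv y i) x)%:R) (h0 n) (h1 n n0) (fun i _ => df_dirac _).
by congr distfuns; apply/funext => x; apply: eq_bigr => i _; rewrite (tnth_nth topv).
Qed.

Lemma df_edf_mean (a : nat -> nat -> R) kappa n (mu : nat -> probability (xvec R l) R) : weights a kappa -> (0 < n)%N ->
  distfuns R l (fun x => \sum_(i < n) a n i * edf mu x i).
Proof.
move=> [h0 h1 _ _ _] n0.
exact: (@df_convex R l n (a n) (fun i x => edf mu x i) (h0 n) (h1 n n0) (fun i _ => df_of_law (mu i))).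
Qed.

End weighted_edf.

Lemma sup_close_sym {R : realType} {I : Type} (f g : I -> R) (e : R) : sup_close f g e -> sup_close g f e.
Proof. by move=> h x; rewrite distrC. Qed.

(** * Limits of the statistics for a general array under the null hypothesis *)

Section core.
Context {R : realType} {m s u : nat}.
Notation D2 := (distfuns R m `*` distfuns R s).
Notation I := (xvec R m + xvec R s)%type.
Notation fpair := ((xvec R m -> R) * (xvec R s -> R))%type.
Variables (T Q : {fun D2 >-> distfuns R u}) (j : {fun D2 >-> D2}).
Variables (F : xvec R m -> R) (G : xvec R s -> R).
Hypotheses (dF : distfuns R m F) (dG : distfuns R s G) (ucF : unif_cont_xvec F) (ucG : unif_cont_xvec G).
Hypotheses (contT : sup_continuous D2 T) (contQ : sup_continuous D2 Q) (contj : sup_continuous2 D2 j).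
Hypothesis jid : forall K, D2 K -> T K = Q K -> j K = K.
Variables (dT dQ : fpair -> xvec R u -> R).
Hypothesis hadT : unif_hadamard T (F, G) dT.
Hypothesis hadQ : unif_hadamard Q (F, G) dQ.
Variables (al be : nat -> nat -> R) (kappa tau eta : R).
Hypotheses (wal : weights al kappa) (wbe : weights be tau) (eta0 : 0 < eta).
Variables (n r : nat -> nat).
Hypothesis minN : (fun k => minn (n k) (r k)) @ \oo --> \oo.
Hypothesis ratio : (fun k => (n k)%:R / (r k)%:R) @ \oo --> eta.
Variables (mu : nat -> nat -> probability (xvec R m) R) (nu : nat -> nat -> probability (xvec R s) R).
Hypothesis hF : forall e : R, 0 < e -> exists i0, \forall k \near \oo, forall i, (i0 <= i < n k)%N ->
  forall x, `|edf (mu k) x i - F x| <= e.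
Hypothesis hG : forall e : R, 0 < e -> exists i0, \forall k \near \oo, forall i, (i0 <= i < r k)%N ->
  forall x, `|edf (nu k) x i - G x| <= e.

Definition Kc k : fpair := (fun x => \sum_(i < n k) al (n k) i * edf (mu k) x i,
                            fun x => \sum_(i < r k) be (r k) i * edf (nu k) x i).

Hypothesis null : \forall k \near \oo, T (Kc k) = Q (Kc k).

Definition Kh k (y : (n k).-tuple (xvec R m) * (r k).-tuple (xvec R s)) : fpair :=
  (wedf al y.1, wedf be y.2).

Definition an k : R := ((n k)%:R * (r k)%:R) `^ (4%:R)^-1.

Lemma near_min M : \forall k \near \oo, (M <= minn (n k) (r k))%N.
Proof. by have /cvgnyPge := minN; exact. Qed.

Lemma near_n M : \forall k \near \oo, (M <= n k)%N.
Proof. by have := near_min M; apply: filterS => k; rewrite leq_min => /andP[]. Qed.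

Lemma near_r M : \forall k \near \oo, (M <= r k)%N.
Proof. by have := near_min M; apply: filterS => k; rewrite leq_min => /andP[]. Qed.

Lemma an_ge0 k : 0 <= an k.
Proof. exact: powR_ge0. Qed.

Lemma an_gt0 k : (0 < n k)%N -> (0 < r k)%N -> 0 < an k.
Proof. by move=> nk rk; apply: powR_gt0; rewrite mulr_gt0 ?ltr0n. Qed.

Lemma an_sqr k : an k ^+ 2 = Num.sqrt (n k)%:R * Num.sqrt (r k)%:R.
Proof.
rewrite -powR_mulrn ?an_ge0// /an -powRrM (_ : 4%:R^-1 * 2%:R = 2^-1); last by field.
by rewrite powR12_sqrt ?sqrtrM ?mulr_ge0.
Qed.

Let sc2 k : R := Num.sqrt ((n k)%:R / (r k)%:R).

Lemma sc2_cvg : sc2 @ \oo --> Num.sqrt eta.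
Proof.
apply: (@cvg_comp _ _ _ (fun k => (n k)%:R / (r k)%:R : R) Num.sqrt _ (nbhs eta)) => //.
exact: sqrt_continuous.
Qed.

(** The common normalization [(n r)^(1/4)] amounts to [sqrt n] times [(r / n)^(1/4)] for one sample
    and to [sqrt r] times [(n / r)^(1/4)] for the other. *)
Lemma an_sc1 : \forall k \near \oo, an k ^+ 2 = (n k)%:R * (sc2 k)^-1.
Proof.
near=> k.
have nk : (0 < n k)%N by near: k; exact: near_n.
have rk : (0 < r k)%N by near: k; exact: near_r.
rewrite an_sqr /sc2 sqrtrM// sqrtrV// invfM invrK -{2}(sqr_sqrtr (ler0n R (n k))).
by field; rewrite gt_eqF// sqrtr_gt0 ltr0n.
Unshelve. all: by end_near. Qed.

Lemma an_sc2 : \forall k \near \oo, an k ^+ 2 = (r k)%:R * sc2 k.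
Proof.
near=> k.
have rk : (0 < r k)%N by near: k; exact: near_r.
rewrite an_sqr /sc2 sqrtrM// sqrtrV// -{2}(sqr_sqrtr (ler0n R (r k))).
by field; rewrite gt_eqF// sqrtr_gt0 ltr0n.
Unshelve. all: by end_near. Qed.

Lemma an_inv : (fun k => (an k)^-1) @ \oo --> (0 : R).
Proof.
apply/cvgrPdist_le => /= e e0; near=> k.
have nk : (0 < n k)%N by near: k; exact: near_n.
have rk : (0 < r k)%N by near: k; exact: near_r.
have a0 := an_gt0 nk rk.
rewrite sub0r normrN gtr0_norm ?invr_gt0// -[leRHS]invrK lef_pV2 ?posrE ?invr_gt0//.
rewrite -(@ler_pXn2r _ 2)// ?nnegrE ?invr_ge0 ?(ltW e0) ?(ltW a0)//.
pose M := Num.bound (e^-1 ^+ 2).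
have Mn : (M <= minn (n k) (r k))%N by near: k; exact: near_min.
apply: (@le_trans _ _ M%:R).
  by apply: ltW; apply: archi_boundP; rewrite sqr_ge0.
move: Mn; rewrite leq_min => /andP[Mn Mr].
rewrite an_sqr -{1}(sqr_sqrtr (ler0n R M)) expr2.
by rewrite ler_pM ?sqrtr_ge0// ler_wsqrtr// ler_nat.
Unshelve. all: by end_near. Qed.

Let c1 k i := an k * al (n k) i.
Let c2 k i := an k * be (r k) i.

(* Limit variances for the normalization [(n r)^(1/4)]; they differ from the
   factors [kappa * eta] and [tau * eta] of the process in the statement. *)
Definition V1 : R := (Num.sqrt eta)^-1 * kappa.
Definition V2 : R := Num.sqrt eta * tau.

Lemma arr1 : sample_array n mu c1 F V1.
Proof.
apply: (array_side (sc := fun k => (sc2 k)^-1) near_n wal dF hF an_ge0 an_sc1).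
by apply: cvgV; [rewrite gt_eqF// sqrtr_gt0|exact: sc2_cvg].
Qed.

Lemma arr2 : sample_array r nu c2 G V2.
Proof. exact: (array_side near_r wbe dG hG an_ge0 an_sc2 sc2_cvg). Qed.

Lemma Kc_cvg (e : R) : 0 < e -> \forall k \near \oo, sup_close (Kc k).1 F e /\ sup_close (Kc k).2 G e.
Proof.
move=> e0; move: (wmean_edf_cvg near_n wal dF hF e0) (wmean_edf_cvg near_r wbe dG hG e0).
by apply: filterS2 => k.
Qed.

Lemma D2_Kc k : (0 < n k)%N -> (0 < r k)%N -> D2 (Kc k).
Proof. by move=> nk rk; split; [exact: (df_edf_mean _ wal)|exact: (df_edf_mean _ wbe)]. Qed.

Lemma D2_Kh k (y : (n k).-tuple (xvec R m) * (r k).-tuple (xvec R s)) : (0 < n k)%N -> (0 < r k)%N -> D2 (Kh y).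
Proof. by move=> nk rk; split; [exact: (df_wedf _ wal)|exact: (df_wedf _ wbe)]. Qed.

Lemma D2_FG : D2 (F, G). Proof. by split. Qed.

(** The null hypothesis holds at the points [Kc k], which tend to [(F, G)]; continuity of both
    functionals transfers it to the limit. *)
Lemma TQ_FG : T (F, G) = Q (F, G).
Proof.
apply/funext => z; apply/eqP; rewrite -subr_eq0 -normr_le0; apply/ler_addgt0Pr => e e0; rewrite add0r.
have e2 : 0 < e / 2 by rewrite divr_gt0.
have [d1 d10 h1] := sup_continuousE contT D2_FG e2.
have [d2 d20 h2] := sup_continuousE contQ D2_FG e2.
have dd0 : 0 < Num.min d1 d2 by rewrite lt_min d10.
have [k [[[[nk rk] nulk] [k1 k2]] _]] := filter_ex (filterI (filterI (filterI (filterI (near_n 1) (near_r 1)) null) (Kc_cvg dd0)) filterT).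
have D := D2_Kc nk rk.
have w1 : Num.min d1 d2 <= d1 by rewrite ge_min lexx.
have w2 : Num.min d1 d2 <= d2 by rewrite ge_min lexx orbT.
have a1 := h1 _ D (fun x => le_trans (sup_close_sym k1 x) w1) (fun x => le_trans (sup_close_sym k2 x) w1) z.
have a2 := h2 _ D (fun x => le_trans (sup_close_sym k1 x) w2) (fun x => le_trans (sup_close_sym k2 x) w2) z.
have := ler_distD (T (Kc k) z) (T (F, G) z) (Q (F, G) z).
rewrite -nulk in a2; rewrite (distrC (T (Kc k) z) (Q (F, G) z)); lra.
Qed.

Lemma j_FG : j (F, G) = (F, G).
Proof. by apply: jid; [exact: D2_FG|exact: TQ_FG]. Qed.

Lemma proc2E k (y : (n k).-tuple (xvec R m) * (r k).-tuple (xvec R s)) x :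
  proc2 mu nu c1 c2 y x = an k * (side (Kh y) x - side (Kc k) x).
Proof.
case: x => x /=; rewrite /eproc /wedf -sumrB mulr_sumr; apply: eq_bigr => i _; rewrite /c1 /c2; ring.
Qed.

Lemma start : exists K0, forall k, (K0 <= k)%N -> [/\ (0 < n k)%N, (0 < r k)%N & T (Kc k) = Q (Kc k)].
Proof.
have [K0 _ h] := filterI (filterI (near_n 1) (near_r 1)) null.
by exists K0 => k kK; have [[h1 h2] h3] := h k kK.
Qed.

Section one_sequence.
Variables (K0 : nat) (z : nat -> {k & ((n k).-tuple (xvec R m) * (r k).-tuple (xvec R s))%type}) (f : I -> R).
Hypothesis hK0 : forall k, (K0 <= k)%N -> [/\ (0 < n k)%N, (0 < r k)%N & T (Kc k) = Q (Kc k)].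
Hypothesis hz : forall i, (K0 + i <= tag (z i))%N.
Hypothesis bf : bnd f.
Hypothesis cf : forall e : R, 0 < e -> \forall i \near \oo, sup_close (proc2 mu nu c1 c2 (tagged (z i))) f e.

Let hk i : [/\ (0 < n (tag (z i)))%N, (0 < r (tag (z i)))%N & T (Kc (tag (z i))) = Q (Kc (tag (z i)))].
Proof. by apply: hK0; apply: leq_trans (hz i); exact: leq_addr. Qed.

Let it i : (i <= tag (z i))%N.
Proof. by apply: leq_trans (hz i); exact: leq_addl. Qed.

Let dKc i : D2 (Kc (tag (z i))).
Proof. by have [h1 h2 _] := hk i; exact: D2_Kc. Qed.

Let dKh i : D2 (Kh (tagged (z i))).
Proof. by have [h1 h2 _] := hk i; exact: D2_Kh. Qed.

Let TQz i : T (Kc (tag (z i))) = Q (Kc (tag (z i))).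
Proof. by have [_ _ h] := hk i. Qed.

Let cKz (e : R) : 0 < e -> \forall i \near \oo, sup_close (Kc (tag (z i))).1 F e /\ sup_close (Kc (tag (z i))).2 G e.
Proof. by move=> e0; exact: (near_sub (Kc_cvg e0) it). Qed.

Let az i : 0 < an (tag (z i)).
Proof. by have [h1 h2 _] := hk i; exact: an_gt0. Qed.

Let aiz : (fun i => (an (tag (z i)))^-1) @ \oo --> (0 : R).
Proof.
apply/cvgrPdist_le => /= e e0; have /cvgrPdist_le /(_ e e0) h := an_inv.
exact: (near_sub h it).
Qed.

Let cfz (e : R) : 0 < e -> \forall i \near \oo,
  sup_close (fun x => an (tag (z i)) * (side (Kh (tagged (z i))) x - side (Kc (tag (z i))) x)) f e.
Proof. by move=> e0; have := cf e0; apply: filterS => i h x; rewrite -proc2E; exact: h. Qed.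

Lemma stat_KS_seq : (fun i => KS T Q (n (tag (z i))) (r (tag (z i))) (Kh (tagged (z i)))) @ \oo --> q1 (Du dT dQ) f.
Proof. exact: (stat_KS hadT hadQ dKc dKh TQz cKz az aiz bf cfz). Qed.

(** The scaled difference of [Kh] and [Kc] stays bounded while the scale tends to infinity. *)
Let Khz (e : R) : 0 < e -> \forall i \near \oo, sup_close F (Kh (tagged (z i))).1 e /\ sup_close G (Kh (tagged (z i))).2 e.
Proof.
move=> e0; have e2 : 0 < e / 2 by rewrite divr_gt0.
have [B hB] := bf.
have B1 : 0 < `|B| + 1 by rewrite ltr_wpDl.
have eB : 0 < e / 2 / (`|B| + 1) by rewrite divr_gt0.
have key : \forall i \near \oo, forall x, `|side (Kh (tagged (z i))) x - side (Kc (tag (z i))) x| <= e / 2.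
  near=> i.
  have h1 : sup_close (fun x => an (tag (z i)) * (side (Kh (tagged (z i))) x - side (Kc (tag (z i))) x)) f 1.
    by near: i; exact: cfz.
  have h2 : (an (tag (z i)))^-1 <= e / 2 / (`|B| + 1).
    by apply: ltW; near: i; exact: (cvgr_lt 0 aiz).
  move=> x; have := h1 x; set D := side _ x - _ => h3.
  have h4 : an (tag (z i)) * `|D| <= `|B| + 1.
    rewrite -[an _](gtr0_norm (az i)) -normrM.
    have := ler_normD (an (tag (z i)) * D - f x) (f x); rewrite subrK.
    have := hB x; have := ler_norm B; lra.
  rewrite -ler_pdivlMl// in h4; apply: (le_trans h4).
  by move: h2; rewrite ler_pdivlMr.
move: key (cKz e2); apply: filterS2 => i h [h1 h2]; split=> x; rewrite distrC.
  have := ler_distD ((Kc (tag (z i))).1 x) ((Kh (tagged (z i))).1 x) (F x).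
  by have := h (inl x); have := h1 x; rewrite /side; lra.
have := ler_distD ((Kc (tag (z i))).2 x) ((Kh (tagged (z i))).2 x) (G x).
by have := h (inr x); have := h2 x; rewrite /side; lra.
Unshelve. all: by end_near. Qed.

Lemma stat_CvM_seq :
  (fun i => Num.sqrt (CvM T Q j (n (tag (z i))) (r (tag (z i))) (Kh (tagged (z i))))) @ \oo -->
  q2 (Du dT dQ) (df_prob (T (F, G))) f.
Proof.
have dj i : D2 (j (Kh (tagged (z i)))) by exact: (@funS _ _ _ _ j _ (dKh i)).
have dTj i : distfuns R u (T (j (Kh (tagged (z i))))) by exact: (@funS _ _ _ _ T _ (dj i)).
have dTF : distfuns R u (T (F, G)) by exact: (@funS _ _ _ _ T _ D2_FG).
have cT (e : R) : 0 < e -> \forall i \near \oo, sup_close (T (j (Kh (tagged (z i))))) (T (F, G)) e.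
  move=> e0.
  have [d1 d10 h1] := sup_continuousE contT D2_FG e0.
  have [d2 d20 h2] := sup_continuous2E contj D2_FG d10.
  have := Khz d20; apply: filterS => i [a1 a2]; apply: sup_close_sym.
  have := h2 _ (dKh i) a1 a2; rewrite j_FG => -[b1 b2].
  exact: h1.
exact: (stat_CvM hadT hadQ dKc dKh TQz cKz az aiz bf cfz dTj dTF cT).
Qed.

End one_sequence.

(* At a null point [j] is the identity, so [j (Kh y)] tends to [(F, G)]. *)
Lemma core_close (de e : R) : 0 < de -> 0 < e -> \forall k \near \oo,
  small (law2 n r mu nu k) [set y | ~ (sup_close F (j (Kh y)).1 de /\ sup_close G (j (Kh y)).2 de)] e.
Proof.
move=> de0 e0.
have [d2 d20 hj] := sup_continuous2E contj D2_FG de0.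
have [B B0 hB] := tight_sup (tight_proc2 arr1 arr2 ucF ucG)
  (fun x e1 e10 => point_tight_proc2 arr1 arr2 x e10) e0.
have d22 : 0 < d2 / 2 by rewrite divr_gt0.
have B1 : 0 < B + 1 by rewrite ltr_wpDl.
have eB : 0 < d2 / 2 / (B + 1) by rewrite divr_gt0.
near=> k.
have nk : (0 < n k)%N by near: k; exact: near_n.
have rk : (0 < r k)%N by near: k; exact: near_r.
have h1 : small (law2 n r mu nu k) [set y | exists x, B < `|proc2 mu nu c1 c2 y x|] e.
  by near: k; exact: hB.
have h2 : (an k)^-1 <= d2 / 2 / (B + 1) by apply: ltW; near: k; exact: (cvgr_lt 0 an_inv).
have [h3 h4] : sup_close (Kc k).1 F (d2 / 2) /\ sup_close (Kc k).2 G (d2 / 2).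
  by near: k; exact: Kc_cvg.
apply: small_sub h1 => // y /= hy; apply: contrapT => /forallNP hx; apply: hy.
have a0 := an_gt0 nk rk.
have key x : `|side (Kh y) x - side (Kc k) x| <= d2 / 2.
  have /negP := hx x; rewrite -leNgt proc2E normrM (gtr0_norm a0) mulrC -ler_pdivlMr// => h.
  apply: (le_trans h); move: h2; rewrite ler_pdivlMr// mulrDr mulr1 [(an k)^-1 * B]mulrC => h2.
  by apply: le_trans h2; rewrite lerDl invr_ge0 ltW.
have D := D2_Kh y nk rk.
have := hj _ D; rewrite j_FG; apply=> x; rewrite distrC.
  have := ler_distD ((Kc k).1 x) ((Kh y).1 x) (F x).
  by have := key (inl x); have := h3 x; rewrite /side; lra.
have := ler_distD ((Kc k).2 x) ((Kh y).2 x) (G x).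
by have := key (inr x); have := h4 x; rewrite /side; lra.
Unshelve. all: by end_near. Qed.

Context {d} {W : measurableType d} (P' : probability W R) (N : W -> I -> R).
Hypothesis nN : nice gridI N.
Hypothesis charN : forall (J : finType) (x : J -> I) c th,
  Ex P' (fun w => cos (th + lin c (fun j => N w (x j)))) =
  expR (- ((\sum_j \sum_l c j * c l * gam V1 F V2 G (x j) (x l)) / 2)) * cos th.

(** Besides the seminorm, the input on the statistic is its limit along sequences of sample points
    whose processes converge uniformly; this is all that distinguishes the two statistics. *)
Lemma core_tails (Th : forall k, (n k).-tuple (xvec R m) * (r k).-tuple (xvec R s) -> R) (q : (I -> R) -> R) (C : R) :
  bseminorm q C ->
  (forall K0 (z : nat -> {k & ((n k).-tuple (xvec R m) * (r k).-tuple (xvec R s))%type}) (f : I -> R), (forall k, (K0 <= k)%N -> [/\ (0 < n k)%N, (0 < r k)%N & T (Kc k) = Q (Kc k)]) ->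
    (forall i, (K0 + i <= tag (z i))%N) -> bnd f ->
    (forall e : R, 0 < e -> \forall i \near \oo, sup_close (proc2 mu nu c1 c2 (tagged (z i))) f e) ->
    (fun i => Th (tag (z i)) (tagged (z i))) @ \oo --> q f) ->
  forall t e : R, 0 < e -> \forall k \near \oo,
  small (law2 n r mu nu k) [set y | Th k y <= t] (cdfn P' (fun w => q (N w)) t + e) /\
  small (law2 n r mu nu k) [set y | t <= Th k y] (tailn P' (fun w => q (N w)) t + e).
Proof.
move=> qs stat t e e0; have [K0 hK0] := start.
apply: tails => //; first exact: (measurable_suplip nN (bseminorm_lip qs)).
move=> phi c D w e' A c0 phic phiD w0 Aphi e'0.
apply: (@stat_bound R I gridI _ _ (law2 n r mu nu) (fun k => @proc2 R m s n r mu nu c1 c2 k) _ _ P' N q C Th K0 _ _ _ _ _ _ _ _ phi c D w e' A) => //.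
- by move=> k x; exact: measurable_proc2.
- by move=> k y; exact: bnd_proc2.
- exact: (tight_proc2 arr1 arr2 ucF ucG).
- by move=> x e1 e10; exact: (point_tight_proc2 arr1 arr2).
- by move=> J x c' th; rewrite charN; exact: (fdd_proc2 arr1 arr2).
- by move=> z hz f bf cf; exact: (stat K0 z f hK0 hz bf cf).
Qed.

Lemma core_KS (t e : R) : 0 < e -> \forall k \near \oo,
  small (law2 n r mu nu k) [set y | KS T Q (n k) (r k) (Kh y) <= t]
    (cdfn P' (fun w => q1 (Du dT dQ) (N w)) t + e) /\
  small (law2 n r mu nu k) [set y | t <= KS T Q (n k) (r k) (Kh y)]
    (tailn P' (fun w => q1 (Du dT dQ) (N w)) t + e).
Proof.
have [C C0 DB] := Du_bound hadT hadQ.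
have qs := q1_bseminorm (fun f f' z => @DuD _ _ _ _ _ _ _ _ _ _ hadT hadQ f f' z)
  (fun a f z => @DuZ _ _ _ _ _ _ _ _ _ _ hadT hadQ a f z) DB.
apply: (core_tails (Th := fun k y => KS T Q (n k) (r k) (Kh y)) qs) => K0 z f h1 h2 h3 h4.
exact: (stat_KS_seq h1 h2 h3 h4).
Qed.

Lemma core_CvM (t e : R) : 0 < e -> \forall k \near \oo,
  small (law2 n r mu nu k) [set y | Num.sqrt (CvM T Q j (n k) (r k) (Kh y)) <= t]
    (cdfn P' (fun w => q2 (Du dT dQ) (df_prob (T (F, G))) (N w)) t + e) /\
  small (law2 n r mu nu k) [set y | t <= Num.sqrt (CvM T Q j (n k) (r k) (Kh y))]
    (tailn P' (fun w => q2 (Du dT dQ) (df_prob (T (F, G))) (N w)) t + e).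
Proof.
have [C C0 DB] := Du_bound hadT hadQ.
have qs := q2_bseminorm (df_prob (T (F, G))) (fun f f' z => @DuD _ _ _ _ _ _ _ _ _ _ hadT hadQ f f' z)
  (fun a f z => @DuZ _ _ _ _ _ _ _ _ _ _ hadT hadQ a f z) DB.
apply: (core_tails (Th := fun k y => Num.sqrt (CvM T Q j (n k) (r k) (Kh y))) qs) => K0 z f h1 h2 h3 h4.
exact: (stat_CvM_seq h1 h2 h3 h4).
Qed.

End core.

(** * Rescaled versions of the limit process *)

Section limit_version.
Context {R : realType} {m s : nat}.
Notation I := (xvec R m + xvec R s)%type.
Context {d} {W : measurableType d} (P : probability W R).
Variables (Mm : xvec R m -> {RV P >-> R}) (Ms : xvec R s -> {RV P >-> R}).
Variables (cm cs : R) (F : xvec R m -> R) (G : xvec R s -> R).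
Hypotheses (indepM : indep_families P Mm Ms) (limMm : limit_process Mm cm F) (limMs : limit_process Ms cs G).
Variables (Mt : W -> xvec R m -> R) (St : W -> xvec R s -> R) (N0 N1 : set W).
Hypotheses (nMt : nice (gridX m) Mt) (nSt : nice (gridX s) St).
Hypotheses (mN0 : measurable N0) (mN1 : measurable N1) (PN0 : P N0 = 0%E) (PN1 : P N1 = 0%E).
Hypotheses (MtE : forall w, ~ N0 w -> forall x, Mt w x = Mm x w) (StE : forall w, ~ N1 w -> forall x, St w x = Ms x w).

(** Rescaling the two components separately adapts the variance factors, so that the limits of the
    arrays are realized on the space of the given limit process. *)
Definition comb (a b : R) (w : W) (i : I) : R :=
  match i with inl x => a * Mt w x | inr x => b * St w x end.

Lemma nice_comb a b : nice gridI (comb a b).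
Proof.
have [mM bM aM] := nMt; have [mS bS aS] := nSt.
split.
- by case=> x /=; apply: measurable_funM.
- move=> w; have [B1 h1] := bM w; have [B2 h2] := bS w.
  exists (`|a| * `|B1| + `|b| * `|B2|) => -[x|x] /=; rewrite normrM.
    apply: (@le_trans _ _ (`|a| * `|B1|)); last by rewrite lerDl mulr_ge0.
    by rewrite ler_wpM2l// (le_trans (h1 x))// ler_norm.
  apply: (@le_trans _ _ (`|b| * `|B2|)); last by rewrite lerDr mulr_ge0.
  by rewrite ler_wpM2l// (le_trans (h2 x))// ler_norm.
move=> w e e0.
have a1 : 0 < `|a| + 1 by rewrite ltr_wpDl.
have b1 : 0 < `|b| + 1 by rewrite ltr_wpDl.
have ea : 0 < e / (`|a| + 1) by rewrite divr_gt0.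
have eb : 0 < e / (`|b| + 1) by rewrite divr_gt0.
have aux (c : R) : 0 < `|c| + 1 -> `|c| * (e / (`|c| + 1)) <= e.
  by move=> c1; rewrite mulrA ler_pdivrMr// mulrC ler_wpM2l ?(ltW e0)// lerDl.
move: (aM w _ ea) (aS w _ eb); apply: filterS2 => p h1 h2 [x|x] /=.
  rewrite -mulrBr normrM; apply: le_trans (aux a a1); rewrite ler_wpM2l//; exact: h1.
rewrite -mulrBr normrM; apply: le_trans (aux b b1); rewrite ler_wpM2l//; exact: h2.
Qed.

Lemma char_comb a b (J : finType) (x : J -> I) (c : J -> R) th :
  Ex P (fun w => cos (th + lin c (fun j => comb a b w (x j)))) =
  expR (- ((\sum_j \sum_l c j * c l * gam (a ^+ 2 * cm) F (b ^+ 2 * cs) G (x j) (x l)) / 2)) * cos th.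
Proof.
pose x1 j := if x j is inl y then y else topv.
pose x2 j := if x j is inr y then y else topv.
pose a1 j := if x j is inl y then a * c j else 0.
pose a2 j := if x j is inr y then b * c j else 0.
have [g1 e1 c1 _] := limMm; have [g2 e2 c2 _] := limMs.
pose G1 := \sum_j \sum_l a1 j * a1 l * (cm * (F (minv (x1 j) (x1 l)) - F (x1 j) * F (x1 l))).
pose G2 := \sum_j \sum_l a2 j * a2 l * (cs * (G (minv (x2 j) (x2 l)) - G (x2 j) * G (x2 l))).
have GE : \sum_j \sum_l c j * c l * gam (a ^+ 2 * cm) F (b ^+ 2 * cs) G (x j) (x l) = G1 + G2.
  rewrite /G1 /G2 -big_split; apply: eq_bigr => j _ /=.
  rewrite -big_split; apply: eq_bigr => l _ /=.
  by rewrite /gam /a1 /a2 /x1 /x2; case: (x j) => y; case: (x l) => z; ring.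
rewrite GE.
pose A w := lin a1 (fun j => Mm (x1 j) w); pose B w := lin a2 (fun j => Ms (x2 j) w).
have mA : measurable_fun setT A by apply: measurable_sum => j; apply: measurable_funM.
have mB : measurable_fun setT B by apply: measurable_sum => j; apply: measurable_funM.
have [mC _ _] := nice_comb a b.
transitivity (Ex P (fun w => cos (th + (A w + B w)))).
  apply: (@Ex_ae _ _ _ P _ _ (N0 `|` N1)).
  - exact: measurableU.
  - by rewrite measureU0.
  - apply: bmeas_cos; apply: measurable_funD => //; apply: measurable_sum => j.
    by apply: measurable_funM.
  - by apply: bmeas_cos; apply: measurable_funD => //; exact: measurable_funD.
  move=> w /not_orP[h0 h1]; congr (cos (th + _)).
  rewrite /A /B /lin -big_split; apply: eq_bigr => j _ /=.
  by rewrite /comb /a1 /a2 /x1 /x2; case: (x j) => z; rewrite ?MtE ?StE//; ring.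
rewrite (indep_cos th indepM mA mB); last 2 first.
- apply: measurable_sum => j; apply: measurable_funM; [exact: measurable_cst|exact: (sigma_of_measurable (X := fun y => Mm y : W -> R))].
- apply: measurable_sum => j; apply: measurable_funM; [exact: measurable_cst|exact: (sigma_of_measurable (X := fun y => Ms y : W -> R))].
transitivity (Ex P (fun w => expR (- (G2 / 2)) * cos (th + A w))).
  apply: eq_Ex => w.
  exact: (gaussian_char (Cv := fun v w => cs * (G (minv v w) - G v * G w)) g2 e2 c2).
rewrite ExZ; last by apply: bmeas_cos; exact: measurable_funD.
rewrite (gaussian_char (Cv := fun v w => cm * (F (minv v w) - F v * F w)) g1 e1 c1).
by rewrite -/G1 mulrA -expRD; congr (expR _ * _); rewrite addrC -opprD mulrDl.
Qed.

(* The law of [comb a b] does not depend on the sign of [b], and [comb 1 1] is a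
   linear combination of [comb a b] and [comb a (- b)]. *)
Lemma comb_nontrivial (q : (I -> R) -> R) (C a b : R) : bseminorm q C -> 0 < a -> 0 < b ->
  P [set w | q (comb 1 1 w) == 0] <> 1%E -> P [set w | q (comb a b w) == 0] = 0%E.
Proof.
move=> qs a0 b0 h11.
have [//|h1] := zero_one (nice_comb a b) (@char_comb a b) qs.
exfalso; apply: h11.
have E : charE P P (comb a b) (comb a (- b)).
  by move=> J x c th; rewrite !char_comb sqrrN.
(* A constant functional and the inequality [0 < 1] make the second condition in [bmeas_event]
   void. *)
have s0 : suplip (fun _ : I -> R => 0 : R) 0 by move=> f f' B _ _ _; rewrite subrr normr0 mul0r.
have mq a' b' : measurable_fun setT (fun w => q (comb a' b' w)).
  exact: (measurable_suplip (nice_comb a' b') (bseminorm_lip qs)).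
have me a' b' : measurable [set w | q (comb a' b' w) == 0] by exact: measurable_eqset.
have [_ h2] := bmeas_event (nice_comb a b) (nice_comb a (- b)) E 0 1 (bseminorm_lip qs) s0.
have h3 : P [set w | q (comb a (- b) w) == 0] = 1%E.
  rewrite -(Ex_ind P (A := fun w => q (comb a (- b) w) == 0))//.
  rewrite -h1 -(Ex_ind P (A := fun w => q (comb a b w) == 0))//; congr EFin.
  transitivity (Ex P (fun w => ((q (comb a (- b) w) == 0) && ((0 : R) < 1)%R)%:R)).
    by apply: eq_Ex => w; rewrite ltr01 andbT.
  by rewrite -h2; apply: eq_Ex => w; rewrite ltr01 andbT.
have key : [set w | q (comb a b w) == 0] `&` [set w | q (comb a (- b) w) == 0] `<=`
  [set w | q (comb 1 1 w) == 0].
  move=> w [/= /eqP k1 /eqP k2].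
  have [_ b1 _] := nice_comb a b; have [_ b2 _] := nice_comb a (- b).
  rewrite eq_le (bs_ge0 qs) andbT.
  (* Solution of [(u1 + u2) a = 1] and [(u1 - u2) b = 1]. *)
  pose u1 : R := 1 / (2 * a) + 1 / (2 * b); pose u2 : R := 1 / (2 * a) - 1 / (2 * b).
  rewrite (_ : comb 1 1 w = (fun x => u1 * comb a b w x + u2 * comb a (- b) w x)).
    apply: (le_trans (bsD qs (bndZ _ (b1 w)) (bndZ _ (b2 w)))).
    by rewrite !(bsZ qs)// k1 k2 !mulr0 addr0.
  by apply/funext => -[x|x] /=; rewrite /u1 /u2; field; rewrite !gt_eqF.
apply/eqP; rewrite eq_le probability_le1//=.
have hI : P ([set w | q (comb a b w) == 0] `&` [set w | q (comb a (- b) w) == 0]) = 1%E.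
  apply/eqP; rewrite eq_le probability_le1 /=; last exact: measurableI.
  have := probability_setC P (measurableI _ _ (me a b) (me a (- b))).
  have : P (~` ([set w | q (comb a b w) == 0] `&` [set w | q (comb a (- b) w) == 0])) = 0%E.
    have c1 := probability_setC P (me a b); have c2 := probability_setC P (me a (- b)).
    rewrite h1 subee// in c1; rewrite h3 subee// in c2.
    have mc1 := measurableC (me a b); have mc2 := measurableC (me a (- b)).
    by rewrite setCI measureU0.
  move=> -> /esym/eqP; rewrite sube_eq ?fin_num_measure// add0e => /eqP <-//.
rewrite -[leLHS]hI; apply: le_measure => //; rewrite inE//; exact: measurableI.
Qed.

End limit_version.

(** * Critical values *)

Section continuous_law.
Context {R : realType} {d} {W : measurableType d} (Q : probability W R) (S : W -> R).
Hypotheses (mS : measurable_fun setT S) (S0 : forall w, 0 <= S w) (QS : forall c, Q [set w | S w == c] = 0%E).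

Lemma bmeas_le (t : R) : bmeas (fun w => (S w <= t)%R%:R : R).
Proof.
apply: bmeas_ind; rewrite (_ : [set w | _] = ~` [set w | (- S w < - t)%R]).
  by apply: measurableC; apply: measurable_ltset; exact: measurableT_comp.
by apply/seteqP; split => w /=; rewrite ltrN2 leNgt => /negP.
Qed.

Lemma bmeas_eqval (t : R) : bmeas (fun w => (S w == t)%:R : R).
Proof. by apply: bmeas_ind; exact: measurable_eqset. Qed.

Lemma Ex_eqval (t : R) : Ex Q (fun w => (S w == t)%:R) = 0.
Proof. by apply: EFin_inj; rewrite Ex_ind ?QS//; exact: measurable_eqset. Qed.

Lemma bmeas_near (t : R) (e : R) : bmeas (fun w => (`|S w - t| <= e)%R%:R : R).
Proof.
apply: bmeas_ind; rewrite (_ : [set w | _] = ~` [set w | (- `|S w - t| < - e)%R]).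
  apply: measurableC; apply: measurable_ltset; apply: measurableT_comp => //.
  by apply: measurableT_comp => //; exact: measurable_funB.
by apply/seteqP; split => w /=; rewrite ltrN2 leNgt => /negP.
Qed.

(** The increment is at most the probability that [S] lies within [v] of [t], which tends to that of
    [S = t] as [v] tends to 0. *)
Lemma continuous_cdfn (t : R) : cdfn Q S x @[x --> t] --> cdfn Q S t.
Proof.
apply/cvgrPdist_le => /= e e0.
have [_ h] : bmeas (fun w => (S w == t)%:R : R) /\
    (fun n => Ex Q (fun w => (`|S w - t| <= n.+1%:R^-1)%R%:R)) @ \oo --> Ex Q (fun w => (S w == t)%:R).
  apply: (@Ex_bounded_cvg _ _ _ Q _ _ 1).
  - by move=> n; have [] := bmeas_near t n.+1%:R^-1.
  - by move=> n w; rewrite normr_nat lern1 leq_b1.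
  move=> w; have [->|/eqP ne] := eqVneq (S w) t.
    by rewrite (_ : (fun n => _) = fun=> 1)//; [exact: cvg_cst|apply/funext => n; rewrite subrr normr0 invr_ge0 ler0n].
  have p0 : 0 < `|S w - t| by rewrite normr_gt0 subr_eq0; exact/eqP.
  apply/cvgrPdist_le => /= e1 e10.
  have := near_infty_natSinv_lt (PosNum p0); apply: filterS => n /= hn.
  have {}hn : n.+1%:R^-1 < `|S w - t| := hn.
  by rewrite (lt_geF hn) subrr normr0 ltW.
rewrite Ex_eqval in h; move/cvgrPdist_le : h => /(_ e e0) [n _ /(_ n (leqnn n)) /=].
rewrite sub0r normrN => hn.
have n0 : 0 < n.+1%:R^-1 :> R by rewrite invr_gt0.
near=> t'.
have tt : `|t - t'| <= n.+1%:R^-1 by near: t'; exact: cvgr_dist_le.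
rewrite /cdfn -ExB; try exact: bmeas_le.
apply: (le_trans (Ex_norm_le _ _)); first by apply: bmeasB; exact: bmeas_le.
apply: le_trans (le_trans (ler_norm _) hn); apply: le_Ex.
- by apply: bmeas_norm; apply: bmeasB; exact: bmeas_le.
- exact: bmeas_near.
move=> w; move: (n.+1%:R^-1) tt => v tt.
have : `|S w - t| <= v \/ (S w <= t)%R = (S w <= t')%R.
  have [?|h] := leP (`|S w - t|) v; [by left|right].
  move: tt h; rewrite ler_norml lter_normr => /andP[h1 h2] h3.
  by apply/idP/idP; move/orP : h3 => [h3|h3] h4; lra.
case=> [-> |->]; last by rewrite subrr normr0.
by case: (S w <= t); case: (S w <= t'); rewrite ?subrr ?subr0 ?sub0r ?normrN ?normr0 ?normr1.
Unshelve. all: by end_near. Qed.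

Lemma cdfn_lt0 (t : R) : t < 0 -> cdfn Q S t = 0.
Proof.
move=> t0; rewrite /cdfn (eq_Ex _ (g := fun=> 0)) ?Ex_cst// => w.
by rewrite leNgt (lt_le_trans t0).
Qed.

Lemma cdfn_infty : (fun n => cdfn Q S n%:R) @ \oo --> (1 : R).
Proof.
rewrite -[X in _ --> X](Ex_cst Q 1).
have [_ //] : bmeas (fun w : W => 1 : R) /\
    (fun n => Ex Q (fun w => (S w <= n%:R)%R%:R)) @ \oo --> Ex Q (fun=> 1).
apply: (@Ex_bounded_cvg _ _ _ Q _ _ 1).
- by move=> n; have [] := bmeas_le n%:R.
- by move=> n w; rewrite normr_nat lern1 leq_b1.
move=> w; apply: cvg_near_cst; exists (Num.bound (S w)) => // n /= hn.
rewrite (_ : (S w <= n%:R) = true)//; apply: (@le_trans _ _ (Num.bound (S w))%:R).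
  by apply: ltW; exact: archi_boundP.
by rewrite ler_nat.
Qed.

(** Intermediate values between -1, where the distribution function vanishes, and a large integer.
    The tail is closed at [t] and equals [1 - v] because [t] is not an atom. *)
Lemma cdf_level (v : R) : 0 < v < 1 -> exists t, [/\ 0 <= t, cdfn Q S t = v & tailn Q S t = 1 - v].
Proof.
move=> /andP[v0 v1].
have [n] : exists n : nat, v <= cdfn Q S n%:R.
  have /cvgrPdist_le := cdfn_infty; move=> /(_ (1 - v)) [|n _ /(_ n (leqnn n)) /= h]; first by rewrite subr_gt0.
  by exists n; move: h; rewrite ler_norml; lra.
move=> hn.
have n1 : (-1 : R) <= n%:R by apply: (@le_trans _ _ 0).
have c1 : cdfn Q S (-1) = 0 by apply: cdfn_lt0; rewrite oppr_lt0.
have [|t] := @IVT R (cdfn Q S) (-1) n%:R v n1 (continuous_subspaceT continuous_cdfn).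
  by rewrite c1 ge_min (ltW v0) le_max hn orbT.
move=> _ tv; exists t; split => //.
  by rewrite leNgt; apply/negP => /cdfn_lt0; rewrite tv => v00; rewrite v00 ltxx in v0.
rewrite -tv /tailn /cdfn -[X in X - _](Ex_cst Q 1) -ExB; [|exact: bmeas_cst|exact: bmeas_le].
rewrite -[RHS]addr0 -[X in _ + X](Ex_eqval t) -ExD; [|by apply: bmeasB; [exact: bmeas_cst|exact: bmeas_le]|exact: bmeas_eqval].
by apply: eq_Ex => w; case: (ltgtP (S w) t) => _ /=; rewrite ?subrr ?subr0 ?addr0 ?add0r.
Qed.

End continuous_law.

Section sample_law.
Context {R : realType} {d} {W : measurableType d} (P : probability W R).

Lemma measurable_xvec_of l : measurable_fun setT (@xvec_of R l).
Proof.
apply/measurable_fun_tnthP => i; rewrite (_ : _ \o _ = EFin \o (fun w : l.-tuple R => tnth w i)).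
  by apply: measurableT_comp => //; exact: measurable_tnth.
by apply/funext => w /=; rewrite tnth_map.
Qed.

Section one_sample.
Context {l : nat} (X : nat -> {RV P >-> l.-tuple R}).

Definition xrv i : {mfun W >-> xvec R l} := mfun_of (measurableT_comp (@measurable_xvec_of l) (measurable_funPT (X i))).

Definition xlaw i : probability (xvec R l) R := distribution P (xrv i).

Definition sample n (w : W) : n.-tuple (xvec R l) := [tuple xvec_of (X i w) | i < n].

Lemma edf_xlaw x i : edf xlaw x i = rv_df P (X i) x.
Proof.
rewrite /edf Ex_distribution; last exact: bmeas_lev.
have ml : measurable [set w | lev (xrv i w) x].
  rewrite (_ : [set w | _] = xrv i @^-1` [set y | lev y x])// -[X in measurable X]setTI.
  by apply: (measurable_funPT (xrv i)) => //; exact: measurable_lev.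
by apply: EFin_inj; rewrite Ex_ind /rv_df ?fineK ?fin_num_measure.
Qed.

Lemma measurable_sample n : measurable_fun setT (sample n).
Proof.
apply/measurable_fun_tnthP => i; rewrite (_ : _ \o _ = xrv i).
  exact: measurable_funPT.
by apply/funext => w /=; rewrite tnth_mktuple.
Qed.

Lemma sigma_sample n :
  measurable_fun (setT : set (g_sigma_algebraType (\bigcup_i preimage_set_system setT (X i) measurable))) (sample n).
Proof.
apply/measurable_fun_tnthP => i; rewrite (_ : _ \o _ = @xvec_of R l \o X i).
  apply: (measurableT_comp (@measurable_xvec_of l)).
  exact: (sigma_of_measurable (X := fun i => X i : W -> _)).
by apply/funext => w /=; rewrite tnth_mktuple.
Qed.

Lemma sample_law n : indep_seq P X -> forall B, measurable B -> P (sample n @^-1` B) = prod_law xlaw n B.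
Proof.
move=> indX; pose Y := mfun_of (@measurable_sample n).
apply: (prod_law_unique (Y := Y)) => A mA.
have mA' i : measurable (@xvec_of R l @^-1` A i).
  by rewrite -[X in measurable X]setTI; exact: measurable_xvec_of.
have := indX [fset i in iota 0 n]%fset _ mA'.
rewrite (perm_big (iota 0 n)) /=; last first.
  by apply: uniq_perm; rewrite ?fset_uniq ?iota_uniq// => i; rewrite !inE.
have -> : (\prod_(i < n) distribution P (xrv i) (A i) = \prod_(i <- iota 0 n) P (X i @^-1` (@xvec_of R l @^-1` A i)))%E.
  by rewrite -[X in iota 0 X]subn0 -/(index_iota 0 n) big_mkord.
move=> <-.
congr (P _); apply/seteqP; split => w /= h.
  move=> i /=; rewrite !inE mem_iota add0n /= => hi.
  by have := h (Ordinal hi); rewrite tnth_mktuple.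
move=> i; rewrite tnth_mktuple; apply: (h i) => /=.
by rewrite !inE mem_iota /= add0n.
Qed.

End one_sample.

Context {m s : nat} (X : nat -> {RV P >-> m.-tuple R}) (V : nat -> {RV P >-> s.-tuple R}).
Hypotheses (indepX : indep_seq P X) (indepV : indep_seq P V) (indepXV : indep_families P X V).

(** By independence the pair of samples has the product law, so estimates on the canonical space
    carry over to [P]. *)
Lemma small_sample (n r : nat -> nat) k A e : small (law2 n r (fun=> xlaw X) (fun=> xlaw V) k) A e ->
  small P [set w | A (sample X (n k) w, sample V (r k) w)] e.
Proof.
pose Y := mfun_of (measurable_fun_pair (@measurable_sample _ X (n k)) (@measurable_sample _ V (r k))).
apply: (small_preimage (X := Y)); first exact: measurable_funPT.
apply: pair_law_unique => C D mC mD.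
rewrite (_ : Y @^-1` (C `*` D) = sample X (n k) @^-1` C `&` sample V (r k) @^-1` D)//.
rewrite -(sample_law indepX mC) -(sample_law indepV mD).
by apply: indepXV; apply: sigma_of_preimage => //; exact: sigma_sample.
Qed.

End sample_law.

(** [t1] is a lower bound of the set whose infimum is the quantile, because the mass up to [t1] is
    at most [e < p]; [t2] is a member of that set. *)
Lemma quantile_between {R : realType} {d} {W : measurableType d} (mu : probability W R) (S : W -> R) (p e t1 t2 : R) :
  small mu [set y | S y <= t1] e -> e < p -> small mu [set y | t2 <= S y] (1 - p) ->
  t1 <= quantile p mu S <= t2.
Proof.
move=> h1 ep h2.
have lb : lbound [set t | (p%:E <= outer mu [set y | (S y <= t)%R])%E] t1.
  move=> t /= ht; rewrite leNgt; apply/negP => tt1.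
  have : (outer mu [set y | (S y <= t)%R] <= e%:E)%E.
    by apply: small_outer; apply: small_sub h1 => // y /= /le_trans; apply; exact: ltW.
  by move=> /(le_trans ht); rewrite lee_fin leNgt ep.
have in2 : (p%:E <= outer mu [set y | (S y <= t2)%R])%E.
  rewrite -[p](subKr 1); apply: outer_setC_ge; apply: small_sub h2 => // y /= /negP.
  by rewrite -ltNge => /ltW.
apply/andP; split; first by apply: lb_le_inf => //; exists t2.
by apply: ge_inf => //; exists t1.
Qed.

Lemma cvg_between {R : realType} (f : nat -> \bar R) (a : R) :
  (forall e : R, 0 < e -> \forall k \near \oo, ((a - e)%:E <= f k <= (a + e)%:E)%E) -> f @ \oo --> a%:E.
Proof.
move=> h; apply/fine_cvgP; split.
  have := h 1 ltr01; apply: filterS => k /andP[h1 h2].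
  by rewrite fin_numE -ltNye -ltey; rewrite (lt_le_trans _ h1) ?ltNyr ?(le_lt_trans h2) ?ltry.
apply/cvgrPdist_le => e e0; have := h e e0; apply: filterS => k /=; case: (f k) => [x||] //=.
  by rewrite !lee_fin ler_norml => /andP[h1 h2]; apply/andP; split; lra.
by rewrite leye_eq andbF.
Qed.

(** * From levels to rejection probabilities *)

Section assembly.
Context {R : realType} {m s u : nat}.
Notation D2 := (distfuns R m `*` distfuns R s).
Notation fpair := ((xvec R m -> R) * (xvec R s -> R))%type.
Variables (T Q : {fun D2 >-> distfuns R u}) (j : {fun D2 >-> D2}).
Variables (F : xvec R m -> R) (G : xvec R s -> R).
Variables (al be : nat -> nat -> R) (kappa tau eta : R).
Hypotheses (wal : weights al kappa) (wbe : weights be tau).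
Variable Sg : nat -> nat -> fpair -> R.

(* Covers both the data and, with [mu k] constant, bootstrap samples drawn from a
   sequence of distribution functions tending to [F]. *)
Definition setting (n r : nat -> nat) (mu : nat -> nat -> probability (xvec R m) R)
    (nu : nat -> nat -> probability (xvec R s) R) :=
  [/\ (fun k => minn (n k) (r k)) @ \oo --> \oo,
    (fun k => (n k)%:R / (r k)%:R) @ \oo --> eta,
    forall e : R, 0 < e -> exists i0, \forall k \near \oo, forall i, (i0 <= i < n k)%N ->
      forall x, `|edf (mu k) x i - F x| <= e,
    forall e : R, 0 < e -> exists i0, \forall k \near \oo, forall i, (i0 <= i < r k)%N ->
      forall x, `|edf (nu k) x i - G x| <= e &
    \forall k \near \oo, T (Kc al be n r mu nu k) = Q (Kc al be n r mu nu k)].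

(** [t] is asymptotically a [v]-quantile along every admissible array, and both half-lines are
    closed at [t], so that no mass concentrates there. The quantification over arrays lets one level
    serve the data and the bootstrap. *)
Definition level (t v : R) := forall n r mu nu, setting n r mu nu -> forall e : R, 0 < e ->
  \forall k \near \oo,
  small (law2 n r mu nu k) [set y | Sg (n k) (r k) (wedf al y.1, wedf be y.2) <= t] (v + e) /\
  small (law2 n r mu nu k) [set y | t <= Sg (n k) (r k) (wedf al y.1, wedf be y.2)] (1 - v + e).

Lemma edf_df_prob {l} (K : xvec R l -> R) x i : distfuns R l K -> edf (fun=> df_prob K) x i = K x.
Proof. by move=> /df_probP/is_dfE ->. Qed.

Variables (n_ r_ : nat -> nat).
Hypothesis minN : (fun k => minn (n_ k) (r_ k)) @ \oo --> \oo.
Hypothesis ratio : (fun k => (n_ k)%:R / (r_ k)%:R) @ \oo --> eta.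

(** For identically distributed observations the weighted mean of the distribution functions is the
    common one, because the weights sum to 1; the condition [i <= (z i).1] makes the sample sizes
    tend to infinity along the sequence. *)
Lemma setting_iid (z : nat -> nat * fpair) :
  (forall i, [/\ (i <= (z i).1)%N, D2 (z i).2, T (z i).2 = Q (z i).2,
    sup_close F (z i).2.1 i.+1%:R^-1 & sup_close G (z i).2.2 i.+1%:R^-1]) ->
  setting (fun i => n_ (z i).1) (fun i => r_ (z i).1) (fun i _ => df_prob (z i).2.1) (fun i _ => df_prob (z i).2.2).
Proof.
move=> hz.
have zi i : (i <= (z i).1)%N by have [] := hz i.
have min' M : \forall k \near \oo, (M <= minn (n_ (z k).1) (r_ (z k).1))%N.
  have /cvgnyPge /(_ M) h := minN.
  exact: (near_sub h zi).
split.
- by apply/cvgnyPge.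
- apply/cvgrPdist_le => /= e e0; have /cvgrPdist_le /(_ e e0) h := ratio.
  exact: (near_sub h zi).
- move=> e e0; exists 0; near=> k => i _ x.
  have [_ [dK _] _ cK _] := hz k.
  rewrite edf_df_prob// distrC; apply: (le_trans (cK x)).
  by apply: ltW; near: k; exact: (near_infty_natSinv_lt (PosNum e0)).
- move=> e e0; exists 0; near=> k => i _ x.
  have [_ [_ dK] _ _ cK] := hz k.
  rewrite edf_df_prob// distrC; apply: (le_trans (cK x)).
  by apply: ltW; near: k; exact: (near_infty_natSinv_lt (PosNum e0)).
have := min' 1; apply: filterS => k; rewrite leq_min => /andP[nk rk].
have [_ [dK1 dK2] TQ _ _] := hz k.
rewrite (_ : Kc _ _ _ _ _ _ _ = (z k).2)//.
have [_ w1 _ _ _] := wal; have [_ w2 _ _ _] := wbe.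
rewrite /Kc [RHS]surjective_pairing; congr pair; apply/funext => x.
  under eq_bigr do rewrite edf_df_prob//.
  by rewrite -mulr_suml w1// mul1r.
under eq_bigr do rewrite edf_df_prob//.
by rewrite -mulr_suml w2// mul1r.
Unshelve. all: by end_near. Qed.

(* Otherwise offending [H] can be chosen along a sequence tending to [(F, G)], and
   the levels apply to samples drawn from that sequence. *)
Lemma crit_between (t1 t2 v1 v2 p : R) : level t1 v1 -> level t2 v2 -> v1 < p -> p < v2 ->
  exists2 de : R, 0 < de & \forall k \near \oo, forall H, D2 H -> T H = Q H ->
    sup_close F H.1 de -> sup_close G H.2 de -> t1 <= crit al be Sg p (n_ k) (r_ k) H <= t2.
Proof.
move=> L1 L2 v1p pv2; apply: contrapT => /forall2NP hn.
have ch i : exists z : nat * fpair, [/\ (i <= z.1)%N, D2 z.2, T z.2 = Q z.2,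
    sup_close F z.2.1 i.+1%:R^-1 & sup_close G z.2.2 i.+1%:R^-1] /\
    ~ (t1 <= crit al be Sg p (n_ z.1) (r_ z.1) z.2 <= t2).
  have [h|h] := hn i.+1%:R^-1; first by exfalso; apply: h; rewrite invr_gt0.
  apply: contrapT => /forallNP nex; apply: h; exists i => // k /= ik H DH TH c1 c2.
  by apply: contrapT => nb; apply: (nex (k, H)).
have [z hz] := choice ch.
have S := setting_iid (fun i => (hz i).1).
pose e1 : R := (p - v1) / 2.
have e10 : 0 < e1 by rewrite divr_gt0 ?subr_gt0.
have e20 : 0 < v2 - p by rewrite subr_gt0.
have [k [[h1 _] [_ h2]]] := filter_ex (filterI (L1 _ _ _ _ S e1 e10) (L2 _ _ _ _ S (v2 - p) e20)).
have [_ nb] := hz k; apply: nb; rewrite /crit /quantile !iid_lawE.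
apply: (quantile_between h1); first by rewrite /e1; lra.
by apply: small_sub h2 => //; lra.
Qed.

Hypothesis TQj : forall K, D2 K -> T (j K) = Q (j K).
Context {d} {W : measurableType d} (P : probability W R).
Variables (X : nat -> {RV P >-> m.-tuple R}) (V : nat -> {RV P >-> s.-tuple R}).
Hypotheses (indepX : indep_seq P X) (indepV : indep_seq P V) (indepXV : indep_families P X V).
Hypothesis data : setting n_ r_ (fun=> xlaw X) (fun=> xlaw V).
Hypothesis jclose : forall de e : R, 0 < de -> 0 < e -> \forall k \near \oo,
  small (law2 n_ r_ (fun=> xlaw X) (fun=> xlaw V) k) [set y | ~ (sup_close F (j (wedf al y.1, wedf be y.2)).1 de /\
    sup_close G (j (wedf al y.1, wedf be y.2)).2 de)] e.
Hypothesis levels : forall v : R, 0 < v < 1 -> exists t, level t v.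

Lemma crit_asymptotics (alpha : R) : 0 < alpha -> alpha < 1 ->
  (fun k => outer P
    [set w | crit al be Sg (1 - alpha) (n_ k) (r_ k) (j (wedf_rv al (n_ k) X w, wedf_rv be (r_ k) V w)) <=
             Sg (n_ k) (r_ k) (wedf_rv al (n_ k) X w, wedf_rv be (r_ k) V w)]) @ \oo --> alpha%:E.
Proof.
move=> a0 a1; apply: cvg_between => e0 e00.
(* The levels [1 - alpha - e] and [1 - alpha + e] must lie in []0, 1[]. The total error is [3 e]:
   one part for the shift of the level, one for the convergence at the level, and one for the event
   that [j] of the empirical distribution functions is far from [(F, G)]. *)
have [e [e_gt0 e1 e2 e3]] : exists e : R, [/\ 0 < e, e * 3 <= e0, e < alpha & e < 1 - alpha].
  exists (Num.min (e0 / 3) (Num.min (alpha / 2) ((1 - alpha) / 2))).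
  rewrite !lt_min; split.
  - by rewrite !divr_gt0// subr_gt0.
  - by rewrite -ler_pdivlMr// ge_min lexx.
  - by rewrite !gt_min; apply/orP; right; apply/orP; left; lra.
  - by rewrite !gt_min; apply/orP; right; apply/orP; right; lra.
have [|t1 L1] := levels (v := 1 - alpha - e); first by apply/andP; split; lra.
have [|t2 L2] := levels (v := 1 - alpha + e); first by apply/andP; split; lra.
have [||de de0 hcrit] := crit_between (p := 1 - alpha) L1 L2; [lra|lra|].
have min1 : \forall k \near \oo, (1 <= minn (n_ k) (r_ k))%N by have /cvgnyPge := minN; exact.
near=> k.
have : (1 <= minn (n_ k) (r_ k))%N by near: k.
rewrite leq_min => /andP[nk rk].
have hc : forall H, D2 H -> T H = Q H -> sup_close F H.1 de -> sup_close G H.2 de ->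
  t1 <= crit al be Sg (1 - alpha) (n_ k) (r_ k) H <= t2 by near: k.
have /(small_sample indepX indepV indepXV) hb : small (law2 n_ r_ (fun=> xlaw X) (fun=> xlaw V) k)
    [set y | ~ (sup_close F (j (wedf al y.1, wedf be y.2)).1 de /\ sup_close G (j (wedf al y.1, wedf be y.2)).2 de)] e.
  by near: k; exact: jclose.
have [_ /(small_sample indepX indepV indepXV) h1] : small (law2 n_ r_ (fun=> xlaw X) (fun=> xlaw V) k)
    [set y | Sg (n_ k) (r_ k) (wedf al y.1, wedf be y.2) <= t1] (1 - alpha - e + e) /\
  small (law2 n_ r_ (fun=> xlaw X) (fun=> xlaw V) k)
    [set y | t1 <= Sg (n_ k) (r_ k) (wedf al y.1, wedf be y.2)] (1 - (1 - alpha - e) + e).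
  by near: k; exact: L1.
have [/(small_sample indepX indepV indepXV) h2 _] : small (law2 n_ r_ (fun=> xlaw X) (fun=> xlaw V) k)
    [set y | Sg (n_ k) (r_ k) (wedf al y.1, wedf be y.2) <= t2] (1 - alpha + e + e) /\
  small (law2 n_ r_ (fun=> xlaw X) (fun=> xlaw V) k)
    [set y | t2 <= Sg (n_ k) (r_ k) (wedf al y.1, wedf be y.2)] (1 - (1 - alpha + e) + e).
  by near: k; exact: L2.
pose Kd w := (wedf_rv al (n_ k) X w, wedf_rv be (r_ k) V w).
have DK w : D2 (Kd w) by split; [exact: (df_wedf _ wal)|exact: (df_wedf _ wbe)].
have good w : sup_close F (j (Kd w)).1 de /\ sup_close G (j (Kd w)).2 de ->
    t1 <= crit al be Sg (1 - alpha) (n_ k) (r_ k) (j (Kd w)) <= t2.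
  by move=> [g1 g2]; apply: hc => //; [exact: (@funS _ _ _ _ j _ (DK w))|exact: TQj].
apply/andP; split.
  rewrite (_ : alpha - e0 = 1 - (e0 + 1 - alpha)); last by ring.
  apply: outer_setC_ge; apply: small_sub (smallU hb h2); last by lra.
  move=> w /= /negP; rewrite -ltNge -/(Kd w) => hw.
  have [/good/andP[_ c2]|nb] := pselect (sup_close F (j (Kd w)).1 de /\ sup_close G (j (Kd w)).2 de); last by left.
  by right; exact: (le_trans (ltW hw)).
apply: small_outer; apply: small_sub (smallU hb h1); last by lra.
move=> w /=; rewrite -/(Kd w) => hw.
have [/good/andP[c1 _]|nb] := pselect (sup_close F (j (Kd w)).1 de /\ sup_close G (j (Kd w)).2 de); last by left.
by right; exact: (le_trans c1).
Unshelve. all: by end_near. Qed.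

End assembly.

(** If [S <= 0] almost surely, the distribution function has already reached 1 at 0 and cannot
    increase further. *)
Lemma strict_nontrivial {R : realType} {d} {W : measurableType d} (P : probability W R) (S : W -> R) (A : set W) :
  (forall a b : R, 0 <= a -> a < b -> (outer P [set w | (S w <= a)%R] < outer P [set w | (S w <= b)%R])%E) ->
  small P (~` A) 0 -> (forall w, A w -> S w <= 0) -> False.
Proof.
move=> h sA AS; have := h 0 1 (lexx _) ltr01; apply/negP; rewrite -leNgt.
have h1 : (outer P [set w | (S w <= 1)%R] <= 1%:E)%E.
  apply: small_outer; exists setT; split; [exact: measurableT|by []|exact: (probability_le1 P measurableT)].
apply: (le_trans h1); rewrite -[in leLHS](subr0 1); apply: outer_setC_ge; apply: small_sub sA => //.
by move=> w /= nS Aw; apply: nS; exact: AS.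
Qed.

Section limit_levels.
Context {R : realType} {m s : nat}.
Notation I := (xvec R m + xvec R s)%type.
Context {d} {W : measurableType d} (P : probability W R).
Variables (Mm : xvec R m -> {RV P >-> R}) (Ms : xvec R s -> {RV P >-> R}).
Variables (cm cs : R) (F : xvec R m -> R) (G : xvec R s -> R).
Hypotheses (indepM : indep_families P Mm Ms) (limMm : limit_process Mm cm F) (limMs : limit_process Ms cs G).

(** [N] is the rescaled version whose variance factors are those of the array limits. The statistic
    [S] of the given process is tied to [q] only by the implication from [q f = 0] to [S <= 0]:
    strict monotonicity for [S] then excludes that [q] vanishes almost surely on the given process,
    and hence on [N]. *)
Lemma limit_levels (V V' : R) : 0 < cm -> 0 < cs -> 0 < V -> 0 < V' ->
  exists N : W -> I -> R, [/\ nice gridI N,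
    forall (J : finType) (x : J -> I) c th, Ex P (fun w => cos (th + lin c (fun j => N w (x j)))) =
      expR (- ((\sum_j \sum_l c j * c l * gam V F V' G (x j) (x l)) / 2)) * cos th &
    forall (q : (I -> R) -> R) (C : R) (S : W -> R), bseminorm q C ->
      (forall w (f : I -> R), bnd f -> (forall x, f (inl x) = Mm x w) -> (forall x, f (inr x) = Ms x w) -> q f = 0 -> S w <= 0) ->
      (forall a b : R, 0 <= a -> a < b -> (outer P [set w | (S w <= a)%R] < outer P [set w | (S w <= b)%R])%E) ->
      forall v : R, 0 < v < 1 -> exists t : R,
        [/\ 0 <= t, cdfn P (fun w => q (N w)) t = v & tailn P (fun w => q (N w)) t = 1 - v]].
Proof.
move=> cm0 cs0 V0 V'0.
have [_ _ _ contMm] := limMm; have [_ _ _ contMs] := limMs.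
have [Mt [N0 [nMt mN0 PN0 MtE]]] := nice_version contMm.
have [St [N1 [nSt mN1 PN1 StE]]] := nice_version contMs.
pose a : R := Num.sqrt (V / cm); pose b : R := Num.sqrt (V' / cs).
have a0 : 0 < a by rewrite sqrtr_gt0 divr_gt0.
have b0 : 0 < b by rewrite sqrtr_gt0 divr_gt0.
have aE : a ^+ 2 * cm = V by rewrite sqr_sqrtr ?divr_ge0 ?(ltW V0) ?(ltW cm0)// divfK ?gt_eqF.
have bE : b ^+ 2 * cs = V' by rewrite sqr_sqrtr ?divr_ge0 ?(ltW V'0) ?(ltW cs0)// divfK ?gt_eqF.
have charN (J : finType) (x : J -> I) c th :
    Ex P (fun w => cos (th + lin c (fun j => comb Mt St a b w (x j)))) =
    expR (- ((\sum_j \sum_l c j * c l * gam V F V' G (x j) (x l)) / 2)) * cos th.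
  by rewrite (char_comb indepM limMm limMs nMt nSt mN0 mN1 PN0 PN1 MtE StE) aE bE.
have nN := nice_comb nMt nSt a b.
exists (comb Mt St a b); split => // q C S qs qS strict v v01.
have mq : measurable_fun setT (fun w => q (comb Mt St a b w)) := measurable_suplip nN (bseminorm_lip qs).
apply: cdf_level => //; first by move=> w; exact: (bs_ge0 qs).
move=> c; have [c0|c0|->] := ltgtP c 0.
- rewrite (_ : [set w | _] = set0) ?measure0//; apply/seteqP; split => w //= /eqP h.
  by have := bs_ge0 qs (comb Mt St a b w); rewrite h leNgt c0.
- exact: (no_atom nN charN qs c0).
apply: (comb_nontrivial indepM limMm limMs nMt nSt mN0 mN1 PN0 PN1 MtE StE qs a0 b0) => h1.
pose E := [set w | q (comb Mt St 1 1 w) == 0].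
have mq1 : measurable_fun setT (fun w => q (comb Mt St 1 1 w)) :=
  measurable_suplip (nice_comb nMt nSt 1 1) (bseminorm_lip qs).
have mE : measurable E by exact: measurable_eqset.
apply: (@strict_nontrivial _ _ _ P S (E `&` ~` (N0 `|` N1)) strict).
  exists (~` E `|` (N0 `|` N1)); split.
  - by apply: measurableU; [exact: measurableC|exact: measurableU].
  - by rewrite setCI setCK.
  have PE : P (~` E) = 0%E by rewrite probability_setC// h1 subee.
  have PN : P (N0 `|` N1) = 0%E by rewrite measureU0.
  have : P (~` E `|` (N0 `|` N1)) = 0%E by rewrite measureU0 ?PE//; [exact: measurableC|exact: measurableU].
  by move/eqP; rewrite eq_le => /andP[].
move=> w [/= /eqP qw /not_orP[n0 n1]].
have [_ bN _] := nice_comb nMt nSt 1 1.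
by apply: (qS w (comb Mt St 1 1 w)) => // x /=; rewrite mul1r ?MtE ?StE.
Qed.

End limit_levels.

Theorem corollary11 (R : realType) (m s u : nat)
  (m_gt0 : (0 < m)%N) (s_gt0 : (0 < s)%N) (u_gt0 : (0 < u)%N)
  (d : measure_display) (W : measurableType d) (P : probability W R)
  (X : nat -> {RV P >-> m.-tuple R}) (V : nat -> {RV P >-> s.-tuple R})
  (indepX : indep_seq P X) (indepV : indep_seq P V)
  (indepXV : indep_families P X V)
  (F : xvec R m -> R) (G : xvec R s -> R)
  (dfF : distfuns R m F) (dfG : distfuns R s G)
  (ucF : unif_cont_xvec F) (ucG : unif_cont_xvec G)
  (cvgF : {uniform, (fun i => rv_df P (X i)) @ \oo --> F})
  (cvgG : {uniform, (fun i => rv_df P (V i)) @ \oo --> G})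
  (n_ r_ : nat -> nat) (eta : R)
  (minN : (fun k => minn (n_ k) (r_ k)) @ \oo --> \oo)
  (eta_gt0 : 0 < eta)
  (ratioN : (fun k => (n_ k)%:R / (r_ k)%:R) @ \oo --> eta)
  (al be : nat -> nat -> R) (kappa tau : R)
  (weights_al : weights al kappa) (weights_be : weights be tau)
  (T Q : {fun distfuns R m `*` distfuns R s >-> distfuns R u})
  (j : {fun distfuns R m `*` distfuns R s >-> distfuns R m `*` distfuns R s})
  (contT : sup_continuous (distfuns R m `*` distfuns R s) T)
  (contQ : sup_continuous (distfuns R m `*` distfuns R s) Q)
  (contj : sup_continuous2 (distfuns R m `*` distfuns R s) j)
  (TQj : forall K, (distfuns R m `*` distfuns R s) K -> T (j K) = Q (j K))
  (jid : forall K, (distfuns R m `*` distfuns R s) K -> T K = Q K -> j K = K)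
  (step : forall n r w, (0 < n)%N -> (0 < r)%N ->
     let K := (wedf_rv al n X w, wedf_rv be r V w) in
     [/\ is_step (T K), is_step (Q K) & is_step (T (j K))])
  (alpha : R) (alpha_gt0 : 0 < alpha) (alpha_lt1 : alpha < 1)
  (null : \forall k \near \oo,
     let K := (wmean al (fun i => rv_df P (X i)) (n_ k),
               wmean be (fun i => rv_df P (V i)) (r_ k)) in T K = Q K)
  (dT dQ : (xvec R m -> R) * (xvec R s -> R) -> xvec R u -> R)
  (hadT : unif_hadamard T (F, G) dT) (hadQ : unif_hadamard Q (F, G) dQ)
  (d' : measure_display) (W' : measurableType d') (P' : probability W' R)
  (Mm : xvec R m -> {RV P' >-> R}) (Ms : xvec R s -> {RV P' >-> R})
  (indepM : indep_families P' Mm Ms)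
  (limMm : limit_process Mm (kappa * eta) (j (F, G)).1)
  (limMs : limit_process Ms (tau * eta) (j (F, G)).2) :
  let Jhat k w := j (wedf_rv al (n_ k) X w, wedf_rv be (r_ k) V w) in
  let Khat k w := (wedf_rv al (n_ k) X w, wedf_rv be (r_ k) V w) in
  let U w : xvec R u -> R := fun z =>
    dT (fun x => Mm x w, fun v => Ms v w) z -
    dQ (fun x => Mm x w, fun v => Ms v w) z in
  ((forall a b : R, 0 <= a -> a < b ->
      (outer P' [set w | (supnorm (U w) <= a)%R] <
       outer P' [set w | (supnorm (U w) <= b)%R])%E) ->
   (fun k => outer P
      [set w | crit al be (KS T Q) (1 - alpha) (n_ k) (r_ k) (Jhat k w) <=
               KS T Q (n_ k) (r_ k) (Khat k w)]) @ \oo --> alpha%:E) /\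
  ((forall a b : R, 0 <= a -> a < b ->
      (outer P' [set w | (sqint (T (F, G)) (U w) <= a)%R] <
       outer P' [set w | (sqint (T (F, G)) (U w) <= b)%R])%E) ->
   (fun k => outer P
      [set w | crit al be (CvM T Q j) (1 - alpha) (n_ k) (r_ k) (Jhat k w) <=
               CvM T Q j (n_ k) (r_ k) (Khat k w)]) @ \oo --> alpha%:E).
Proof.
have data : setting T Q F G al be eta n_ r_ (fun=> xlaw X) (fun=> xlaw V).
  split => //.
  - move=> e e0; have [i0 _ h] := (unif_cvgP _ _).1 cvgF e e0.
    exists i0; near=> k => i /andP[hi _] x; rewrite edf_xlaw; exact: (h i hi x).
  - move=> e e0; have [i0 _ h] := (unif_cvgP _ _).1 cvgG e e0.
    exists i0; near=> k => i /andP[hi _] x; rewrite edf_xlaw; exact: (h i hi x).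
  apply: filterS null => k /=; set K := (_, _); suff -> : Kc al be n_ r_ (fun=> xlaw X) (fun=> xlaw V) k = K by [].
  by rewrite /Kc /K /wmean; congr pair; apply/funext => x; apply: eq_bigr => i _; rewrite edf_xlaw.
have [_ _ hF hG hnull] := data.
(* Since [J = (F, G)], the covariances of the limit process are those of [F] and [G]. *)
have jE := j_FG dfF dfG contT contQ jid weights_al weights_be minN hF hG hnull.
rewrite jE /= in limMm limMs.
have [_ _ _ _ kappa1] := weights_al; have [_ _ _ _ tau1] := weights_be.
have kappa0 : 0 < kappa := lt_le_trans ltr01 kappa1.
have tau0 : 0 < tau := lt_le_trans ltr01 tau1.
have V10 : 0 < V1 kappa eta by rewrite /V1 mulr_gt0// invr_gt0 sqrtr_gt0.
have V20 : 0 < V2 tau eta by rewrite /V2 mulr_gt0// sqrtr_gt0.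
have [N [nN charN lev]] := limit_levels indepM limMm limMs (mulr_gt0 kappa0 eta_gt0) (mulr_gt0 tau0 eta_gt0) V10 V20.
have jclose (de e : R) (de0 : 0 < de) (e0 : 0 < e) := core_close dfF dfG ucF ucG contT contQ contj jid
  weights_al weights_be eta_gt0 minN ratioN hF hG hnull de0 e0.
have [C C0 DB] := Du_bound hadT hadQ.
have DD := fun f f' z => @DuD _ _ _ _ _ _ _ _ _ _ hadT hadQ f f' z.
have DZ := fun a f z => @DuZ _ _ _ _ _ _ _ _ _ _ hadT hadQ a f z.
move=> Jhat Khat U.
have UE w (f : xvec R m + xvec R s -> R) : (forall x, f (inl x) = Mm x w) -> (forall x, f (inr x) = Ms x w) ->
    Du dT dQ f = U w.
  move=> h1 h2; apply/funext => z; rewrite /Du /U.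
  suff -> : pairL f = (fun x => Mm x w, fun v => Ms v w) by [].
  by congr pair; apply/funext.
split=> strict.
- apply: (crit_asymptotics weights_al weights_be minN ratioN TQj indepX indepV indepXV data jclose _ alpha_gt0 alpha_lt1) => v v01.
  have [|t [t0 tv tv']] := lev _ _ _ (q1_bseminorm DD DZ DB) _ strict v v01.
    by move=> w f bf f1 f2; rewrite /q1 (UE w f f1 f2) => ->.
  exists t => n r mu nu [h1 h2 h3 h4 h5] e e0.
  have := core_KS dfF dfG ucF ucG hadT hadQ weights_al weights_be eta_gt0 h1 h2 h3 h4 h5 nN charN t e0.
  by rewrite tv tv'.
apply: (crit_asymptotics weights_al weights_be minN ratioN TQj indepX indepV indepXV data jclose _ alpha_gt0 alpha_lt1) => v v01.
have [|t [t0 tv tv']] := lev _ _ _ (q2_bseminorm (df_prob (T (F, G))) DD DZ DB) _ strict v v01.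
  move=> w f bf f1 f2 /(q2_eq0 DB bf); rewrite (UE w f f1 f2) => h.
  by rewrite /sqint h.
(* The tail bounds concern the square root of the statistic, for which the level is [t]; it is
   squared here, with [t >= 0]. *)
exists (t ^+ 2) => n r mu nu [h1 h2 h3 h4 h5] e e0.
have := core_CvM dfF dfG ucF ucG contT contQ contj jid hadT hadQ weights_al weights_be eta_gt0 h1 h2 h3 h4 h5 nN charN t e0.
rewrite tv tv'; apply: filterS => k [k1 k2]; split.
  apply: small_sub k1 => // y /= /ler_wsqrtr; rewrite sqrtr_sqr ger0_norm//.
apply: small_sub k2 => // y /= /ler_wsqrtr; rewrite sqrtr_sqr ger0_norm//.
Unshelve. all: by end_near. Qed.
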